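(* Let $P$ be an irreducible Artin-Tits monoid with set of atoms $A$, and let $\mathrm{Ker}_\partial$ be the kernel of the canonical projection $C^*_\lambda(P)\twoheadrightarrow\partial C^*_\lambda(P)$. (1) If $P$ is spherical, then $\mathrm{Ker}_\partial=\mathcal K(\ell^2P)$ if $\#A=1$, and $\mathcal K(\ell^2P)$ is the only non-trivial ideal of $\mathrm{Ker}_\partial$ if $2\le\#A<\infty$. In the latter case, $\mathrm{Ker}_\partial/\mathcal K(\ell^2P)$ is purely infinite simple. (2) If $P$ is not finitely generated and left reversible, then $\mathrm{Ker}_\partial$ is purely infinite simple. (3) If $P$ is finitely generated and not spherical, then $\mathcal K(\ell^2P)$ is the only non-trivial ideal of $C^*_\lambda(P)$, and $C^*_\lambda(P)/\mathcal K(\ell^2P)$ is purely infinite simple. (4) If $P$ is not finitely generated and not left reversible, then $C^*_\lambda(P)$ is purely infinite simple.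
   Context: An Artin-Tits monoid is a monoid with presentation $P=\langle A\mid (ab)^{[m_{a,b}]}=(ba)^{[m_{b,a}]}\ \forall a\ne b\in A\rangle^+$, where $A$ is a set (the atoms), $m_{a,b}=m_{b,a}\in\{2,3,\dots\}\cup\{\infty\}$, $(ab)^{[m]}$ is the alternating word $abab\cdots$ of length $m$, and $m_{a,b}=\infty$ means that no relation involving $a$ and $b$ is imposed. $P$ is irreducible if $A\ne\emptyset$ and the graph with vertex set $A$ and edges $\{a,b\}$ for $m_{a,b}>2$ (including $\infty$) is connected. $P$ is spherical if it is finitely generated and the associated Coxeter group $\langle A\mid a^2=1,\ (ab)^{m_{a,b}}=1\rangle$ is finite. $P$ is left reversible if $pP\cap qP\ne\emptyset$ for all $p,q\in P$. $C^*_\lambda(P)\subseteq\mathcal L(\ell^2P)$ is the C*-algebra generated by the isometries $\lambda_p:\delta_x\mapsto\delta_{px}$, $p\in P$. $\mathcal K(\ell^2 P)$ denotes the compact operators. ''Ideal'' means closed two-sided ideal; ''non-trivial'' means non-zero and proper. Boundary quotient: $I_l$ is the smallest semigroup of partial bijections of $P$ containing $x\mapsto px$ ($p\in P$) and closed under inverses; $\mathcal J=\{\mathrm{dom}(s):s\in I_l\}$, with product given by intersection; $\widehat{\mathcal J}$ is the space of non-zero multiplicative maps $\chi:\mathcal J\to\{0,1\}$ with $\chi(\emptyset)=0$ if $\emptyset\in\mathcal J$ (pointwise convergence); $\Omega\subseteq\widehat{\mathcal J}$ is the subspace of $\chi$ such that $e=\bigcup_{i=1}^nf_i$ ($e,f_i\in\mathcal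 J$) and $\chi(e)=1$ imply $\chi(f_i)=1$ for some $i$; $\partial\Omega$ is the closure of the set of $\chi\in\widehat{\mathcal J}$ with $\chi^{-1}(1)$ maximal. $I_l$ acts on $\Omega$ and $\partial\Omega$ by $s.\chi=\chi(s^{-1}\cdot s)$ on $\{\chi(s^{-1}s)=1\}$, with transformation groupoids $I_l\ltimes\Omega$, $I_l\ltimes\partial\Omega$ (classes $[s,\chi]$, with $[s,\chi]=[t,\chi]$ iff $se=te$ for some $e\in\mathcal J$ with $\chi(e)=1$). $C^*_\lambda(P)\cong C^*_r(I_l\ltimes\Omega)$ canonically, $\partial C^*_\lambda(P):=C^*_r(I_l\ltimes\partial\Omega)$, and the canonical projection is induced by restriction to $\partial\Omega$. *)

(* Defs.v *)
From HB Require Import structures.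
From mathcomp Require Import all_boot all_order all_algebra.
From mathcomp Require Import complex ring.
From mathcomp Require Import all_classical all_reals all_analysis.

Set Implicit Arguments.
Unset Strict Implicit.
Unset Printing Implicit Defensive.
Import Order.TTheory GRing.Theory Num.Theory.
Import numFieldNormedType.Exports.
Local Open Scope classical_set_scope.
Local Open Scope ring_scope.
Local Open Scope complex_scope.

Section SquareSummable.
Context {R : realType} {X : choiceType}.
Implicit Types f g : X -> R[i]^o.

Definition sqnormc (z : R[i]) : R := complex.Re z ^+ 2 + complex.Im z ^+ 2.

Definition sqsum f : \bar R := \esum_(x in [set: X]) (sqnormc (f x))%:E.

Definition l2pred : {pred (X -> R[i]^o)} := [pred f | (sqsum f < +oo)%E].

Lemma sqnormc_ge0 z : 0 <= sqnormc z.
Proof. by rewrite addr_ge0 ?sqr_ge0. Qed.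

Lemma sqnormcE z : (sqnormc z)%:C = `|z| ^+ 2.
Proof. by rewrite /sqnormc add_Re2_Im2. Qed.

Lemma sqnormcM z w : sqnormc (z * w) = sqnormc z * sqnormc w.
Proof. by case: z w => a b [c d]; rewrite /sqnormc /=; ring. Qed.

Lemma sqsum_ge0 f : (0 <= sqsum f)%E.
Proof. by apply: esum_ge0 => x _; rewrite lee_fin sqnormc_ge0. Qed.

Lemma esumZ (c : R) (a : X -> \bar R) : 0 < c -> (forall x, 0 <= a x)%E ->
  (\esum_(x in [set: X]) (c%:E * a x) = c%:E * \esum_(x in [set: X]) a x)%E.
Proof.
have le (e : R) (b : X -> \bar R) : 0 < e -> (forall x, 0 <= b x)%E ->
    (\esum_(x in [set: X]) (e%:E * b x) <= e%:E * \esum_(x in [set: X]) b x)%E.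
  move=> e0 b0; apply: ge_ereal_sup => _ [F [finF FX]] <-.
  rewrite -ge0_mule_fsumr//; apply: lee_wpmul2l; first by rewrite lee_fin ltW.
  by apply: ereal_sup_ubound; exists F.
move=> c0 a0; apply/eqP; rewrite eq_le le//=.
rewrite -lee_pdivlMl//; have := le c^-1 (fun x => c%:E * a x)%E.
under eq_esum do rewrite muleA -EFinM mulVf ?gt_eqF// mul1e.
by apply; rewrite ?invr_gt0// => x; rewrite mule_ge0// lee_fin ltW.
Qed.

Lemma sqsumZ (c : R[i]) f : sqsum (c *: f) = ((sqnormc c)%:E * sqsum f)%E.
Proof.
have [c0|c0] := eqVneq (sqnormc c) 0.
  rewrite c0 mul0e /sqsum esum1// => x _.
  by rewrite [(c *: f) x]/(c * f x) sqnormcM c0 mul0r.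
rewrite -esumZ; last 2 first.
- by rewrite lt_neqAle eq_sym c0 sqnormc_ge0.
- by move=> x; rewrite lee_fin sqnormc_ge0.
by apply: eq_esum => x _; rewrite -EFinM -sqnormcM.
Qed.

Lemma sqnormcD_le (a b : R) z w : 0 < a -> 0 < b ->
  sqnormc (z + w) <= (a + b) * (a^-1 * sqnormc z + b^-1 * sqnormc w).
Proof.
move=> a0 b0; rewrite -subr_ge0.
have -> : (a + b) * (a^-1 * sqnormc z + b^-1 * sqnormc w) - sqnormc (z + w)
    = (a * b)^-1 * ((b * complex.Re z - a * complex.Re w) ^+ 2
                    + (b * complex.Im z - a * complex.Im w) ^+ 2).
  case: z w => z1 z2 [w1 w2]; rewrite /sqnormc /=; field.
  by rewrite !gt_eqF.
by rewrite mulr_ge0 ?addr_ge0 ?sqr_ge0// invr_ge0 mulr_ge0 ?ltW.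
Qed.

Lemma sqsumD_le (a b : R) f g : 0 < a -> 0 < b ->
  (sqsum (f + g)%R <= (a + b)%:E * (a^-1%:E * sqsum f + b^-1%:E * sqsum g))%E.
Proof.
move=> a0 b0; have s0 (h : X -> R[i]^o) x : (0 <= (sqnormc (h x))%:E)%E.
  by rewrite lee_fin sqnormc_ge0.
rewrite -!esumZ ?invr_gt0//.
have q0 (c : R) h x : 0 < c -> (0 <= c^-1%:E * (sqnormc (h x))%:E)%E.
  by move=> c0; rewrite mule_ge0 ?lee_fin ?sqnormc_ge0// invr_ge0 ltW.
rewrite -esumD; last 2 first.
- by move=> ? _; exact: q0.
- by move=> ? _; exact: q0.
rewrite -esumZ ?addr_gt0//; last by move=> x; rewrite adde_ge0 ?q0.
by apply: le_esum => x _; rewrite lee_fin sqnormcD_le.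
Qed.

Lemma l2_submod_closed : submod_closed l2pred.
Proof.
split=> [|c f g]; rewrite !inE.
  by rewrite /sqsum esum1// => x _; rewrite /sqnormc /= expr0n addr0.
move=> f2 g2; apply: (le_lt_trans (sqsumD_le _ _ ltr01 ltr01)).
rewrite sqsumZ !invr1 !mul1e lte_mul_pinfty ?lee_fin// lte_add_pinfty//.
by rewrite lte_mul_pinfty ?lee_fin ?sqnormc_ge0.
Qed.

HB.instance Definition _ :=
  GRing.isSubmodClosed.Build R[i] (X -> R[i]^o) l2pred l2_submod_closed.

End SquareSummable.

Record l2 (R : realType) (X : choiceType) : Type :=
  L2 { l2fun :> X -> R[i]^o ; l2funP : l2fun \in l2pred }.

Section L2Space.
Context {R : realType} {X : choiceType}.
Implicit Types f g : l2 R X.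

HB.instance Definition _ := [isSub for @l2fun R X].
HB.instance Definition _ := [Choice of l2 R X by <:].
HB.instance Definition _ := [SubChoice_isSubLmodule of l2 R X by <:].

Definition l2norm f : R := Num.sqrt (fine (sqsum f)).

Lemma sqsum_l2norm f : sqsum f = ((l2norm f) ^+ 2)%:E.
Proof.
have f2 : (sqsum f < +oo)%E := l2funP f.
by rewrite sqr_sqrtr ?fine_ge0 ?sqsum_ge0// fineK// ge0_fin_numE ?sqsum_ge0.
Qed.

Lemma l2norm_ge0 f : 0 <= l2norm f.
Proof. exact: sqrtr_ge0. Qed.

Lemma l2norm_eq0 f : l2norm f = 0 -> f = 0.
Proof.
move=> f0; apply/val_inj/funext => x /=.
have : ((sqnormc (f x))%:E <= sqsum f)%E.
  apply: esum_ge; exists [set x]; first by split.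
  by rewrite fsbig_set1.
rewrite sqsum_l2norm f0 expr0n lee_fin /=.
case: (f x) => a b; rewrite /sqnormc /= => h.
have /andP[] : (a ^+ 2 == 0) && (b ^+ 2 == 0).
  by rewrite -paddr_eq0 ?sqr_ge0// eq_le h addr_ge0 ?sqr_ge0.
by rewrite !sqrf_eq0 => /eqP -> /eqP ->.
Qed.

Lemma ler_l2normD f g : l2norm (f + g) <= l2norm f + l2norm g.
Proof.
have [f0|f0] := eqVneq (l2norm f) 0.
  by rewrite f0 (l2norm_eq0 f0) !add0r.
have [g0|g0] := eqVneq (l2norm g) 0.
  by rewrite g0 (l2norm_eq0 g0) !addr0.
have fp : 0 < l2norm f by rewrite lt_neqAle eq_sym f0 l2norm_ge0.
have gp : 0 < l2norm g by rewrite lt_neqAle eq_sym g0 l2norm_ge0.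
have := @sqsumD_le R X _ _ f g fp gp.
rewrite -[_ + _]/(l2fun (f + g)) !sqsum_l2norm lee_fin.
rewrite !expr2 !mulKf// -!expr2 ler_sqr// nnegrE ?l2norm_ge0//.
by rewrite addr_ge0 ?l2norm_ge0.
Qed.

Definition l2normC f : R[i] := (l2norm f)%:C.

Lemma ler_l2normCD f g : l2normC (f + g) <= l2normC f + l2normC g.
Proof. by rewrite -rmorphD lecR ler_l2normD. Qed.

Lemma l2normCZ (c : R[i]) f : l2normC (c *: f) = `|c| * l2normC f.
Proof.
rewrite /l2normC normc_def -rmorphM; congr (_%:C).
rewrite /l2norm [l2fun (c *: f)]/(c *: l2fun f) sqsumZ fineM//=.
  by rewrite sqrtrM// sqnormc_ge0.
by rewrite sqsum_l2norm.
Qed.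

Lemma l2normC_eq0 f : l2normC f = 0 -> f = 0.
Proof. by move=> /complexI; exact: l2norm_eq0. Qed.

HB.instance Definition _ := @Lmodule_isNormed.Build R[i] (l2 R X)
  l2normC ler_l2normCD l2normCZ l2normC_eq0.

Lemma delta_l2 (x : X) : (fun y => (y == x)%:R : R[i]^o) \in l2pred.
Proof.
rewrite inE /sqsum (@eq_esum _ _ _ _ (fun y => if y \in [set x] then 1%E else 0%E)).
  by rewrite -esum_mkcond esum_set1 ?ltry// lee_fin.
move=> y _; rewrite in_set1 /sqnormc; case: (y == x) => /=.
  by rewrite expr1n expr0n addr0.
by rewrite expr0n addr0.
Qed.

Definition delta (x : X) : l2 R X := L2 (delta_l2 x).

End L2Space.

(* Normed *-algebras.  Non-unital algebras are not available in MathComp, and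
   the algebras needed here are subalgebras of L(l^2 X) and quotients of these
   by ideals, so an algebra is given by its operations on an ambient type
   together with the set [elts] of its actual elements.  The C*-axioms are not
   bundled: none of the notions below refers to them, and they are theorems
   for L(l^2 X), its closed *-subalgebras and their quotients by ideals. *)
Record star_alg (R : realType) := StarAlg {
  ambient :> Type;
  elts : set ambient;
  azero : ambient;
  aadd : ambient -> ambient -> ambient;
  ascale : R[i] -> ambient -> ambient;
  amul : ambient -> ambient -> ambient;
  astar : ambient -> ambient;
  anorm : ambient -> R }.

Arguments elts {R} s _.
Arguments azero {R s}.

Unset Implicit Arguments.
Section StarAlgTheory.
Context {R : realType}.
Implicit Type A : star_alg R.

Definition asub {A} (a b : A) : A := aadd a (ascale (-1) b).

Definition aclosure A (S : set A) : set A :=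
  [set a | elts A a /\
    forall e : R, 0 < e -> exists2 b, S b & anorm (asub a b) < e].

Definition linear_subspace A (I : set A) :=
  [/\ I `<=` elts A, I azero,
      forall a b, I a -> I b -> I (aadd a b) &
      forall (c : R[i]) a, I a -> I (ascale c a)].

Definition cstar_subalg A (B : set A) :=
  [/\ linear_subspace A B,
      forall a b, B a -> B b -> B (amul a b),
      forall a, B a -> B (astar a) &
      aclosure A B `<=` B].

Definition cstar_generated A (S : set A) : set A :=
  [set a | forall B, cstar_subalg A B -> S `<=` B -> B a].

Definition ideal A (I : set A) :=
  [/\ linear_subspace A I,
      forall a b, elts A a -> I b -> I (amul a b),
      forall a b, elts A a -> I b -> I (amul b a) &
      aclosure A I `<=` I].

Definition nontrivial_ideal A (I : set A) :=
  [/\ ideal A I, I <> [set azero] & I <> elts A].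

Definition only_nontrivial_ideal A (K : set A) :=
  forall I : set A, nontrivial_ideal A I <-> I = K.

Definition simple A :=
  elts A <> [set azero] /\ forall I : set A, ~ nontrivial_ideal A I.

Definition positive {A} (a : A) :=
  exists2 x, elts A x & a = amul (astar x) x.

Definition hereditary_subalg A (B : set A) :=
  cstar_subalg A B /\
  forall a b, positive a -> positive (asub b a) -> B b -> B a.

Definition projection {A} (p : A) :=
  [/\ elts A p, astar p = p & amul p p = p].

(* [p] is Murray-von Neumann equivalent to a proper subprojection of itself. *)
Definition infinite_projection {A} (p : A) :=
  projection p /\
  exists v q : A, [/\ elts A v, projection q,
    amul (astar v) v = p, amul v (astar v) = q & amul p q = q /\ q <> p].

Definition purely_infinite_simple A :=
  simple A /\
  forall B : set A, hereditary_subalg A B -> B <> [set azero] ->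
    exists2 p, B p & infinite_projection p.

Definition star_hom {A B : star_alg R} (phi : A -> B) :=
  [/\ forall a, elts A a -> elts B (phi a),
      forall a b, elts A a -> elts A b -> phi (aadd a b) = aadd (phi a) (phi b),
      forall c a, elts A a -> phi (ascale c a) = ascale c (phi a),
      forall a b, elts A a -> elts A b -> phi (amul a b) = amul (phi a) (phi b) &
      forall a, elts A a -> phi (astar a) = astar (phi a)].

Definition star_iso {A B : star_alg R} (phi : A -> B) :=
  star_hom phi /\ set_bij (elts A) (elts B) phi.

Definition sub_alg A (B : set A) : star_alg R :=
  @StarAlg R A B azero (@aadd R A) (@ascale R A) (@amul R A) (@astar R A)
    (@anorm R A).

(* The quotient A / J by an ideal: elements are the cosets a + J.  The
   summand j below makes setwise products and scalar multiples of cosets into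
   full cosets. *)
Definition coset A (J : set A) (a : A) : set A := [set aadd a j | j in J].

Definition quotient_alg A (J : set A) : star_alg R :=
  @StarAlg R (set A) [set coset A J a | a in elts A] J
    (fun E F => [set c | exists a b, [/\ E a, F b & c = aadd a b]])
    (fun z E => [set c | exists a j, [/\ E a, J j & c = aadd (ascale z a) j]])
    (fun E F => [set c | exists a b j,
                   [/\ E a, F b, J j & c = aadd (amul a b) j]])
    (fun E => [set astar a | a in E])
    (fun E => inf [set anorm a | a in E]).

End StarAlgTheory.
Set Implicit Arguments.

Section Operators.
Context {R : realType} {X : choiceType}.
Local Notation H := (l2 R X).

Definition bounded_op (T : H -> H) := linear T /\ continuous T.

Definition opnorm (T : H -> H) : R :=
  inf [set M : R | 0 <= M /\ forall f, l2norm (T f) <= M * l2norm f].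

(* The sum of an absolutely summable real family. *)
Definition rsum (u : X -> R) : R :=
  fine (\esum_(x in [set: X]) (Num.max (u x) 0)%:E) -
  fine (\esum_(x in [set: X]) (Num.max (- u x) 0)%:E).

Definition inner (f g : H) : R[i] :=
  Complex (rsum (fun x => complex.Re (f x * conjc (g x))))
          (rsum (fun x => complex.Im (f x * conjc (g x)))).

(* The unique bounded S with <T f, g> = <f, S g>, which exists for bounded T. *)
Definition adjoint (T : H -> H) : H -> H :=
  xget (fun=> 0) [set S | bounded_op S /\ forall f g, inner (T f) g = inner f (S g)].

Definition compact_op (T : H -> H) :=
  bounded_op T /\ compact (closure (T @` [set f | l2norm f <= 1])).

End Operators.

Definition bounded_ops (R : realType) (X : choiceType) : star_alg R :=
  @StarAlg R (l2 R X -> l2 R X) [set T | bounded_op T] (fun=> 0)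
    (fun S T f => S f + T f) (fun c T f => c *: T f) (fun S T f => S (T f))
    adjoint opnorm.

Definition compact_ops (R : realType) (X : choiceType) :
  set (bounded_ops R X) := [set T | compact_op T].
Arguments compact_ops R X _ : clear implicits.

Section Presentation.
Context {X : choiceType} (rel : seq X -> seq X -> Prop).

Inductive word_eqv : seq X -> seq X -> Prop :=
| word_rel u v l r of rel l r : word_eqv (u ++ l ++ v) (u ++ r ++ v)
| word_refl u : word_eqv u u
| word_sym u v of word_eqv u v : word_eqv v u
| word_trans u v w of word_eqv u v & word_eqv v w : word_eqv u w.

Lemma word_catl w u v : word_eqv u v -> word_eqv (w ++ u) (w ++ v).
Proof.
elim=> [a b l r lr|a|a b _ ih|a b c _ ih1 _ ih2].
- by rewrite !(catA w a); exact: word_rel.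
- exact: word_refl.
- exact: word_sym.
- exact: word_trans ih1 ih2.
Qed.

Lemma word_catr w u v : word_eqv u v -> word_eqv (u ++ w) (v ++ w).
Proof.
elim=> [a b l r lr|a|a b _ ih|a b c _ ih1 _ ih2].
- by rewrite -!catA; exact: word_rel.
- exact: word_refl.
- exact: word_sym.
- exact: word_trans ih1 ih2.
Qed.

Definition word_eqvb (u v : seq X) : bool := `[< word_eqv u v >].

Lemma word_eqvb_refl : reflexive word_eqvb.
Proof. by move=> u; apply/asboolP; exact: word_refl. Qed.

Lemma word_eqvb_sym : symmetric word_eqvb.
Proof. by move=> u v; apply/asboolP/asboolP; exact: word_sym. Qed.

Lemma word_eqvb_trans : transitive word_eqvb.
Proof.
move=> v u w /asboolP uv /asboolP vw; apply/asboolP.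
exact: word_trans uv vw.
Qed.

Canonical word_eqvb_equiv :=
  EquivRel word_eqvb word_eqvb_refl word_eqvb_sym word_eqvb_trans.

(* The monoid presented by the alphabet X and the relations l = r, rel l r. *)
Definition presented : Type := {eq_quot word_eqvb}%qT.
HB.instance Definition _ := Choice.on presented.
HB.instance Definition _ := EqQuotient.on presented.

Definition word_class (w : seq X) : presented := (\pi_presented w)%qT.

Lemma word_classP u v : word_class u = word_class v <-> word_eqv u v.
Proof.
split=> [/eqP|uv]; first by rewrite /word_class eqmodE => /asboolP.
by apply/eqP; rewrite /word_class eqmodE; apply/asboolP.
Qed.

Definition presented_mul (x y : presented) : presented :=
  word_class (repr x ++ repr y).

Lemma word_repr x : word_class (repr x) = x.
Proof. exact: reprK. Qed.

Lemma word_classM u v :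
  presented_mul (word_class u) (word_class v) = word_class (u ++ v).
Proof.
apply/word_classP; apply: (@word_trans _ (u ++ repr (word_class v))).
  by apply: word_catr; apply/word_classP; exact: word_repr.
by apply: word_catl; apply/word_classP; exact: word_repr.
Qed.

Lemma presented_mulA : associative presented_mul.
Proof.
move=> x y z; rewrite -(word_repr x) -(word_repr y) -(word_repr z).
by rewrite !word_classM catA.
Qed.

Lemma presented_mul1 : left_id (word_class [::]) presented_mul.
Proof. by move=> x; rewrite -(word_repr x) word_classM. Qed.

Lemma presented_mulr1 : right_id (word_class [::]) presented_mul.
Proof. by move=> x; rewrite -(word_repr x) word_classM cats0. Qed.

HB.instance Definition _ := isMonoid.Build presented
  presented_mulA presented_mul1 presented_mulr1.

End Presentation.

Section ArtinTits.
Context {A : choiceType}.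

(* [m a b = None] encodes m_{a,b} = oo; the diagonal of [m] is not used. *)
Variable m : A -> A -> option nat.

Definition coxeter_matrix := forall a b, a <> b ->
  m a b = m b a /\ (forall n, m a b = Some n -> (2 <= n)%N).

(* The alternating word abab... of length n. *)
Fixpoint alternating (a b : A) (n : nat) : seq A :=
  if n is n'.+1 then a :: alternating b a n' else [::].

Inductive artin_rel : seq A -> seq A -> Prop :=
| ArtinRel a b n n' of a <> b & m a b = Some n & m b a = Some n' :
    artin_rel (alternating a b n) (alternating b a n').

Definition artin_tits : monoidType := presented artin_rel.

(* Letters (a, true) and (a, false) stand for a and its formal inverse, so the
   monoid presented below is the Coxeter group. *)
Inductive coxeter_rel : seq (A * bool) -> seq (A * bool) -> Prop :=
| CoxFree a e : coxeter_rel [:: (a, e); (a, ~~ e)] [::]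
| CoxSquare a : coxeter_rel [:: (a, true); (a, true)] [::]
| CoxBraid a b n of a <> b & m a b = Some n :
    coxeter_rel (flatten (nseq n [:: (a, true); (b, true)])) [::].

Definition coxeter_group : monoidType := presented coxeter_rel.

Definition coxeter_edge (a b : A) : bool :=
  (a != b) && (if m a b is Some n then (2 < n)%N else true).

Definition irreducible := [set: A] !=set0 /\
  forall a b : A, exists2 p, path coxeter_edge a p & last a p = b.

End ArtinTits.

Definition finitely_generated (P : monoidType) :=
  exists s : seq P, forall p : P,
    exists2 w : seq P, {subset w <= s} & p = (\prod_(x <- w) x)%g.

Definition left_reversible (P : monoidType) :=
  forall p q : P, [set (p * x)%g | x in [set: P]] `&`
                  [set (q * x)%g | x in [set: P]] !=set0.

Definition spherical (A : choiceType) (m : A -> A -> option nat) :=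
  finitely_generated (artin_tits m) /\ finite_set [set: coxeter_group m].

Section InverseSemigroup.
Variable P : monoidType.

(* Partial bijections of P are encoded by their graphs;
   [(s \; t)%relation] is the composite "first t, then s". *)
Definition pbij := set (P * P).

Definition left_mult (p : P) : pbij := [set xy | xy.2 = (p * xy.1)%g].

Inductive Il : set pbij :=
| Il_left p : Il (left_mult p)
| Il_comp s t of Il s & Il t : Il (s \; t)%relation
| Il_inv s of Il s : Il (s^-1)%relation.

Definition dom (s : pbij) : set P := [set x | exists y, s (x, y)].

Definition preim (s : pbij) (e : set P) : set P :=
  [set x | exists2 y, s (x, y) & e y].

Definition constr_ideals : set (set P) := [set dom s | s in Il].

(* Maps J -> {0,1} are extended by 0 to all subsets of P, which does not
   change the topology of pointwise convergence. *)
Definition char := {ptws set P -> bool}.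

Definition Jhat : set char :=
  [set chi : char | [/\ forall e, chi e -> constr_ideals e,
                 exists e, chi e,
                 ~~ chi set0 &
                 forall e f, constr_ideals e -> constr_ideals f ->
                   chi (e `&` f) = chi e && chi f]].

Definition Omega : set char :=
  [set chi : char | Jhat chi /\
    forall (e : set P) (fs : seq (set P)), constr_ideals e ->
      (forall f, f \in fs -> constr_ideals f) ->
      e = \bigcup_(f in [set` fs]) f -> chi e ->
      exists2 f, f \in fs & chi f].

Definition maximal_chars : set char :=
  [set chi : char | Jhat chi /\ forall psi : char, Jhat psi ->
    (forall e, chi e -> psi e) -> psi = chi].

Definition boundary : set char := Jhat `&` closure maximal_chars.

(* s.chi = chi(s^-1 . s); s^-1 e s is the idempotent with domain s^-1(e). *)
Definition act (s : pbij) (chi : char) : char :=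
  fun e => `[< constr_ideals e >] && chi (preim s e).

(* The class [s, chi], as the set of its representatives. *)
Definition germ (s : pbij) (chi : char) : set (pbij * char) :=
  [set tpsi | [/\ Il tpsi.1, tpsi.2 = chi, chi (dom tpsi.1) &
    exists e, [/\ constr_ideals e, chi e &
      forall x y, e x -> s (x, y) <-> tpsi.1 (x, y)]]].

(* The transformation groupoid of the action on the invariant subspace Y. *)
Definition groupoid (Y : set char) : set (set (pbij * char)) :=
  [set g | exists s chi, [/\ Il s, Y chi, chi (dom s) & g = germ s chi]].

(* The open bisection {[s, chi] | chi in Y, chi(s^-1 s) = 1}. *)
Definition bisection (Y : set char) (s : pbij) : set (set (pbij * char)) :=
  [set germ s chi | chi in Y `&` [set chi : char | chi (dom s)]].

End InverseSemigroup.

Section SemigroupAlgebras.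
Variables (R : realType) (P : monoidType).
Local Notation arrows := (set (pbij P * char P)).

(* Functions on the groupoid are extended by 0.  Those supported on one of the
   compact open bisections are of the form [s, chi] |-> h(chi). *)
Definition elementary_fun (Y : set (char P)) (f : arrows -> R[i]) :=
  exists s (h : char P -> R[i]^o),
    [/\ Il s,
        {within Y `&` [set chi : char P | chi (dom s)], continuous h},
        forall chi, Y chi -> chi (dom s) -> f (germ s chi) = h chi &
        forall g, ~ bisection Y s g -> f g = 0].

(* C_c of the groupoid, i.e. the linear span of the functions above. *)
Definition Cc (Y : set (char P)) : set (arrows -> R[i]) :=
  [set f | exists n (F : 'I_n -> arrows -> R[i]),
    (forall i, elementary_fun Y (F i)) /\ forall g, f g = \sum_(i < n) F i g].

(* [T] is the convolution operator of [f] on l^2 of the groupoid (the direct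
   sum of the regular representations on l^2 of the source fibres):
   (T delta_h)(g) = f(g h^-1) if g and h have the same source, else 0, where
   [s, chi] [t, chi]^-1 = [s t^-1, t.chi]. *)
Definition regular_rep (Y : set (char P)) (f : arrows -> R[i])
    (T : l2 R (groupoid Y) -> l2 R (groupoid Y)) :=
  bounded_op T /\
  forall (g h : groupoid Y) s t chi psi,
    (val g) (s, chi) -> (val h) (t, psi) ->
    (chi = psi -> T (delta h) g = f (germ (s \; t^-1)%relation (act t chi))) /\
    (chi <> psi -> T (delta h) g = 0).

Definition Cstar_groupoid (Y : set (char P)) : star_alg R :=
  sub_alg (bounded_ops R (groupoid Y))
    (aclosure (bounded_ops R (groupoid Y))
      [set T | exists2 f, Cc Y f & regular_rep f T]).

Definition left_regular (p : P) (T : l2 R P -> l2 R P) :=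
  bounded_op T /\ forall x, T (delta x) = delta (p * x)%g.

Definition Cstar_lambda : star_alg R :=
  sub_alg (bounded_ops R P)
    (cstar_generated (bounded_ops R P)
      [set T | exists p, left_regular p T]).

Definition canonical_iso
    (Phi : Cstar_lambda -> Cstar_groupoid (@Omega P)) :=
  star_iso Phi /\
  forall p T, left_regular p T ->
    regular_rep (\1_(bisection (@Omega P) (left_mult p))) (Phi T).

Definition restriction_map
    (rho : Cstar_groupoid (@Omega P) -> Cstar_groupoid (@boundary P)) :=
  star_hom rho /\
  forall f T, Cc (@Omega P) f -> regular_rep f T ->
    regular_rep (patch (fun=> 0) (groupoid (@boundary P)) f) (rho T).

Definition canonical_projection
    (pi : Cstar_lambda -> Cstar_groupoid (@boundary P)) :=
  exists Phi rho, [/\ canonical_iso Phi, restriction_map rho & pi = rho \o Phi].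

(* Values outside [elts] are irrelevant; on [elts Cstar_lambda] the canonical
   projection is unique, so this is the kernel of *the* canonical projection. *)
Definition Ker_boundary : set (bounded_ops R P) :=
  [set T | elts Cstar_lambda T /\
    exists2 pi, canonical_projection pi & pi T = azero].

Definition Ker_alg : star_alg R := sub_alg (bounded_ops R P) Ker_boundary.

End SemigroupAlgebras.

Arguments Ker_boundary R P _ : clear implicits.

(* Main.v *)
(* Let V_p be the isometries generating C*_lambda(P), and 1_Y the projection onto l2(Y).

   Every T in C*_lambda(P) outside the smallest ideal (the compact operators if A is finite, 0
   otherwise) can be cut down to a projection.  If A is infinite and T delta_x <> 0, approximate
   V_x^* T^* T V_x by a polynomial S in the V_p and V_p^*: on the elements of P avoiding the
   finitely many atoms occurring in S, it is a scalar.  If A is finite, an operator with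
   |T delta_(p c^j)| -> 0 for all p in P and all atoms c is compact: p |-> {c : t <= p c^N implies
   t <= p for all N and all short t} provides almost invariant choices of an atom c, so that the
   vectors in l2(P) supported far from 1 decompose into pieces on which S almost commutes with
   right multiplication by powers of a single c.  Hence T delta_(p c^j) does not tend to 0 for some
   p and c, and S is a scalar on the set of y for which c^j is the exact power of c dividing y and
   no other atom divides y.

   A game on the Coxeter graph turns these projections into a fixed one.  Multiplying p on the left
   by suitable atoms moves the set of atoms dividing p, as irreducibility makes any atom reachable;
   if P is left reversible this requires that some atom a does not divide p, otherwise nothing.  So
   1_(P - aP), respectively 1, lies in the ideal generated by T, is infinite, and generates
   Ker_boundary, respectively C*_lambda(P): when P is left reversible the boundary is a single point,
   and T belongs to Ker_boundary if and only if the norms of T V_p are arbitrarily small. *)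

Require Import Defs.
From HB Require Import structures.
From mathcomp Require Import all_boot all_order all_algebra.
From mathcomp Require Import complex ring lra zify.
From mathcomp Require Import all_classical all_reals all_analysis.
From mathcomp Require Rstruct.

Set Implicit Arguments.
Unset Strict Implicit.
Unset Printing Implicit Defensive.
Import Order.TTheory GRing.Theory Num.Theory.
Import numFieldNormedType.Exports.

(** * Coxeter groups *)

(** Cancellation and lcms in the monoid are obtained from the Coxeter group: a signed action on
    reflections gives the exchange condition, the dual of the geometric representation shows that
    the order of a b is not smaller than m_{a,b}, and Matsumoto's theorem embeds the simple elements
    into the group. An induction on length then passes from simple elements to all of P.

    For finite A the obstacle is that no choice of a good atom c = c(p) is exactly invariant under
    the partial translations u z |-> v z occurring in S^* S. So M choices are made at M increasing
    scales. The set of good atoms at p shrinks as the scale grows, so the choices at p and at a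
    translate of p differ for a number of scales bounded independently of M; averaging over the
    scales leaves an error of order 1/M.

    Membership in [Ker_boundary] asserts that a canonical projection exists. It is built by
    continuity from a relation between spans of generators, which works because a groupoid operator
    in the span is, on finitely many basis vectors of a source fibre, a copy of an operator on
    l2(P). *)

Section PresentedAction.
Context {X : choiceType} (rel : seq X -> seq X -> Prop) {T : Type}.
Variable act : X -> T -> T.

Lemma presented_act :
  (forall l r, rel l r -> forall t, foldr act t l = foldr act t r) ->
  forall u v, word_eqv rel u v -> forall t, foldr act t u = foldr act t v.
Proof.
move=> h u v; elim=> [a b l r lr|a|a b _ ih|a b c _ ih1 _ ih2] t.
- by rewrite !foldr_cat (h _ _ lr).
- by [].
- by rewrite ih.
- by rewrite ih1.
Qed.

End PresentedAction.

Section CoxeterAction.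
Context {A : choiceType} (m : A -> A -> option nat) {T : Type}.
Variable act : A -> T -> T.
Hypothesis actK : forall a, involutive (act a).
Hypothesis act_braid : forall a b n, a <> b -> m a b = Some n ->
  forall t, foldr act t (flatten (nseq n [:: a; b])) = t.

(** A formal inverse may act like its generator because each [act a] is an involution; this is why
    [map fst] may forget the exponents. *)
Lemma coxeter_act (u v : seq (A * bool)) :
  word_eqv (coxeter_rel m) u v ->
  forall t, foldr act t (map fst u) = foldr act t (map fst v).
Proof.
move=> uv t; rewrite !foldr_map.
apply: (@presented_act _ _ _ (fun x => act x.1) _ _ _ uv) => {u v uv t}.
move=> l r [a e|a|a b n ab mab] s /=; rewrite ?actK//.
rewrite -[RHS](act_braid ab mab); elim: (n) => //= k ->//.
Qed.

End CoxeterAction.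

Local Notation alternating := (@Defs.alternating _).

Section Coxeter.
Context {A : choiceType} (m : A -> A -> option nat).
Hypothesis hm : coxeter_matrix m.
Implicit Types (a b c : A) (s t : seq A).
Local Open Scope group_scope.

Definition wd (s : seq A) : coxeter_group m :=
  word_class (coxeter_rel m) [seq (a, true) | a <- s].
Local Notation g a := (wd [:: a]).

Lemma wd_cat s t : wd (s ++ t) = wd s * wd t.
Proof. by rewrite /wd map_cat -word_classM. Qed.

Lemma wd_cons a s : wd (a :: s) = g a * wd s.
Proof. exact: (wd_cat [:: a]). Qed.

Lemma wd_nil : wd [::] = 1. Proof. by []. Qed.

Lemma wd_rcons s a : wd (rcons s a) = wd s * g a.
Proof. by rewrite -cats1 wd_cat. Qed.

Lemma genK a : g a * g a = 1.
Proof.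
rewrite -wd_cat; apply/word_classP.
exact: (@word_rel _ (coxeter_rel m) [::] [::] _ _ (CoxSquare m a)).
Qed.

Lemma genKA a x : g a * (g a * x) = x.
Proof. by rewrite mulgA genK mul1g. Qed.

Lemma genAK a x : x * g a * g a = x.
Proof. by rewrite -mulgA genK mulg1. Qed.

Lemma wd_revl s : wd (rev s) * wd s = 1.
Proof.
elim: s => [|a s ih]; first by rewrite mulg1.
by rewrite rev_cons wd_rcons (wd_cons a s) -mulgA genKA.
Qed.

Lemma wd_revr s : wd s * wd (rev s) = 1.
Proof. by rewrite -{1}(revK s) wd_revl. Qed.

Lemma wd_cancel s x y : wd s * x = wd s * y -> x = y.
Proof.
by move=> /(congr1 (fun z => wd (rev s) * z)); rewrite !mulgA !wd_revl !mul1g.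
Qed.

Lemma wd_cancelr s x y : x * wd s = y * wd s -> x = y.
Proof.
by move=> /(congr1 (fun z => z * wd (rev s))); rewrite -!mulgA !wd_revr !mulg1.
Qed.

Lemma wd_rev s t : wd s = wd t -> wd (rev s) = wd (rev t).
Proof. by move=> st; apply: (@wd_cancel s); rewrite wd_revr st wd_revr. Qed.

Lemma wd_surj (x : coxeter_group m) : exists s, x = wd s.
Proof.
suff h u : exists s, word_class (coxeter_rel m) u = wd s.
  by have [s hs] := h (repr x); exists s; rewrite -hs (word_repr x).
elim: u => [|[a e] u [s hs]]; first by exists [::].
exists (a :: s); rewrite wd_cons -hs (_ : (a, e) :: u = [:: (a, e)] ++ u)//.
rewrite -word_classM; congr (_ * _).
case: e => //; apply: (@wd_cancel [:: a]); rewrite genK.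
rewrite [LHS]word_classM; apply/word_classP.
exact: (@word_rel _ (coxeter_rel m) [::] [::] _ _ (CoxFree m a true)).
Qed.

Lemma gen_order a b n : a <> b -> m a b = Some n -> (g a * g b) ^+ n = 1.
Proof.
move=> ab mab.
have -> : (g a * g b) ^+ n = wd (flatten (nseq n [:: a; b])).
  elim: (n) => // k ih; rewrite expgS ih.
  by rewrite -[RHS]/(wd ([:: a; b] ++ _)) (wd_cat [:: a; b]) (wd_cons a [:: b]).
apply/word_classP.
have := @word_rel _ (coxeter_rel m) [::] [::] _ _ (CoxBraid ab mab).
rewrite cats0 /=; congr word_eqv.
by elim: (n) => //= k ->.
Qed.

Lemma alternating_cat a b j i :
  alternating a b (j + i) =
  alternating a b j ++ alternating (if odd j then b else a)
                                   (if odd j then a else b) i.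
Proof.
elim: j a b => // j ih a b; rewrite addSn /= ih; congr cons; congr cat.
by case: (odd j).
Qed.

Lemma size_alternating a b k : size (alternating a b k) = k.
Proof. by elim: k a b => //= k ih a b; rewrite ih. Qed.

Lemma rev_alternating a b k : rev (alternating a b k) =
  if odd k then alternating a b k else alternating b a k.
Proof.
elim: k a b => // k ih a b.
rewrite -[in LHS]addn1 alternating_cat rev_cat ih /=.
by case: (odd k).
Qed.

Lemma wd_alternating2 a b n : wd (alternating a b n.*2) = (g a * g b) ^+ n.
Proof.
elim: n => // n ih; rewrite doubleS expgS -ih.
by rewrite -[LHS]/(wd ([:: a; b] ++ _)) (wd_cat [:: a; b]) (wd_cons a [:: b]).
Qed.

Lemma wd_braid a b n : a <> b -> m a b = Some n ->
  wd (alternating a b n) = wd (alternating b a n).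
Proof.
move=> ab mab.
apply: (@wd_cancelr (rev (alternating b a n))); rewrite wd_revr -wd_cat.
rewrite rev_alternating -(gen_order ab mab) -wd_alternating2 -addnn.
by rewrite alternating_cat; case: (odd n).
Qed.

(* The words [altr a b k] are the alternating words ending in [b]. *)
Fixpoint altr (a b : A) (k : nat) : seq A :=
  if k is k'.+1 then (if odd k' then a else b) :: altr a b k' else [::].

Lemma altrE a b k :
  altr a b k = if odd k then alternating b a k else alternating a b k.
Proof.
elim: k => //= k ->; case: (odd k) => //=.
Qed.

Lemma altrS a b k : altr a b k.+1 = rcons (altr b a k) b.
Proof.
elim: k => // k ih.
by rewrite -[LHS]/(_ :: altr a b k.+1) ih /=; case: (odd k).
Qed.

Lemma flatten_altr a b n : flatten (nseq n [:: a; b]) = altr a b n.*2.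
Proof. by elim: n => //= n ->; rewrite odd_double. Qed.

(* [reflections s] lists the reflections t such that deleting one letter of the
   word s yields a word for (wd s) * t. *)
Fixpoint reflections (s : seq A) : seq (coxeter_group m) :=
  if s is a :: s' then wd (rev s') * g a * wd s' :: reflections s' else [::].

Lemma size_reflections s : size (reflections s) = size s.
Proof. by elim: s => //= a s ->. Qed.

Lemma mem_reflections s (t : coxeter_group m) : t \in reflections s ->
  exists s1 c s2, s = s1 ++ c :: s2 /\ wd s2 * t = g c * wd s2.
Proof.
elim: s => //= a s ih; rewrite inE => /predU1P[->|/ih[s1 [c [s2 [-> h]]]]].
  by exists [::], a, s; split=> //; rewrite !mulgA wd_revr mul1g.
by exists (a :: s1), c, s2.
Qed.

(** The signed conjugation action: a conjugates t, and flips the sign exactly when t = a. It is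
    defined on all group elements t, which avoids singling out the set of reflections. *)
Let actN a (te : coxeter_group m * bool) := (g a * te.1 * g a, te.2 (+) (te.1 == g a)).

Let foldr_actN s (t : coxeter_group m) e : foldr actN (t, e) s =
  (wd s * t * wd (rev s), e (+) odd (count_mem t (reflections s))).
Proof.
elim: s => [|a s ih] /=; first by rewrite wd_nil mul1g mulg1 addbF.
rewrite ih /actN /= rev_cons wd_rcons (wd_cons a s) !mulgA; congr pair.
rewrite oddD oddb -addbA; congr (_ (+) _); rewrite addbC; congr (_ (+) _).
apply/eqP/eqP => [h|<-].
  by rewrite -h !mulgA wd_revl mul1g -mulgA wd_revl mulg1.
by rewrite !mulgA wd_revr mul1g -mulgA wd_revr mulg1.
Qed.

Let actNK a : involutive (actN a).
Proof.
case=> t e; rewrite /actN /= !mulgA genK mul1g genAK -addbA.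
suff -> : (g a * t * g a == g a) = (t == g a) by rewrite addbb addbF.
apply/eqP/eqP => [h|->]; last by rewrite genK mul1g.
by rewrite -[t](genKA a) -[g a * t](genAK a) h genK mulg1.
Qed.

Lemma gen_shift a b k : g b * (g a * g b) ^+ k = (g b * g a) ^+ k * g b.
Proof.
elim: k => [|k ih]; first by rewrite mulg1 mul1g.
by rewrite expgSr mulgA ih !mulgA expgSr !mulgA.
Qed.

Lemma reflections_altr a b k :
  reflections (altr a b k) = rev [seq (g b * g a) ^+ i * g b | i <- iota 0 k].
Proof.
suff h j : forall a b, wd (rev (altr a b j)) * g (if odd j then a else b) * wd (altr a b j)
    = (g b * g a) ^+ j * g b.
  elim: k => // k ih; rewrite (_ : iota 0 k.+1 = rcons (iota 0 k) k).
    by rewrite map_rcons rev_rcons -ih -h.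
  by rewrite -addn1 iotaD cats1.
elim: j => [|j ih] {}a {}b.
  by rewrite -[rev _]/[::] wd_nil expg0 !mul1g mulg1.
rewrite altrS rev_rcons wd_rcons (wd_cons b (rev _)) ?wd_rcons.
transitivity (g b * (wd (rev (altr b a j)) * g (if odd j then b else a) * wd (altr b a j)) * g b).
  by rewrite /= !mulgA; case: (odd j).
by rewrite ih !mulgA gen_shift -!mulgA expgSr !mulgA.
Qed.

(** Along the braid word of length 2n the reflections are (b a)^i b for i < 2n. Since (b a)^n = 1,
    each is listed an even number of times and the signs cancel. *)
Let actN_braid a b n : a <> b -> m a b = Some n ->
  forall te, foldr actN te (flatten (nseq n [:: a; b])) = te.
Proof.
move=> ab mab [t e]; rewrite foldr_actN flatten_altr.
have ba1 : (g b * g a) ^+ n = 1.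
  by rewrite -[LHS](genAK b) -gen_shift (gen_order ab mab) mulg1 genK.
have e1 : wd (altr a b n.*2) = 1.
  by rewrite altrE odd_double wd_alternating2 (gen_order ab mab).
rewrite e1 mul1g (wd_rev (t := [::])) ?e1// mulg1; congr pair.
rewrite reflections_altr count_rev -addnn iotaD map_cat count_cat add0n.
rewrite -{2}[n]addn0 iotaDl -map_comp.
rewrite (@eq_map _ _ (_ \o _) (fun i => (g b * g a) ^+ i * g b)).
  by rewrite addnn odd_double addbF.
by move=> i /=; rewrite expgnDr ba1 mul1g.
Qed.

(** By [foldr_actN] this parity is the sign that the word produces at t, and [actN] is an action of
    the Coxeter group. *)
Lemma odd_count_reflections s s' (t : coxeter_group m) : wd s = wd s' ->
  odd (count_mem t (reflections s)) = odd (count_mem t (reflections s')).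
Proof.
move=> /word_classP/(coxeter_act actNK actN_braid)/(_ (t, false)).
by rewrite -!map_comp !map_id_in// !foldr_actN /= => -[].
Qed.

(** The sign character, realised by letting every generator negate a boolean. *)
Lemma odd_size_wd s s' : wd s = wd s' -> odd (size s) = odd (size s').
Proof.
have hK (a : A) : involutive negb by exact: negbK.
have hb (a b : A) n : a <> b -> m a b = Some n ->
    forall e, foldr (fun=> negb) e (flatten (nseq n [:: a; b])) = e.
  by move=> _ _ e; elim: n => //= n ->; rewrite negbK.
move=> /word_classP/(coxeter_act hK hb)/(_ false).
rewrite -!map_comp !map_id_in//.
have sz (u : seq A) : foldr (fun=> negb) false u = odd (size u).
  by elim: u => //= a u ->.
by rewrite !sz.
Qed.

End Coxeter.

(** * The geometric representation and the order of a product of two generators *)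

Section GeometricRepresentation.
Context {RR : realType} {A : choiceType} (m : A -> A -> option nat).
Hypothesis hm : coxeter_matrix m.
Implicit Types (a b c : A) (s t : seq A).
Local Notation g a := (wd m [:: a]).
Local Open Scope ring_scope.

(** With B the standard bilinear form on simple roots, [kappa] is -2 B. The value m_{a,b} = oo is
    read as the angle 0, that is B = -1. *)
Let angle a b : RR := if m a b is Some n then pi / n%:R else 0.
Let kappa a b : RR := if a == b then - 2 else 2 * cos (angle a b).
(* The contragredient of the geometric representation: f is the function
   a |-> f(alpha_a) on the simple roots. *)
Let refl a (f : A -> RR) : A -> RR := fun c => f c + kappa a c * f a.

Let kappaC a b : kappa a b = kappa b a.
Proof.
rewrite /kappa eq_sym; case: eqVneq => // /eqP ba.
by rewrite /angle (hm ba).1.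
Qed.

Let kappaxx a : kappa a a = - 2. Proof. by rewrite /kappa eqxx. Qed.

Let reflE a f c : refl a f c = f c + kappa a c * f a. Proof. by []. Qed.

Let reflK a : involutive (refl a).
Proof. by move=> f; apply/funext => c; rewrite /refl kappaxx; ring. Qed.

(** The coefficients along a dihedral orbit satisfy a Chebyshev recurrence. It is solved by q j =
    sin((j - 1) t) / sin t, or by q j = j - 1 when m_{a,b} = oo, whence the shifted initial values
    -1, 0, 1. *)
Let foldr_refl_altr a b (q : nat -> RR) f j : a <> b ->
  q 0%N = -1 -> q 1%N = 0 -> q 2%N = 1 ->
  (forall j, q j.+2 = kappa a b * q j.+1 - q j) ->
  foldr refl f (altr a b j) (if odd j then a else b) =
    q j.+2 * f b + q j.+1 * f a /\
  foldr refl f (altr a b j) (if odd j then b else a) =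
    - (q j.+1 * f b + q j * f a).
Proof.
move=> ab q0 q1 q2 qS; elim: j => [|j [ih1 ih2]].
  by rewrite /= q0 q1 q2; split; ring.
rewrite [altr _ _ _]/= [foldr _ _ _]/= [odd j.+1]/= !reflE; split; last first.
  by case: (odd j) ih1 ih2 => /= -> _; rewrite kappaxx; ring.
rewrite (qS j.+1); case: (odd j) ih1 ih2 => /= -> ->; rewrite (qS j); first by ring.
by rewrite kappaC; ring.
Qed.

Let sin_rec (t : RR) (x : RR) : sin ((x + 1) * t) = 2 * cos t * sin (x * t) - sin ((x - 1) * t).
Proof. by rewrite !mulrDl mulN1r sinD sinB !mul1r; ring. Qed.

Let angle_gt0 a b n : a <> b -> m a b = Some n ->
  [/\ (1 < n)%N, 0 < pi / n%:R :> RR, pi / n%:R < pi :> RR & sin (pi / n%:R : RR) != 0].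
Proof.
move=> ab mab; have n1 := (hm ab).2 _ mab.
have n0 : (0 : RR) < n%:R by rewrite ltr0n ltnW.
have h0 : 0 < pi / n%:R :> RR by rewrite divr_gt0 ?pi_gt0.
have h1 : pi / n%:R < pi :> RR.
  by rewrite ltr_pdivrMr// ltr_pMr ?pi_gt0// ltr1n.
by split=> //; rewrite gt_eqF// sin_gt0_pi// h0.
Qed.

Let refl_braid a b n : a <> b -> m a b = Some n ->
  forall f, foldr refl f (flatten (nseq n [:: a; b])) = f.
Proof.
move=> ab mab f; rewrite flatten_altr.
have [n1 t0 tpi s0] := angle_gt0 ab mab.
set t : RR := pi / n%:R in t0 tpi s0.
have kab : kappa a b = 2 * cos t by rewrite /kappa; case: eqP => // _; rewrite /angle mab.
pose q j : RR := sin ((j%:R - 1) * t) / sin t.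
have nt : n.*2%:R * t = pi *+ 2.
  rewrite -mul2n natrM -mulrA [n%:R * _]mulrC /t divfK ?mulr_natl//.
  by rewrite pnatr_eq0 -lt0n ltnW.
have q0 : q 0%N = -1 by rewrite /q sub0r mulN1r sinN mulNr divff.
have q1 : q 1%N = 0 by rewrite /q subrr mul0r sin0 mul0r.
have q2 : q 2%N = 1 by rewrite /q (_ : 2%:R - 1 = 1) ?mul1r ?divff//; ring.
have qS j : q j.+2 = kappa a b * q j.+1 - q j.
  rewrite /q kab (_ : j.+2%:R - 1 = j%:R + 1) ?sin_rec; last by rewrite -addn2 natrD; ring.
  rewrite (_ : j.+1%:R - 1 = j%:R); last by rewrite -addn1 natrD; ring.
  by rewrite mulrDl mulNr mulrA.
have [] := foldr_refl_altr f n.*2 ab q0 q1 q2 qS.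
rewrite odd_double.
have per x : sin ((n.*2%:R + x) * t) = sin (x * t) :> RR.
  by rewrite mulrDl nt addrC sinD2pi.
have -> : q n.*2.+2 = 1.
  by rewrite -q2 /q -(addn2 n.*2) natrD -addrA per.
have -> : q n.*2.+1 = 0.
  by rewrite -q1 /q -(addn1 n.*2) natrD -addrA per.
have -> : q n.*2 = -1 by rewrite -q0 /q per sub0r.
rewrite !mul1r !mul0r addr0 add0r mulN1r opprK => hb ha.
apply/funext => c.
have [->//|/eqP cb] := eqVneq c b.
have [->//|/eqP ca] := eqVneq c a.
(* For a third root alpha_c, the coefficients u and v below make alpha_c + u alpha_a + v alpha_b
   orthogonal to alpha_a and alpha_b, so its value is invariant under both reflections. The linear
   system has determinant d = 4 sin(t)^2. *)
pose d : RR := 4 - kappa a b ^+ 2.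
have d0 : d != 0.
  rewrite /d kab exprMn cos2sin2 (_ : _ - _ = 4 * sin t ^+ 2); last by ring.
  by rewrite mulf_neq0 ?expf_neq0// pnatr_eq0.
pose u := (2 * kappa a c + kappa a b * kappa b c) / d.
pose v := (2 * kappa b c + kappa a b * kappa a c) / d.
pose I (h : A -> RR) := h c + u * h a + v * h b.
have hu : 2 * u = kappa a c + kappa a b * v by rewrite /u /v /d; field.
have hv : 2 * v = kappa b c + kappa a b * u by rewrite /u /v /d; field.
have Ia h : I (refl a h) = I h.
  rewrite /I /refl kappaxx; apply/eqP; rewrite -subr_eq0.
  rewrite (_ : _ - _ = (kappa a c + kappa a b * v - 2 * u) * h a); last by ring.
  by rewrite hu subrr mul0r.
have Ib h : I (refl b h) = I h.
  rewrite /I /refl kappaxx (kappaC b a); apply/eqP; rewrite -subr_eq0.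
  rewrite (_ : _ - _ = (kappa b c + kappa a b * u - 2 * v) * h b); last by ring.
  by rewrite hv subrr mul0r.
have : I (foldr refl f (altr a b n.*2)) = I f.
  by elim: (n.*2) => //= k ih; case: (odd k); rewrite ?Ia ?Ib.
by rewrite /I ha hb => /addIr/addIr.
Qed.

(** The word is evaluated on the function that is 1 at alpha_b and 0 at the other roots. If i < n,
    triviality forces sin(2 i t) = 0 and cos(2 i t) = 1, hence sin(i t) = 0, although 0 < i t < pi.
    For m_{a,b} = oo the coefficient 2 i would have to vanish. *)
Lemma gen_order_ge_subproof a b i : a <> b -> (0 < i)%N ->
  ((g a * g b) ^+ i = 1)%g -> exists2 n, m a b = Some n & (n <= i)%N.
Proof.
move=> ab i0 abi.
have e1 : wd m (altr a b i.*2) = wd m [::].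
  by rewrite altrE odd_double wd_alternating2 abi.
have e2 f : foldr refl f (altr a b i.*2) = f.
  move: e1 => /word_classP/(coxeter_act reflK refl_braid)/(_ f).
  by rewrite -!map_comp !map_id_in.
pose f c : RR := (c == b)%:R.
have fa : f a = 0 by rewrite /f; case: eqP.
have fb : f b = 1 by rewrite /f eqxx.
case mab: (m a b) => [n|]; last first.
  pose q j : RR := j%:R - 1.
  have := @foldr_refl_altr a b q f i.*2 ab; rewrite odd_double e2 fa fb /q /=.
  rewrite /kappa (negbTE (introN eqP ab)) /angle mab cos0.
  case=> //; try ring.
    by move=> j; rewrite -addn2 -addn1 !natrD; ring.
  move=> _ /eqP; rewrite eq_sym oppr_eq0 mulr0 addr0 mulr1 -addn1 natrD addrK.
  by rewrite pnatr_eq0 double_eq0 (gtn_eqF i0).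
exists n => //; rewrite leqNgt; apply/negP => ilt.
have [n1 t0 tpi s0] := angle_gt0 ab mab.
set t : RR := pi / n%:R in t0 tpi s0.
have kab : kappa a b = 2 * cos t by rewrite /kappa; case: eqP => // _; rewrite /angle mab.
pose q j : RR := sin ((j%:R - 1) * t) / sin t.
have q0 : q 0%N = -1 by rewrite /q sub0r mulN1r sinN mulNr divff.
have q1 : q 1%N = 0 by rewrite /q subrr mul0r sin0 mul0r.
have q2 : q 2%N = 1 by rewrite /q (_ : 2%:R - 1 = 1) ?mul1r ?divff//; ring.
have qS j : q j.+2 = kappa a b * q j.+1 - q j.
  rewrite /q kab (_ : j.+2%:R - 1 = j%:R + 1) ?sin_rec; last by rewrite -addn2 natrD; ring.
  rewrite (_ : j.+1%:R - 1 = j%:R); last by rewrite -addn1 natrD; ring.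
  by rewrite mulrDl mulNr mulrA.
have [] := foldr_refl_altr f i.*2 ab q0 q1 q2 qS.
rewrite odd_double e2 fa fb !mulr0 !mulr1 !addr0 /q => /esym/(congr1 ( *%R^~ (sin t))).
rewrite mulfVK// mul1r => h1 /esym/eqP; rewrite oppr_eq0 mulf_eq0 invr_eq0 (negbTE s0) orbF.
rewrite -addn1 natrD addrK => /eqP h2.
move: h1; rewrite -addn2 natrD (_ : _ - 1 = i.*2%:R + 1); last by ring.
rewrite mulrDl mul1r sinD h2 mul0r add0r -[RHS]mul1r => /(mulIf s0).
rewrite -muln2 natrM mulrAC mulr_natr cos_mulr2n cos2sin2 => h3.
have : sin (i%:R * t) ^+ 2 == 0 by apply/eqP; move: h3; rewrite mulr2n; lra.
rewrite sqrf_eq0 gt_eqF// sin_gt0_pi//.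
rewrite mulr_gt0 ?ltr0n//= /t mulrCA gtr_pMr ?pi_gt0//.
by rewrite ltr_pdivrMr ?mul1r ?ltr_nat// ltr0n ltnW.
Qed.

End GeometricRepresentation.

Lemma cat_cons_split (T : Type) (u z s1 s2 : seq T) x :
  u ++ z = s1 ++ x :: s2 ->
  (exists2 u2, u = s1 ++ x :: u2 & s2 = u2 ++ z) \/
  (exists2 z1, s1 = u ++ z1 & z = z1 ++ x :: s2).
Proof.
elim: u s1 => [|y u ih] [|w s1] /=; first by right; exists [::].
- by move=> ->; right; exists (w :: s1).
- by case=> -> <-; left; exists u.
case=> -> /ih[[u2 -> ->]|[z1 -> ->]]; first by left; exists u2.
by right; exists z1.
Qed.

(** * Reduced words: exchange condition and Matsumoto's theorem *)

Section Reduced.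
Context {A : choiceType} (m : A -> A -> option nat).
Hypothesis hm : coxeter_matrix m.
Implicit Types (a b c : A) (s t u v z : seq A).
Local Notation wd := (wd m).
Local Notation g a := (wd [:: a]).

(** The statement mentions no real field, so the representation is taken over a concrete model of
    the reals. *)
Lemma gen_order_ge a b i : a <> b -> 0 < i ->
  ((g a * g b) ^+ i = 1)%g -> exists2 n, m a b = Some n & n <= i.
Proof.
exact: (@gen_order_ge_subproof Rstruct.RbaseSymbolsImpl_R__canonical__reals_Real).
Qed.

Definition reduced s := forall t, wd t = wd s -> size s <= size t.

Lemma reduced_eq s t : wd s = wd t -> size s = size t -> reduced s -> reduced t.
Proof. by move=> st sz rs u; rewrite -st -sz; exact: rs. Qed.

Lemma reduced_rev s : reduced s -> reduced (rev s).
Proof.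
move=> rs t /(@wd_rev _ m); rewrite revK size_rev => /rs.
by rewrite size_rev.
Qed.

Lemma reduced_catr s t : reduced (s ++ t) -> reduced t.
Proof.
move=> rst u ut; have := rst (s ++ u); rewrite !wd_cat ut => /(_ erefl).
by rewrite !size_cat leq_add2l.
Qed.

Lemma reduced_catl s t : reduced (s ++ t) -> reduced s.
Proof.
move=> rst u us; have := rst (u ++ t); rewrite !wd_cat us => /(_ erefl).
by rewrite !size_cat leq_add2r.
Qed.

Lemma reduced_exists (x : coxeter_group m) : exists2 s, x = wd s & reduced s.
Proof.
have [s xs] := wd_surj x.
have : exists n, `[< exists2 t, wd t = wd s & size t = n >].
  by exists (size s); apply/asboolP; exists s.
case/ex_minnP => n /asboolP[t ts <-] h.
exists t; first by rewrite ts.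
by move=> u ut; apply: h; apply/asboolP; exists u => //; rewrite ut.
Qed.

Lemma not_reducedP s : ~ reduced s -> exists2 t, wd t = wd s & size t < size s.
Proof.
move=> h; have [t st rt] := reduced_exists (wd s).
exists t => //; rewrite ltnNge; apply/negP => sz; apply: h.
by move=> u us; apply: leq_trans sz _; apply: rt; rewrite us.
Qed.

Lemma deletion_mem s t a : wd s = wd t -> g a \in reflections m t ->
  exists s1 c s2, t = s1 ++ c :: s2 /\ wd (c :: s2) = wd (rcons s2 a).
Proof.
move=> _ /mem_reflections[s1 [c [s2 [-> h]]]]; exists s1, c, s2; split=> //.
by rewrite wd_rcons h wd_cons.
Qed.

(** If a shorter word t represents s a, then t a represents s, and appending a changes the parity of
    the occurrences of a among the reflections. So a is a reflection of s, which is the claim, or of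
    t; in the latter case deleting a letter of t gives a word for s shorter than s. *)
Lemma exchange_r s a : reduced s -> ~ reduced (rcons s a) ->
  exists s1 c s2, s = s1 ++ c :: s2 /\ wd (c :: s2) = wd (rcons s2 a).
Proof.
move=> rs /not_reducedP[t ta sz].
have st : wd s = wd (rcons t a) by rewrite wd_rcons ta wd_rcons genAK.
have szt : size t < size s.
  have := odd_size_wd ta; rewrite !size_rcons /= in sz *.
  by move: sz; rewrite ltnS leq_eqVlt => /orP[/eqP->|//]; case: (odd _).
have := odd_count_reflections (g a) st.
have -> : odd (count_mem (g a) (reflections m (rcons t a))) =
          ~~ odd (count_mem (g a) (reflections m t)).
  have h u x : count_mem x (reflections m (rcons u a)) =
      count_mem (g a * x * g a)%g (reflections m u) + (x == g a).
    elim: u => [|c u ih].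
      rewrite [rcons _ _]/= [reflections _ [:: a]]/= [count_mem _ _]/= add0n addn0.
      by rewrite -[rev _]/[::] wd_nil mul1g mulg1 eq_sym.
    rewrite [rcons _ _]/= [reflections _ _]/= [count_mem _ _]/= ih [reflections _ _ in RHS]/=.
    rewrite [in RHS]/= -addnA; congr (nat_of_bool _ + _).
    rewrite rev_rcons wd_rcons (wd_cons m a (rev u)).
    apply/eqP/eqP => [<-|h].
      by rewrite !mulgA genK mul1g genAK.
    by rewrite -[x](genKA a) -[(g a * x)%g](genAK a) -h !mulgA.
  by rewrite h eqxx -mulgA genK mulg1 oddD addbT.
have [/idP ma|/negbTE nma] := boolP (g a \in reflections m s).
  by move=> _; exact: (deletion_mem erefl ma).
have -> : count_mem (g a) (reflections m s) = 0 by apply/count_memPn; rewrite nma.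
move=> /esym/negbT; rewrite negbK => odd1.
have /(deletion_mem erefl)[s1 [c [s2 [ets h]]]] : g a \in reflections m t.
  by apply/negPn/negP => /count_memPn h; rewrite h in odd1.
have := rs (s1 ++ s2); rewrite st ets wd_rcons !wd_cat h wd_rcons -mulgA genAK => /(_ erefl).
move=> h2; move: szt; rewrite ets !size_cat /= addnS ltnNge ltnW//.
by rewrite ltnS -size_cat.
Qed.

Lemma exchange s a : reduced s -> ~ reduced (a :: s) ->
  exists s1 c s2, s = s1 ++ c :: s2 /\ wd (a :: s1) = wd (rcons s1 c).
Proof.
move=> rs nr; have nr' : ~ reduced (rcons (rev s) a).
  by rewrite -rev_cons => /reduced_rev; rewrite revK.
have [s1 [c [s2 [es /(@wd_rev _ m) h]]]] := exchange_r (reduced_rev rs) nr'.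
exists (rev s2), c, (rev s1); split; last by rewrite -rev_cons h rev_rcons.
by rewrite -[s]revK es rev_cat rev_cons cat_rcons.
Qed.

Lemma not_reduced_cons s a z : wd s = wd (a :: z) -> size z < (size s).+1 ->
  ~ reduced (a :: s).
Proof.
by move=> sz h /(_ z); rewrite (wd_cons _ a s) sz (wd_cons _ a z) genKA => /(_ erefl); rewrite leqNgt h.
Qed.

(** The k reflections of the word are pairwise distinct because the order of a b is at least k. Each
    of them occurs an odd number of times in any other word for the same element, which therefore
    has at least k letters. *)
Lemma reduced_alternating a b k : a <> b ->
  (forall n, m a b = Some n -> k <= n) -> reduced (alternating a b k).
Proof.
suff h (c d : A) : c <> d -> (forall n, m c d = Some n -> k <= n) -> reduced (altr c d k).
  move=> ab hk; have := h a b ab hk; have := h b a (nesym ab); rewrite -(hm ab).1 => /(_ hk).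
  by rewrite !altrE; case: (odd k).
move=> cd hk t et.
have u : uniq (reflections m (altr c d k)).
  rewrite reflections_altr rev_uniq map_inj_in_uniq ?iota_uniq//.
  move=> i j; rewrite !mem_iota !add0n /=.
  wlog ij : i j / i <= j.
    by move=> W ik jk e; have [/W->|/ltnW/W->] := leqP i j.
  move=> ik jk e; apply/eqP; rewrite eqn_leq ij /= leqNgt; apply/negP => ilt.
  have e2 : ((g d * g c) ^+ (j - i) = 1)%g.
    have : ((g d * g c) ^+ i * (g d * g c) ^+ (j - i) = (g d * g c) ^+ i * 1)%g.
      rewrite -expgnDr subnKC// mulg1.
      by rewrite -[LHS](genAK d) -e genAK.
    by rewrite -(wd_alternating2 m d c i) => /wd_cancel.
  have [|n mn nle] := gen_order_ge (nesym cd) _ e2; first by rewrite subn_gt0.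
  have := hk n; rewrite (hm cd).1 => /(_ mn) kn.
  have := leq_trans kn nle; rewrite leqNgt => /negP; apply.
  exact: leq_ltn_trans (leq_subr _ _) jk.
have : size (reflections m (altr c d k)) <= size (reflections m t).
  apply: uniq_leq_size => // x xr; apply/negPn/negP => /count_memPn h.
  have := odd_count_reflections x et; rewrite h (count_uniq_mem _ u) xr.
  by [].
by rewrite !size_reflections.
Qed.

(** The exchange condition is applied with a and b in turn, each time pulling one more letter to the
    front. The exchanged letter never lies in the alternating prefix, since the prefix with one more
    letter is still reduced. For m_{a,b} = oo the prefix would outgrow s. *)
Lemma two_descents a b s : a <> b -> reduced s ->
  ~ reduced (a :: s) -> ~ reduced (b :: s) ->
  exists n z, [/\ m a b = Some n, wd s = wd (alternating a b n ++ z) &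
                  size s = n + size z].
Proof.
move=> ab rs na nb.
have step (c d : A) (j : nat) z : c <> d -> ~ reduced (c :: s) ->
    (forall n, m c d = Some n -> j.+1 <= n) ->
    wd s = wd (alternating d c j ++ z) -> size s = j + size z ->
    exists2 z', wd s = wd (alternating c d j.+1 ++ z') & size s = j.+1 + size z'.
  move=> cd nc hj e sz.
  have sz' : size s = size (alternating d c j ++ z).
    by rewrite size_cat size_alternating.
  have rv := reduced_eq e sz' rs.
  have nv : ~ reduced (c :: alternating d c j ++ z).
    move=> h; apply: nc; apply: reduced_eq h; last by rewrite /= sz'.
    by rewrite wd_cons -e -wd_cons.
  have [s1 [x [s2 [es h]]]] := exchange rv nv.
  have [[u2 ealt _]|[z1 e1 e2]] := cat_cons_split es.
    exfalso; have := reduced_alternating cd hj (t := s1 ++ u2).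
    rewrite size_alternating [alternating c d j.+1]/= ealt => h1.
    have : j < size (s1 ++ u2).
      apply: h1; rewrite -cat_cons -cat_rcons !wd_cat (wd_rcons _ (c :: s1)) h wd_rcons genAK.
      by [].
    have := congr1 size ealt; rewrite size_alternating !size_cat /=; lia.
  exists (z1 ++ s2).
    rewrite e [in LHS]es [alternating c d j.+1]/= cat_cons catA -e1 -cat_cons.
    by rewrite -cat_rcons !wd_cat h.
  by move: sz; rewrite e2 !size_cat /=; lia.
have key j : (forall n, m a b = Some n -> j <= n) ->
   (exists2 z, wd s = wd (alternating a b j ++ z) & size s = j + size z) /\
   (exists2 z, wd s = wd (alternating b a j ++ z) & size s = j + size z).
  elim: j => [_|j ih hj]; first by split; exists s.
  have [|[z1 e1 f1] [z2 e2 f2]] := ih; first by move=> n /hj/ltnW.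
  split; first exact: step e2 f2.
  by apply: step e1 f1 => //; [exact: nesym|rewrite -(hm ab).1].
case mab : (m a b) => [n|].
  have [|[z e f] _] := key n; first by move=> k; rewrite mab => -[->].
  by exists n, z.
have [|[z _ f] _] := key (size s).+1; first by move=> k; rewrite mab.
by move: f; lia.
Qed.

Lemma artin_rel_wd s t : word_eqv (artin_rel m) s t -> wd s = wd t.
Proof.
elim=> [u v l r []|//|u v _ ->//|u v w _ -> _ ->//].
move=> a b n n' ab mab; rewrite -(hm ab).1 mab => -[<-].
by rewrite !wd_cat (wd_braid ab mab).
Qed.

Lemma word_eqv_size s t : word_eqv (artin_rel m) s t -> size s = size t.
Proof.
elim=> [u v l r []|//|u v _ ->//|u v w _ -> _ ->//].
move=> a b n n' ab mab; rewrite -(hm ab).1 mab => -[<-].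
by rewrite !size_cat !size_alternating.
Qed.

Lemma word_eqv_braid a b n z : a <> b -> m a b = Some n ->
  word_eqv (artin_rel m) (alternating a b n ++ z) (alternating b a n ++ z).
Proof.
move=> ab mab; apply: (@word_rel _ _ [::] z).
by apply: ArtinRel => //; rewrite -(hm ab).1.
Qed.

(** Tits' argument by induction on the length: a common first letter is cancelled. If the first
    letters a and b differ, both are descents, and [two_descents] supplies a word starting with one
    side of the braid relation of a and b; each given word shares its first letter with one of its
    two versions. *)
Lemma matsumoto s t : reduced s -> reduced t -> wd s = wd t ->
  word_eqv (artin_rel m) s t.
Proof.
move: {2}(size s) (erefl (size s)) => n.
elim: n s t => [|n ih] s t szs rs rt est.
  have szt : size t <= 0 by rewrite -szs; exact: rt.
  rewrite (size0nil szs) (@size0nil _ t); first exact: word_refl.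
  by apply/eqP; rewrite -leqn0.
have szt : size t = n.+1 by apply/eqP; rewrite eqn_leq -szs rt// rs.
case: s t => [//|a s] [//|b t] in szs szt rs rt est *.
have hd c x y : size x = n -> reduced (c :: x) -> reduced (c :: y) ->
    wd (c :: x) = wd (c :: y) -> word_eqv (artin_rel m) (c :: x) (c :: y).
  move=> szx rx ry exy; apply: (@word_catl _ _ [:: c]); apply: ih => //.
  - exact: (@reduced_catr [:: c]).
  - exact: (@reduced_catr [:: c]).
  - by apply: (@wd_cancel _ m [:: c]); rewrite -!wd_cons.
case: szs szt => szs [szt].
have [ab|/eqP ab] := eqVneq a b; first by subst b; exact: hd.
have na : ~ reduced (a :: a :: s) by apply: (@not_reduced_cons _ _ s) => //=; rewrite ltnW.
have nb : ~ reduced (b :: a :: s) by apply: (@not_reduced_cons _ _ t) => //=; rewrite szs szt ltnW.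
have [k [z [mab ez sz]]] := two_descents ab rs na nb.
have k0 : 0 < k by rewrite ltnW// (hm ab).2.
have r1 : reduced (alternating a b k ++ z).
  by apply: reduced_eq rs => //; rewrite size_cat size_alternating.
have ez2 : wd (alternating a b k ++ z) = wd (alternating b a k ++ z).
  exact: artin_rel_wd (word_eqv_braid z ab mab).
have r2 : reduced (alternating b a k ++ z).
  by apply: reduced_eq r1 => //; rewrite !size_cat !size_alternating.
apply: (@word_trans _ _ _ (alternating a b k ++ z)).
  by case: k k0 {mab sz ez2 r2} r1 ez => //= k _ r1 ez; exact: hd.
apply: (word_trans (word_eqv_braid z ab mab)); apply: word_sym.
move: est; rewrite ez ez2; case: k k0 {mab sz ez ez2 r1} r2 => //= k _ r2 est.
by apply: hd => //; rewrite est.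
Qed.

Lemma reduced_word_eqv s t : word_eqv (artin_rel m) s t -> reduced s -> reduced t.
Proof. by move=> st; apply: reduced_eq (artin_rel_wd st) (word_eqv_size st). Qed.

(** At the first failure both a and b are descents of a reduced word i letters longer than s, with i
    < n. Then [two_descents] writes it with a full braid word in front, and cancelling the first i
    letters exhibits a or b as a descent of s. *)
Lemma reduced_alternating_cat a b n s : a <> b -> m a b = Some n ->
  reduced (a :: s) -> reduced (b :: s) -> reduced (alternating a b n ++ s).
Proof.
move=> ab mab ra rb.
suff key j : j <= n -> reduced (alternating a b j ++ s) /\ reduced (alternating b a j ++ s).
  by have [] := key n (leqnn n).
have step c d i : c <> d -> m c d = Some n -> i < n ->
    reduced (c :: s) -> reduced (d :: s) ->
    reduced (alternating d c i ++ s) -> reduced (alternating c d i.+1 ++ s).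
  move=> cd mcd lin rc rd ri; apply: contrapT => nri.
  case: i => [|i] in lin ri nri *; first exact: nri.
  have nd : ~ reduced (d :: alternating d c i.+1 ++ s).
    by apply: (@not_reduced_cons _ _ (alternating c d i ++ s)) => //=; rewrite ltnW.
  have [k [z [mk e sz]]] := two_descents (nesym cd) ri nd nri.
  move: mk; rewrite -(hm cd).1 mcd => -[kn]; subst k.
  move: e sz; rewrite size_cat size_alternating -(subnKC (ltnW lin)).
  rewrite alternating_cat -catA !wd_cat => /wd_cancel.
  rewrite -wd_cat -addnA => es /addnI; rewrite -subnSK//.
  case: (odd i.+1) es; rewrite -subnSK//= => es sz.
    by apply: (not_reduced_cons es _ rc); rewrite size_cat size_alternating sz ltnW.
  by apply: (not_reduced_cons es _ rd); rewrite size_cat size_alternating sz ltnW.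
elim: j => [_|j ih jn].
  by split; exact: (@reduced_catr [:: a]).
have [h1 h2] := ih (ltnW jn).
by split; apply: step => //; [exact: nesym|rewrite -(hm ab).1].
Qed.

End Reduced.

(** * Artin-Tits monoids *)

Section ArtinMonoid.
Context {A : choiceType} (m : A -> A -> option nat).
Hypothesis hm : coxeter_matrix m.
Local Notation P := (artin_tits m).
Implicit Types (a b c e : A) (s t u v : seq A) (x y z : P) (C : pred A).
Local Open Scope group_scope.

Definition wp s : P := word_class (artin_rel m) s.
Definition atom a : P := wp [:: a].
Definition alt a b n : P := wp (alternating a b n).
(* Right complement of atoms: lcm(a, b) = atom a * res a b n if m a b = Some n. *)
Definition res a b n : P := wp (alternating b a n.-1).
Definition len x : nat := size (repr x).
Definition inP C x : bool := all C (repr x).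
(* The elements satisfying [red] are the simple elements of Garside theory. *)
Definition red x : Prop := reduced m (repr x).
Definition ldiv x y := exists z, y = x * z.

Lemma wp_repr x : wp (repr x) = x. Proof. exact: word_repr. Qed.

Lemma wp_cat s t : wp (s ++ t) = wp s * wp t.
Proof. by rewrite /wp -word_classM. Qed.

Lemma wp_cons a s : wp (a :: s) = atom a * wp s. Proof. exact: (wp_cat [:: a]). Qed.

Lemma wp_eqv s t : wp s = wp t <-> word_eqv (artin_rel m) s t.
Proof. exact: word_classP. Qed.

Lemma repr_wp s : word_eqv (artin_rel m) (repr (wp s)) s.
Proof. by apply/wp_eqv; rewrite wp_repr. Qed.

Lemma len_wp s : len (wp s) = size s.
Proof. by rewrite /len; exact: (word_eqv_size hm (repr_wp s)). Qed.

Lemma lenM x y : len (x * y) = (len x + len y)%N.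
Proof. by rewrite -{1}(wp_repr x) -{1}(wp_repr y) -wp_cat len_wp size_cat. Qed.

Lemma len1 : len 1 = 0%N. Proof. exact: (len_wp [::]). Qed.

Lemma len_atom a : len (atom a) = 1%N. Proof. exact: len_wp. Qed.

Lemma len_eq0 x : len x = 0%N -> x = 1.
Proof. by move=> /size0nil h; rewrite -(wp_repr x) h. Qed.

Lemma atom_case x : x = 1 \/ exists a y, x = atom a * y.
Proof.
rewrite -(wp_repr x); case: (repr x) => [|a s]; first by left.
by right; exists a, (wp s); rewrite wp_cons.
Qed.

Lemma atom_ind (Q : P -> Prop) : Q 1 -> (forall a x, Q x -> Q (atom a * x)) ->
  forall x, Q x.
Proof.
move=> Q1 QS x; rewrite -(wp_repr x); elim: (repr x) => // a s ih.
by rewrite wp_cons; exact: QS.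
Qed.

Lemma inP_wp C s : inP C (wp s) = all C s.
Proof.
suff h u v : word_eqv (artin_rel m) u v -> all C u = all C v.
  by apply: h; exact: repr_wp.
elim=> {s u v}[u v l r []|//|u v _ ->//|u v w _ -> _ ->//].
move=> a b n n' ab mab; rewrite -(hm ab).1 mab => -[<-].
have alt2 c d k : (1 < k)%N -> all C (alternating c d k) = C c && C d.
  case: k => // -[//|k] _; case: k c d => [|k] c d; first by rewrite /= andbT.
  have h i : forall c d, C c && C d -> all C (alternating c d i).
    by elim: i => //= i ih x y /andP[Cx Cy]; rewrite Cx ih// Cy.
  rewrite -[LHS]/(C c && (C d && all C (alternating c d k.+1))) andbA.
  by have [cd|//] := boolP (C c && C d); rewrite h.
by have n1 := (hm ab).2 _ mab; rewrite !all_cat !alt2// [C a && _]andbC.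
Qed.

Lemma inPM C x y : inP C (x * y) = inP C x && inP C y.
Proof. by rewrite -{1}(wp_repr x) -{1}(wp_repr y) -wp_cat inP_wp all_cat. Qed.

Lemma inP_atom C a : inP C (atom a) = C a.
Proof. by rewrite inP_wp /= andbT. Qed.

Lemma inP1 C : inP C 1. Proof. exact: (inP_wp C [::]). Qed.

Lemma inP_res C a b n : C a -> C b -> inP C (res a b n).
Proof.
move=> Ca Cb; rewrite inP_wp; elim: n.-1 a b Ca Cb => //= k ih a b Ca Cb.
by rewrite Cb ih.
Qed.

Definition wdP x : coxeter_group m := wd m (repr x).

Lemma wdP_wp s : wdP (wp s) = wd m s.
Proof. by rewrite /wdP; exact: (artin_rel_wd hm (repr_wp s)). Qed.

Lemma wdPM x y : wdP (x * y) = wdP x * wdP y.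
Proof. by rewrite -(wp_repr x) -(wp_repr y) -wp_cat !wdP_wp wd_cat. Qed.

Lemma red_wp s : red (wp s) <-> reduced m s.
Proof.
rewrite /red; split; first exact: (reduced_word_eqv hm (repr_wp s)).
by apply: (reduced_word_eqv hm); apply: word_sym; exact: repr_wp.
Qed.

Lemma redMr x y : red (x * y) -> red y.
Proof.
by rewrite -{1}(wp_repr x) -{1}(wp_repr y) -wp_cat => /red_wp/reduced_catr.
Qed.

Lemma redMl x y : red (x * y) -> red x.
Proof.
by rewrite -{1}(wp_repr x) -{1}(wp_repr y) -wp_cat => /red_wp/reduced_catl.
Qed.

Lemma red_atom a : red (atom a).
Proof.
apply/red_wp => t ta; have := odd_size_wd ta; by case: t {ta}.
Qed.

Lemma red_inj x y : red x -> red y -> wdP x = wdP y -> x = y.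
Proof.
move=> rx ry xy; rewrite -(wp_repr x) -(wp_repr y); apply/wp_eqv.
exact: (matsumoto hm).
Qed.

Lemma atom_res a b n : (0 < n)%N -> atom a * res a b n = alt a b n.
Proof. by case: n => // n _; rewrite /res -wp_cons. Qed.

Lemma altC a b n : a <> b -> m a b = Some n -> alt a b n = alt b a n.
Proof.
by move=> ab mab; apply/wp_eqv; have := word_eqv_braid hm [::] ab mab; rewrite !cats0.
Qed.

Lemma ldiv_refl x : ldiv x x. Proof. by exists 1; rewrite mulg1. Qed.

Lemma ldiv_trans y x z : ldiv x y -> ldiv y z -> ldiv x z.
Proof. by move=> [u ->] [v ->]; exists (u * v); rewrite mulgA. Qed.

Lemma ldivMr x y : ldiv x (x * y). Proof. by exists y. Qed.

Lemma ldiv_mul z x y : ldiv x y -> ldiv (z * x) (z * y).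
Proof. by move=> [u ->]; exists u; rewrite mulgA. Qed.

Lemma ldiv1 x : ldiv 1 x. Proof. by exists x; rewrite mul1g. Qed.

Lemma ldiv_mulr x y z : ldiv x y -> ldiv x (y * z).
Proof. by move=> [u ->]; exists (u * z); rewrite mulgA. Qed.

(* Newman's diamond lemma for the relation x -> x * atom a inside E. *)
Lemma newman (E : P -> Prop) N :
  (forall x, E x -> (len x <= N)%N) -> (forall x y, E (x * y) -> E x) ->
  (forall x a b, a <> b -> E (x * atom a) -> E (x * atom b) ->
     exists2 n, m a b = Some n & E (x * alt a b n)) ->
  forall x, E x -> exists g, [/\ E g, ldiv x g &
     forall y, E y -> ldiv x y -> ldiv y g].
Proof.
move=> EN Epre Ebraid x; have [k] := ubnP (N - len x); elim: k x => // k ih x.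
rewrite ltnS => kN Ex.
have [[a Ea]|no] := pselect (exists a, E (x * atom a)); last first.
  exists x; split=> //; first exact: ldiv_refl.
  move=> y Ey [z yE]; subst y; case: (atom_case z) => [->|[a [w zE]]].
    by rewrite mulg1; exact: ldiv_refl.
  by case: no; exists a; apply: (Epre _ w); rewrite -mulgA -zE.
have top b : E (x * atom b) -> exists g, [/\ E g, ldiv (x * atom b) g &
     forall y, E y -> ldiv (x * atom b) y -> ldiv y g].
  move=> Eb; apply: ih => //; have := EN _ Eb; rewrite lenM len_atom.
  by move: kN; lia.
have [g [Eg ag gtop]] := top a Ea.
exists g; split=> //; first by apply: ldiv_trans ag; exact: ldivMr.
move=> y Ey [z yE]; subst y; case: (atom_case z) => [->|[b [w zE]]].
  by rewrite mulg1; apply: ldiv_trans ag; exact: ldivMr.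
have Eb : E (x * atom b) by apply: (Epre _ w); rewrite -mulgA -zE.
have [ab|/eqP ab] := eqVneq a b.
  by apply: gtop => //; rewrite zE ab mulgA; exact: ldivMr.
have [n mab Eab] := Ebraid _ _ _ ab Ea Eb.
have n0 : (0 < n)%N by rewrite ltnW// (hm ab).2.
have [h [Eh bh htop]] := top b Eb.
have hy : ldiv (x * z) h by apply: htop => //; rewrite zE mulgA; exact: ldivMr.
apply: (ldiv_trans hy); apply: gtop => //.
apply: (@ldiv_trans (x * alt a b n)).
  by apply: ldiv_mul; rewrite -atom_res//; exact: ldivMr.
by apply: htop => //; apply: ldiv_mul; rewrite altC// -atom_res//; exact: ldivMr.
Qed.

Lemma red_braid x a b n : a <> b -> m a b = Some n ->
  red (x * atom a) -> red (x * atom b) -> red (x * alt a b n).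
Proof.
move=> ab mab; rewrite -{1 2}(wp_repr x) -!wp_cat => /red_wp/reduced_rev ra /red_wp/reduced_rev rb.
move: ra rb; rewrite !cats1 !rev_rcons => ra rb.
have := reduced_rev (reduced_alternating_cat hm ab mab ra rb).
rewrite rev_cat revK rev_alternating => /red_wp; rewrite wp_cat wp_repr.
by case: (odd n) => // h; rewrite (altC ab mab).
Qed.

(** Simple elements are determined by their image in the Coxeter group, where cancellation is free;
    so [two_descents] lifts to P. *)
Lemma red_two_descents x y z a b : red x -> x = atom a * y -> x = atom b * z ->
  a <> b -> exists n w, [/\ m a b = Some n, y = res a b n * w & z = res b a n * w].
Proof.
move=> rx xa xb ab.
have hd c y' : x = atom c * y' -> ~ reduced m (c :: repr x).
  move=> xc; apply: (@not_reduced_cons _ _ _ c (repr y')).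
    by rewrite -wdP_wp -wdP_wp wp_repr wp_cons wp_repr xc.
  by rewrite -/(len x) -/(len y') xc lenM len_atom; lia.
have [n [w [mab ex sx]]] := two_descents hm ab rx (hd _ _ xa) (hd _ _ xb).
have n0 : (0 < n)%N by rewrite ltnW// (hm ab).2.
exists n, (wp w).
have rw : red (alt a b n * wp w).
  by rewrite -wp_cat; apply/red_wp; apply: reduced_eq rx => //; rewrite size_cat size_alternating.
have ew : x = alt a b n * wp w.
  by apply: red_inj => //; rewrite -wp_cat wdP_wp.
have half c d y' : x = atom c * y' -> alt a b n = alt c d n -> y' = res c d n * wp w.
  move=> xc acd; have eq2 : atom c * y' = atom c * (res c d n * wp w).
    by rewrite -xc mulgA atom_res// -acd.
  apply: red_inj.
  - by apply: (@redMr (atom c)); rewrite -xc.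
  - by apply: (@redMr (atom c)); rewrite -eq2 -xc.
  by have := congr1 wdP eq2; rewrite !(wdPM (atom c)) wdP_wp => /wd_cancel.
by split=> //; apply: half => //; exact: altC.
Qed.

(** The expected consequence of a x = b y. The first alternative is cancellation of an atom, the
    second says that the braid of a and b is their lcm. *)
Definition qdiv a b x y := (a = b /\ x = y) \/
  (a <> b /\ exists n z, [/\ m a b = Some n, x = res a b n * z & y = res b a n * z]).

Let atoms_upto n := forall a b x y, (len x < n)%N -> atom a * x = atom b * y -> qdiv a b x y.

Let lcancel_upto n : atoms_upto n ->
  forall x y z, (len (x * y) <= n)%N -> x * y = x * z -> y = z.
Proof.
move=> H; elim/atom_ind => [|a x ih] y z; first by rewrite !mul1g.
rewrite -!mulgA lenM len_atom => h e.
case: (H _ _ _ _ h e) => [[_]|[]//].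
by apply: ih; exact: ltnW.
Qed.

(** [newman] applies to the left divisors x of z with u x simple: [red_braid] preserves simplicity,
    and the hypothesis on shorter elements makes the braid divide z. *)
Let red_top_upto n : atoms_upto n -> forall u z : P, (len z <= n)%N -> red u ->
  exists g, [/\ ldiv g z, red (u * g) & forall x, ldiv x z -> red (u * x) -> ldiv x g].
Proof.
move=> H u z zn ru.
pose E x := ldiv x z /\ red (u * x).
have [||||g [[g1 g2] _ gtop]] := @newman E (len z) _ _ _ 1.
- by move=> x [[y ->] _]; rewrite lenM leq_addr.
- move=> x y [h]; rewrite mulgA => /redMl rx; split=> //.
  by apply: ldiv_trans h; exact: ldivMr.
- move=> x a b ab [[z1 e1] r1] [[z2 e2] r2].
  have e3 : atom a * z1 = atom b * z2.
    apply: (lcancel_upto H (x := x)); first by rewrite mulgA -e1.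
    by rewrite !mulgA -e1.
  have [|[]//|[_ [k [w [mab ez1 _]]]]] := H _ _ _ _ _ e3.
    by apply: leq_trans zn; rewrite e1 !lenM len_atom; lia.
  exists k => //; split; last by rewrite mulgA; apply: red_braid => //; rewrite -mulgA.
  exists w; rewrite e1 ez1 -!mulgA; congr (_ * _); rewrite mulgA atom_res//.
  by rewrite ltnW// (hm ab).2.
- by split; [exact: ldiv1|rewrite mulg1].
by exists g; split=> // x xz rx; apply: gtop; [split|exact: ldiv1].
Qed.

Lemma qdiv_sym a b x y : qdiv a b x y -> qdiv b a y x.
Proof.
case=> [[-> ->]|[ab [n [z [mab -> ->]]]]]; first by left.
right; split; first exact: nesym.
by exists n, z; rewrite -(hm ab).1.
Qed.

(** The critical case of three distinct letters. Take the greatest g dividing z with c g simple: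
    both complements of c divide g, so c g is a simple element divisible by a and b, and
    [red_two_descents] settles the question inside it. The remaining factor h is carried along. *)
Let qdiv_trans n : atoms_upto n -> forall a b c x y z, len z = n ->
  qdiv a c x z -> qdiv c b z y -> qdiv a b x y.
Proof.
move=> H a b c x y z zn [[-> ->]//|[ac [k [U [mac xE zE]]]]].
case=> [[<- <-]|[cb [l [V [mcb zE2 yE]]]]]; first by right; split=> //; exists k, U.
have k0 : (0 < k)%N by rewrite ltnW// (hm ac).2.
have l0 : (0 < l)%N by rewrite ltnW// (hm cb).2.
have [ab|/eqP ab] := eqVneq a b.
  subst b; left; split=> //; rewrite xE yE.
  move: mcb; rewrite -(hm ac).1 mac => -[kl]; subst l; congr (_ * _).
  apply: (lcancel_upto H (x := res c a k)); first by rewrite -zE zn.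
  by rewrite -zE -zE2.
have [g [[h gz] rg gtop]] := red_top_upto H (eq_leq zn) (@red_atom c).
have ralt d e' j : (0 < j)%N -> d <> e' -> m d e' = Some j -> red (atom d * res d e' j).
  move=> j0 de mde; rewrite atom_res//; apply/red_wp; apply: reduced_alternating => //.
  by move=> i; rewrite mde => -[->].
have [g1 g1E] : ldiv (res c a k) g.
  apply: gtop; first by rewrite zE; exact: ldivMr.
  by apply: ralt => //; [exact: nesym|rewrite -(hm ac).1].
have [g2 g2E] : ldiv (res c b l) g.
  by apply: gtop; [rewrite zE2; exact: ldivMr|exact: ralt].
have UE : U = g1 * h.
  apply: (lcancel_upto H (x := res c a k)); first by rewrite -zE zn.
  by rewrite -zE gz g1E mulgA.
have VE : V = g2 * h.
  apply: (lcancel_upto H (x := res c b l)); first by rewrite -zE2 zn.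
  by rewrite -zE2 gz g2E mulgA.
have ca : atom c * g = atom a * (res a c k * g1).
  rewrite g1E !mulgA !atom_res// altC//; first exact: nesym.
  by rewrite -(hm ac).1.
have cb' : atom c * g = atom b * (res b c l * g2).
  by rewrite g2E !mulgA !atom_res// altC.
have [j [w [mab e1 e2]]] := red_two_descents rg ca cb' ab.
right; split=> //; exists j, (w * h); split=> //.
  by rewrite xE UE !mulgA e1.
by rewrite yE VE !mulgA e2.
Qed.

(** Equality in P is generated by single braid moves. A move at the head is an instance of [qdiv], a
    move further right keeps the first letter, and chains of moves are composed by [qdiv_trans] at
    the same length. *)
Let atoms_all n : atoms_upto n.
Proof.
elim: n => // n ih a b x y xn.
have := xn; rewrite ltnS leq_eqVlt => /orP[/eqP{}xn|]; last by move=> /ih; apply.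
pose R s t := match s, t with
  | a :: s', b :: t' => qdiv a b (wp s') (wp t') | [::], [::] => True | _, _ => False end.
have key s t : word_eqv (artin_rel m) s t -> size s = n.+1 -> R s t.
  elim=> {s t}[u v l r lr|u|u v uv IH|u v w uv IH1 vw IH2] sz.
  - case: u sz => [|d u] sz /=; last by left; split=> //; apply/wp_eqv; exact: word_rel.
    case: lr sz => c d k k' cd mcd; rewrite -(hm cd).1 mcd => -[<-] sz.
    have := (hm cd).2 _ mcd; case: k mcd sz => // k mcd sz _ /=.
    by right; split=> //; exists k.+1, (wp v); rewrite !wp_cat.
  - by case: u sz => //= d u _; left.
  - have /IH : size u = n.+1 by rewrite (word_eqv_size hm uv).
    by case: u v {IH uv sz} => [|c u] [|d v] //=; exact: qdiv_sym.
  - have sv : size v = n.+1 by rewrite -(word_eqv_size hm uv).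
    have {}IH1 := IH1 sz; have {}IH2 := IH2 sv.
    case: u v w {uv vw sz} IH1 IH2 sv => [|c u] [|d v] [|e w] //= h1 h2 [sv].
    by apply: (qdiv_trans ih _ h1 h2); rewrite len_wp.
rewrite -(wp_repr x) -(wp_repr y) -!wp_cons => /wp_eqv/key; apply.
by rewrite /= -/(len x) xn.
Qed.

Lemma artin_atoms a b x y : atom a * x = atom b * y -> qdiv a b x y.
Proof. exact: (@atoms_all (len x).+1). Qed.

Lemma artin_lcancel x y z : x * y = x * z -> y = z.
Proof. exact: (lcancel_upto (@atoms_all _) (leqnn _)). Qed.

Lemma red_top (u z : P) : red u ->
  exists g, [/\ ldiv g z, red (u * g) & forall x, ldiv x z -> red (u * x) -> ldiv x g].
Proof. exact: red_top_upto (@atoms_all _) _ _ (leqnn _). Qed.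

Lemma ldiv_cancel x y z : ldiv (x * y) (x * z) -> ldiv y z.
Proof. by move=> [w]; rewrite -mulgA => /artin_lcancel ->; exact: ldivMr. Qed.

Let revP x : P := wp (rev (repr x)).

Let word_eqv_rev s t : word_eqv (artin_rel m) s t -> word_eqv (artin_rel m) (rev s) (rev t).
Proof.
elim=> [u v l r [a b n n' ab mab mba]|u|u v _|u v w _ h _].
- rewrite !rev_cat -!catA; apply: word_rel.
  have en : n = n' by move: mba; rewrite -(hm ab).1 mab => -[].
  subst n'; rewrite !rev_alternating.
  by case: (odd n); apply: ArtinRel => //; exact: nesym.
- exact: word_refl.
- exact: word_sym.
- exact: word_trans.
Qed.

Let revP_wp s : revP (wp s) = wp (rev s).
Proof. by apply/wp_eqv; apply: word_eqv_rev; exact: repr_wp. Qed.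

Let revPM x y : revP (x * y) = revP y * revP x.
Proof.
by rewrite -(wp_repr x) -(wp_repr y) -wp_cat !revP_wp rev_cat wp_cat.
Qed.

(** Reversing words permutes the braid relations, hence induces an anti-automorphism that exchanges
    the two kinds of cancellation. *)
Lemma artin_rcancel x y z : x * z = y * z -> x = y.
Proof.
have revK' (w : P) : revP (revP w) = w by rewrite -{1}(wp_repr w) !revP_wp revK wp_repr.
move=> /(congr1 revP); rewrite !revPM => /artin_lcancel/(congr1 revP).
by rewrite !revK'.
Qed.

(** For x = a x1 and y = b y1 the lcm is completed in two steps, as in word reversing: x1 with the
    complement of a in the braid, then the resulting remainder with y1. The common multiple z bounds
    the recursion. The last clause says that parabolic submonoids are closed under lcms. *)
Lemma artin_lcm x y z : ldiv x z -> ldiv y z -> exists l,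
  [/\ ldiv x l, ldiv y l, (forall z', ldiv x z' -> ldiv y z' -> ldiv l z') &
      forall C, inP C x -> inP C y -> inP C l].
Proof.
have [n] := ubnP (len z); elim: n x y z => // n ih x y z; rewrite ltnS => zn.
have [->|[a [x1 ->]]] := atom_case x => xz.
  by exists y; split=> //; [exact: ldiv1|exact: ldiv_refl].
have [->|[b [y1 ->]]] := atom_case y => yz.
  by exists (atom a * x1); split=> //; [exact: ldiv_refl|exact: ldiv1].
have [p pE] := xz; have [q qE] := yz.
have zp : (len (x1 * p) < n)%N.
  by move: zn; rewrite pE -mulgA (lenM (atom a)) len_atom add1n.
have zq : (len (y1 * q) < n)%N.
  by move: zn; rewrite qE -mulgA (lenM (atom b)) len_atom add1n.
have e : atom a * (x1 * p) = atom b * (y1 * q) by rewrite !mulgA -pE -qE.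
case: (artin_atoms e) => [[ab e2]|[ab [k [w [mab e1 e2]]]]].
  subst b; have [||l [l1 l2 l3 l4]] := ih x1 y1 _ zp; first exact: ldivMr.
    by rewrite e2; exact: ldivMr.
  exists (atom a * l); split; [exact: ldiv_mul|exact: ldiv_mul| |].
    move=> z' [p' pE'] [q' qE']; move: (pE'); rewrite qE' -!mulgA => /artin_lcancel e3.
    by apply: ldiv_mul; apply: l3; [rewrite e3|]; exact: ldivMr.
  by move=> C; rewrite !inPM => /andP[-> h1] /andP[_ h2]; exact: l4.
have k0 : (0 < k)%N by rewrite ltnW// (hm ab).2.
have [||l1 [x1l1 [t tE] l1min l1C]] := ih x1 (res a b k) _ zp; first exact: ldivMr.
  by rewrite e1; exact: ldivMr.
set qq := res b a k * t.
have l1qq : atom a * l1 = atom b * qq.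
  by rewrite tE !mulgA !atom_res// ?(altC ab).
have qqy : ldiv qq (y1 * q).
  have : ldiv l1 (x1 * p) by apply: l1min; [|rewrite e1]; exact: ldivMr.
  by move=> /(ldiv_mul (atom a)); rewrite e l1qq => /ldiv_cancel.
have [||l2 [qql2 y1l2 l2min l2C]] := ih qq y1 _ zq => //; first exact: ldivMr.
exists (atom b * l2); split.
- apply: (@ldiv_trans (atom a * l1)); first exact: ldiv_mul.
  by rewrite l1qq; exact: ldiv_mul.
- exact: ldiv_mul.
- move=> z' [p' pE'] [q' qE'].
  have e' : atom a * (x1 * p') = atom b * (y1 * q') by rewrite !mulgA -pE' -qE'.
  case: (artin_atoms e') => [[//]|[_ [k' [w' [mab' e1' e2']]]]].
  move: mab'; rewrite mab => -[kk]; subst k'.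
  rewrite qE' -mulgA; apply: ldiv_mul; apply: l2min; last exact: ldivMr.
  have : ldiv l1 (x1 * p') by apply: l1min; [|rewrite e1']; exact: ldivMr.
  by move=> /(ldiv_mul (atom a)); rewrite e' l1qq => /ldiv_cancel.
- move=> C; rewrite !inPM !inP_atom => /andP[Ca Cx1] /andP[Cb Cy1].
  rewrite Cb; apply: l2C => //.
  have : inP C (atom a * l1) by rewrite inPM inP_atom Ca l1C// inP_res.
  by rewrite l1qq inPM => /andP[].
Qed.

(** One letter c of z is removed at a time: the greatest simple divisor g of c z w is a multiple of
    c and of t, and g = c t' leaves a simple t' dividing z w. *)
Lemma red_residue (z t w : P) : red t -> ldiv t (z * w) ->
  exists u : P, [/\ red u, ldiv u w & ldiv t (z * u)].
Proof.
elim/atom_ind: z t => [|c z ih] t rt h.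
  by exists t; move: h; rewrite !mul1g; split=> //; exact: ldiv_refl.
have r1 : red 1 by apply: (@redMr (atom c)); rewrite mulg1; exact: red_atom.
have [g [gz]] := red_top (atom c * z * w) r1.
rewrite mul1g => rg gtop.
have [t' gE] : ldiv (atom c) g.
  by apply: gtop; rewrite ?mul1g; [rewrite -mulgA; exact: ldivMr|exact: red_atom].
have tg : ldiv t g by apply: gtop; rewrite ?mul1g.
have rt' : red t' by apply: (@redMr (atom c)); rewrite -gE.
have [|u [ru uw t'u]] := ih t' rt'.
  by apply: (@ldiv_cancel (atom c)); rewrite -gE mulgA.
exists u; split=> //; apply: (ldiv_trans tg).
by rewrite gE -mulgA; exact: ldiv_mul.
Qed.

(** By [red_residue] only a simple left divisor of a^n matters, and such a divisor is 1 or a because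
    a a is not reduced. *)
Lemma ldiv_atom_expn b z a n : ldiv (atom b) (z * atom a ^+ n) ->
  ldiv (atom b) (z * atom a).
Proof.
move=> /(red_residue (@red_atom b))[u [ru [v uv] bu]].
have : inP (pred1 a) (atom a ^+ n).
  elim: n {uv} => [|n ih]; first exact: inP1.
  by rewrite expgS inPM ih inP_atom /= eqxx.
rewrite uv inPM => /andP[+ _]; rewrite /inP => /all_pred1P.
move: ru bu; rewrite /red -{2}(wp_repr u).
case: (size _) => [|[|k]] /= h; [move=> +e|move=> +e|move=> _ e]; rewrite e in h *.
- by rewrite mulg1 => h2; exact: ldiv_mulr.
- by [].
have := h (nseq k a); rewrite !(wd_cons _ a (_ :: _)) !(wd_cons _ a (nseq _ _)) genKA => /(_ erefl).
by rewrite /= size_nseq; lia.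
Qed.

Lemma atom_inj a b : atom a = atom b -> a = b.
Proof.
rewrite -(mulg1 (atom a)) -(mulg1 (atom b)) => /artin_atoms[[]//|[ab [n [z [mab e _]]]]].
have := congr1 len e; rewrite len1 lenM len_wp size_alternating.
by have := (hm ab).2 _ mab; lia.
Qed.

Lemma expg_atom_inj a i j : atom a ^+ i = atom a ^+ j -> i = j.
Proof.
have le k : len (atom a ^+ k) = k.
  by elim: k => [|k ih]; rewrite ?len1// expgS lenM ih len_atom.
by move=> /(congr1 len); rewrite !le.
Qed.

End ArtinMonoid.

(** * Left reversibility, finite generation and finiteness of the Coxeter group *)

Section Reversibility.
Context {A : choiceType} (m : A -> A -> option nat).
Hypothesis hm : coxeter_matrix m.
Local Notation P := (artin_tits m).
Local Notation atom := (atom m).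
Implicit Types (a b c e : A) (x y z p q t u v w : P) (C : pred A).
Local Open Scope group_scope.

Definition compatible x y := exists z, ldiv x z /\ ldiv y z.

Lemma left_reversibleP : left_reversible P <-> forall p q, compatible p q.
Proof.
split=> [h p q|h p q].
  by have [z [[x _ xz] [y _ yz]]] := h p q; exists z; split; [exists x|exists y].
by have [z [[x xz] [y yz]]] := h p q; exists z; split; [exists x|exists y].
Qed.

Lemma compatible_atoms : (forall x a, compatible x (atom a)) -> forall p q, compatible p q.
Proof.
move=> h p q; elim/(@atom_ind A m): q p => [|a q ih] p.
  by exists p; split; [exact: ldiv_refl|exact: ldiv1].
have [z [[u zu] [v zv]]] := h p a; have [z' [[r vr] qz']] := ih v.
exists (atom a * z'); split; last exact: ldiv_mul.
by exists (u * r); rewrite vr !mulgA -zv zu.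
Qed.

(** The word s is built from the right. Every letter a is a descent of s0, so a s r is not reduced;
    the exchanged letter cannot lie in s because a s is reduced, so it is taken from r. *)
Lemma reduced_prefix s0 : (forall a, ~ reduced m (a :: s0)) -> reduced m s0 ->
  forall s, reduced m s -> exists2 r, wd m s0 = wd m (s ++ r) & size s0 = (size s + size r)%N.
Proof.
move=> hd r0; elim=> [|a s ih] rs; first by exists s0.
have [r e sz] := ih (@reduced_catr _ _ [:: a] _ rs).
have rsr : reduced m (s ++ r) by apply: reduced_eq r0; rewrite ?size_cat.
have nr : ~ reduced m (a :: s ++ r).
  move=> h; apply: (hd a); apply: reduced_eq h; last by rewrite /= size_cat sz.
  by rewrite (wd_cons _ a (s ++ r)) -e -wd_cons.
have [s1 [c [s2 [es h]]]] := exchange rsr nr.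
have [[u2 su2 _]|[z1 e1 e2]] := cat_cons_split es.
  have := rs (s1 ++ u2); rewrite su2 -cat_cons -cat_rcons !wd_cat -/([:: a] ++ s1).
  rewrite (wd_rcons _ (a :: s1)) h wd_rcons genAK => /(_ erefl).
  by rewrite /= !size_cat size_rcons; lia.
exists (z1 ++ s2); last by rewrite sz e2 !size_cat /=; lia.
by rewrite e es -cat_rcons wd_cat -h -wd_cat /= e1 -catA.
Qed.

(** Lengths of reduced words are bounded, so there is a longest element, divisible by all simple
    elements. Its greatest simple left divisor is g = c t', and a common multiple of x and t' yields
    one of c x and any simple t. *)
Lemma spherical_reversible : spherical m -> left_reversible P.
Proof.
move=> [_ /finite_seqP[ws hws]]; apply/left_reversibleP/compatible_atoms.
have [N hN] : exists N, forall s, reduced m s -> (size s <= N)%N.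
  suff [N hN] : exists N, forall s, reduced m s -> wd m s \in ws -> (size s <= N)%N.
    exists N => s rs; apply: hN => //.
    by have : [set: coxeter_group m]%classic (wd m s) by []; rewrite hws.
  elim: (ws) => [|g l [N hN]]; first by exists 0%N.
  have [t gt rt] := reduced_exists g; exists (maxn N (size t)) => s rs.
  rewrite inE leq_max => /predU1P[sg|/(hN _ rs) -> //].
  by rewrite orbC rs// sg gt.
have [s0 [r0 hd]] : exists s0, reduced m s0 /\ forall a, ~ reduced m (a :: s0).
  apply: contrapT => h.
  have key k : exists2 s, reduced m s & size s = k.
    elim: k => [|k [s rs sk]]; first by exists [::].
    have [a ra] : exists a, reduced m (a :: s).
      apply: contrapT => h2; apply: h; exists s; split=> // a ra; apply: h2.
      by exists a.
    by exists (a :: s) => //=; rewrite sk.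
  by have [s /hN + sk] := key N.+1; rewrite sk ltnn.
have dvd t : red t -> ldiv t (wp m s0).
  move=> rt; have [r e sz] := reduced_prefix hd r0 rt.
  exists (wp m r); rewrite -{1}(wp_repr t) -wp_cat; apply/wp_eqv; apply: (matsumoto hm) => //.
  by apply: reduced_eq r0; rewrite // size_cat.
move=> x a.
suff h t : red t -> compatible x t by apply: h; exact: red_atom.
elim/(@atom_ind A m): x t => [|c x ih] t rt.
  by exists t; split; [exact: ldiv1|exact: ldiv_refl].
have r1 : red (1 : P) by apply: (redMr hm (x := atom c)); rewrite mulg1; exact: red_atom.
have [g [_]] := red_top hm (wp m s0) r1; rewrite mul1g => rg gtop.
have [t' gE] : ldiv (atom c) g.
  by apply: gtop; rewrite ?mul1g; [apply: dvd|]; exact: red_atom.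
have tg : ldiv t g by apply: gtop; rewrite ?mul1g//; exact: dvd.
have rt' : red t' by apply: (redMr hm (x := atom c)); rewrite -gE.
have [z [xz t'z]] := ih t' rt'.
exists (atom c * z); split; first exact: ldiv_mul.
by apply: (ldiv_trans tg); rewrite gE; exact: ldiv_mul.
Qed.

Lemma finite_ball : finite_set [set: A]%classic -> forall n, exists s : seq P,
  forall x, (len x <= n)%N -> x \in s.
Proof.
move=> /finite_seqP[As hA]; have inA a : a \in As.
  by have : [set: A]%classic a by []; rewrite hA.
elim=> [|n [s hs]].
  by exists [:: 1] => x; rewrite leqn0 => /eqP/len_eq0 ->; rewrite inE.
exists (1 :: [seq atom a * x | a <- As, x <- s]) => x.
case: (atom_case x) => [->|[a [y ->]]]; first by rewrite inE eqxx.
rewrite (lenM hm) (len_atom hm) => h; rewrite inE; apply/orP; right.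
by apply/allpairsP; exists (a, y); split=> //; exact: hs.
Qed.

Lemma common_multiple (s : seq A) : (forall p q, compatible p q) ->
  exists z, forall a, a \in s -> ldiv (atom a) z.
Proof.
move=> h; elim: s => [|a s [z hz]]; first by exists 1.
have [z' [az zz']] := h (atom a) z; exists z' => c; rewrite inE => /predU1P[->//|/hz cz].
exact: ldiv_trans zz'.
Qed.

(** The greatest simple divisor g of a common multiple of all atoms has every generator as a
    descent. By [reduced_prefix] no reduced word is longer than g, and balls in P are finite. *)
Lemma reversible_spherical : left_reversible P -> finite_set [set: A]%classic ->
  finite_set [set: coxeter_group m]%classic.
Proof.
move=> /left_reversibleP hP fA; have /finite_seqP[As hA] := fA.
have inA a : a \in As by have : [set: A]%classic a by []; rewrite hA.
have [z hz] := common_multiple As hP.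
have [[a0 _]|noA] := pselect (exists a : A, True); last first.
  have [s hs] := finite_ball fA 0.
  apply: (@sub_finite_set _ _ [set 1%g]%classic) => // g _ /=.
  have [[|a t] ->] := wd_surj g; first by [].
  by exfalso; apply: noA; exists a.
have r1 : red (1 : P) by apply: (redMr hm (x := atom a0)); rewrite mulg1; exact: red_atom.
have [g [_]] := red_top hm z r1; rewrite mul1g => rg gtop.
have hd a : ~ reduced m (a :: repr g).
  have [g' gE] : ldiv (atom a) g.
    by apply: gtop; rewrite ?mul1g; [exact: hz|exact: red_atom].
  apply: (@not_reduced_cons _ _ _ a (repr g')).
    by rewrite -(wdP_wp hm) -(wdP_wp hm) wp_repr wp_cons wp_repr gE.
  by rewrite -/(len g) -/(len g') gE (lenM hm) (len_atom hm); lia.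
have [s hs] := finite_ball fA (len g).
apply: (@sub_finite_set _ _ [set wdP x | x in [set` s]]%classic); last exact: finite_image.
move=> h _; have [t xt rt] := reduced_exists h.
have [r _ sz] := reduced_prefix hd rg rt.
exists (wp m t); last by rewrite (wdP_wp hm).
by rewrite /=; apply: hs; rewrite (len_wp hm) -/(len g) /len sz leq_addr.
Qed.

(** Length is additive and atoms have length 1, so any generating set contains all atoms. *)
Lemma finitely_generatedP : finitely_generated P <-> finite_set [set: A]%classic.
Proof.
split=> [[s hs]|/finite_seqP[As hA]].
  apply: (@sub_finite_set _ _ (atom @^-1` [set` s])%classic); last first.
    apply: finite_preimage => // a b _ _; exact: atom_inj.
  move=> a _ /=; have [w ws e] := hs (atom a).
  have : exists2 x, x \in w & x = atom a.
    elim: w ws e => [|x w ih] ws; rewrite ?big_nil ?big_cons.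
      by move=> /(congr1 (@len _ m)); rewrite (len_atom hm) (len1 hm).
    move: ih; set z := \big[_/_]_(_ <- _) _ => ih e.
    have := congr1 (@len _ m) e; rewrite (len_atom hm) (lenM hm) => h.
    have [x0|x0] := posnP (len x).
      have [||q qw qe] := ih; first by move=> q qw; apply: ws; rewrite inE qw orbT.
        by rewrite e (len_eq0 x0) mul1g.
      by exists q => //; rewrite inE qw orbT.
    exists x; first by rewrite inE eqxx.
    have z0 : len z = 0%N by move: h x0; lia.
    by rewrite e (len_eq0 z0) mulg1.
  by move=> [x xw <-]; exact: ws.
exists [seq atom a | a <- As] => p.
exists [seq atom a | a <- repr p].
  move=> x /mapP[a _ ->]; apply/mapP; exists a => //.
  by have : [set: A]%classic a by []; rewrite hA.
rewrite -{1}(wp_repr p); elim: (repr p) => [|a t ih]; first by rewrite big_nil.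
by rewrite /= big_cons wp_cons ih.
Qed.

End Reversibility.

(** * Moving the set of dividing atoms along walks in the Coxeter graph *)

Section Game.
Context {A : choiceType} (m : A -> A -> option nat).
Hypothesis hm : coxeter_matrix m.
Local Notation P := (artin_tits m).
Local Notation atom := (atom m).
Implicit Types (a b c e : A) (x y z p q t u v w : P) (B : pred A) (C : seq A).
Local Open Scope group_scope.

Lemma ldiv_atomM_neq c e x : c <> e -> ldiv (atom c) (atom e * x) -> exists n z,
  [/\ m e c = Some n, x = res m e c n * z & ldiv (atom c) x].
Proof.
move=> ce [y] /(artin_atoms hm)[[]//|[_ [n [z [mec xE yE]]]]].
  by move=> ec; case: ce.
exists n, z; split=> //; rewrite xE; apply: ldiv_mulr.
have := (hm (nesym ce)).2 _ mec; case: n {mec xE yE} => // -[//|n] _.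
by rewrite /res /= wp_cons; exact: ldivMr.
Qed.

Lemma ldiv_atom_support C B x p : inP (fun c => (c \in C) && B c) x ->
  (forall c, c \in C -> ldiv (atom c) p -> B c) ->
  forall c, c \in C -> ldiv (atom c) (x * p) -> B c.
Proof.
move=> + hp; elim/(@atom_ind A m): x => [_|d x ih]; first by move=> c; rewrite mul1g; exact: hp.
rewrite (inPM hm) (inP_atom hm) => /andP[/andP[dC Bd] xB] c cC; rewrite -mulgA.
have [->//|/eqP cd] := eqVneq c d.
by move=> /(ldiv_atomM_neq cd)[n [z [_ _]]]; exact: ih.
Qed.

Definition orth e c := (c != e) && (m e c == Some 2).

(* One move: after firing e, only e and the letters of B commuting with e can
   be left divisors. *)
Lemma game_move C B e v p : e \in C -> ~~ B e ->
  inP (fun c => (c \in C) && B c) v ->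
  (forall c, c \in C -> B c -> ldiv (atom c) v) ->
  (forall c, c \in C -> ldiv (atom c) p -> B c) ->
  forall c, c \in C -> ldiv (atom c) (atom e * v * p) -> (c == e) || (B c && orth e c).
Proof.
move=> eC nBe vB hv hp c cC; have [//|/eqP ce] := eqVneq c e; rewrite -mulgA.
move=> /(ldiv_atomM_neq ce)[n [z [mec vpE cvp]]].
have Bc : B c := ldiv_atom_support vB hp cC cvp.
rewrite Bc /orth mec (introN eqP ce) /=.
have n2 := (hm (nesym ce)).2 _ mec.
case: n n2 mec vpE => [//|[//|[//|n]]] _ mec; rewrite /res /= !wp_cons -!mulgA.
have [vc vE] := hv c cC Bc; rewrite vE -mulgA => /(artin_lcancel hm) vcE.
have vcB : inP (fun c => (c \in C) && B c) vc.
  by move: vB; rewrite vE (inPM hm) => /andP[].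
exfalso; apply: (negP nBe); apply: (ldiv_atom_support vcB hp eC).
by rewrite vcE; exact: ldivMr.
Qed.

Lemma support_lcm (s : seq A) z : (forall c, c \in s -> ldiv (atom c) z) ->
  exists v, inP (mem s) v /\ forall c, c \in s -> ldiv (atom c) v.
Proof.
move=> hs; suff [v [vz vs hv]] : exists v, [/\ ldiv v z, inP (mem s) v &
    forall c, c \in s -> ldiv (atom c) v] by exists v.
suff h (r : seq A) : {subset r <= s} -> exists v, [/\ ldiv v z, inP (mem s) v &
    forall c, c \in r -> ldiv (atom c) v] by exact: h.
elim: r => [_|a r ih rs]; first by exists 1; split=> //; [exact: ldiv1|exact: inP1].
have [|v [vz vs hv]] := ih; first by move=> c cr; apply: rs; rewrite inE cr orbT.
have ar : a \in s by apply: rs; rewrite inE eqxx.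
have [l [al vl lmin lC]] := artin_lcm hm (hs _ ar) vz.
exists l; split.
- by apply: lmin => //; exact: hs.
- by apply: lC => //; rewrite (inP_atom hm).
- by move=> c; rewrite inE => /predU1P[->//|/hv cv]; exact: ldiv_trans vl.
Qed.

(** The letters of B in C generate a spherical parabolic submonoid, v being a common multiple inside
    it. The condition keeps a legal move available at every stage of the game. *)
Let spherical_in C B := exists v, inP (fun c => (c \in C) && B c) v /\
  (forall c, c \in C -> B c -> ldiv (atom c) v).

Let game_spherical C B e : e \in C -> spherical_in C B ->
  spherical_in C (fun c => (c == e) || (B c && orth e c)).
Proof.
move=> eC [v [vB hv]].
have [|v0 [v0s hv0]] := @support_lcm [seq c <- C | B c && orth e c] v.
  by move=> c; rewrite mem_filter => /andP[/andP[Bc _] cC]; exact: hv.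
exists (atom e * v0); split.
  rewrite (inPM hm) (inP_atom hm) eC eqxx /=.
  apply: sub_all v0s => c /=; rewrite mem_filter => /andP[-> ->].
  by rewrite orbT.
move=> c cC /predU1P[->|/andP[Bc oc]]; first exact: ldivMr.
have [w ->] : ldiv (atom c) v0 by apply: hv0; rewrite mem_filter Bc oc.
have /andP[ce /eqP mec] := oc.
have := altC hm (nesym (elimN eqP ce)) mec; rewrite /alt /= !wp_cons => e2.
have e3 : atom e * atom c = atom c * atom e by move: e2; rewrite (_ : wp m [::] = 1 :> P)// !mulg1.
by rewrite mulgA e3 -mulgA; exact: ldivMr.
Qed.

Let edge_orth e c : coxeter_edge m e c -> ~~ orth e c.
Proof.
rewrite /coxeter_edge /orth negb_and => /andP[_] h; apply/orP; right.
by apply/eqP => mec; rewrite mec in h.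
Qed.

Let edge_orth_sym e c : coxeter_edge m e c -> ~~ orth c e.
Proof.
move=> ec; have /andP[/eqP/nesym ne _] := ec.
by apply: contra (edge_orth ec); rewrite /orth eq_sym -(hm ne).1.
Qed.

(** The letters of r are fired one after another; each is admissible because it is adjacent to its
    predecessor, hence not orthogonal to it. What survives besides the last letter is orthogonal to
    all fired letters, which is impossible when each letter of C is adjacent to a fired one. *)
Lemma game C B e (r : seq A) : e \in C -> {subset r <= C} -> ~~ B e ->
  path (coxeter_edge m) e r ->
  (forall c, c \in C -> exists2 d, d \in e :: r & coxeter_edge m d c) ->
  spherical_in C B -> exists u, forall p,
    (forall c, c \in C -> ldiv (atom c) p -> B c) ->
    forall c, c \in C -> ldiv (atom c) (u * p) -> c = last e r.
Proof.
move=> eC rC nBe er hcov sB.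
suff [B' [[u hu] hB']] : exists B', (exists u, forall p,
    (forall c, c \in C -> ldiv (atom c) p -> B c) ->
    forall c, c \in C -> ldiv (atom c) (u * p) -> B' c) /\
    forall c, B' c -> c = last e r \/ B c /\ forall d, d \in e :: r -> orth d c.
  exists u => p hp c cC cup; have [//|[_ h]] := hB' _ (hu p hp c cC cup).
  by have [d /h dc /edge_orth] := hcov c cC; rewrite dc.
move=> {hcov}; elim: r e B eC rC nBe er sB => [|f r ih] e B eC rC nBe.
  move=> _ [v [vB hv]]; exists (fun c => (c == e) || (B c && orth e c)); split.
    by exists (atom e * v) => p hp; exact: (game_move eC nBe vB hv hp).
  move=> c /predU1P[->|/andP[Bc oc]]; first by left.
  by right; split=> // d; rewrite inE => /eqP ->.
move=> /= /andP[ef fr] sB.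
have [v [vB hv]] := sB.
pose B1 c := (c == e) || (B c && orth e c).
have fC : f \in C by apply: rC; rewrite inE eqxx.
have nB1f : ~~ B1 f.
  rewrite /B1 negb_or negb_and (edge_orth ef) orbT andbT.
  by move: ef => /andP[]; rewrite eq_sym.
have [|B' [[u hu] hB']] := ih f B1 fC _ nB1f fr (game_spherical eC sB).
  by move=> d dr; apply: rC; rewrite inE dr orbT.
exists B'; split.
  exists (u * (atom e * v)) => p hp c cC; rewrite -mulgA; apply: hu => //.
  exact: (game_move eC nBe vB hv hp).
move=> c /hB'[->|[/predU1P[->|/andP[Bc oc]] h]]; first by left.
  by have := h f; rewrite inE eqxx (negbTE (edge_orth_sym ef)) => /(_ isT).
right; split=> // d; rewrite inE => /predU1P[->//|]; exact: h.
Qed.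

(* A closed walk through any given finite set of letters: its vertex set is a
   connected finite parabolic. *)
Lemma closed_walk (F : seq A) a0 : irreducible m -> exists L,
  [/\ path (coxeter_edge m) a0 L, last a0 L = a0 & {subset F <= a0 :: L}].
Proof.
move=> [_ hc]; elim: F => [|f F [L [L1 L2 L3]]]; first by exists [::].
have [p p1 p2] := hc a0 f; have [q q1 q2] := hc f a0.
exists (p ++ q ++ L); split.
- by rewrite !cat_path p1 p2 q1 q2.
- by rewrite !last_cat p2 q2.
move=> c; rewrite inE => /predU1P[->|/L3].
  by rewrite -cat_cons mem_cat -p2 mem_last.
by rewrite !inE !mem_cat => /orP[->//|->]; rewrite !orbT.
Qed.

Lemma walk_cover a0 L : path (coxeter_edge m) a0 L -> last a0 L = a0 ->
  forall e b, e \in a0 :: L -> b \in a0 :: L -> exists r,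
  [/\ path (coxeter_edge m) e r, last e r = b, {subset r <= a0 :: L} &
      {subset a0 :: L <= e :: r}].
Proof.
move=> L1 L2 e b eL bL.
have to_a0 : exists r, [/\ path (coxeter_edge m) e r, last e r = a0 & {subset r <= a0 :: L}].
  move: eL; rewrite inE => /predU1P[->|]; first by exists [::].
  move=> eL; move: L1 L2; case/path.splitPr: eL => p1 p2; rewrite cat_path last_cat /=.
  move=> /and3P[_ _ ep2] lp2; exists p2; split=> // c cp2.
  by rewrite inE mem_cat inE cp2 !orbT.
have from_a0 : exists r, [/\ path (coxeter_edge m) a0 r, last a0 r = b & {subset r <= a0 :: L}].
  move: bL; rewrite inE => /predU1P[->|]; first by exists [::].
  move=> bL; move: L1; case/path.splitP: bL => p1 p2; rewrite cat_path => /andP[h _].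
  exists (rcons p1 b); split=> //; first by rewrite last_rcons.
  by move=> c cp; rewrite inE mem_cat cp orbT.
have [r1 [r1p r1l r1s]] := to_a0; have [r2 [r2p r2l r2s]] := from_a0.
exists (r1 ++ L ++ r2); split.
- by rewrite !cat_path r1p r1l L1 L2.
- by rewrite !last_cat r1l L2.
- move=> c; rewrite !mem_cat => /or3P[/r1s//|cL|/r2s//].
  by rewrite inE cL orbT.
move=> c; rewrite inE => /predU1P[->|cL].
  by rewrite -cat_cons mem_cat -{1}r1l mem_last.
by rewrite inE !mem_cat cL !orbT.
Qed.

Lemma walk_neighbour a0 L : path (coxeter_edge m) a0 L -> L != [::] ->
  forall c, c \in a0 :: L -> exists2 d, d \in a0 :: L & coxeter_edge m d c.
Proof.
have symE a b : coxeter_edge m a b -> coxeter_edge m b a.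
  rewrite /coxeter_edge => /andP[ab]; rewrite eq_sym ab /=.
  by rewrite -(hm (elimN eqP ab)).1.
move=> + + c; elim: L a0 => // f L ih a0 /= /andP[af fL] _.
rewrite inE => /predU1P[->|cL].
  by exists f; [rewrite !inE eqxx orbT|exact: symE].
case: (L =P [::]) => [L0|/eqP L0].
  by move: cL; rewrite L0 inE => /eqP ->; exists a0 => //; rewrite inE eqxx.
have [d dL dc] := ih f fL L0 cL.
by exists d => //; rewrite inE dL orbT.
Qed.

Let parabolic (F : seq A) a0 a1 : irreducible m -> a0 <> a1 -> exists C, {subset F <= C} /\
  forall B b e, e \in C -> b \in C -> ~~ B e -> spherical_in C B -> exists u, forall p,
    (forall c, c \in C -> ldiv (atom c) p -> B c) ->
    forall c, c \in C -> ldiv (atom c) (u * p) -> c = b.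
Proof.
move=> hirr a01; have [L [L1 L2 L3]] := closed_walk (a1 :: F) a0 hirr.
have L0 : L != [::].
  apply/eqP => L0; have := L3 a1; rewrite L0 !inE eqxx => /(_ isT)/eqP.
  exact: nesym.
exists (a0 :: L); split; first by move=> c cF; apply: L3; rewrite inE cF orbT.
move=> B b e eL bL Be sB; have [r [r1 r2 r3 r4]] := walk_cover L1 L2 eL bL.
have [|u hu] := game eL r3 Be r1 _ sB; last by exists u; rewrite r2 in hu.
by move=> c /(walk_neighbour L1 L0)[d /r4 dr dc]; exists d.
Qed.

(** The game starts with B the complement of a, whose letters in C have a common multiple by left
    reversibility. It runs in a finite connected set C of letters containing F. *)
Lemma game_reversible (F : seq A) a b : irreducible m -> left_reversible P ->
  a \in F -> b \in F -> (exists a1, a1 <> a) -> exists u, forall p, ~ ldiv (atom a) p ->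
  forall c, c \in F -> ldiv (atom c) (u * p) -> c = b.
Proof.
move=> hirr /left_reversibleP hP aF bF [a1 a1a].
have [C [FC hC]] := parabolic F hirr (nesym a1a).
have [||u hu] := hC (predC1 a) b a (FC _ aF) (FC _ bF).
- by rewrite /= eqxx.
- have [z hz] := common_multiple [seq c <- C | predC1 a c] hP.
  have [v [v1 v2]] := support_lcm hz; exists v; split.
    by apply: sub_all v1 => c /=; rewrite mem_filter andbC.
  by move=> c cC ca; apply: v2; rewrite mem_filter ca.
exists u => p ap c cF; apply: hu; last exact: FC.
by move=> d _ dp /=; apply/eqP => da; apply: ap; rewrite -da.
Qed.

(** An initial factor w with no common multiple with some atom a keeps a from dividing w p for every
    p, so the start of the game imposes no condition on p. *)
Lemma game_nonreversible (F : seq A) b : irreducible m -> ~ left_reversible P ->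
  b \in F -> (exists a0 a1 : A, a0 <> a1) -> exists u, forall p c, c \in F ->
  ldiv (atom c) (u * p) -> c = b.
Proof.
move=> hirr hP bF [a0 [a1 a01]].
have [w0 [a nwa]] : exists w a, ~ compatible w (atom a).
  apply: contrapT => h; apply: hP; apply/left_reversibleP/compatible_atoms => x a.
  by apply: contrapT => h2; apply: h; exists x, a.
have [C [FC hC]] := parabolic (a :: F) hirr a01.
have aC : a \in C by apply: FC; rewrite inE eqxx.
(* Extend w until every letter of C compatible with it divides it. *)
have [w [wa hw]] : exists w, ~ compatible w (atom a) /\
    forall c, c \in C -> compatible w (atom c) -> ldiv (atom c) w.
  suff h (s : seq A) : exists w, ~ compatible w (atom a) /\
      forall c, c \in s -> compatible w (atom c) -> ldiv (atom c) w by exact: h.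
  elim: s => [|d s [w [wa hw]]]; first by exists w0.
  have [[z [wz dz]]|nd] := pselect (compatible w (atom d)).
    exists z; split.
      by move=> [q [zq aq]]; apply: wa; exists q; split=> //; exact: (ldiv_trans wz zq).
    move=> c; rewrite inE => /predU1P[->//|/hw cs] [q [zq cq]].
    by apply: (ldiv_trans _ wz); apply: cs; exists q; split=> //; exact: (ldiv_trans wz zq).
  by exists w; split=> // c; rewrite inE => /predU1P[->/nd//|]; exact: hw.
pose B c : bool := `[< ldiv (atom c) w >].
have sB : spherical_in C B.
  have [|v [v1 v2]] := @support_lcm [seq c <- C | B c] w.
    by move=> c; rewrite mem_filter => /andP[/asboolP].
  exists v; split; last by move=> c cC Bc; apply: v2; rewrite mem_filter Bc.
  by apply: sub_all v1 => c /=; rewrite mem_filter andbC.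
have nBa : ~~ B a.
  by apply/asboolP => aw; apply: wa; exists w; split; [exact: ldiv_refl|].
have bC : b \in C by apply: FC; rewrite inE bF orbT.
have [u hu] := hC B b a aC bC nBa sB.
exists (u * w) => p c cF; rewrite -mulgA; apply: hu; last by apply: FC; rewrite inE cF orbT.
move=> d dC dwp; apply/asboolP; apply: hw => //.
by exists (w * p); split; [exact: ldivMr|].
Qed.

End Game.

(** * Atoms whose powers create no short left divisors *)

Section GoodTails.
Context {A : choiceType} (m : A -> A -> option nat).
Hypothesis hm : coxeter_matrix m.
Local Notation P := (artin_tits m).
Local Notation atom := (atom m).
Implicit Types (a b c e : A) (x y z p q t u v w : P).
Local Open Scope group_scope.

(** If c divides b p, then b p begins with the braid of b and c. Multiplying it by b once more gives
    an alternating word with one more letter, which again begins with that braid. *)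
Lemma ldiv_atom_pow c b k p : c <> b -> (0 < k)%N ->
  ldiv (atom c) (atom b ^+ k * p) <-> ldiv (atom c) (atom b * p).
Proof.
move=> cb; case: k => // k _; elim: k => [|k ih]; first by rewrite expg1.
rewrite expgS -mulgA; split.
  by move=> /(ldiv_atomM_neq hm cb)[n [z [_ _]]]; exact: ih.1.
move=> /(ih.2); rewrite expgS -mulgA => /(ldiv_atomM_neq hm cb)[n [z [mbc -> _]]].
have bc := nesym cb; have n2 := (hm bc).2 _ mbc.
rewrite [X in atom b * X]mulgA atom_res ?(ltnW n2)// altC// mulgA.
apply: ldiv_mulr; rewrite /alt -wp_cons -[_ :: _]/(alternating b c n.+1).
rewrite -addn1 alternating_cat wp_cat; apply: ldiv_mulr.
rewrite -[wp m _]/(alt m b c n) altC//; case: n n2 {mbc} => // n _.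
by rewrite /alt /= wp_cons; exact: ldivMr.
Qed.

(* Left divisors of p of length at most L cannot be created by appending
   powers of the atom c. *)
Definition good L p c := forall t N, (len t <= L)%N ->
  ldiv t (p * atom c ^+ N) -> ldiv t p.

Lemma good_le L L' p c : (L <= L')%N -> good L' p c -> good L p c.
Proof. by move=> LL h t N tL; apply: h; exact: leq_trans LL. Qed.

Lemma lcm_len x y : exists n, forall z, ldiv x z -> ldiv y z ->
  exists l, [/\ ldiv x l, ldiv y l, ldiv l z & (len l <= n)%N].
Proof.
have [[z [xz yz]]|no] := pselect (compatible x y); last first.
  by exists 0%N => z xz yz; case: no; exists z.
have [l [xl yl lmin _]] := artin_lcm hm xz yz.
by exists (len l) => z' xz' yz'; exists l; split=> //; exact: lmin.
Qed.

Lemma lcm_len_seq (s r : seq P) : exists n, forall x y z, x \in s -> y \in r ->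
  ldiv x z -> ldiv y z -> exists l, [/\ ldiv x l, ldiv y l, ldiv l z & (len l <= n)%N].
Proof.
have one x : exists n, forall y z, y \in r ->
  ldiv x z -> ldiv y z -> exists l, [/\ ldiv x l, ldiv y l, ldiv l z & (len l <= n)%N].
  elim: r => [|y r [n hn]]; first by exists 0%N.
  have [k hk] := lcm_len x y; exists (maxn n k) => y' z.
  rewrite inE => /predU1P[->|yr] xz yz.
    have [l [? ? ? ?]] := hk z xz yz; exists l; split=> //.
    by rewrite leq_max orbC; apply/orP; left.
  have [l [? ? ? ?]] := hn _ z yr xz yz; exists l; split=> //.
  by rewrite leq_max; apply/orP; left.
elim: s => [|x s [n hn]]; first by exists 0%N.
have [k hk] := one x; exists (maxn n k) => x' y z.
rewrite inE => /predU1P[->|xs] yr xz yz.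
  have [l [? ? ? ?]] := hk _ z yr xz yz; exists l; split=> //.
  by rewrite leq_max orbC; apply/orP; left.
have [l [? ? ? ?]] := hn _ _ z xs yr xz yz; exists l; split=> //.
by rewrite leq_max; apply/orP; left.
Qed.

Hypothesis fA : finite_set [set: A]%classic.

Lemma lcm_divisors (s : seq P) : exists n, forall p, exists u,
  [/\ ldiv u p, (len u <= n)%N & forall t, t \in s -> ldiv t p -> ldiv t u].
Proof.
elim: s => [|x s [n hn]].
  by exists 0%N => p; exists 1; split; [exact: ldiv1|rewrite (len1 hm)|].
have [b hb] := finite_ball hm fA n; have [k hk] := lcm_len_seq [:: x] b.
exists (maxn n k) => p; have [u [up un hu]] := hn p.
have [xp|nxp] := pselect (ldiv x p); last first.
  exists u; split; rewrite ?leq_max ?un// => t.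
  by rewrite inE => /predU1P[->/nxp//|]; exact: hu.
have [|l [xl ul lp ll]] := hk _ _ p _ (hb _ un) xp up; first by rewrite inE eqxx.
exists l; split; rewrite ?leq_max ?ll ?orbT// => t.
by rewrite inE => /predU1P[->//|ts tp]; exact: ldiv_trans (hu _ ts tp) ul.
Qed.

Lemma atom_last x : x = 1 \/ exists a y, x = y * atom a.
Proof.
rewrite -(wp_repr x); case/lastP: (repr x) => [|s a]; first by left.
by right; exists a, (wp m s); rewrite -cats1 wp_cat.
Qed.

(** All divisors of p of length at most L divide a divisor u of bounded length, so p = u r with r
    non-trivial, and the last letter a of r is good. A new divisor of p a^N would provide an atom
    dividing p1 a^N but not p1, where p1 ends in a; [ldiv_atom_expn] excludes this. *)
Lemma good_exists L : exists n, forall p, (n <= len p)%N -> exists c, good L p c.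
Proof.
have [b hb] := finite_ball hm fA L; have [n hn] := lcm_divisors b.
exists n.+1 => p np; have [u [[r pE] un hu]] := hn p.
case: (atom_last r) => [r1|[a [r' rE]]].
  by move: np; rewrite pE r1 mulg1 ltnNge un.
exists a => t N tL tp.
(* The common left divisor t0 of t and p is extended until no atom divides both remainders. *)
have [t0 [t1 [p1 [tE pE1 h]]]] : exists t0 t1 p1, [/\ t = t0 * t1, p = t0 * p1 &
    forall c, ldiv (atom c) t1 -> ~ ldiv (atom c) p1].
  suff H k : forall t0 p1 t1, p = t0 * p1 -> t = t0 * t1 -> (len t - len t0 < k)%N ->
      exists t0 t1 p1, [/\ t = t0 * t1, p = t0 * p1 &
      forall c, ldiv (atom c) t1 -> ~ ldiv (atom c) p1].
    by apply: (H (len t).+1 1 p t); rewrite ?mul1g// ltnS leq_subr.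
  elim: k => // k ih t0 p1 t1 pE1 tE; rewrite ltnS => h.
  have [[c [[t2 t2E] [p2 p2E]]]|no] := pselect (exists c, ldiv (atom c) t1 /\ ldiv (atom c) p1).
    apply: (ih (t0 * atom c) p2 t2); rewrite -?mulgA -?t2E -?p2E//.
    by move: h; rewrite tE t2E !(lenM hm) (len_atom hm); lia.
  by exists t0, t1, p1; split=> // c ct cp; apply: no; exists c.
case: (atom_case t1) => [t11|[c [t2 t2E]]]; first by rewrite tE t11 mulg1 pE1; exact: ldivMr.
exfalso; apply: (h c); first by rewrite t2E; exact: ldivMr.
have [s uE] : ldiv t0 u.
  apply: hu; last by rewrite pE1; exact: ldivMr.
  by apply: hb; apply: leq_trans tL; rewrite tE (lenM hm) leq_addr.
have p1E : p1 = s * r' * atom a.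
  by apply: (artin_lcancel hm (x := t0)); rewrite -pE1 pE uE rE !mulgA.
rewrite p1E; apply: (ldiv_atom_expn hm (n := N.+1)); rewrite expgS !mulgA -p1E.
apply: (@ldiv_trans _ _ t1); first by rewrite t2E; exact: ldivMr.
by apply: (ldiv_cancel hm (x := t0)); rewrite mulgA -pE1 -tE.
Qed.

(** If r divides x z c^N, so does the lcm x v of x and r, hence y v divides y z c^N. All lengths
    involved are bounded over the finite sets s, t and the ball of radius L, so goodness at y z
    applies to y v. *)
Lemma good_shift (s t : seq P) L : exists2 L', (L <= L')%N &
  forall x y z c, x \in s -> y \in t -> good L' (y * z) c -> good L (x * z) c.
Proof.
have [b hb] := finite_ball hm fA L; have [n hn] := lcm_len_seq s b.
have [k hk] : exists k, forall y, y \in t -> (len y <= k)%N.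
  elim: t => [|y t [k hk]]; first by exists 0%N.
  exists (maxn (len y) k) => y'; rewrite inE leq_max => /predU1P[->|/hk->].
    by rewrite leqnn.
  by rewrite orbT.
(* k bounds the length of y and n that of the lcm of x and r; L is added for monotonicity only. *)
exists (k + n + L)%N; first by rewrite leq_addl.
move=> x y z c xs yt hg r N rL [w]; rewrite -mulgA => rw.
have [||l [[v lE] rl lx ln]] := hn x r (x * (z * atom c ^+ N)) xs (hb _ rL).
- exact: ldivMr.
- by rewrite rw; exact: ldivMr.
apply: (ldiv_trans rl); rewrite lE; apply: ldiv_mul.
apply: (ldiv_cancel hm (x := y)); apply: (hg _ N).
  rewrite (lenM hm) -addnA; apply: leq_add; first exact: hk.
  by apply: leq_trans (leq_addr _ _); apply: leq_trans ln; rewrite lE (lenM hm) leq_addl.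
rewrite -mulgA; apply: ldiv_mul; apply: (ldiv_cancel hm (x := x)).
by rewrite -lE.
Qed.

End GoodTails.

Local Open Scope classical_set_scope.

(** * Operators on l2 *)

Section ComplexModulus.
Context {R : realType}.
Implicit Types z w : R[i].
Local Open Scope ring_scope.
Local Open Scope complex_scope.

(** The modulus with values in R; the norm of R[i] takes its values in R[i]. *)
Definition cabs z : R := Num.sqrt (sqnormc z).

Lemma sqr_cabs z : cabs z ^+ 2 = sqnormc z.
Proof. by rewrite sqr_sqrtr ?sqnormc_ge0. Qed.

Lemma cabs_ge0 z : 0 <= cabs z. Proof. exact: sqrtr_ge0. Qed.

Lemma cabsE z : `|z| = (cabs z)%:C. Proof. by rewrite normc_def. Qed.

Lemma cabsM z w : cabs (z * w) = cabs z * cabs w.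
Proof. by apply: complexI; rewrite rmorphM /= -!cabsE normrM. Qed.

Lemma cabsD z w : cabs (z + w) <= cabs z + cabs w.
Proof. by rewrite -lecR rmorphD /= -!cabsE ler_normD. Qed.

Lemma cabsN z : cabs (- z) = cabs z.
Proof. by apply: complexI; rewrite -!cabsE normrN. Qed.

Lemma cabs0 : cabs 0 = 0.
Proof. by apply: complexI; rewrite -!cabsE normr0. Qed.

Lemma cabs_real (x : R) : cabs x%:C = `|x|.
Proof. by rewrite /cabs /sqnormc /= expr0n addr0 sqrtr_sqr. Qed.

Lemma cabs_eq0 z : cabs z = 0 -> z = 0.
Proof. by move=> z0; apply/eqP; rewrite -normr_eq0 cabsE z0. Qed.

Lemma sqnormc_conj z : sqnormc (conjc z) = sqnormc z.
Proof. by case: z => a b; rewrite /sqnormc /= sqrrN. Qed.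

Lemma cabs_conj z : cabs (conjc z) = cabs z.
Proof. by rewrite /cabs sqnormc_conj. Qed.

Lemma cabs1 : cabs 1 = 1.
Proof. by apply: complexI; rewrite -!cabsE normr1. Qed.

Lemma cabsB z w : cabs (z - w) <= cabs z + cabs w.
Proof. by rewrite -(cabsN w) cabsD. Qed.

Lemma cabs_sum (I : Type) (s : seq I) (F : I -> R[i]) :
  cabs (\sum_(i <- s) F i) <= \sum_(i <- s) cabs (F i).
Proof.
elim/big_rec2: _ => [|i y1 y2 _ h]; first by rewrite cabs0.
by apply: (le_trans (cabsD _ _)); rewrite lerD2l.
Qed.

Lemma Re_le_cabs z : `|complex.Re z| <= cabs z.
Proof. by rewrite -lecR -cabsE normc_ge_Re. Qed.

Lemma Im_le_cabs z : `|complex.Im z| <= cabs z.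
Proof.
rewrite -(@ler_pXn2r _ 2)// ?nnegrE ?cabs_ge0// sqr_cabs /sqnormc real_normK ?num_real//.
by rewrite lerDr sqr_ge0.
Qed.

Lemma conjcD z w : conjc (z + w) = conjc z + conjc w. Proof. exact: rmorphD. Qed.
Lemma conjcM z w : conjc (z * w) = conjc z * conjc w. Proof. exact: rmorphM. Qed.
Lemma conjcN z : conjc (- z) = - conjc z. Proof. exact: rmorphN. Qed.

End ComplexModulus.

(** * Absolutely summable real families *)

Section RealSums.
Context {R : realType} {X : choiceType}.
Local Open Scope ring_scope.
Implicit Types u v p q : X -> R.

Local Notation esumT u := (\esum_(x in [set: X]) (u x)%:E)%E.
Definition rsummable u := (esumT (fun x => `|u x|) < +oo)%E.

Let esumT_ge0 u : (forall x, 0 <= u x) -> (0 <= esumT u)%E.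
Proof. by move=> u0; apply: esum_ge0 => x _; rewrite lee_fin. Qed.

Let esumT_fin u : (forall x, 0 <= u x) -> (esumT u < +oo)%E -> esumT u \is a fin_num.
Proof. by move=> u0 h; rewrite ge0_fin_numE ?esumT_ge0. Qed.

Let esumT_le u v : (forall x, u x <= v x) -> (esumT u <= esumT v)%E.
Proof. by move=> uv; apply: le_esum => x _; rewrite lee_fin. Qed.

Let esumTD u v : (forall x, 0 <= u x) -> (forall x, 0 <= v x) ->
  (esumT (fun x => u x + v x)%R = esumT u + esumT v)%E.
Proof.
move=> u0 v0; rewrite -esumD//; last 2 first.
- by move=> x _; rewrite lee_fin.
- by move=> x _; rewrite lee_fin.
Qed.

(** [rsum] is defined by positive and negative parts, which are not additive. Any other
    decomposition into non-negative summable families gives the same value, and additivity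
    follows. *)
Lemma rsum_diff p q : (forall x, 0 <= p x) -> (forall x, 0 <= q x) ->
  (esumT p < +oo)%E -> (esumT q < +oo)%E ->
  rsum (fun x => p x - q x) = fine (esumT p) - fine (esumT q).
Proof.
move=> p0 q0 pf qf.
have m0 (y : R) : 0 <= Num.max y 0 by rewrite le_max lexx orbT.
have Pp : (esumT (fun x => Num.max (p x - q x) 0)%R <= esumT p)%E.
  by apply: esumT_le => x; rewrite ge_max p0 lerBlDr lerDl q0.
have Qq : (esumT (fun x => Num.max (- (p x - q x)) 0)%R <= esumT q)%E.
  by apply: esumT_le => x; rewrite ge_max q0 opprB lerBlDr lerDl p0.
have e : (esumT (fun x => Num.max (p x - q x) 0)%R + esumT q =
          esumT (fun x => Num.max (- (p x - q x)) 0)%R + esumT p)%E.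
  rewrite -!esumTD//; apply: eq_esum => x _; congr EFin.
  rewrite opprB; have [h|h] := lerP (p x) (q x).
    by rewrite max_r ?subr_le0// max_l ?subr_ge0// add0r subrK.
  by rewrite max_l ?subr_ge0 ?ltW// max_r ?subr_le0 ?ltW// add0r subrK.
rewrite /rsum.
have f1 := esumT_fin (fun x => m0 _) (le_lt_trans Pp pf).
have f2 := esumT_fin (fun x => m0 _) (le_lt_trans Qq qf).
have f3 := esumT_fin p0 pf; have f4 := esumT_fin q0 qf.
apply/eqP; rewrite subr_eq addrAC eq_sym subr_eq eq_sym; apply/eqP.
by rewrite -!fineD// e addeC.
Qed.

Lemma rsum_ge0E p : (forall x, 0 <= p x) -> (esumT p < +oo)%E -> rsum p = fine (esumT p).
Proof.
move=> p0 pf; have := @rsum_diff p (fun=> 0) p0 (fun=> lexx _) pf.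
have -> : esumT (fun=> 0 : R) = 0%E by rewrite esum1.
rewrite ltry /= subr0 => /(_ isT) <-; congr rsum.
by apply/funext => x; rewrite subr0.
Qed.

Let pos u x := Num.max (u x) 0.
Let neg u x := Num.max (- u x) 0.
Let pos0 u x : 0 <= pos u x. Proof. by rewrite /pos le_max lexx orbT. Qed.
Let neg0 u x : 0 <= neg u x. Proof. by rewrite /neg le_max lexx orbT. Qed.

Let posneg u x : u x = pos u x - neg u x.
Proof.
rewrite /pos /neg; have [h|h] := lerP 0 (u x).
  by rewrite max_r ?subr0// oppr_le0.
by rewrite max_l ?oppr_ge0 ?ltW// sub0r opprK.
Qed.

Let pos_fin u : rsummable u -> (esumT (pos u) < +oo)%E.
Proof.
apply: le_lt_trans; apply: esumT_le => x.
by rewrite /pos ge_max normr_ge0 ler_norm.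
Qed.

Let neg_fin u : rsummable u -> (esumT (neg u) < +oo)%E.
Proof.
apply: le_lt_trans; apply: esumT_le => x.
by rewrite /neg ge_max normr_ge0 -normrN ler_norm.
Qed.

Lemma rsumD u v : rsummable u -> rsummable v ->
  rsum (fun x => u x + v x) = rsum u + rsum v.
Proof.
move=> su sv.
rewrite (_ : (fun x => _) = fun x => (pos u x + pos v x) - (neg u x + neg v x)); last first.
  by apply/funext => x; rewrite (posneg u) (posneg v); ring.
have h1 := pos_fin su; have h2 := pos_fin sv.
have h3 := neg_fin su; have h4 := neg_fin sv.
rewrite rsum_diff; last 4 first.
- by move=> x; rewrite addr_ge0.
- by move=> x; rewrite addr_ge0.
- by rewrite esumTD// lte_add_pinfty.
- by rewrite esumTD// lte_add_pinfty.
rewrite !esumTD// !fineD ?esumT_fin// /rsum -/(pos u) -/(neg u) -/(pos v) -/(neg v).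
by rewrite opprD addrACA.
Qed.

Lemma rsummableZ c u : rsummable u -> rsummable (fun x => c * u x).
Proof.
rewrite /rsummable => h; have [->|c0] := eqVneq c 0.
  by rewrite esum1 ?ltry// => x _; rewrite mul0r normr0.
have -> : esumT (fun x => `|c * u x|) = (`|c|%:E * esumT (fun x => `|u x|))%E.
  rewrite -esumZ ?normr_gt0//.
  by apply: eq_esum => x _; rewrite normrM EFinM.
by rewrite lte_mul_pinfty ?lee_fin.
Qed.

Lemma rsumZ c u : rsummable u -> rsum (fun x => c * u x) = c * rsum u.
Proof.
move=> su; have h1 := pos_fin su; have h2 := neg_fin su.
have Z (d : R) w : 0 < d -> (forall x, 0 <= w x) -> (esumT w < +oo)%E ->
    (esumT (fun x => d * w x)%R < +oo)%E /\ fine (esumT (fun x => d * w x)%R) = d * fine (esumT w).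
  move=> d0 w0 wf; have -> : (esumT (fun x => d * w x)%R = d%:E * esumT w)%E.
    by rewrite -esumZ// => x; rewrite lee_fin.
  by rewrite lte_mul_pinfty ?lee_fin ?ltW// fineM// esumT_fin.
have [c0|c0|->] := ltgtP c 0.
- have c0' : 0 < - c by rewrite oppr_gt0.
  have [f1 e1] := Z (- c) (pos u) c0' (pos0 u) h1.
  have [f2 e2] := Z (- c) (neg u) c0' (neg0 u) h2.
  have g1 x : 0 <= - c * neg u x by rewrite mulr_ge0 ?neg0 ?pos0// ltW.
  have g2 x : 0 <= - c * pos u x by rewrite mulr_ge0 ?neg0 ?pos0// ltW.
  have := rsum_diff g1 g2 f2 f1; rewrite e1 e2.
  rewrite (_ : (fun x => _) = fun x => c * u x); last first.
    by apply/funext => x; rewrite [in RHS](posneg u); ring.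
  by move=> ->; rewrite /rsum -/(pos u) -/(neg u); ring.
- have [f1 e1] := Z c (pos u) c0 (pos0 u) h1.
  have [f2 e2] := Z c (neg u) c0 (neg0 u) h2.
  have g1 x : 0 <= c * neg u x by rewrite mulr_ge0 ?neg0 ?pos0// ltW.
  have g2 x : 0 <= c * pos u x by rewrite mulr_ge0 ?neg0 ?pos0// ltW.
  have := rsum_diff g2 g1 f1 f2; rewrite e1 e2.
  rewrite (_ : (fun x => _) = fun x => c * u x); last first.
    by apply/funext => x; rewrite [in RHS](posneg u); ring.
  by move=> ->; rewrite /rsum -/(pos u) -/(neg u); ring.
- rewrite mul0r rsum_ge0E; last 2 first.
  + by move=> x; rewrite mul0r.
  + by rewrite esum1 ?ltry// => x _; rewrite mul0r.
  by rewrite esum1// => x _; rewrite mul0r.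
Qed.

Lemma rsum_single u x0 : (forall x, x != x0 -> u x = 0) -> rsum u = u x0.
Proof.
move=> u0.
have e (w : X -> R) : (forall x, x != x0 -> w x = 0) -> 0 <= w x0 -> esumT w = (w x0)%:E.
  move=> w0 wx; rewrite -(@esum_set1 _ _ x0 (fun x => (w x)%:E)) ?lee_fin//.
  rewrite [RHS]esum_mkcond; apply: eq_esum => x _; rewrite in_set1.
  by case: eqVneq => [->//|/w0 ->].
have hp : esumT (pos u) = (pos u x0)%:E.
  by apply: e => // x /u0; rewrite /pos => ->; rewrite maxxx.
have hn : esumT (neg u) = (neg u x0)%:E.
  by apply: e => // x /u0; rewrite /neg => ->; rewrite oppr0 maxxx.
by rewrite (posneg u x0) /rsum -/(pos u) -/(neg u) hp hn.
Qed.

End RealSums.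

Section InnerProduct.
Context {R : realType} {X : choiceType}.
Local Notation H := (l2 R X).
Local Notation C := R[i].
Implicit Types (f g h : H) (c : C).
Local Open Scope ring_scope.
Local Open Scope complex_scope.

Let rsummable_cabs (u : X -> R) f g : (forall x, `|u x| <= cabs (f x) * cabs (g x)) -> rsummable u.
Proof.
move=> h; apply: (@le_lt_trans _ _ (\esum_(x in [set: X]) ((sqnormc (f x))%:E + (sqnormc (g x))%:E))%E).
  apply: le_esum => x _; rewrite lee_fin -!sqr_cabs; apply: (le_trans (h x)).
  have := sqr_ge0 (cabs (f x) - cabs (g x)).
  have := sqr_ge0 (cabs (f x)); have := sqr_ge0 (cabs (g x)); nra.
rewrite esumD; last 2 first.
- by move=> x _; rewrite lee_fin sqnormc_ge0.
- by move=> x _; rewrite lee_fin sqnormc_ge0.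
by rewrite lte_add_pinfty//; [exact: (l2funP f)|exact: (l2funP g)].
Qed.

Let sumRe f g : rsummable (fun x => complex.Re (f x * conjc (g x))).
Proof.
apply: (@rsummable_cabs _ f g) => x; apply: (le_trans (Re_le_cabs _)).
by rewrite cabsM cabs_conj.
Qed.

Let sumIm f g : rsummable (fun x => complex.Im (f x * conjc (g x))).
Proof.
apply: (@rsummable_cabs _ f g) => x; apply: (le_trans (Im_le_cabs _)).
by rewrite cabsM cabs_conj.
Qed.

Lemma innerDl f g h : inner (f + g) h = inner f h + inner g h.
Proof.
apply/eqP; rewrite eq_complex /=; apply/andP; split; apply/eqP.
  rewrite -(rsumD (sumRe f h) (sumRe g h)); congr rsum; apply/funext => x.
  by rewrite -[LHS]/(complex.Re ((f x + g x) * conjc (h x))) mulrDl raddfD.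
rewrite -(rsumD (sumIm f h) (sumIm g h)); congr rsum; apply/funext => x.
by rewrite -[LHS]/(complex.Im ((f x + g x) * conjc (h x))) mulrDl raddfD.
Qed.

Lemma innerZl c f g : inner (c *: f) g = c * inner f g.
Proof.
case: c => a b; apply/eqP; rewrite eq_complex /= -!mulNr; apply/andP; split; apply/eqP.
  rewrite -(rsumZ a (sumRe f g)) -(rsumZ (- b) (sumIm f g)).
  rewrite -(rsumD (rsummableZ a (sumRe f g)) (rsummableZ (- b) (sumIm f g))).
  congr rsum; apply/funext => x.
  by rewrite -[LHS]/(complex.Re (Complex a b * f x * conjc (g x))) -mulrA; case: (f x * _) => p q /=; ring.
rewrite -(rsumZ a (sumIm f g)) -(rsumZ b (sumRe f g)).
rewrite -(rsumD (rsummableZ a (sumIm f g)) (rsummableZ b (sumRe f g))).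
congr rsum; apply/funext => x.
by rewrite -[LHS]/(complex.Im (Complex a b * f x * conjc (g x))) -mulrA; case: (f x * _) => p q /=; ring.
Qed.

Lemma innerC f g : inner g f = conjc (inner f g).
Proof.
rewrite /inner /= -mulN1r -(rsumZ (-1) (sumIm f g)); congr Complex; congr rsum; apply/funext => x.
  by case: (f x) (g x) => a b [c d] /=; ring.
by case: (f x) (g x) => a b [c d] /=; ring.
Qed.

Lemma inner_norm f : inner f f = (l2norm f ^+ 2)%:C.
Proof.
have e x : f x * conjc (f x) = (sqnormc (f x))%:C.
  by case: (f x) => a b; rewrite /sqnormc; apply/eqP; rewrite eq_complex /=; apply/andP; split; apply/eqP; ring.
rewrite /inner /real_complex_def; congr Complex.
  rewrite rsum_ge0E.
  - apply: EFin_inj; rewrite -sqsum_l2norm fineK.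
      by apply: eq_esum => x _; rewrite e.
    have -> : (\esum_(x in [set: X]) (complex.Re (f x * conjc (f x)))%:E)%E = sqsum f.
      by apply: eq_esum => x _; rewrite e.
    by rewrite ge0_fin_numE ?sqsum_ge0//; exact: (l2funP f).
  - by move=> x; rewrite e /= sqnormc_ge0.
  - have := l2funP f; rewrite inE; congr (_ < _)%E.
    by apply: eq_esum => x _; rewrite e.
rewrite -[RHS](mul0r (rsum (fun x => complex.Im (f x * conjc (f x))))) -(rsumZ 0 (sumIm f f)); congr rsum.
by apply/funext => x; rewrite e /= mulr0.
Qed.

Lemma inner_delta f x : inner f (delta x) = f x.
Proof.
have z y : y != x -> f y * conjc ((delta x : H) y) = 0.
  move=> /negbTE yx; have d : conjc (l2fun (delta x : H) y) = 0 by rewrite /= yx; exact: conjc0.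
  by rewrite d mulr0.
rewrite /inner !(@rsum_single _ _ _ x); last 2 first.
- by move=> y /z ->.
- by move=> y /z ->.
have d : conjc (l2fun (delta x : H) x) = 1 by rewrite /= eqxx; exact: conjc1.
by rewrite d mulr1; case: (f x).
Qed.

Lemma innerDr f g h : inner f (g + h) = inner f g + inner f h.
Proof. by rewrite innerC innerDl conjcD -!innerC. Qed.

Lemma innerZr c f g : inner f (c *: g) = conjc c * inner f g.
Proof. by rewrite innerC innerZl conjcM -!innerC. Qed.

Lemma innerNl f g : inner (- f) g = - inner f g.
Proof. by rewrite -scaleN1r innerZl mulN1r. Qed.

Lemma innerNr f g : inner f (- g) = - inner f g.
Proof. by rewrite innerC innerNl conjcN -innerC. Qed.

Lemma innerBl f g h : inner (f - g) h = inner f h - inner g h.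
Proof. by rewrite innerDl innerNl. Qed.

Lemma innerBr f g h : inner f (g - h) = inner f g - inner f h.
Proof. by rewrite innerDr innerNr. Qed.

Lemma inner0l f : inner 0 f = 0.
Proof. by rewrite -(scale0r (0 : H)) innerZl mul0r. Qed.

Lemma inner0r f : inner f 0 = 0.
Proof. by rewrite innerC inner0l conjc0. Qed.

Lemma inner_sumr (I : Type) (s : seq I) f (F : I -> H) :
  inner f (\sum_(i <- s) F i) = \sum_(i <- s) inner f (F i).
Proof. by elim/big_rec2: _ => [|i a b _ <-]; rewrite ?inner0r ?innerDr. Qed.

Lemma inner_suml (I : Type) (s : seq I) f (F : I -> H) :
  inner (\sum_(i <- s) F i) f = \sum_(i <- s) inner (F i) f.
Proof. by elim/big_rec2: _ => [|i a b _ <-]; rewrite ?inner0l ?innerDl. Qed.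

Lemma l2normN f : l2norm (- f) = l2norm f.
Proof.
apply/eqP; rewrite -(@eqrXn2 _ 2) ?l2norm_ge0//; apply/eqP/complexI.
by rewrite -!inner_norm innerNl innerNr opprK.
Qed.

Lemma l2norm0 : l2norm (0 : H) = 0.
Proof.
apply/eqP; rewrite -(@eqrXn2 _ 2) ?l2norm_ge0//; apply/eqP/complexI.
by rewrite -!inner_norm inner0l expr0n.
Qed.

Lemma l2normZ c f : l2norm (c *: f) = cabs c * l2norm f.
Proof. by apply: complexI; rewrite rmorphM /= -cabsE; exact: l2normCZ. Qed.

Lemma ler_l2normB f g : l2norm (f - g) <= l2norm f + l2norm g.
Proof. by rewrite -(l2normN g) ler_l2normD. Qed.

Lemma l2norm_delta x : l2norm (delta x : H) = 1.
Proof.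
apply/eqP; rewrite -(@eqrXn2 _ 2) ?l2norm_ge0//; apply/eqP/complexI.
by rewrite -inner_norm inner_delta /= eqxx expr1n.
Qed.

Lemma ler_l2norm_sum (I : Type) (s : seq I) (F : I -> H) :
  l2norm (\sum_(i <- s) F i) <= \sum_(i <- s) l2norm (F i).
Proof.
elim/big_rec2: _ => [|i y1 y2 _ h]; first by rewrite l2norm0.
by apply: (le_trans (ler_l2normD _ _)); rewrite lerD2l.
Qed.

(** Cauchy-Schwarz, read off the squared norm of f - c g, where c g is the orthogonal projection of
    f onto g. *)
Lemma inner_le f g : cabs (inner f g) <= l2norm f * l2norm g.
Proof.
have [g0|g0] := eqVneq (l2norm g) 0.
  by rewrite (l2norm_eq0 g0) inner0r cabs0 l2norm0 mulr0.
have gp : 0 < l2norm g by rewrite lt_neqAle eq_sym g0 l2norm_ge0.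
pose N := l2norm g ^+ 2; have N0 : N != 0 by rewrite expf_neq0.
pose c := (N^-1)%:C * inner f g.
have h : inner (f - c *: g) (f - c *: g) = (l2norm f ^+ 2 - sqnormc (inner f g) / N)%:C.
  rewrite innerBl !innerBr !innerZl !innerZr !inner_norm -/N (innerC f g) /c conjcM conjc_real.
  have qn : (N^-1)%:C * N%:C = 1 by rewrite -rmorphM mulVf// rmorph1.
  have -> : (l2norm f ^+ 2 - sqnormc (inner f g) / N)%:C =
      (l2norm f ^+ 2)%:C - inner f g * conjc (inner f g) * (N^-1)%:C.
    by rewrite -sqr_normc -sqnormcE -rmorphM -rmorphB.
  apply/eqP; rewrite -subr_eq0.
  rewrite (_ : _ - _ = (N^-1)%:C * inner f g * conjc (inner f g) * ((N^-1)%:C * N%:C - 1)); last by ring.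
  by rewrite qn subrr mulr0.
have := sqr_ge0 (l2norm (f - c *: g)); rewrite -ler0c -inner_norm h ler0c subr_ge0.
rewrite ler_pdivrMr ?exprn_gt0// -exprMn -sqr_cabs ler_sqr ?nnegrE ?cabs_ge0//.
by rewrite mulr_ge0 ?l2norm_ge0.
Qed.

Lemma l2_coord_le f x : cabs (f x) <= l2norm f.
Proof. by rewrite -inner_delta (le_trans (inner_le _ _))// l2norm_delta mulr1. Qed.

Lemma inner_inj f g : (forall h, inner f h = inner g h) -> f = g.
Proof.
by move=> e; apply/val_inj/funext => x /=; rewrite -[LHS]inner_delta -[RHS]inner_delta.
Qed.

End InnerProduct.

(** * Finitely supported vectors and completeness of l2 *)

Section FiniteSupport.
Context {R : realType} {X : choiceType}.
Local Notation H := (l2 R X).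
Local Notation C := R[i].
Implicit Types (f g : H) (c : C) (h k : X -> R[i]^o) (s : seq X) (x y : X).
Local Open Scope ring_scope.
Local Open Scope complex_scope.

Lemma l2ZE c f x : l2fun (c *: f) x = c * f x. Proof. by []. Qed.
Lemma l2DE f g x : l2fun (f + g) x = f x + g x. Proof. by []. Qed.
Lemma l2BE f g x : l2fun (f - g) x = f x - g x. Proof. by []. Qed.

Definition fsq h s : R := \sum_(x <- s) sqnormc (h x).

Definition fin s h : H := \sum_(x <- s) h x *: delta x.

Lemma l2_sumE (I : Type) (r : seq I) (F : I -> H) x :
  (\sum_(i <- r) F i) x = \sum_(i <- r) F i x.
Proof. by rewrite -inner_delta inner_suml; apply: eq_bigr => i _; rewrite inner_delta. Qed.

Lemma finE s h x : uniq s -> fin s h x = if x \in s then h x else 0.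
Proof.
rewrite /fin l2_sumE; elim: s => [|y s ih] /=; first by rewrite big_nil.
move=> /andP[ys us]; rewrite big_cons ih// inE.
rewrite -[X in X + _ = _]/(h y * (x == y)%:R : C).
by case: eqVneq => [->|_]; rewrite ?(negbTE ys) ?mulr1 ?addr0//= mulr0 add0r.
Qed.

Lemma norm_fin s h : uniq s -> l2norm (fin s h) ^+ 2 = fsq h s.
Proof.
move=> us; apply: complexI; rewrite -inner_norm {2}/fin inner_sumr /fsq rmorph_sum /=.
rewrite !big_seq; apply: eq_bigr => x xs.
by rewrite innerZr inner_delta finE// xs sqnormcE sqr_normc mulrC.
Qed.

Lemma fsq_ge0 h s : 0 <= fsq h s.
Proof. by apply: sumr_ge0 => x _; exact: sqnormc_ge0. Qed.

Lemma fsq_le_sqsum h s : uniq s -> ((fsq h s)%:E <= sqsum h)%E.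
Proof.
move=> us; apply: esum_ge; exists [set` s]; first by split.
by rewrite -fsbig_seq// sumEFin.
Qed.

Lemma sqsum_le h (M : R) : (forall s, uniq s -> fsq h s <= M) -> (sqsum h <= M%:E)%E.
Proof.
move=> hM; apply: ge_ereal_sup => _ [F [finF _] <-].
by rewrite fsbig_finite//= sumEFin lee_fin; apply: hM; exact: finmap.fset_uniq.
Qed.

Lemma fsq_le_norm f s : uniq s -> fsq f s <= l2norm f ^+ 2.
Proof. by move=> us; rewrite -lee_fin -sqsum_l2norm fsq_le_sqsum. Qed.

(* The vector with coordinates h, or 0 if h is not square summable. *)
Definition mk h : H := insubd 0 h.

Lemma mkE h (M : R) : (forall s, uniq s -> fsq h s <= M) -> mk h = h :> (X -> C).
Proof.
move=> hM; rewrite /mk [LHS]val_insubd ifT//.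
by rewrite inE; apply: (le_lt_trans (sqsum_le hM)); rewrite ltry.
Qed.

Lemma mk_norm h (M : R) : 0 <= M -> (forall s, uniq s -> fsq h s <= M ^+ 2) ->
  l2norm (mk h) <= M.
Proof.
move=> M0 hM; rewrite -ler_sqr ?nnegrE ?l2norm_ge0//.
by rewrite -lee_fin -sqsum_l2norm (mkE hM) sqsum_le.
Qed.

Lemma l2norm_le f (M : R) : 0 <= M -> (forall s, uniq s -> fsq f s <= M ^+ 2) -> l2norm f <= M.
Proof.
move=> M0 hM; rewrite -ler_sqr ?nnegrE ?l2norm_ge0//.
by rewrite -lee_fin -sqsum_l2norm sqsum_le.
Qed.

Lemma finD s h k : fin s (fun x => h x + k x) = fin s h + fin s k.
Proof.
by rewrite /fin -big_split; apply: eq_bigr => x _; exact: (scalerDl (delta x : H) (h x : C) (k x)).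
Qed.

Lemma fin_norm_sum s h : l2norm (fin s h) <= \sum_(x <- s) cabs (h x).
Proof.
apply: (le_trans (ler_l2norm_sum _ _)); apply: ler_sum => x _.
by rewrite l2normZ l2norm_delta mulr1.
Qed.

Lemma norm_fin_le f s : uniq s -> l2norm (fin s f) <= l2norm f.
Proof.
move=> us; rewrite -ler_sqr ?nnegrE ?l2norm_ge0// norm_fin//.
exact: fsq_le_norm.
Qed.

Lemma l2_approx f (e : R) : 0 < e -> exists2 s, uniq s & l2norm (f - fin s f) < e.
Proof.
move=> e0; have e2 : 0 < e ^+ 2 / 4 by rewrite divr_gt0 ?exprn_gt0.
have [s us hs] : exists2 s, uniq s & l2norm f ^+ 2 - e ^+ 2 / 4 < fsq f s.
  apply: contrapT => no.
  have : (sqsum f <= (l2norm f ^+ 2 - e ^+ 2 / 4)%:E)%E.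
    apply: sqsum_le => s us; rewrite leNgt; apply/negP => h; apply: no.
    by exists s.
  by rewrite sqsum_l2norm lee_fin lerBrDr gerDl leNgt e2.
exists s => //; apply: (@le_lt_trans _ _ (e / 2)); last by lra.
apply: l2norm_le; first by lra.
move=> r ur.
pose r' := [seq x <- r | x \notin s].
have -> : fsq (f - fin s f) r = fsq f r'.
  rewrite /fsq big_filter [RHS]big_mkcond; apply: eq_bigr => x _.
  rewrite l2BE finE//.
  by case: (x \in s); rewrite /= ?subrr ?subr0// /sqnormc /= expr0n addr0.
have : fsq f (s ++ r') <= l2norm f ^+ 2.
  apply: fsq_le_norm; rewrite cat_uniq us filter_uniq//= andbT.
  by apply/hasPn => x; rewrite mem_filter => /andP[].
rewrite /fsq big_cat /= -/(fsq f s) -/(fsq f r'); move: hs.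
rewrite (_ : (e / 2) ^+ 2 = e ^+ 2 / 4); last by field.
lra.
Qed.

Lemma real_cauchy (u : nat -> R) :
  (forall e, 0 < e -> exists N, forall i j, (N <= i)%N -> (N <= j)%N -> `|u i - u j| < e) ->
  exists l, forall e, 0 < e -> exists N, forall i, (N <= i)%N -> `|u i - l| < e.
Proof.
move=> hu.
have /cauchy_cvgP/cvg_ex[l /cvgrPdist_lt hl] : cauchy (u @ \oo).
  apply/cauchyP => e e0; have [N hN] := hu e e0; exists (u N).
  by exists N => // i /= Ni; rewrite /ball/= hN.
exists l => e e0; have [N _ hN] := hl e e0; exists N => i Ni.
by rewrite distrC; exact: hN.
Qed.

(** The limit h is taken coordinatewise. The restrictions of F i - h to finite sets are small
    uniformly in the finite set, which shows both that h is square summable and that convergence is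
    in norm. *)
Lemma l2_complete (F : nat -> H) :
  (forall e, 0 < e -> exists N, forall i j, (N <= i)%N -> (N <= j)%N -> l2norm (F i - F j) < e) ->
  exists f, forall e, 0 < e -> exists N, forall i, (N <= i)%N -> l2norm (F i - f) < e.
Proof.
move=> hF.
have sub f g x : (f - g) x = f x - g x by [].
have /choice[h hh] : forall x, exists c : R[i]^o, forall e, 0 < e ->
    exists N, forall i, (N <= i)%N -> cabs (F i x - c) < e.
  move=> x.
  have [|a ha] := @real_cauchy (fun i => complex.Re (F i x)).
    move=> e /hF[N hN]; exists N => i j Ni Nj; apply: le_lt_trans (hN i j Ni Nj).
    by rewrite -raddfB; apply: (le_trans (Re_le_cabs _)); exact: l2_coord_le (F i - F j) x.
  have [|b hb] := @real_cauchy (fun i => complex.Im (F i x)).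
    move=> e /hF[N hN]; exists N => i j Ni Nj; apply: le_lt_trans (hN i j Ni Nj).
    by rewrite -raddfB; apply: (le_trans (Im_le_cabs _)); exact: l2_coord_le (F i - F j) x.
  exists (Complex a b) => e e0; have e2 : 0 < e / 2 by lra.
  have [N1 h1] := ha _ e2; have [N2 h2] := hb _ e2; exists (maxn N1 N2) => i.
  rewrite geq_max => /andP[/h1 {}h1 /h2 {}h2].
  rewrite -(@ltr_pXn2r _ 2)// ?nnegrE ?cabs_ge0 ?ltW// sqr_cabs /sqnormc.
  rewrite !raddfB /= -[X in X + _]real_normK ?num_real// -[X in _ + X]real_normK ?num_real//.
  have := normr_ge0 (complex.Re (F i x) - a); have := normr_ge0 (complex.Im (F i x) - b).
  nra.
have key e : 0 < e -> exists N, forall i, (N <= i)%N ->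
    forall s, uniq s -> l2norm (fin s (fun x => F i x - h x)) <= e.
  move=> e0; have e2 : 0 < e / 2 by lra.
  have [N hN] := hF _ e2; exists N => i Ni s us.
  pose d := e / 2 / (size s).+1%:R.
  have d0 : 0 < d by rewrite divr_gt0.
  have [J hJ] : exists J, forall j, (J <= j)%N -> forall x, x \in s -> cabs (F j x - h x) <= d.
    elim: (s) => [|x r [J1 h1]]; first by exists 0%N.
    have [J2 h2] := hh x _ d0; exists (maxn J1 J2) => j; rewrite geq_max => /andP[J1j J2j] y.
    by rewrite inE => /predU1P[->|]; [rewrite ltW// h2|exact: h1].
  pose j := maxn N J.
  have -> : (fun x => F i x - h x) = fun x => (F i - F j) x + (F j x - h x).
    by apply/funext => x; rewrite l2BE addrA subrK.
  rewrite finD; apply: (le_trans (ler_l2normD _ _)).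
  have h1 : l2norm (fin s (F i - F j)) <= e / 2.
    apply: (le_trans (norm_fin_le (F i - F j) us)); rewrite ltW// hN//.
    exact: leq_maxl.
  have h2 : l2norm (fin s (fun x => F j x - h x)) <= e / 2.
    apply: (le_trans (fin_norm_sum _ _)).
    apply: (@le_trans _ _ (\sum_(x <- s) d)).
      by rewrite !big_seq; apply: ler_sum => x; apply: hJ; exact: leq_maxr.
    rewrite big_const_seq count_predT iter_addr_0; apply: (@le_trans _ _ (d *+ (size s).+1)).
      by rewrite mulrS lerDr ltW.
    by rewrite -[_ *+ _]mulr_natr /d divfK// pnatr_eq0.
  by rewrite [e]splitr lerD.
have [N1 h1] := key 1 ltr01.
have bd s : uniq s -> fsq h s <= (l2norm (F N1) + 1) ^+ 2.
  move=> us; rewrite -norm_fin// ler_sqr ?nnegrE ?addr_ge0 ?l2norm_ge0//.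
  have -> : fin s h = fin s (F N1) - fin s (fun x => F N1 x - h x).
    apply/eqP; rewrite eq_sym subr_eq -finD; apply/eqP; congr fin.
    by apply/funext => x; rewrite addrC subrK.
  apply: (le_trans (ler_l2normB _ _)); apply: lerD; first exact: norm_fin_le.
  exact: h1.
exists (mk h) => e e0; have e2 : 0 < e / 2 by lra.
have [N hN] := key _ e2.
exists N => i Ni; apply: (@le_lt_trans _ _ (e / 2)); last by lra.
apply: l2norm_le; first lra.
move=> s us; have -> : fsq (F i - mk h) s = fsq (fun x => F i x - h x) s.
  by apply: eq_bigr => x _; rewrite l2BE (mkE bd).
by rewrite -norm_fin// ler_sqr ?nnegrE ?l2norm_ge0//; [exact: hN|lra].
Qed.

End FiniteSupport.

(** * Bounded operators, operator norm and adjoints *)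

Section BoundedOperators.
Context {R : realType} {X Y : choiceType}.
Local Notation C := R[i].
Local Notation HX := (l2 R X).
Local Notation HY := (l2 R Y).
Implicit Types (S T : HX -> HY) (f g : HX) (c : C).
Local Open Scope ring_scope.
Local Open Scope complex_scope.

(** Boundedness with an explicit constant and between two different spaces, whereas [bounded_op] is
    continuity of an endomorphism; [bounded_opP] links the two. *)
Definition bdd T (M : R) := linear T /\ forall f, l2norm (T f) <= M * l2norm f.

Lemma linD T : linear T -> forall f g, T (f + g) = T f + T g.
Proof. by move=> lT f g; have := lT 1 f g; rewrite !scale1r. Qed.

Lemma lin0 T : linear T -> T 0 = 0.
Proof. by move=> lT; apply: (@addrI _ (T 0)); rewrite -linD// !addr0. Qed.

Lemma linZ T : linear T -> forall c f, T (c *: f) = c *: T f.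
Proof. by move=> lT c f; have := lT c f 0; rewrite !addr0 lin0// addr0. Qed.

Lemma linB T : linear T -> forall f g, T (f - g) = T f - T g.
Proof. by move=> lT f g; rewrite -scaleN1r linD// linZ// scaleN1r. Qed.

Lemma lin_sum T (I : Type) (r : seq I) (F : I -> HX) : linear T ->
  T (\sum_(i <- r) F i) = \sum_(i <- r) T (F i).
Proof. by move=> lT; elim/big_rec2: _ => [|i a b _ <-]; rewrite ?lin0 ?linD. Qed.

Lemma lin_fin T s (h : X -> R[i]^o) : linear T ->
  T (fin s h) = \sum_(x <- s) h x *: T (delta x).
Proof. by move=> lT; rewrite /fin lin_sum//; apply: eq_bigr => x _; rewrite linZ. Qed.

Lemma bdd_ext S T M N : bdd S M -> bdd T N ->
  (forall x, S (delta x) = T (delta x)) -> S = T.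
Proof.
move=> [lS bS] [lT bT] e; apply/funext => f; apply/eqP; rewrite -subr_eq0; apply/eqP.
apply: l2norm_eq0; apply/eqP; rewrite eq_le l2norm_ge0 andbT; apply/ler_addgt0Pr => d d0.
rewrite add0r; pose K := `|M| + `|N| + 1.
have K0 : 0 < K by rewrite ltr_wpDl ?addr_ge0.
have [s us hs] := l2_approx f (divr_gt0 d0 K0).
have -> : S f - T f = S (f - fin s f) - T (f - fin s f).
  rewrite !linB//; have -> : S (fin s f) = T (fin s f).
    by rewrite !lin_fin//; apply: eq_bigr => x _; rewrite e.
  by rewrite opprB addrA subrK.
apply: (le_trans (ler_l2normB _ _)); apply: (@le_trans _ _ (K * l2norm (f - fin s f))); last first.
  by rewrite mulrC -ler_pdivlMr// ltW.
rewrite /K !mulrDl mul1r; apply: ler_wpDr; first exact: l2norm_ge0.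
apply: lerD; [apply: (le_trans (bS _))|apply: (le_trans (bT _))];
  by rewrite ler_wpM2r ?l2norm_ge0 ?ler_norm.
Qed.

Lemma bdd_dense T K M : 0 <= M -> bdd T K ->
  (forall s, uniq s -> forall h, l2norm (T (fin s h)) <= M * l2norm (fin s h)) -> bdd T M.
Proof.
move=> M0 [lT bT] h; split=> // f; apply/ler_addgt0Pr => d d0.
pose K1 := `|K| + 1; have K0 : 0 < K1 by rewrite ltr_wpDl.
have [s us hs] := l2_approx f (divr_gt0 d0 K0).
have -> : T f = T (f - fin s f) + T (fin s f) by rewrite -linD// subrK.
apply: (le_trans (ler_l2normD _ _)); rewrite addrC; apply: lerD.
  by apply: (le_trans (h _ us _)); rewrite ler_wpM2l// norm_fin_le.
apply: (le_trans (bT _)); apply: (@le_trans _ _ (K1 * l2norm (f - fin s f))).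
  by rewrite ler_wpM2r ?l2norm_ge0// (le_trans (ler_norm _))// lerDl.
by rewrite mulrC -ler_pdivlMr// ltW.
Qed.

End BoundedOperators.

Section WeightedInjection.
Context {R : realType} {X Y : choiceType}.
Local Notation C := R[i].
Local Open Scope ring_scope.
Local Open Scope complex_scope.
Variables (psi : Y -> option X) (w : Y -> C) (M : R).
Hypothesis psi_inj : forall y y' x, psi y = Some x -> psi y' = Some x -> y = y'.
Hypothesis wM : forall y, cabs (w y) <= M.
Hypothesis M0 : 0 <= M.

Definition wpi_fun (f : X -> R[i]^o) : Y -> R[i]^o :=
  fun y => if psi y is Some x then w y * f x else 0.

Definition wpi (f : l2 R X) : l2 R Y := mk (wpi_fun f).

Let wpi_bound (f : l2 R X) s : uniq s -> fsq (wpi_fun f) s <= (M * l2norm f) ^+ 2.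
Proof.
move=> us; rewrite exprMn.
apply: (@le_trans _ _ (M ^+ 2 * fsq f (pmap psi s))); last first.
  rewrite ler_wpM2l ?sqr_ge0// fsq_le_norm//.
  elim: s us => //= y s ih /andP[ys us]; case e : (psi y) => [x|] /=; last exact: ih.
  rewrite ih// andbT -(mem_map (@Some_inj _)) pmapS_filter; apply/mapP => -[y'].
  rewrite mem_filter => /andP[_ y's] e'; case/negP: ys.
  by rewrite (psi_inj e (esym e')).
rewrite /fsq; elim: s {us} => [|y s ih] /=; first by rewrite !big_nil mulr0.
rewrite big_cons {1}/wpi_fun; case: (psi y) => [x|] /=.
  rewrite big_cons mulrDr; apply: lerD => //.
  by rewrite sqnormcM ler_wpM2r ?sqnormc_ge0// -sqr_cabs ler_sqr ?nnegrE ?cabs_ge0.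
by rewrite {1}/sqnormc /= expr0n !add0r.
Qed.

Lemma wpiE f y : wpi f y = if psi y is Some x then w y * f x else 0.
Proof. by rewrite /wpi (mkE (wpi_bound f)). Qed.

Lemma wpi_linear : linear wpi.
Proof.
move=> c f g; apply/val_inj/funext => y.
rewrite -[LHS]/(wpi (c *: f + g) y) -[RHS]/((c * wpi f y + wpi g y : C)) !wpiE.
case: (psi y) => [x|]; last by rewrite [RHS]addr0 mulr0.
by rewrite -[(c *: f + g) x]/((c * f x + g x : C)) mulrDr mulrCA.
Qed.

Lemma wpi_bdd : bdd wpi M.
Proof.
split; first exact: wpi_linear.
by move=> f; apply: mk_norm; [rewrite mulr_ge0 ?l2norm_ge0|exact: wpi_bound].
Qed.

End WeightedInjection.

Section OperatorAlgebra.
Context {R : realType} {X : choiceType}.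
Local Notation H := (l2 R X).
Local Notation C := R[i].
Local Notation B := (bounded_ops R X).
Implicit Types (S T U V : H -> H) (f g : H) (c : C).
Local Open Scope ring_scope.
Local Open Scope complex_scope.

Lemma bounded_opP T : bounded_op T <-> exists2 M : R, 0 <= M & bdd T M.
Proof.
split=> [[lT cT]|[M M0 [lT bT]]].
  pose L : {linear H -> H} := HB.pack T (GRing.isLinear.Build _ _ _ _ T lT).
  have /linear_boundedP/pinfty_ex_gt0[M M0 hM] : bounded_near L (nbhs 0).
    exact/linear_bounded_continuous.
  have MR : M = (complex.Re M)%:C by rewrite RRe_real// gtr0_real.
  have Re0 : 0 <= complex.Re M by rewrite -ler0c -MR ltW.
  exists (complex.Re M) => //; split=> // f.
  by rewrite -lecR rmorphM /= -MR; exact: hM.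
split=> //; pose L : {linear H -> H} := HB.pack T (GRing.isLinear.Build _ _ _ _ T lT).
suff : bounded_near L (nbhs 0) by move/linear_bounded_continuous.
apply/linear_boundedP; near=> r => f.
have hM : M%:C <= r.
  by near: r; apply: nbhs_pinfty_ge; rewrite ger0_real// ler0c.
apply: (@le_trans _ _ (M%:C * `|f|)); last by rewrite ler_wpM2r.
rewrite -[`|L f|]/((l2norm (T f))%:C) -[`|f|]/((l2norm f)%:C) -rmorphM lecR.
exact: bT.
Unshelve. all: by end_near. Qed.

Lemma bounded_op_linear T : bounded_op T -> linear T. Proof. by case. Qed.

Lemma bounded_bdd T M : 0 <= M -> bdd T M -> bounded_op T.
Proof. by move=> M0 h; apply/bounded_opP; exists M. Qed.

Lemma opnorm_le T M : 0 <= M -> (forall f, l2norm (T f) <= M * l2norm f) -> opnorm T <= M.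
Proof.
move=> M0 hM; apply: ge_inf; last by split.
by exists 0 => N [].
Qed.

Lemma opnorm_ge0 T : 0 <= opnorm T.
Proof.
rewrite /opnorm; set E := [set M : R | _].
have [[M EM]|E0] := pselect (E !=set0).
  by apply: lb_le_inf; [exists M|move=> N []].
by rewrite (_ : E = set0) ?inf0//; apply/seteqP; split=> M // EM; apply: E0; exists M.
Qed.

Lemma opnormP T : bounded_op T -> forall f, l2norm (T f) <= opnorm T * l2norm f.
Proof.
move=> /bounded_opP[M M0 [lT bT]] f.
have [f0|f0] := eqVneq (l2norm f) 0.
  by rewrite (l2norm_eq0 f0) lin0// l2norm0 mulr0.
have fp : 0 < l2norm f by rewrite lt_neqAle eq_sym f0 l2norm_ge0.
rewrite -ler_pdivrMr//; apply: lb_le_inf; first by exists M.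
by move=> N [N0 hN]; rewrite ler_pdivrMr.
Qed.

Lemma opnorm_bdd T : bounded_op T -> bdd T (opnorm T).
Proof. by move=> bT; split; [exact: bounded_op_linear|exact: opnormP]. Qed.

Lemma bdd_opnorm T M : 0 <= M -> bdd T M -> opnorm T <= M.
Proof. by move=> M0 [_ h]; exact: opnorm_le. Qed.

Definition opD S T : H -> H := fun f => S f + T f.
Definition opB S T : H -> H := fun f => S f - T f.
Definition opZ c T : H -> H := fun f => c *: T f.

Lemma bddD S T M N : bdd S M -> bdd T N -> bdd (opD S T) (M + N).
Proof.
move=> [lS bS] [lT bT]; split=> [c f g|f]; rewrite /opD.
  by rewrite lS lT scalerDr addrACA.
by apply: (le_trans (ler_l2normD _ _)); rewrite mulrDl lerD.
Qed.

Lemma bddZ c T M : bdd T M -> bdd (opZ c T) (cabs c * M).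
Proof.
move=> [lT bT]; split=> [d f g|f]; rewrite /opZ.
  by rewrite lT scalerDr !scalerA mulrC.
by rewrite l2normZ -mulrA ler_wpM2l ?cabs_ge0.
Qed.

Lemma bddM S T M N : 0 <= M -> bdd S M -> bdd T N -> bdd (S \o T) (M * N).
Proof.
move=> M0 [lS bS] [lT bT]; split=> [c f g|f] /=; first by rewrite lT lS.
by apply: (le_trans (bS _)); rewrite -mulrA ler_wpM2l.
Qed.

Lemma opBE S T : opB S T = opD S (opZ (-1) T).
Proof. by apply/funext => f; rewrite /opB /opD /opZ scaleN1r. Qed.

Lemma bddB S T M N : bdd S M -> bdd T N -> bdd (opB S T) (M + N).
Proof.
move=> hS hT; rewrite opBE; apply: bddD => //.
by have := bddZ (-1) hT; rewrite cabsN cabs1 mul1r.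
Qed.

Lemma bdd0 : bdd ((fun=> 0) : H -> H) 0.
Proof.
by split=> [c f g|f]; rewrite ?scaler0 ?addr0// l2norm0 mul0r.
Qed.

Lemma bdd_id : bdd (id : H -> H) 1.
Proof. by split=> [c f g|f] //; rewrite mul1r. Qed.

Lemma bounded_opD S T : bounded_op S -> bounded_op T -> bounded_op (opD S T).
Proof.
move=> /opnorm_bdd hS /opnorm_bdd hT; apply: bounded_bdd (bddD hS hT).
by rewrite addr_ge0 ?opnorm_ge0.
Qed.

Lemma bounded_opZ c T : bounded_op T -> bounded_op (opZ c T).
Proof.
move=> /opnorm_bdd hT; apply: bounded_bdd (bddZ c hT).
by rewrite mulr_ge0 ?cabs_ge0 ?opnorm_ge0.
Qed.

Lemma bounded_opB S T : bounded_op S -> bounded_op T -> bounded_op (opB S T).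
Proof. by move=> hS hT; rewrite opBE; apply: bounded_opD => //; exact: bounded_opZ. Qed.

Lemma bounded_opM S T : bounded_op S -> bounded_op T -> bounded_op (S \o T).
Proof.
move=> /opnorm_bdd hS /opnorm_bdd hT; apply: bounded_bdd (bddM (opnorm_ge0 _) hS hT).
by rewrite mulr_ge0 ?opnorm_ge0.
Qed.

Lemma bounded_op0 : bounded_op (fun=> 0 : H).
Proof. exact: bounded_bdd (lexx _) bdd0. Qed.

Lemma bounded_op_id : bounded_op (id : H -> H).
Proof. exact: bounded_bdd ler01 bdd_id. Qed.

Lemma opnormD S T : bounded_op S -> bounded_op T -> opnorm (opD S T) <= opnorm S + opnorm T.
Proof.
move=> hS hT; apply: bdd_opnorm; first by rewrite addr_ge0 ?opnorm_ge0.
by apply: bddD; exact: opnorm_bdd.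
Qed.

Lemma opnormB S T : bounded_op S -> bounded_op T -> opnorm (opB S T) <= opnorm S + opnorm T.
Proof.
move=> hS hT; apply: bdd_opnorm; first by rewrite addr_ge0 ?opnorm_ge0.
by apply: bddB; exact: opnorm_bdd.
Qed.

Lemma opnormZ c T : bounded_op T -> opnorm (opZ c T) <= cabs c * opnorm T.
Proof.
move=> hT; apply: bdd_opnorm; first by rewrite mulr_ge0 ?cabs_ge0 ?opnorm_ge0.
by apply: bddZ; exact: opnorm_bdd.
Qed.

Lemma opnormM S T : bounded_op S -> bounded_op T -> opnorm (S \o T) <= opnorm S * opnorm T.
Proof.
move=> hS hT; apply: bdd_opnorm; first by rewrite mulr_ge0 ?opnorm_ge0.
by apply: bddM; [exact: opnorm_ge0|exact: opnorm_bdd|exact: opnorm_bdd].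
Qed.

Lemma opnorm_eq0 T : bounded_op T -> opnorm T = 0 -> T = fun=> 0.
Proof.
move=> hT T0; apply/funext => f; apply: l2norm_eq0; apply/eqP.
by rewrite eq_le l2norm_ge0 andbT; have := opnormP hT f; rewrite T0 mul0r.
Qed.

Lemma opnormC S T : opnorm (opB S T) = opnorm (opB T S).
Proof.
rewrite /opnorm; congr inf; apply/seteqP; split=> M /= [M0 h]; split=> // f;
  by rewrite /opB -opprB l2normN; exact: h.
Qed.

Lemma opnorm_triangle U S T : bounded_op S -> bounded_op U -> bounded_op T ->
  opnorm (opB S T) <= opnorm (opB S U) + opnorm (opB U T).
Proof.
move=> hS hU hT.
have -> : opB S T = opD (opB S U) (opB U T).
  by apply/funext => f; rewrite /opD /opB addrA subrK.
by apply: opnormD; exact: bounded_opB.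
Qed.

Lemma bounded_ext S T : bounded_op S -> bounded_op T ->
  (forall x, S (delta x) = T (delta x)) -> S = T.
Proof. by move=> /opnorm_bdd hS /opnorm_bdd hT; exact: bdd_ext hS hT. Qed.

Lemma opnorm_complete (F : nat -> H -> H) : (forall n, bounded_op (F n)) ->
  (forall e : R, 0 < e -> exists N, forall i j, (N <= i)%N -> (N <= j)%N ->
     opnorm (opB (F i) (F j)) < e) ->
  exists2 T, bounded_op T & forall e : R, 0 < e -> exists N, forall i, (N <= i)%N ->
     opnorm (opB (F i) T) <= e.
Proof.
move=> hF hC.
have ptC f : exists h, forall e : R, 0 < e -> exists N, forall i, (N <= i)%N -> l2norm (F i f - h) < e.
  apply: l2_complete => e e0; pose K := l2norm f + 1.
  have K0 : 0 < K by rewrite ltr_wpDl ?l2norm_ge0.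
  have [N hN] := hC (e / K) (divr_gt0 e0 K0); exists N => i j Ni Nj.
  apply: (le_lt_trans (opnormP (bounded_opB (hF i) (hF j)) f)).
  apply: (@le_lt_trans _ _ (opnorm (opB (F i) (F j)) * K)).
    by rewrite ler_wpM2l ?opnorm_ge0// lerDl.
  by rewrite -ltr_pdivlMr// hN.
have /choice[T hT] := ptC.
have key (e : R) : 0 < e -> exists N, forall i, (N <= i)%N ->
    forall f, l2norm (F i f - T f) <= e * l2norm f.
  move=> e0; have [N hN] := hC e e0; exists N => i Ni f.
  apply/ler_addgt0Pr => d d0; have [J hJ] := hT f d d0.
  pose j := maxn N J; have hj := hJ j (leq_maxr _ _).
  have -> : F i f - T f = (F i f - F j f) + (F j f - T f) by rewrite addrA subrK.
  apply: (le_trans (ler_l2normD _ _)); apply: lerD; last exact: ltW.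
  apply: (le_trans (opnormP (bounded_opB (hF i) (hF j)) f)).
  by rewrite ler_wpM2r ?l2norm_ge0// ltW// hN// leq_maxl.
have lT : linear T.
  move=> c f g; apply/eqP; rewrite -subr_eq0; apply/eqP/l2norm_eq0/eqP.
  rewrite eq_le l2norm_ge0 andbT; apply/ler_addgt0Pr => d d0; rewrite add0r.
  pose K := 2 + cabs c; have K0 : 0 < K by rewrite ltr_wpDr ?cabs_ge0.
  have dK : 0 < d / K by rewrite divr_gt0.
  have [N1 h1] := hT (c *: f + g) _ dK; have [N2 h2] := hT f _ dK; have [N3 h3] := hT g _ dK.
  pose n := maxn N1 (maxn N2 N3).
  have {}h1 := h1 n (leq_maxl _ _).
  have {}h2 : l2norm (F n f - T f) < d / K by apply: h2; rewrite /n !leq_max leqnn orbT.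
  have {}h3 : l2norm (F n g - T g) < d / K by apply: h3; rewrite /n !leq_max leqnn !orbT.
  have -> : T (c *: f + g) - (c *: T f + T g) =
      - (F n (c *: f + g) - T (c *: f + g)) + (c *: (F n f - T f) + (F n g - T g)).
    rewrite (bounded_op_linear (hF n)) scalerBr.
    by rewrite opprB [_ - _ + (F n g - _)]addrACA -opprD addrA subrK.
  apply: (le_trans (ler_l2normD _ _)); rewrite l2normN.
  apply: (@le_trans _ _ (d / K + (cabs c * (d / K) + d / K))).
    apply: lerD; first exact: ltW.
    apply: (le_trans (ler_l2normD _ _)); rewrite l2normZ; apply: lerD; last exact: ltW.
    by rewrite ler_wpM2l ?cabs_ge0 ?ltW.
  have -> : d / K + (cabs c * (d / K) + d / K) = K * (d / K) by rewrite {4}/K; ring.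
  by rewrite mulrC divfK// gt_eqF.
have [N1 h1] := key 1 ltr01.
have bT : bounded_op T.
  apply: (@bounded_bdd _ (opnorm (F N1) + 1)); first by rewrite addr_ge0 ?opnorm_ge0.
  split=> // f; have -> : T f = F N1 f - (F N1 f - T f) by rewrite opprB addrC subrK.
  apply: (le_trans (ler_l2normB _ _)); rewrite mulrDl; apply: lerD; first exact: opnormP.
  exact: h1.
exists T => // e e0; have [N hN] := key e e0; exists N => i Ni.
by apply: opnorm_le; [exact: ltW|exact: hN].
Qed.

Lemma inner_continuous_l T (K : R) g : bdd T K -> forall h, (forall x, inner (T (delta x)) g = inner (delta x) h) ->
  forall f, inner (T f) g = inner f h.
Proof.
move=> [lT bT] h e f; apply/eqP; rewrite -subr_eq0; apply/eqP/cabs_eq0/eqP.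
rewrite eq_le cabs_ge0 andbT; apply/ler_addgt0Pr => d d0; rewrite add0r.
pose M := `|K| * l2norm g + l2norm h + 1.
have M0 : 0 < M by rewrite ltr_wpDl// addr_ge0 ?mulr_ge0 ?l2norm_ge0.
have [s us hs] := l2_approx f (divr_gt0 d0 M0).
have -> : inner (T f) g - inner f h = inner (T (f - fin s f)) g - inner (f - fin s f) h.
  rewrite linB// !innerBl.
  have -> : inner (T (fin s f)) g = inner (fin s f) h.
    rewrite lin_fin// /fin !inner_suml; apply: eq_bigr => x _.
    by rewrite !innerZl e.
  by rewrite opprB addrA subrK.
apply: (le_trans (cabsB _ _)); apply: (@le_trans _ _ (M * l2norm (f - fin s f))); last first.
  by rewrite mulrC -ler_pdivlMr// ltW.
rewrite /M !mulrDl mul1r; apply: ler_wpDr; first exact: l2norm_ge0.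
apply: lerD; last by rewrite [X in _ <= X]mulrC; exact: inner_le.
apply: (le_trans (inner_le _ _)); rewrite mulrAC ler_wpM2r ?l2norm_ge0//.
by apply: (le_trans (bT _)); rewrite ler_wpM2r ?l2norm_ge0// ler_norm.
Qed.

(** The coordinates of the adjoint are (S g)(x) = <g, T delta_x>. Their square sum over a finite set
    is bounded by testing T on the vector xi having just these coordinates. *)
Lemma adjoint_exists T : bounded_op T ->
  exists S, bounded_op S /\ forall f g, inner (T f) g = inner f (S g).
Proof.
move=> bT; have hT := opnorm_bdd bT.
pose h g : X -> R[i]^o := fun x => inner g (T (delta x)).
have hb g s : uniq s -> fsq (h g) s <= (opnorm T * l2norm g) ^+ 2.
  move=> us; pose xi := fin s (h g).
  have e : (fsq (h g) s)%:C = inner g (T xi).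
    rewrite /xi (lin_fin _ _ hT.1) inner_sumr /fsq rmorph_sum /=; apply: eq_bigr => x _.
    by rewrite innerZr sqnormcE sqr_normc mulrC.
  have le1 : fsq (h g) s <= l2norm g * (opnorm T * l2norm xi).
    apply: (@le_trans _ _ (cabs (inner g (T xi)))).
      by rewrite -e cabs_real ger0_norm ?fsq_ge0.
    by apply: (le_trans (inner_le _ _)); rewrite ler_wpM2l ?l2norm_ge0// opnormP.
  have n2 : l2norm xi ^+ 2 = fsq (h g) s by exact: norm_fin.
  rewrite -n2 in le1 *; rewrite ler_sqr ?nnegrE ?l2norm_ge0 ?mulr_ge0 ?opnorm_ge0 ?l2norm_ge0//.
  have [->|x0] := eqVneq (l2norm xi) 0; first by rewrite mulr_ge0 ?opnorm_ge0 ?l2norm_ge0.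
  have xp : 0 < l2norm xi by rewrite lt_neqAle eq_sym x0 l2norm_ge0.
  by move: le1; rewrite expr2 mulrA ler_pM2r// mulrC.
pose S g : H := mk (h g).
have SE f g : inner (T f) g = inner f (S g).
  apply: (inner_continuous_l hT) => x.
  rewrite [RHS]innerC inner_delta /S (mkE (hb g)) /h.
  exact: innerC.
have lS : linear S.
  move=> c f g; apply: inner_inj => k.
  by rewrite innerC -SE innerDr innerZr !SE -innerZr -innerDr -innerC.
exists S; split=> //; apply: (@bounded_bdd _ (opnorm T)); first exact: opnorm_ge0.
split=> // g; apply: mk_norm; first by rewrite mulr_ge0 ?opnorm_ge0 ?l2norm_ge0.
exact: hb.
Qed.

Lemma adjointP T : bounded_op T ->
  bounded_op (adjoint T) /\ forall f g, inner (T f) g = inner f (adjoint T g).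
Proof.
by move=> /adjoint_exists[S hS]; rewrite /adjoint; apply: (@xgetPex _ _ [set S | bounded_op S /\ forall f g, inner (T f) g = inner f (S g)]); exists S.
Qed.

Lemma adjoint_bounded T : bounded_op T -> bounded_op (adjoint T).
Proof. by move=> /adjointP[]. Qed.

Lemma inner_adj T f g : bounded_op T -> inner (T f) g = inner f (adjoint T g).
Proof. by move=> /adjointP[_]. Qed.

Lemma inner_adjr T f g : bounded_op T -> inner f (T g) = inner (adjoint T f) g.
Proof. by move=> bT; rewrite innerC (inner_adj _ _ bT) -innerC. Qed.

Lemma inner_injr f g : (forall h, inner h f = inner h g) -> f = g.
Proof. by move=> e; apply: inner_inj => h; rewrite innerC e -innerC. Qed.

Lemma adjoint_uniq T S : bounded_op T -> (forall f g, inner (T f) g = inner f (S g)) ->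
  adjoint T = S.
Proof.
move=> bT h; apply/funext => g; apply: inner_injr => f.
by rewrite -h (inner_adj _ _ bT).
Qed.

Lemma adjK T : bounded_op T -> adjoint (adjoint T) = T.
Proof.
move=> bT; apply: adjoint_uniq; first exact: adjoint_bounded.
by move=> f g; rewrite inner_adjr.
Qed.

Lemma adjD S T : bounded_op S -> bounded_op T ->
  adjoint (opD S T) = opD (adjoint S) (adjoint T).
Proof.
move=> bS bT; apply: adjoint_uniq; first exact: bounded_opD.
by move=> f g; rewrite /opD innerDl innerDr -!inner_adj.
Qed.

Lemma adjZ c T : bounded_op T -> adjoint (opZ c T) = opZ (conjc c) (adjoint T).
Proof.
move=> bT; apply: adjoint_uniq; first exact: bounded_opZ.
by move=> f g; rewrite /opZ innerZl innerZr conjcK -inner_adj.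
Qed.

Lemma adjB S T : bounded_op S -> bounded_op T ->
  adjoint (opB S T) = opB (adjoint S) (adjoint T).
Proof.
move=> bS bT; apply: adjoint_uniq; first exact: bounded_opB.
by move=> f g; rewrite /opB innerBl innerBr -!inner_adj.
Qed.

Lemma adjM S T : bounded_op S -> bounded_op T -> adjoint (S \o T) = adjoint T \o adjoint S.
Proof.
move=> bS bT; apply: adjoint_uniq; first exact: bounded_opM.
by move=> f g; rewrite /= (inner_adj _ _ bS) (inner_adj _ _ bT).
Qed.

Lemma opnorm_adj T : bounded_op T -> opnorm (adjoint T) <= opnorm T.
Proof.
move=> bT; apply: opnorm_le; first exact: opnorm_ge0.
move=> f; have bA := adjoint_bounded bT.
have h : l2norm (adjoint T f) ^+ 2 <= opnorm T * l2norm (adjoint T f) * l2norm f.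
  have := inner_le (T (adjoint T f)) f; rewrite (inner_adj _ _ bT) inner_norm cabs_real.
  rewrite ger0_norm ?sqr_ge0// => /le_trans; apply.
  by rewrite ler_wpM2r ?l2norm_ge0// opnormP.
have [->|x0] := eqVneq (l2norm (adjoint T f)) 0; first by rewrite mulr_ge0 ?opnorm_ge0 ?l2norm_ge0.
have xp : 0 < l2norm (adjoint T f) by rewrite lt_neqAle eq_sym x0 l2norm_ge0.
by move: h; rewrite expr2 mulrAC ler_pM2r.
Qed.

Lemma opnorm_adjE T : bounded_op T -> opnorm (adjoint T) = opnorm T.
Proof.
move=> bT; apply/eqP; rewrite eq_le opnorm_adj//= -{1}(adjK bT).
exact: opnorm_adj (adjoint_bounded bT).
Qed.

End OperatorAlgebra.

Section Vectors.
Context {R : realType} {X : choiceType}.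
Local Open Scope ring_scope.
Lemma l2P (f g : l2 R X) : (forall x, l2fun f x = l2fun g x) -> f = g.
Proof. by move=> e; apply/val_inj/funext. Qed.
Lemma l2NE (f : l2 R X) x : l2fun (- f) x = - f x. Proof. by []. Qed.
Lemma l20E x : l2fun (0 : l2 R X) x = 0. Proof. by []. Qed.
End Vectors.
Ltac l2ring := apply: l2P => ?; rewrite ?(l2DE, l2ZE, l2BE, l2NE, l20E); ring.

(** * Square roots and inverses in closed subalgebras *)

Section Calculus.
Context {R : realType} {X : choiceType}.
Local Notation H := (l2 R X).
Local Notation C := R[i].
Local Notation B := (bounded_ops R X).
Implicit Types (S T U V a b d : H -> H) (f g : H) (c : C).
Local Open Scope ring_scope.
Local Open Scope complex_scope.

Lemma asubE a b : @asub R B a b = opB a b.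
Proof. by apply/funext => f; rewrite /asub /opB /= scaleN1r. Qed.

Definition op_closed (D : set (H -> H)) := forall a, bounded_op a ->
  (forall e : R, 0 < e -> exists2 b, D b & opnorm (opB a b) < e) -> D a.

Lemma aclosureE (D : set (H -> H)) a : @aclosure R B D a <->
  bounded_op a /\ forall e : R, 0 < e -> exists2 b, D b & opnorm (opB a b) < e.
Proof.
split=> -[ba h]; split; [exact: ba|move=> e /h[b Db]; rewrite asubE => hb|exact: ba|].
  by exists b; [exact: Db|exact: hb].
by move=> e /h[b Db hb]; exists b; [exact: Db|rewrite asubE; exact: hb].
Qed.

Lemma op_closedP (D : set (H -> H)) : op_closed D <-> @aclosure R B D `<=` D.
Proof.
split=> [h a /aclosureE[ba ha]|h a ba ha]; first exact: h.
by apply: h; apply/aclosureE.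
Qed.

Section Subalgebra.
Variable D : set (H -> H).
Hypothesis hD : @cstar_subalg R B D.

Lemma csub_bounded a : D a -> bounded_op a. Proof. by case: hD => -[h _ _ _] _ _ _; exact: h. Qed.
Lemma csub0 : D (fun=> 0). Proof. by case: hD => -[]. Qed.
Lemma csubD a b : D a -> D b -> D (opD a b). Proof. by case: hD => -[_ _ h _] _ _ _; exact: h. Qed.
Lemma csubZ c a : D a -> D (opZ c a). Proof. by case: hD => -[_ _ _ h] _ _ _; exact: h. Qed.
Lemma csubB a b : D a -> D b -> D (opB a b).
Proof. by move=> Da Db; rewrite opBE; apply: csubD => //; exact: csubZ. Qed.
Lemma csubM a b : D a -> D b -> D (a \o b). Proof. by case: hD => _ h _ _; exact: h. Qed.
Lemma csub_adj a : D a -> D (adjoint a). Proof. by case: hD => _ _ h _; exact: h. Qed.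
Lemma csub_closed : op_closed D. Proof. by case: hD => _ _ _ /op_closedP. Qed.

End Subalgebra.

Lemma small_expr (r K e : R) : 0 <= r < 1 -> 0 < e -> exists N, r ^+ N * K < e.
Proof.
move=> /andP[r0 r1] e0; pose K' := `|K| + 1; have K0 : 0 < K' by rewrite ltr_wpDl.
have /cvgr0Pnorm_lt/(_ _ (divr_gt0 e0 K0)) : r ^+ n @[n --> \oo] --> (0 : R).
  by apply: cvg_expr; rewrite ger0_norm.
move=> [N _ /(_ N (leqnn N))] /=; rewrite ger0_norm ?exprn_ge0// ltr_pdivlMr// => h.
exists N; apply: le_lt_trans h; rewrite ler_wpM2l ?exprn_ge0//.
by rewrite (le_trans (ler_norm _))// lerDl.
Qed.

(** Banach's fixed point theorem inside a norm-closed set of operators; square roots and inverses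
    are found as fixed points that automatically belong to the algebra. *)
Lemma contraction (D : set (H -> H)) (G : (H -> H) -> H -> H) (r : R) d0 :
  0 <= r < 1 -> (forall a, D a -> bounded_op a) -> op_closed D -> D d0 ->
  (forall a, D a -> D (G a)) ->
  (forall a b, D a -> D b -> opnorm (opB (G a) (G b)) <= r * opnorm (opB a b)) ->
  exists2 d, D d & G d = d.
Proof.
move=> r01 Db Dc D0 DG hG; have /andP[r0 r1] := r01.
pose F n := iter n G d0; have DF n : D (F n) by elim: n => // n; exact: DG.
pose K := opnorm (opB d0 (G d0)) / (1 - r).
have K0 : 0 <= K by rewrite divr_ge0 ?opnorm_ge0// subr_ge0 ltW.
have hF N k : opnorm (opB (F N) (F (N + k)%N)) <= r ^+ N * K.
  elim: N => [|N ih]; last first.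
    rewrite addSn exprS -mulrA; apply: (le_trans (hG _ _ (DF _) (DF _))).
    by rewrite ler_wpM2l.
  rewrite expr0 mul1r add0n; elim: k => [|k ih].
    suff -> : opnorm (opB (F 0%N) (F 0%N)) = 0 by [].
    apply/eqP; rewrite eq_le opnorm_ge0 andbT; apply: opnorm_le => // f.
    by rewrite /opB subrr l2norm0 mul0r.
  apply: (le_trans (opnorm_triangle (Db _ (DF 0%N)) (Db _ (DF 1%N)) (Db _ (DF k.+1)))).
  have := hG _ _ (DF 0%N) (DF k); rewrite -[G (F 0%N)]/(F 1%N) -[G (F k)]/(F k.+1) => h.
  have h2 : opnorm (opB (F 0%N) (F 1%N)) = K * (1 - r).
    by rewrite /K mulfVK// subr_eq0 gt_eqF.
  rewrite h2; have := ler_wpM2l r0 ih => h3; clear -h h3; lra.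
have hC (e : R) : 0 < e -> exists N, forall i j, (N <= i)%N -> (N <= j)%N ->
     opnorm (opB (F i) (F j)) < e.
  move=> e0; have [N hN] := small_expr (K + K) r01 e0; exists N => i j Ni Nj.
  apply: (le_lt_trans (opnorm_triangle (Db _ (DF i)) (Db _ (DF N)) (Db _ (DF j)))).
  apply: le_lt_trans hN; rewrite mulrDr opnormC; apply: lerD.
    by rewrite -(subnKC Ni); exact: hF.
  by rewrite -(subnKC Nj); exact: hF.
have [T bT hT] := opnorm_complete (fun n => Db _ (DF n)) hC.
have DT : D T.
  apply: Dc => // e e0; have e2 : 0 < e / 2 by rewrite divr_gt0.
  have [N hN] := hT _ e2; exists (F N); first exact: DF.
  by rewrite opnormC (le_lt_trans (hN N (leqnn N)))// ltr_pdivrMr// ltr_pMr// ltr1n.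
exists T => //; apply/funext => f; apply/eqP; rewrite -subr_eq0; apply/eqP.
suff : opB (G T) T = fun=> 0 by move/(congr1 (@^~ f)).
apply: opnorm_eq0; first exact: bounded_opB (Db _ (DG _ DT)) bT.
apply/eqP; rewrite eq_le opnorm_ge0 andbT; apply/ler_addgt0Pr => e e0; rewrite add0r.
have [N hN] := hT _ (divr_gt0 e0 (ltr0Sn _ 1)).
apply: (le_trans (opnorm_triangle (Db _ (DG _ DT)) (Db _ (DF N.+1)) bT)).
rewrite [e]splitr; apply: lerD; last exact: hN.
apply: (le_trans (hG _ _ DT (DF N))); apply: (@le_trans _ _ (opnorm (opB T (F N)))).
  by rewrite ler_piMl ?opnorm_ge0 ?ltW.
by rewrite opnormC; exact: hN.
Qed.

Lemma opnorm_close_le a (r : R) : 0 <= r -> bounded_op a ->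
  (forall e : R, 0 < e -> exists2 b, bounded_op b /\ opnorm b <= r & opnorm (opB a b) < e) ->
  opnorm a <= r.
Proof.
move=> r0 ba h; apply/ler_addgt0Pr => e /h[b [bb br] hb].
have -> : a = opD b (opB a b) by apply/funext => f; rewrite /opD /opB addrC subrK.
apply: (le_trans (opnormD bb (bounded_opB ba bb))).
by apply: lerD => //; exact: ltW.
Qed.

Lemma adj_close a : bounded_op a ->
  (forall e : R, 0 < e -> exists2 b, bounded_op b /\ adjoint b = b & opnorm (opB a b) < e) ->
  adjoint a = a.
Proof.
move=> ba h; have baa := adjoint_bounded ba.
suff : opB (adjoint a) a = fun=> 0.
  by move=> e; apply/funext => f; apply/eqP; rewrite -subr_eq0; apply/eqP/(congr1 (@^~ f) e).
apply: opnorm_eq0; first exact: bounded_opB.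
apply/eqP; rewrite eq_le opnorm_ge0 andbT; apply/ler_addgt0Pr => e e0; rewrite add0r.
have [b [bb eb] hb] := h _ (divr_gt0 e0 (ltr0Sn _ 1)).
apply: (le_trans (opnorm_triangle baa bb ba)); rewrite [e]splitr; apply: lerD; last first.
  by rewrite opnormC ltW.
by rewrite -[in X in opB _ X]eb -adjB// opnorm_adjE; [exact: ltW|exact: bounded_opB].
Qed.

(** d is 1 - sqrt(1 - x), the fixed point of d |-> (x + d^2) / 2, which contracts the ball of radius
    norm(x) with ratio norm(x). Passing to d keeps everything inside D even when D has no unit. *)
Lemma half_sqrt (D : set (H -> H)) x : @cstar_subalg R B D -> D x -> adjoint x = x ->
  opnorm x < 1 -> exists2 d, D d & [/\ adjoint d = d, opnorm d <= opnorm x &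
    forall f, x f = d f + d f - d (d f)].
Proof.
move=> hD Dx xs x1; set r := opnorm x in x1 *; have r0 : 0 <= r := opnorm_ge0 x.
pose h : C := (2^-1 : R)%:C; have ch : cabs h = 2^-1 by rewrite cabs_real ger0_norm ?invr_ge0.
pose D' : set (H -> H) := [set d | [/\ D d, adjoint d = d & opnorm d <= r]].
pose G d := opZ h (opD x (d \o d)).
have DG a : D' a -> D' (G a).
  move=> [Da aa ar]; have bx := csub_bounded hD Dx; have ba := csub_bounded hD Da.
  have baa := bounded_opM ba ba; split.
  - by apply: csubZ => //; apply: csubD => //; exact: csubM.
  - rewrite adjZ; last exact: bounded_opD.
    by rewrite adjD// adjM// aa xs /h conjc_real.
  - apply: (le_trans (opnormZ _ (bounded_opD bx baa))); rewrite ch.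
    have h1 := opnormD bx baa; have h2 := opnormM ba ba.
    have h3 : opnorm a * opnorm a <= r * 1.
      by apply: ler_pM; rewrite ?opnorm_ge0// (le_trans ar)// ltW.
    rewrite mulr1 in h3; rewrite -/r in h1; rewrite ler_pdivrMl// mulr_natl; apply: (le_trans h1).
    exact: lerD (lexx r) (le_trans h2 h3).
have [||||||d [Dd dd dr] Gd] := @contraction D' G r (fun=> 0).
- by rewrite r0.
- by move=> a [/(csub_bounded hD)].
- move=> a ba ha; split.
  + by apply: (csub_closed hD) => // e /ha[b [Db _ _]]; exists b.
  + by apply: adj_close => // e /ha[b [/(csub_bounded hD) bb eb _]]; exists b.
  + by apply: opnorm_close_le => // e /ha[b [/(csub_bounded hD) bb _ br]]; exists b.
- split; first exact: csub0.
  + by apply: (adjoint_uniq bounded_op0) => f g; rewrite inner0l inner0r.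
  + by apply: opnorm_le => // f; rewrite l2norm0 mulr_ge0// l2norm_ge0.
- exact: DG.
- move=> a b [/(csub_bounded hD) ba _ ar] [/(csub_bounded hD) bb _ br].
  have -> : opB (G a) (G b) = opZ h (opD (a \o opB a b) (opB a b \o b)).
    apply/funext => f; rewrite /opB /G /opZ /opD /= (linB ba.1); l2ring.
  have bab := bounded_opB ba bb.
  have b1 := bounded_opM ba bab; have b2 := bounded_opM bab bb.
  apply: (le_trans (opnormZ _ (bounded_opD b1 b2))); rewrite ch.
  have h0 := opnormD b1 b2; have h1 := opnormM ba bab; have h2 := opnormM bab bb.
  have h3 : opnorm a * opnorm (opB a b) <= r * opnorm (opB a b) by rewrite ler_wpM2r ?opnorm_ge0.
  have h4 : opnorm (opB a b) * opnorm b <= r * opnorm (opB a b).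
    by rewrite mulrC ler_wpM2r ?opnorm_ge0.
  rewrite ler_pdivrMl// mulr_natl; apply: (le_trans h0).
  exact: lerD (le_trans h1 h3) (le_trans h2 h4).
exists d => //; split=> // f.
have e : d f = h *: (x f + d (d f)) := esym (congr1 (@^~ f) Gd).
have hh : h + h = 1 by rewrite /h -rmorphD (_ : 2^-1 + 2^-1 = 1 :> R)//; lra.
rewrite {1 2}e -scalerDl hh scale1r; l2ring.
Qed.

(** g is the series d + d^2 + ..., so that 1 + g inverts 1 - d in the unitization. *)
Lemma neumann (D : set (H -> H)) d : @cstar_subalg R B D -> D d -> opnorm d < 1 ->
  exists2 g, D g & forall f, g f = d f + d (g f).
Proof.
move=> hD Dd d1; have bd := csub_bounded hD Dd.
have [|||||| g Dg e] := @contraction D (fun g : H -> H => opD d (d \o g)) (opnorm d) d.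
- by rewrite opnorm_ge0.
- by move=> a; exact: csub_bounded.
- exact: csub_closed.
- exact: Dd.
- by move=> a Da; apply: csubD => //; exact: csubM.
- move=> a b /(csub_bounded hD) ba /(csub_bounded hD) bb.
  have -> : opB (opD d (d \o a)) (opD d (d \o b)) = d \o opB a b.
    apply/funext => f; rewrite /opB /opD /= (linB bd.1); l2ring.
  by apply: opnormM => //; exact: bounded_opB.
by exists g => // f; rewrite -[LHS]/(g f) -{1}e.
Qed.

(* If [x = 1 - (1 - d)^2] with [d] self-adjoint, then [1 - x] is a square in the unitization. *)
Lemma inner_half_sqrt x d f : bounded_op d -> adjoint d = d ->
  (forall f, x f = d f + d f - d (d f)) ->
  inner (f - x f) f = (l2norm (f - d f) ^+ 2)%:C.
Proof.
move=> bd dd ex; have -> : f - x f = (f - d f) - d (f - d f).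
  by rewrite ex (linB bd.1); l2ring.
rewrite -inner_norm innerBl innerBr; congr (_ - _).
by rewrite (inner_adj _ _ bd) dd.
Qed.

(* The projection f acts as the unit of the corner [f D f]. *)
Definition corner (D : set (H -> H)) p : set (H -> H) :=
  [set a | [/\ D a, p \o a = a & a \o p = a]].

Lemma corner_csub (D : set (H -> H)) p : @cstar_subalg R B D -> D p -> adjoint p = p ->
  @cstar_subalg R B (corner D p).
Proof.
move=> hD Dp pp; have bp := csub_bounded hD Dp.
have pE a : p \o a = a -> forall f, p (a f) = a f by move=> e f; rewrite -[LHS]/((p \o a) f) e.
have pE' a : a \o p = a -> forall f, a (p f) = a f by move=> e f; rewrite -[LHS]/((a \o p) f) e.
split.
- split.
  + by move=> a [/(csub_bounded hD)].
  + split; first exact: (csub0 hD).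
    * by apply/funext => f /=; rewrite (lin0 bp.1).
    * by [].
  + move=> a b [Da pa ap] [Db pb bpp]; split; first exact: (csubD hD).
    * by apply/funext => f /=; rewrite (linD bp.1) !pE.
    * by apply/funext => f /=; rewrite !pE'.
  + move=> c a [Da pa ap]; split; first exact: (csubZ hD).
    * by apply/funext => f /=; rewrite (linZ bp.1) !pE.
    * by apply/funext => f /=; rewrite !pE'.
- move=> a b [Da pa ap] [Db pb bpp]; split; first exact: (csubM hD).
  + by apply/funext => f /=; rewrite !pE.
  + by apply/funext => f /=; rewrite !pE'.
- move=> a [Da pa ap]; split; first exact: (csub_adj hD).
  + by have := adjM (csub_bounded hD Da) bp; rewrite ap pp.
  + by have := adjM bp (csub_bounded hD Da); rewrite pa pp.
- apply/op_closedP => a ba ha; have Da : D a.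
    by apply: (csub_closed hD) => // e /ha[b [Db _ _]]; exists b.
  have key (a1 a2 : H -> H) (K : R) : bounded_op a1 -> bounded_op a2 -> 0 <= K ->
      (forall b, bounded_op b -> p \o b = b -> b \o p = b ->
        opnorm (opB a1 a2) <= K * opnorm (opB a b)) -> a1 = a2.
    move=> b1 b2 K0 hK; suff : opB a1 a2 = fun=> 0.
      by move=> e; apply/funext => f; apply/eqP; rewrite -subr_eq0; apply/eqP/(congr1 (@^~ f) e).
    apply: opnorm_eq0; first exact: bounded_opB.
    apply/eqP; rewrite eq_le opnorm_ge0 andbT; apply/ler_addgt0Pr => e e0; rewrite add0r.
    have K1 : 0 < K + 1 by rewrite ltr_wpDl.
    have [b [/(csub_bounded hD) bb pb bpp] hb] := ha _ (divr_gt0 e0 K1).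
    apply: (le_trans (hK b bb pb bpp)); apply: (@le_trans _ _ ((K + 1) * opnorm (opB a b))).
      by rewrite ler_wpM2r ?opnorm_ge0// lerDl.
    by rewrite mulrC -ler_pdivlMr// ltW.
  have K0 : 0 <= opnorm p + 1 by rewrite addr_ge0 ?opnorm_ge0.
  split=> //.
  + apply: (key _ _ (opnorm p + 1)) => //; first exact: bounded_opM.
    move=> b bb pb _; have bab := bounded_opB ba bb.
    have -> : opB (p \o a) a = opB (p \o opB a b) (opB a b).
      by apply/funext => f; rewrite /opB /= (linB bp.1) (pE _ pb); l2ring.
    rewrite mulrDl mul1r; apply: (le_trans (opnormB (bounded_opM bp bab) bab)).
    by apply: lerD => //; exact: opnormM.
  + apply: (key _ _ (opnorm p + 1)) => //; first exact: bounded_opM.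
    move=> b bb _ pb; have bab := bounded_opB ba bb.
    have -> : opB (a \o p) a = opB (opB a b \o p) (opB a b).
      by apply/funext => f; rewrite /opB /= (pE' _ pb); l2ring.
    rewrite mulrDl mul1r; apply: (le_trans (opnormB (bounded_opM bab bp) bab)).
    by apply: lerD => //; rewrite mulrC; exact: opnormM.
Qed.

(* [p - x = (p - d)^2] is inverted by [p + g], where [g = d + d g]. *)
Lemma corner_inverse (D : set (H -> H)) p x : @cstar_subalg R B D -> D p -> adjoint p = p ->
  p \o p = p -> corner D p x -> adjoint x = x -> opnorm x < 1 ->
  exists2 y, corner D p y & adjoint y \o opB p x \o y = p.
Proof.
move=> hD Dp pp p2 cx xs x1; have hc := corner_csub hD Dp pp.
have [d cd [dd dx ed]] := half_sqrt hc cx xs x1.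
have [g cg eg] := neumann hc cd (le_lt_trans dx x1).
have cp : corner D p p by [].
have bd := csub_bounded hc cd; have bg := csub_bounded hc cg; have bp := csub_bounded hc cp.
exists (opD p g); first exact: csubD.
case: (cd) => _ pd dp; case: (cg) => _ pg gp.
have r f : opB p d (opD p g f) = p f.
  have Ep h : p (p h) = p h by rewrite -[LHS]/((p \o p) h) p2.
  have E1 h : p (g h) = g h by rewrite -[LHS]/((p \o g) h) pg.
  have E2 h : d (p h) = d h by rewrite -[LHS]/((d \o p) h) dp.
  rewrite /opB /opD (linD bp.1) (linD bd.1) Ep E1 E2 {1}eg; l2ring.
have e1 : opB p d \o opD p g = p by apply/funext => f; exact: r.
have e2 : adjoint (opD p g) \o opB p d = p.
  rewrite -{3}pp -[in RHS]e1 adjM; last exact: bounded_opD.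
    by rewrite adjB// pp dd.
  exact: bounded_opB.
have -> : opB p x = opB p d \o opB p d.
  apply/funext => f; rewrite /opB /= (linB bp.1) (linB bd.1) ed.
  have -> : p (p f) = p f by rewrite -[LHS]/((p \o p) f) p2.
  have -> : d (p f) = d f by rewrite -[LHS]/((d \o p) f) dp.
  have -> : p (d f) = d f by rewrite -[LHS]/((p \o d) f) pd.
  by l2ring.
rewrite -compA -compA e1 compA e2; exact: p2.
Qed.

End Calculus.

(** * Homomorphisms: contractivity and extension by continuity *)

Section Homomorphisms.
Context {R : realType} {X Y : choiceType}.
Local Notation C := R[i].
Local Open Scope ring_scope.
Local Open Scope complex_scope.
Variables (D : set (l2 R X -> l2 R X)) (E : set (l2 R Y -> l2 R Y)).
Hypothesis hD : @cstar_subalg R (bounded_ops R X) D.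
Hypothesis hE : forall t, E t -> bounded_op t.

(** For norm(a1) < 1 the relation 1 - a1^* a1 = (1 - d)^2 is expressed without the unit by
    [half_sqrt], so it survives phi. It then shows that phi(a1) does not increase norms; rescaling a
    gives the bound. *)
Lemma star_hom_contractive (phi : sub_alg (bounded_ops R X) D -> sub_alg (bounded_ops R Y) E) :
  star_hom phi -> forall a, D a -> opnorm (phi a) <= opnorm a.
Proof.
move=> [phiE phiD phiZ phiM phiA] a Da; have ba := csub_bounded hD Da.
apply/ler_addgt0Pr => e e0; set M := opnorm a + e.
have M0 : 0 < M by rewrite ltr_wpDl ?opnorm_ge0.
pose s : C := (M^-1)%:C; have cs : cabs s = M^-1 by rewrite cabs_real ger0_norm ?invr_ge0 ?ltW.
pose a1 := opZ s a; have Da1 : D a1 by exact: csubZ.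
have ba1 := csub_bounded hD Da1.
have n1 : opnorm a1 < 1.
  apply: (le_lt_trans (opnormZ _ ba)); rewrite cs mulrC ltr_pdivrMr// mul1r.
  by rewrite ltrDl.
have baa := adjoint_bounded ba1; pose x := adjoint a1 \o a1.
have Dx : D x by apply: csubM => //; exact: csub_adj.
have [||d Dd [dd _ ed]] := half_sqrt hD Dx.
- by rewrite adjM// adjK.
- apply: (le_lt_trans (opnormM baa ba1)); rewrite opnorm_adjE//.
  by rewrite -[ltRHS]mulr1 ltr_pM ?opnorm_ge0.
have bphi t : D t -> bounded_op (phi t) by move=> Dt; apply: hE; exact: phiE.
have ex f : phi x f = phi d f + phi d f - phi d (phi d f).
  have -> : x = opD (opD d d) (opZ (-1) (d \o d)).
    by apply/funext => h; rewrite ed /opD /opZ scaleN1r.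
  have Ddd := csubM hD Dd Dd; have D2 := csubD hD Dd Dd.
  rewrite (phiD _ _ D2 (csubZ hD _ Ddd)) (phiD _ _ Dd Dd) (phiZ _ _ Ddd) (phiM _ _ Dd Dd) /=.
  by rewrite scaleN1r.
have pd : adjoint (phi d) = phi d by have := phiA _ Dd; rewrite /= dd.
have px f : inner (phi x f) f = (l2norm (phi a1 f) ^+ 2)%:C.
  rewrite -inner_norm /x (phiM _ _ (csub_adj hD Da1) Da1) (phiA _ Da1) /=.
  by rewrite -inner_adjr//; exact: bphi.
have le1 f : l2norm (phi a1 f) <= l2norm f.
  rewrite -ler_sqr ?nnegrE ?l2norm_ge0//.
  have := inner_half_sqrt f (bphi _ Dd) pd ex.
  rewrite innerBl px inner_norm -rmorphB /= => /complexI h.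
  have := sqr_ge0 (l2norm (f - phi d f)); rewrite -h; clear; lra.
apply: opnorm_le; first exact: ltW.
move=> f; have := le1 f; rewrite (phiZ _ _ Da) /= l2normZ cs.
by rewrite mulrC ler_pdivrMr// mulrC.
Qed.

End Homomorphisms.

Lemma contr_aux (R : realFieldType) (x y z w u e : R) :
  (y <= u -> u <= z + w -> z < e / 2 -> x < e / 2 -> x + y <= w + e)%R.
Proof. lra. Qed.

Section HomGraph.
Context {R : realType} {X Y : choiceType}.
Local Notation C := R[i].
Local Open Scope ring_scope.
Local Open Scope complex_scope.
Implicit Types (s : l2 R X -> l2 R X) (t : l2 R Y -> l2 R Y).

(** A homomorphism between spans of generators is handled as a relation, because an element of a
    span has many expressions. That the relation is a function is a consequence of contractivity,
    and [gbar] is its closure. *)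
Definition hom_graph (G : (l2 R X -> l2 R X) -> (l2 R Y -> l2 R Y) -> Prop) :=
  [/\ G (fun=> 0) (fun=> 0), (forall s t, G s t -> bounded_op s /\ bounded_op t),
   (forall s t s' t', G s t -> G s' t' -> G (opD s s') (opD t t')),
   (forall c s t, G s t -> G (opZ c s) (opZ c t)) &
   (forall s t s' t', G s t -> G s' t' -> G (s \o s') (t \o t')) /\
   (forall s t, G s t -> G (adjoint s) (adjoint t))].

Variable G : (l2 R X -> l2 R X) -> (l2 R Y -> l2 R Y) -> Prop.
Hypothesis hG : hom_graph G.

Let GB s t s' t' : G s t -> G s' t' -> G (opB s s') (opB t t').
Proof. by case: hG => _ _ hD hZ _ h h'; rewrite !opBE; apply: hD => //; exact: hZ. Qed.
Let Gb s t : G s t -> bounded_op s /\ bounded_op t. Proof. by case: hG => _ h _ _ _; exact: h. Qed.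

Definition gbar a b := [/\ bounded_op a, bounded_op b & forall e : R, 0 < e ->
  exists s t, [/\ G s t, opnorm (opB a s) < e & opnorm (opB b t) < e]].

Lemma gbar_sub s t : G s t -> gbar s t.
Proof.
move=> h; have [bs bt] := Gb h; split=> // e e0; exists s, t.
have z (Z : choiceType) (u : l2 R Z -> l2 R Z) : opnorm (opB u u) < e.
  apply: le_lt_trans e0; apply: opnorm_le => // f.
  by rewrite /opB subrr l2norm0 mul0r.
by split.
Qed.

Lemma gbar0 : gbar (fun=> 0) (fun=> 0). Proof. by apply: gbar_sub; case: hG. Qed.

Lemma gbarD a b a' b' : gbar a b -> gbar a' b' -> gbar (opD a a') (opD b b').
Proof.
move=> [ba bb h] [ba' bb' h']; split; [exact: bounded_opD..|move=> e e0].
have [s [t [Gst hs ht]]] := h _ (divr_gt0 e0 (ltr0Sn _ 1)).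
have [s' [t' [Gst' hs' ht']]] := h' _ (divr_gt0 e0 (ltr0Sn _ 1)).
have [bs bt] := Gb Gst; have [bs' bt'] := Gb Gst'.
have e2 (Z : choiceType) (u v u' v' : l2 R Z -> l2 R Z) : opB (opD u v) (opD u' v') = opD (opB u u') (opB v v').
  by apply/funext => f; rewrite /opB /opD opprD addrACA.
exists (opD s s'), (opD t t'); split; first by case: hG => _ _ hD _ _; exact: hD.
  rewrite e2 [e]splitr; apply: (le_lt_trans (opnormD (bounded_opB ba bs) (bounded_opB ba' bs'))).
  exact: ltrD.
rewrite e2 [e]splitr; apply: (le_lt_trans (opnormD (bounded_opB bb bt) (bounded_opB bb' bt'))).
exact: ltrD.
Qed.

Lemma gbarZ c a b : gbar a b -> gbar (opZ c a) (opZ c b).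
Proof.
move=> [ba bb h]; split; [exact: bounded_opZ..|move=> e e0].
pose K := cabs c + 1; have K0 : 0 < K by rewrite ltr_wpDl ?cabs_ge0.
have [s [t [Gst hs ht]]] := h _ (divr_gt0 e0 K0); have [bs bt] := Gb Gst.
have key (Z : choiceType) (u v : l2 R Z -> l2 R Z) : bounded_op u -> bounded_op v ->
    opnorm (opB u v) < e / K -> opnorm (opB (opZ c u) (opZ c v)) < e.
  move=> bu bv; rewrite ltr_pdivlMr// => huv.
  have -> : opB (opZ c u) (opZ c v) = opZ c (opB u v).
    by apply/funext => f; rewrite /opB /opZ scalerBr.
  apply: (le_lt_trans (opnormZ _ (bounded_opB bu bv))); apply: le_lt_trans huv.
  by rewrite mulrC ler_wpM2l ?opnorm_ge0// lerDl.
exists (opZ c s), (opZ c t); split; [by case: hG => _ _ _ hZ _; exact: hZ|exact: key..].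
Qed.

Lemma gbarB a b a' b' : gbar a b -> gbar a' b' -> gbar (opB a a') (opB b b').
Proof.
move=> h h'; have h2 := gbarZ (-1) h'; have h3 := gbarD h h2.
rewrite [opB a a']opBE [opB b b']opBE; exact h3.
Qed.

Lemma gbarM a b a' b' : gbar a b -> gbar a' b' -> gbar (a \o a') (b \o b').
Proof.
move=> [ba bb h] [ba' bb' h']; split; [exact: bounded_opM..|move=> e e0].
pose K := opnorm a + opnorm b + opnorm a' + opnorm b' + 2 : R.
have K2 : 2 <= K by rewrite /K lerDr !addr_ge0 ?opnorm_ge0.
have K0 : 0 < K by rewrite (lt_le_trans _ K2).
(* d <= 1 keeps the approximants bounded by K, and d <= e / (2 K) makes each of the two error terms
   at most e / 2. *)
pose d := Num.min 1 (e / K / 2); have d0 : 0 < d by rewrite lt_min ltr01 !divr_gt0.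
have [s [t [Gst hs ht]]] := h _ d0; have [s' [t' [Gst' hs' ht']]] := h' _ d0.
have [bs bt] := Gb Gst; have [bs' bt'] := Gb Gst'.
have key (Z : choiceType) (u v u' v' : l2 R Z -> l2 R Z) : bounded_op u -> bounded_op v ->
    bounded_op u' -> bounded_op v' -> opnorm (opB u v) < d -> opnorm (opB u' v') < d ->
    opnorm u + 1 <= K -> opnorm u' <= K -> opnorm (opB (u \o u') (v \o v')) < e.
  move=> bu bv bu' bv' huv huv' uK uK'.
  have nv : opnorm v <= K.
    apply: le_trans uK; have -> : v = opB u (opB u v) by apply/funext => f; rewrite /opB opprB addrC subrK.
    apply: (le_trans (opnormB bu (bounded_opB bu bv))); apply: lerD => //.
    by apply: (le_trans (ltW huv)); rewrite /d ge_min lexx.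
  have -> : opB (u \o u') (v \o v') = opD (opB u v \o u') (v \o opB u' v').
    by apply/funext => f; rewrite /opB /opD /= (linB bv.1) addrA subrK.
  have b1 := bounded_opB bu bv; have b2 := bounded_opB bu' bv'.
  apply: (le_lt_trans (opnormD (bounded_opM b1 bu') (bounded_opM bv b2))).
  have d2 : K * d <= e / 2.
    have : d <= e / K / 2 by rewrite /d ge_min lexx orbT.
    by move=> h0; apply: (le_trans (ler_wpM2l (ltW K0) h0)); rewrite mulrA mulrCA mulfV ?mulr1// gt_eqF.
  have m1 := opnormM b1 bu'; have m2 := opnormM bv b2.
  have m3 : opnorm (opB u v) * opnorm u' <= d * K by apply: ler_pM; rewrite ?opnorm_ge0// ltW.
  have m4 : opnorm v * opnorm (opB u' v') < K * d.
    apply: (@le_lt_trans _ _ (K * opnorm (opB u' v'))); first by rewrite ler_wpM2r ?opnorm_ge0.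
    by rewrite ltr_pM2l.
  rewrite [d * K]mulrC in m3; rewrite [e]splitr; apply: ler_ltD; first exact: le_trans m1 (le_trans m3 d2).
  exact: le_lt_trans m2 (lt_le_trans m4 d2).
exists (s \o s'), (t \o t'); split; first by case: hG => _ _ _ _ [hM _]; exact: hM.
  have := opnorm_ge0 a; have := opnorm_ge0 b; have := opnorm_ge0 a'; have := opnorm_ge0 b'.
  move=> p1 p2 p3 p4; apply: key => //; rewrite /K; clear -p1 p2 p3 p4; lra.
have := opnorm_ge0 a; have := opnorm_ge0 b; have := opnorm_ge0 a'; have := opnorm_ge0 b'.
move=> p1 p2 p3 p4; apply: key => //; rewrite /K; clear -p1 p2 p3 p4; lra.
Qed.

Lemma gbarA a b : gbar a b -> gbar (adjoint a) (adjoint b).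
Proof.
move=> [ba bb h]; split; [exact: adjoint_bounded..|move=> e e0].
have [s [t [Gst hs ht]]] := h _ e0; have [bs bt] := Gb Gst.
exists (adjoint s), (adjoint t); split; first by case: hG => _ _ _ _ [_ hA]; exact: hA.
  by rewrite -adjB// opnorm_adjE//; exact: bounded_opB.
by rewrite -adjB// opnorm_adjE//; exact: bounded_opB.
Qed.

Lemma gbar_closed a b : bounded_op a -> bounded_op b -> (forall e : R, 0 < e ->
  exists s t, [/\ gbar s t, opnorm (opB a s) < e & opnorm (opB b t) < e]) -> gbar a b.
Proof.
move=> ba bb h; split=> // e e0; have [s [t [[bs bt h'] hs ht]]] := h _ (divr_gt0 e0 (ltr0Sn _ 1)).
have [s' [t' [Gst hs' ht']]] := h' _ (divr_gt0 e0 (ltr0Sn _ 1)); have [bs' bt'] := Gb Gst.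
exists s', t'; split=> //; rewrite [e]splitr.
  by apply: (le_lt_trans (opnorm_triangle ba bs bs')); exact: ltrD.
by apply: (le_lt_trans (opnorm_triangle bb bt bt')); exact: ltrD.
Qed.

Hypothesis Gc : forall s t, G s t -> opnorm t <= opnorm s.

Lemma gbar_contractive a b : gbar a b -> opnorm b <= opnorm a.
Proof.
move=> [ba bb h]; apply/ler_addgt0Pr => e e0.
have [s [t [Gst hs ht]]] := h _ (divr_gt0 e0 (ltr0Sn _ 1)); have [bs bt] := Gb Gst.
have -> : b = opD (opB b t) t by apply/funext => f; rewrite /opB /opD subrK.
apply: (le_trans (opnormD (bounded_opB bb bt) bt)).
have h1 : opnorm s <= opnorm (opB a s) + opnorm a.
  have {1}-> : s = opB a (opB a s) by apply/funext => f; rewrite /opB opprB addrC subrK.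
  by rewrite addrC; exact: opnormB ba (bounded_opB ba bs).
exact: contr_aux (Gc Gst) h1 hs ht.
Qed.

Lemma gbar_fun a b b' : gbar a b -> gbar a b' -> b = b'.
Proof.
move=> h h'; have := gbar_contractive (gbarB h h').
have [_ bb _] := h; have [_ bb' _] := h'.
have -> : opnorm (opB a a) = 0.
  apply/eqP; rewrite eq_le opnorm_ge0 andbT; apply: opnorm_le => // f.
  by rewrite /opB subrr l2norm0 mul0r.
move=> n0; suff e : opB b b' = fun=> 0.
  by apply/funext => f; apply/eqP; rewrite -subr_eq0; apply/eqP/(congr1 (@^~ f) e).
by apply: opnorm_eq0; [exact: bounded_opB|apply/eqP; rewrite eq_le n0 opnorm_ge0].
Qed.

Lemma gbar_total a : bounded_op a ->
  (forall e : R, 0 < e -> exists2 s, (exists t, G s t) & opnorm (opB a s) < e) ->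
  exists b, gbar a b.
Proof.
move=> ba h.
have /choice[F hF] : forall n : nat, exists st, G st.1 st.2 /\ opnorm (opB a st.1) < n.+1%:R^-1.
  move=> n; have n0 : 0 < n.+1%:R^-1 :> R by rewrite invr_gt0.
  by have [s [t Gst] hs] := h _ n0; exists (s, t).
have bF n := Gb (hF n).1.
have lim (e : R) : 0 < e -> exists N : nat, N.+1%:R^-1 < e.
  move=> e0; exists (Num.truncn e^-1).
  by rewrite invf_plt ?posrE ?ltr0Sn// truncnS_gt// invr_ge0 ltW.
have mono N i : (N <= i)%N -> i.+1%:R^-1 <= N.+1%:R^-1 :> R.
  by move=> Ni; rewrite lef_pV2 ?posrE ?ltr0Sn// ler_nat.
have [|b bb hb] := @opnorm_complete R Y (fun n => (F n).2) (fun n => (bF n).2).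
  move=> e e0; have [N hN] := lim _ (divr_gt0 e0 (ltr0Sn _ 1)); exists N => i j Ni Nj.
  apply: (le_lt_trans (Gc (GB (hF i).1 (hF j).1))).
  apply: (le_lt_trans (opnorm_triangle (bF i).1 ba (bF j).1)).
  rewrite [e]splitr opnormC; apply: ltrD.
    by apply: (lt_trans (hF i).2); apply: (le_lt_trans (mono _ _ Ni)).
  by apply: (lt_trans (hF j).2); apply: (le_lt_trans (mono _ _ Nj)).
exists b; split=> // e e0.
have [N hN] := lim _ e0; have [N' hN'] := hb _ (divr_gt0 e0 (ltr0Sn _ 1)).
pose n := maxn N N'; exists (F n).1, (F n).2; split; first exact: (hF n).1.
  by apply: (lt_trans (hF n).2); apply: (le_lt_trans (mono N n (leq_maxl _ _))).
rewrite opnormC; apply: (le_lt_trans (hN' n (leq_maxr _ _))).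
by rewrite ltr_pdivrMr// ltr_pMr// ltr1n.
Qed.

Definition gext a : l2 R Y -> l2 R Y := xget (fun=> 0) [set b | gbar a b].

Lemma gextE a b : gbar a b -> gext a = b.
Proof.
move=> h; apply: (@gbar_fun a); last exact: h.
by apply: (@xgetPex _ _ [set b | gbar a b]); exists b; exact: h.
Qed.

Definition gdom := @aclosure R (bounded_ops R X) [set s | exists t, G s t].
Definition gran := @aclosure R (bounded_ops R Y) [set t | exists s, G s t].

Lemma gdom_gbar a : gdom a -> gbar a (gext a).
Proof.
move=> /aclosureE[ba ha]; have [b hb] := gbar_total ba ha; by rewrite (gextE hb).
Qed.

Lemma gbar_ran a b : gbar a b -> gran b.
Proof.
move=> [ba bb h]; apply/aclosureE; split=> // e e0; have [s [t [Gst _ ht]]] := h e e0.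
by exists t => //; exists s.
Qed.

Lemma gbar_dom a b : gbar a b -> gdom a.
Proof.
move=> [ba bb h]; apply/aclosureE; split=> // e e0; have [s [t [Gst hs _]]] := h e e0.
by exists s => //; exists t.
Qed.

Lemma gext_hom : @star_hom R (sub_alg (bounded_ops R X) gdom) (sub_alg (bounded_ops R Y) gran) gext.
Proof.
split=> [a /gdom_gbar/gbar_ran//|a b|c a|a b|a].
- by move=> /gdom_gbar ha /gdom_gbar hb; exact: gextE (gbarD ha hb).
- by move=> /gdom_gbar ha; exact: gextE (gbarZ c ha).
- by move=> /gdom_gbar ha /gdom_gbar hb; exact: gextE (gbarM ha hb).
- by move=> /gdom_gbar ha; exact: gextE (gbarA ha).
Qed.

End HomGraph.

Section ClosureSubalgebra.
Context {R : realType} {X Y : choiceType}.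
Local Open Scope ring_scope.

Lemma hom_graph_sym (G : (l2 R X -> l2 R X) -> (l2 R Y -> l2 R Y) -> Prop) :
  hom_graph G -> hom_graph (fun t s => G s t).
Proof.
case=> h0 hb hD hZ [hM hA]; split=> //.
- by move=> s t /hb[].
- by move=> s t s' t' h h'; exact: hD.
- by move=> c s t; exact: hZ.
- by split=> [s t s' t' h h'|s t]; [exact: hM|exact: hA].
Qed.

Lemma gext_iso (G : (l2 R X -> l2 R X) -> (l2 R Y -> l2 R Y) -> Prop) :
  hom_graph G -> (forall s t, G s t -> opnorm t = opnorm s) ->
  @star_iso R (sub_alg (bounded_ops R X) (gdom G)) (sub_alg (bounded_ops R Y) (gran G)) (gext G).
Proof.
move=> hG iG; have Gc s t : G s t -> opnorm t <= opnorm s by move/iG ->.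
have Gc' t s : G s t -> opnorm s <= opnorm t by move/iG ->.
have sym a b : gbar G a b -> gbar (fun t s => G s t) b a.
  move=> [ba bb h]; split=> // e /h[s [t [Gst hs ht]]]; by exists t, s.
have sym' a b : gbar (fun t s => G s t) b a -> gbar G a b.
  move=> [ba bb h]; split=> // e /h[s [t [Gst hs ht]]]; by exists t, s.
split; first exact: gext_hom.
split=> [a ha|a b /set_mem ha /set_mem hb e|b hb].
- exact: gbar_ran (gdom_gbar hG Gc ha).
- have {}ha := gdom_gbar hG Gc ha; have {}hb := gdom_gbar hG Gc hb; rewrite -e in hb.
  exact: (gbar_fun (hom_graph_sym hG) Gc' (sym _ _ ha) (sym _ _ hb)).
- have h := gdom_gbar (hom_graph_sym hG) Gc' hb.
  exists (gext (fun t s => G s t) b); first exact: gbar_dom (sym' _ _ h).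
  exact (gextE hG Gc (sym' _ _ h)).
Qed.

(** The diagonal of D is the graph of a homomorphism, so the closure properties of [gbar] apply to
    it. *)
Lemma closure_csub (D : set (l2 R X -> l2 R X)) :
  (forall a, D a -> bounded_op a) -> D (fun=> 0) ->
  (forall a b, D a -> D b -> D (opD a b)) -> (forall c a, D a -> D (opZ c a)) ->
  (forall a b, D a -> D b -> D (a \o b)) -> (forall a, D a -> D (adjoint a)) ->
  @cstar_subalg R (bounded_ops R X) (@aclosure R (bounded_ops R X) D).
Proof.
move=> Db D0 DD DZ DM DA; pose G (s t : l2 R X -> l2 R X) := D s /\ t = s.
have hG : hom_graph G.
  split=> [//|s t [/Db bs ->]//|s t s' t' [Ds ->] [Ds' ->]|c s t [Ds ->]|].
  - by split=> //; exact: DD.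
  - by split=> //; exact: DZ.
  by split=> [s t s' t' [Ds ->] [Ds' ->]|s t [Ds ->]]; split=> //; [exact: DM|exact: DA].
have E a : @aclosure R (bounded_ops R X) D a <-> gbar G a a.
  split=> [/aclosureE[ba h]|[ba _ h]].
    by split=> // e /h[s Ds hs]; exists s, s.
  by apply/aclosureE; split=> // e /h[s [t [[Ds _] hs _]]]; exists s.
split.
- split=> [a /aclosureE[]//||a b /E ha /E hb|c a /E ha]; apply/E.
  + exact: gbar0.
  + exact: gbarD.
  + exact: gbarZ.
- by move=> a b /E ha /E hb; apply/E/gbarM.
- by move=> a /E ha; apply/E/gbarA.
- move=> a /aclosureE[ba h]; apply/E/gbar_closed => // e /h[s /E Es hs].
  by exists s, s.
Qed.

End ClosureSubalgebra.

Section Fibres.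
Context {R : realType} {X : choiceType} {K : eqType}.
Local Open Scope ring_scope.
Local Open Scope complex_scope.

Lemma inner_disjoint (f g : l2 R X) : (forall x, f x = 0 \/ g x = 0) -> inner f g = 0.
Proof.
move=> h; have z (x : X) : f x * conjc (g x) = 0.
  by case: (h x) => ->; rewrite ?mul0r// rmorph0 mulr0.
have r0 : rsum (fun _ : X => 0 : R) = 0.
  by rewrite /rsum !(esum1 (D := [set: X])) ?subrr// => x _; rewrite ?oppr0 maxxx.
rewrite /inner (_ : (fun x => _) = fun=> 0); last by apply/funext => x; rewrite z.
rewrite (_ : (fun x => complex.Im _) = fun=> 0); last by apply/funext => x; rewrite z.
by rewrite r0.
Qed.

Lemma pythagoras (f g : l2 R X) : inner f g = 0 ->
  l2norm (f + g) ^+ 2 = l2norm f ^+ 2 + l2norm g ^+ 2.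
Proof.
move=> fg; apply: complexI; rewrite rmorphD -!inner_norm innerDl !innerDr fg addr0.
by rewrite (innerC f g) fg conjc0 add0r !inner_norm.
Qed.

(** T respects the orthogonal decomposition of l2 along the fibres of c, so a bound on each fibre is
    a bound on T. A finite support is split off one fibre at a time, the images being orthogonal. *)
Lemma fibre_bound (c : X -> K) (T : l2 R X -> l2 R X) (L M : R) : 0 <= M -> bdd T L ->
  (forall x y, c x <> c y -> T (delta x) y = 0) ->
  (forall s k, uniq s -> (forall x, x \in s -> c x = k) -> forall h,
    l2norm (T (fin s h)) <= M * l2norm (fin s h)) -> bdd T M.
Proof.
move=> M0 hT disj hM; apply: (bdd_dense M0 hT) => s us h.
rewrite -ler_sqr ?nnegrE ?mulr_ge0 ?l2norm_ge0// exprMn.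
have [n] := ubnP (size s); elim: n s us => // n ih [|x0 s0] us sn.
  by rewrite /fin big_nil (lin0 hT.1) l2norm0 expr0n mulr0.
set s := x0 :: s0 in us sn *; pose k := c x0.
pose s1 := [seq x <- s | c x == k]; pose s2 := [seq x <- s | c x != k].
have e2 : fin s h = fin s1 h + fin s2 h.
  by rewrite /fin (bigID (fun x => c x == k)) /= /s1 /s2 !big_filter.
have n2 : l2norm (fin s h) ^+ 2 = l2norm (fin s1 h) ^+ 2 + l2norm (fin s2 h) ^+ 2.
  rewrite !norm_fin ?filter_uniq// /fsq (bigID (fun x => c x == k)) /= /s1 /s2 !big_filter//.
have c1 x : x \in s1 -> c x = k by rewrite mem_filter => /andP[/eqP].
have c2 x : x \in s2 -> c x <> k by rewrite mem_filter => /andP[/eqP].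
rewrite n2 e2 (linD hT.1) pythagoras; last first.
  rewrite !(lin_fin _ _ hT.1) inner_suml big_seq big1// => x xs1.
  rewrite inner_sumr big_seq big1// => y ys2; rewrite innerZl innerZr inner_disjoint ?mulr0//.
  move=> z; have [xz|xz] := eqVneq (c x) (c z); last by left; apply: disj; exact/eqP.
  by right; apply: disj => yz; apply: (c2 _ ys2); rewrite yz -xz; exact: c1.
rewrite mulrDr; apply: lerD.
  rewrite -exprMn ler_sqr ?nnegrE ?mulr_ge0 ?l2norm_ge0//.
  by apply: (hM _ k) => //; rewrite filter_uniq.
apply: ih; first by rewrite filter_uniq.
apply: (@leq_trans (size s)); last by rewrite -ltnS.
by rewrite /s2 /= eqxx /= ltnS size_filter count_size.
Qed.

End Fibres.

Lemma thirdE (R : realFieldType) (e : R) : (e = e / 3 + (e / 3 + e / 3))%R.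
Proof. lra. Qed.

Lemma fifthE (R : realFieldType) (e : R) :
  (e = (e / 5 + (e / 5 + (e / 5 + e / 5))) + e / 5)%R.
Proof. lra. Qed.

(** * Compact operators as limits of truncations *)

Section CompactOperators.
Context {R : realType} {X : choiceType}.
Local Notation H := (l2 R X).
Local Notation C := R[i].
Local Open Scope ring_scope.
Local Open Scope complex_scope.
Implicit Types (S T U : H -> H) (f g h : H) (s : seq X).

Lemma nbhs_l2 h (N : set H) : nbhs h N <->
  exists2 e : R, 0 < e & forall h', l2norm (h - h') < e -> N h'.
Proof.
split=> [/nbhs_normP[e /= e0 hN]|[e e0 hN]].
  have eR : e = (complex.Re e)%:C by rewrite RRe_real// gtr0_real.
  exists (complex.Re e) => [|h' hh]; first by rewrite -ltcR -eR.
  by apply: hN; rewrite /ball_ /= eR -[`|_|]/((l2norm (h - h'))%:C) ltcR.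
apply/nbhs_normP; exists e%:C => [/=|h' /=]; first by rewrite ltcR.
by rewrite -[`|_|]/((l2norm (h - h'))%:C) ltcR; exact: hN.
Qed.

Definition pr s f : H := fin s f.

Lemma pr_coord s f x : uniq s -> pr s f x = if x \in s then f x else 0.
Proof. exact: finE. Qed.

Lemma pr_linear s : linear (pr s).
Proof.
move=> c f g; rewrite /pr /fin scaler_sumr -big_split /=; apply: eq_bigr => x _.
by transitivity ((c * f x + g x : C) *: (delta x : H)); rewrite // scalerDl scalerA.
Qed.

Lemma pr_bdd s : uniq s -> bdd (pr s) 1.
Proof. by move=> us; split=> [|f]; [exact: pr_linear|rewrite mul1r; exact: norm_fin_le]. Qed.

Lemma pr_bounded s : uniq s -> bounded_op (pr s).
Proof. by move=> us; apply: (bounded_bdd ler01); exact: pr_bdd. Qed.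

Lemma pr_opnorm s : uniq s -> opnorm (pr s) <= 1.
Proof. by move=> us; apply: (bdd_opnorm ler01); exact: pr_bdd. Qed.

Lemma adj_pr s : uniq s -> adjoint (pr s) = pr s.
Proof.
move=> us; apply: (adjoint_uniq (pr_bounded us)) => f g.
rewrite /pr /fin inner_suml inner_sumr; apply: eq_bigr => x _.
by rewrite innerZl innerZr (innerC g) !inner_delta mulrC.
Qed.

Lemma pr_compl_norm s f : uniq s -> l2norm (f - pr s f) <= l2norm f.
Proof.
move=> us; rewrite -ler_sqr ?nnegrE ?l2norm_ge0//.
have {3}-> : f = pr s f + (f - pr s f) by rewrite addrC subrK.
rewrite (@pythagoras _ _ (pr s f) (f - pr s f)); first by rewrite lerDr sqr_ge0.
apply: inner_disjoint => x.
rewrite l2BE pr_coord//; case: ifP => _; [right|left] => //; exact: subrr.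
Qed.

Lemma pr_compl_mono s s' f : uniq s -> uniq s' -> {subset s <= s'} ->
  l2norm (f - pr s' f) <= l2norm (f - pr s f).
Proof.
move=> us us' ss; have -> : f - pr s' f = (f - pr s f) - pr s' (f - pr s f).
  apply: l2P => x; rewrite !l2BE !pr_coord// l2BE pr_coord//.
  have [xs|xs] := boolP (x \in s); first by rewrite (ss _ xs) !subrr.
  by case: ifP => _; rewrite ?subr0 ?subrr.
exact: pr_compl_norm.
Qed.

Lemma common_approx (L : seq H) (e : R) : 0 < e ->
  exists2 s, uniq s & forall f, f \in L -> l2norm (f - pr s f) < e.
Proof.
move=> e0; elim: L => [|g L [s us hs]]; first by exists [::].
have [s' us' hs'] := l2_approx g e0.
have ss2 : {subset s <= undup (s ++ s')} by move=> x xs; rewrite mem_undup mem_cat xs.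
have ss1 : {subset s' <= undup (s ++ s')} by move=> x xs; rewrite mem_undup mem_cat xs orbT.
exists (undup (s ++ s')) => [|f]; first exact: undup_uniq.
rewrite inE => /orP[/eqP ->|fL].
  by apply: le_lt_trans hs'; exact: pr_compl_mono (undup_uniq _) ss1.
by apply: le_lt_trans (hs f fL); exact: pr_compl_mono (undup_uniq _) ss2.
Qed.

(** Norm approximation of T by truncating its source to finitely many coordinates; [lfa] truncates
    the range instead. Both are equivalent to compactness, and [rfa] is the form used for ideals. *)
Definition rfa T := bounded_op T /\ forall e : R, 0 < e ->
  exists2 s, uniq s & opnorm (opB T (T \o pr s)) <= e.
Definition lfa T := bounded_op T /\ forall e : R, 0 < e ->
  exists2 s, uniq s & opnorm (opB T (pr s \o T)) <= e.

(** T [pr s] has its range spanned by the finitely many vectors T delta_x with x in s, and one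
    further finite set approximates all of them. *)
Lemma rfa_lfa T : rfa T -> lfa T.
Proof.
move=> [bT h]; split; first exact: bT.
move=> e e0; have e2 : 0 < e / 2 by rewrite divr_gt0.
have [s us hs] := h _ e2; pose n : R := (size s)%:R + 1.
have n0 : 0 < n by rewrite ltr_wpDl.
have [s' us' hs'] := common_approx [seq T (delta x) | x <- s] (divr_gt0 e2 n0).
exists s' => //; have bp := pr_bounded us; have bp' := pr_bounded us'.
apply: opnorm_le; first exact: ltW.
move=> f; rewrite /opB /=.
pose u := T f - T (pr s f); have uE : T f = u + T (pr s f) by rewrite /u subrK.
have nu : l2norm u <= e / 2 * l2norm f.
  apply: (le_trans (opnormP (bounded_opB bT (bounded_opM bT bp)) f)).
  by rewrite ler_wpM2r ?l2norm_ge0.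
have nv : l2norm (T (pr s f) - pr s' (T (pr s f))) <= e / 2 * l2norm f.
  rewrite [pr s f]/pr (lin_fin _ _ bT.1) (lin_sum _ _ (pr_linear s')).
  rewrite -sumrB; apply: (le_trans (ler_l2norm_sum _ _)).
  apply: (@le_trans _ _ (\sum_(x <- s) (e / 2 / n * l2norm f))).
    rewrite big_seq [leRHS]big_seq; apply: ler_sum => x xs.
    rewrite (linZ (pr_linear s')) -scalerBr l2normZ mulrC; apply: ler_pM; rewrite ?cabs_ge0 ?l2norm_ge0//.
      by apply/ltW/hs'/map_f.
    exact: l2_coord_le.
  have -> : \sum_(x <- s) (e / 2 / n * l2norm f) = (size s)%:R / n * (e / 2 * l2norm f).
    rewrite big_const_seq count_predT iter_addr_0 -[LHS]mulr_natr; ring.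
  apply: ler_piMl; first exact: mulr_ge0 (ltW e2) (l2norm_ge0 _).
  by rewrite ler_pdivrMr// mul1r lerDl.
have -> : T f - pr s' (T f) = (u - pr s' u) + (T (pr s f) - pr s' (T (pr s f))).
  by rewrite uE (linD (pr_linear s')) opprD addrACA.
apply: (le_trans (ler_l2normD _ _)); rewrite [e]splitr mulrDl; apply: lerD => //.
exact: le_trans (pr_compl_norm _ us') nu.
Qed.

Lemma rfa_adj T : rfa T -> rfa (adjoint T).
Proof.
move=> /rfa_lfa[bT h]; split; first exact: adjoint_bounded.
move=> e /h[s us hs]; exists s => //; have bp := pr_bounded us.
rewrite -(adj_pr us) -(adjM bp bT) -(adjB bT (bounded_opM bp bT)) opnorm_adjE//.
exact: bounded_opB bT (bounded_opM bp bT).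
Qed.

Lemma lfa_rfa T : lfa T -> rfa T.
Proof.
move=> [bT h]; rewrite -(adjK bT); apply: rfa_adj; split; first exact: adjoint_bounded.
move=> e /h[s us hs]; exists s => //; have bp := pr_bounded us.
rewrite -(adj_pr us) -(adjM bp bT) -(adjB bT (bounded_opM bp bT)) opnorm_adjE//.
exact: bounded_opB bT (bounded_opM bp bT).
Qed.

Lemma rfaM S T : bounded_op S -> rfa T -> rfa (S \o T).
Proof.
move=> bS [bT h]; split; first exact: bounded_opM.
move=> e e0; have K0 : 0 < opnorm S + 1 by rewrite ltr_wpDl ?opnorm_ge0.
have [s us hs] := h _ (divr_gt0 e0 K0); exists s => //.
have b := bounded_opB bT (bounded_opM bT (pr_bounded us)).
have -> : opB (S \o T) ((S \o T) \o pr s) = S \o opB T (T \o pr s).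
  by apply/funext => f; rewrite /opB /= (linB bS.1).
apply: (le_trans (opnormM bS b)); apply: (@le_trans _ _ ((opnorm S + 1) * (e / (opnorm S + 1)))).
  by apply: ler_pM; rewrite ?opnorm_ge0// lerDl.
by rewrite mulrCA mulfV ?mulr1// gt_eqF.
Qed.

Lemma rfaMr S T : bounded_op S -> rfa T -> rfa (T \o S).
Proof.
move=> bS hT; have bT := hT.1; rewrite -(adjK (bounded_opM bT bS)) adjM//.
by apply/rfa_adj/rfaM; [exact: adjoint_bounded|exact: rfa_adj].
Qed.

Lemma rfa_closed T : bounded_op T ->
  (forall e : R, 0 < e -> exists2 S, rfa S & opnorm (opB T S) < e) -> rfa T.
Proof.
move=> bT h; split; first exact: bT.
move=> e e0; have e3 : 0 < e / 3 by rewrite divr_gt0.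
have [S [bS hS] TS] := h _ e3; have [s us hs] := hS _ e3; exists s => //.
have bp := pr_bounded us; have bTS := bounded_opB bT bS.
have -> : opB T (T \o pr s) = opD (opB T S) (opB (opB S (S \o pr s)) (opB T S \o pr s)).
  by apply/funext => f; rewrite /opB /opD /=; l2ring.
apply: (le_trans (opnormD bTS (bounded_opB (bounded_opB bS (bounded_opM bS bp)) (bounded_opM bTS bp)))).
have h2 := opnormB (bounded_opB bS (bounded_opM bS bp)) (bounded_opM bTS bp).
have h3 : opnorm (opB T S \o pr s) <= e / 3.
  apply: (le_trans (opnormM bTS bp)); rewrite -[leRHS]mulr1.
  by apply: ler_pM; [exact: opnorm_ge0|exact: opnorm_ge0|exact: ltW|exact: pr_opnorm].
rewrite [e]thirdE.
apply: lerD; first exact: ltW.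
exact: le_trans h2 (lerD hs h3).
Qed.

Lemma rfaD S T : rfa S -> rfa T -> rfa (opD S T).
Proof.
move=> [bS hS] [bT hT]; split; first exact: bounded_opD.
move=> e e0; have e2 : 0 < e / 2 by rewrite divr_gt0.
have [s us hs] := hS _ e2; have [s' us' hs'] := hT _ e2; pose t := undup (s ++ s').
have ut : uniq t by exact: undup_uniq.
exists t => //; have bp := pr_bounded ut.
have key (U : H -> H) r : bounded_op U -> uniq r -> {subset r <= t} ->
    opnorm (opB U (U \o pr r)) <= e / 2 -> opnorm (opB U (U \o pr t)) <= e / 2.
  move=> bU ur rt hU; have br := pr_bounded ur; apply: opnorm_le; first exact: ltW.
  move=> f; rewrite /opB /= -(linB bU.1).
  have -> : f - pr t f = (f - pr t f) - pr r (f - pr t f).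
    apply: l2P => x; rewrite !l2BE !pr_coord// l2BE pr_coord//.
    have [xr|xr] := boolP (x \in r); first by rewrite (rt _ xr) !subrr.
    by rewrite subr0.
  rewrite (linB bU.1); apply: (le_trans (opnormP (bounded_opB bU (bounded_opM bU br)) _)).
  apply: ler_pM; rewrite ?opnorm_ge0 ?l2norm_ge0//; exact: pr_compl_norm.
have -> : opB (opD S T) (opD S T \o pr t) = opD (opB S (S \o pr t)) (opB T (T \o pr t)).
  by apply/funext => f; rewrite /opB /opD /= opprD addrACA.
apply: (le_trans (opnormD (bounded_opB bS (bounded_opM bS bp)) (bounded_opB bT (bounded_opM bT bp)))).
rewrite [e]splitr; apply: lerD; [apply: (key _ s)|apply: (key _ s')] => // x xs;
  by rewrite mem_undup mem_cat xs ?orbT.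
Qed.

Lemma rfaZ c T : rfa T -> rfa (opZ c T).
Proof.
move=> hT; have -> : opZ c T = opZ c id \o T by [].
by apply: rfaM => //; apply: bounded_opZ; exact: bounded_op_id.
Qed.

Lemma rfa_pr s : uniq s -> rfa (pr s).
Proof.
move=> us; have bp := pr_bounded us; split; first exact: bp.
move=> e e0; exists s => //; apply: opnorm_le; first exact: ltW.
move=> f; have pp : pr s (pr s f) = pr s f.
  by apply: l2P => x; rewrite !pr_coord//; case: (x \in s).
by rewrite /opB /= pp subrr l2norm0 mulr_ge0 ?l2norm_ge0 ?ltW.
Qed.

Lemma rfa_pr_approx T (e : R) : rfa T -> 0 < e ->
  exists2 s, uniq s & opnorm (opB T (pr s \o T \o pr s)) <= e.
Proof.
move=> hT e0; have [bT h1] := hT; have [_ h2] := rfa_lfa hT.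
have e2 : 0 < e / 2 by rewrite divr_gt0.
have [s us hs] := h1 _ e2; have [s' us' hs'] := h2 _ e2; pose t := undup (s ++ s').
have ut : uniq t by exact: undup_uniq.
have st : {subset s <= t} by move=> x xs; rewrite mem_undup mem_cat xs.
have st' : {subset s' <= t} by move=> x xs; rewrite mem_undup mem_cat xs orbT.
exists t => //; apply: opnorm_le; first exact: ltW.
move=> f; rewrite /opB /=.
have -> : T f - pr t (T (pr t f)) = (T f - pr t (T f)) + pr t (T (f - pr t f)).
  by rewrite (linB bT.1) (linB (pr_linear t)) addrA subrK.
apply: (le_trans (ler_l2normD _ _)); rewrite [e]splitr mulrDl; apply: lerD.
  apply: (le_trans (pr_compl_mono _ us' ut st')).
  apply: (le_trans (opnormP (bounded_opB bT (bounded_opM (pr_bounded us') bT)) f)).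
  by rewrite ler_wpM2r ?l2norm_ge0.
apply: (le_trans (norm_fin_le _ ut)).
have -> : T (f - pr t f) = opB T (T \o pr s) (f - pr t f).
  rewrite /opB /= (_ : pr s (f - pr t f) = 0) ?(lin0 bT.1) ?subr0//.
  apply: l2P => x; rewrite pr_coord// l2BE pr_coord//.
  by case: ifP => // xs; rewrite st// subrr.
apply: (le_trans (opnormP (bounded_opB bT (bounded_opM bT (pr_bounded us))) _)).
by apply: ler_pM; rewrite ?opnorm_ge0 ?l2norm_ge0// pr_compl_norm.
Qed.

(** Truncations converge to the identity locally uniformly along the filter of finite sets, hence
    uniformly on the compact closure of the image of the unit ball. *)
Lemma compact_op_lfa T : compact_op T -> lfa T.
Proof.
move=> [bT /compact_near_coveringP cT]; split; first exact: bT.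
move=> e e0; have e2 : 0 < e / 2 by rewrite divr_gt0.
pose F : set_system (seq X) := [set N | exists2 s, uniq s & forall s', uniq s' -> {subset s <= s'} -> N s'].
have FF : Filter F.
  split=> [|P Q [s us hs] [s' us' hs']|P Q PQ [s us hs]].
  - by exists [::].
  - exists (undup (s ++ s')); first exact: undup_uniq.
    move=> t ut st; split; [apply: hs => //|apply: hs' => //] => x xs;
      by apply: st; rewrite mem_undup mem_cat xs ?orbT.
  - by exists s => // t ut st; apply/PQ/hs.
have := cT _ F (fun s h => l2norm (h - pr s h) < e) FF.
case=> [h _|s us hs].
  have [s us hs] := l2_approx h e2.
  exists ([set h' | l2norm (h - h') < e / 2], [set t | uniq t /\ {subset s <= t}]).
    by split=> /=; [apply/nbhs_l2; exists (e / 2)|exists s].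
  move=> [h' t] /= [hh [ut st]].
  have -> : h' - pr t h' = (h - pr t h) - ((h - h') - pr t (h - h')).
    by rewrite (linB (pr_linear t)); l2ring.
  apply: (le_lt_trans (ler_l2normB _ _)); rewrite [e]splitr; apply: ltrD.
    exact: le_lt_trans (pr_compl_mono _ us ut st) hs.
  exact: le_lt_trans (pr_compl_norm _ ut) hh.
exists s => //; have bp := pr_bounded us; apply: opnorm_le; first exact: ltW.
move=> f; rewrite /opB /=; have [f0|f0] := eqVneq (l2norm f) 0.
  by rewrite (l2norm_eq0 f0) (lin0 bT.1) (lin0 (pr_linear s)) subr0 l2norm0 mulr0.
have fp : 0 < l2norm f by rewrite lt_neqAle eq_sym f0 l2norm_ge0.
pose c : C := ((l2norm f)^-1)%:C; have cc : cabs c = (l2norm f)^-1 by rewrite cabs_real ger0_norm ?invr_ge0 ?ltW.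
have /(hs s us (fun _ => id)) : closure (T @` [set f | l2norm f <= 1]) (T (c *: f)).
  apply: subset_closure; exists (c *: f) => //=.
  by rewrite l2normZ cc mulVf.
rewrite (linZ bT.1) (linZ (pr_linear s)) -scalerBr l2normZ cc mulrC ltr_pdivrMr//.
exact: ltW.
Qed.

Lemma closure_l2 (A : set H) h : closure A h -> forall e : R, 0 < e -> exists2 h', A h' & l2norm (h - h') < e.
Proof.
move=> hA e e0; have /hA[h' [Ah' hh]] : nbhs h [set h' | l2norm (h - h') < e].
  by apply/nbhs_l2; exists e.
by exists h'.
Qed.

(** Along an ultrafilter on K the real and imaginary parts of every coordinate converge, since
    segments are compact. Points of K are uniformly close to their truncations, which turns
    coordinatewise convergence into convergence in norm. *)
Lemma lfa_compact_op T : lfa T -> compact_op T.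
Proof.
move=> [bT hT]; split; first exact: bT.
set K := closure _; pose M := opnorm T.
have KM h : K h -> l2norm h <= M.
  move=> /closure_l2 hK; apply/ler_addgt0Pr => e /hK[_ [f /= f1 <-] hh].
  have -> : h = (h - T f) + T f by rewrite subrK.
  apply: (le_trans (ler_l2normD _ _)); rewrite [M + e]addrC; apply: lerD; first exact: ltW.
  by apply: (le_trans (opnormP bT f)); rewrite ler_piMr ?opnorm_ge0.
have Kpr (e : R) : 0 < e -> exists2 s, uniq s & forall h, K h -> l2norm (h - pr s h) <= e.
  move=> e0; have e2 : 0 < e / 2 by rewrite divr_gt0.
  have [s us hs] := hT _ e2; exists s => // h /closure_l2/(_ _ e2)[_ [f /= f1 <-] hh].
  have -> : h - pr s h = ((h - T f) - pr s (h - T f)) + (T f - pr s (T f)).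
    by rewrite (linB (pr_linear s)); l2ring.
  apply: (le_trans (ler_l2normD _ _)); rewrite [e]splitr; apply: lerD.
    exact: le_trans (pr_compl_norm _ us) (ltW hh).
  apply: (le_trans (opnormP (bounded_opB bT (bounded_opM (pr_bounded us) bT)) f)).
  by rewrite -[leRHS]mulr1; apply: ler_pM; rewrite ?opnorm_ge0 ?l2norm_ge0.
rewrite compact_ultra => F UF FK.
have PF : ProperFilter F by exact: ultra_proper.
have cv (u : H -> R) : (forall h, `|u h| <= l2norm h) -> exists a : R, (u @ F)%classic --> a.
  move=> hu; have uM : (u @ F)%classic `[- M, M]%classic.
    have sub : K `<=` u @^-1` `[- M, M].
      by move=> z /KM zM; rewrite /= in_itv /= -ler_norml (le_trans (hu z)).
    exact: filterS sub FK.
  have [a [_ ha]] := @segment_compact R (- M) M _ (fmap_proper_filter u PF) uM.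
  exists a => N Na; have [//|FN] := in_ultra_setVsetC (u @^-1` N) UF.
  by have [r [nr Nr]] := ha _ _ (FN : (u @ F)%classic (~` N)) Na.
have /choice[a ha] : forall x, exists a : R, ((fun h : H => complex.Re (h x)) @ F)%classic --> a.
  by move=> x; apply: (cv (fun h : H => complex.Re (h x))) => h; rewrite (le_trans (Re_le_cabs _))// l2_coord_le.
have /choice[b hb] : forall x, exists a : R, ((fun h : H => complex.Im (h x)) @ F)%classic --> a.
  by move=> x; apply: (cv (fun h : H => complex.Im (h x))) => h; rewrite (le_trans (Im_le_cabs _))// l2_coord_le.
pose k : X -> R[i]^o := fun x => Complex (a x) (b x).
have nk (e : R) s : 0 < e -> F [set h : H | forall x, x \in s -> cabs (h x - k x) < e].
  move=> e0; elim: s => [|x s ih]; first by apply: filterS FK.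
  have e2 : 0 < e / 2 by rewrite divr_gt0.
  have /cvgrPdist_lt/(_ _ e2) n1 := ha x; have /cvgrPdist_lt/(_ _ e2) n2 := hb x.
  apply: filterS (filterI ih (filterI n1 n2)) => h [ihh [h1 h2]] y.
  rewrite inE => /orP[/eqP ->|]; last exact: ihh.
  have -> : h x - k x = (complex.Re (h x) - a x)%:C + 'i%C * (complex.Im (h x) - b x)%:C.
    by rewrite /k; case: (l2fun h x) => p q; apply/eqP; rewrite eq_complex /= !mul0r !mulr0 !mul1r ?subr0 ?addr0 ?add0r !eqxx.
  apply: (le_lt_trans (cabsD _ _)); rewrite cabsM !cabs_real.
  have -> : cabs ('i%C : C) = 1 by rewrite /cabs /sqnormc /= expr0n add0r expr1n sqrtr1.
  by rewrite mul1r [e]splitr; apply: ltrD; rewrite distrC.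
have cauchy (e : R) : 0 < e -> F [set h : H | forall s, uniq s -> l2norm (fin s (fun x => h x - k x)) <= e].
  move=> e0; have e5 : 0 < e / 5 by rewrite divr_gt0.
  have [s0 us0 hs0] := Kpr _ e5; pose n : R := (size s0)%:R + 1.
  have n0 : 0 < n by rewrite ltr_wpDl.
  have hN := nk _ s0 (divr_gt0 e5 n0).
  apply: filterS (filterI FK hN) => h [Kh h1] s us.
  have ns : 0 < (size s)%:R + 1 :> R by rewrite ltr_wpDl.
  have [h' [[Kh' h'1] h'2]] := filter_ex (filterI (filterI FK hN) (nk _ s (divr_gt0 e5 ns))).
  have -> : fin s (fun x => h x - k x) = pr s (h - h') + fin s (fun x => h' x - k x).
    by apply: l2P => x; rewrite l2DE pr_coord// !finE// l2BE; case: ifP => _; ring.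
  have small (r : seq X) (u : X -> R[i]^o) : uniq r -> (forall x, x \in r -> cabs (u x) < e / 5 / ((size r)%:R + 1)) ->
      l2norm (fin r u) <= e / 5.
    move=> ur hu; apply: (le_trans (fin_norm_sum _ _)).
    apply: (@le_trans _ _ (\sum_(x <- r) (e / 5 / ((size r)%:R + 1)))).
      by rewrite big_seq [leRHS]big_seq; apply: ler_sum => x xr; apply/ltW/hu.
    have nr : 0 < (size r)%:R + 1 :> R by rewrite ltr_wpDl.
    rewrite big_const_seq count_predT iter_addr_0 -[leLHS]mulr_natr -mulrA.
    by apply: ler_piMr; [exact: ltW|rewrite mulrC ler_pdivrMr// mul1r lerDl].
  apply: (le_trans (ler_l2normD _ _)).
  have s2 := small _ _ us h'2; have s1 := small s0 _ us0 h1; have s3 := small s0 _ us0 h'1.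
  rewrite [leRHS]fifthE.
  apply: lerD => //; apply: (le_trans (norm_fin_le _ us)).
  have -> : h - h' = (h - pr s0 h) - (h' - pr s0 h') + (fin s0 (fun x => h x - k x) - fin s0 (fun x => h' x - k x)).
    apply: l2P => x; rewrite !(l2DE, l2NE) !pr_coord// !finE//; case: ifP => _; ring.
  apply: (le_trans (ler_l2normD _ _)).
  rewrite addrA; apply: lerD; apply: (le_trans (ler_l2normB _ _)); apply: lerD => //; exact: hs0.
have [h1 hh1] : exists h, (forall s, uniq s -> l2norm (fin s (fun x => h x - k x)) <= 1) by exact: filter_ex (cauchy _ ltr01).
have kb s : uniq s -> fsq k s <= (l2norm h1 + 1) ^+ 2.
  move=> us; rewrite -(norm_fin _ us) ler_sqr ?nnegrE ?l2norm_ge0 ?addr_ge0 ?l2norm_ge0//.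
  have -> : fin s k = pr s h1 - fin s (fun x => h1 x - k x).
    by apply: l2P => x; rewrite l2BE pr_coord// !finE//; case: ifP => _; ring.
  by apply: (le_trans (ler_l2normB _ _)); apply: lerD; [exact: norm_fin_le|exact: hh1].
have kE := mkE kb; exists (mk k).
have cvk : F --> mk k.
  move=> N /nbhs_l2[e e0 hN]; have e2 : 0 < e / 2 by rewrite divr_gt0.
  apply: filterS (cauchy _ e2) => h hh; apply: hN.
  rewrite -l2normN opprB; apply: (@le_lt_trans _ _ (e / 2)).
    apply: l2norm_le; first exact: ltW.
    move=> s us; rewrite -(norm_fin _ us) ler_sqr ?nnegrE ?l2norm_ge0//; last exact: ltW.
    have -> : fin s (h - mk k) = fin s (fun x => h x - k x); last exact (hh s us).
    by apply: l2P => x; rewrite !finE// l2BE kE.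
  by rewrite ltr_pdivrMr// ltr_pMr// ltr1n.
split; last exact: cvk.
have -> : K = closure K by apply/closure_id; exact: closed_closure.
by move=> N /cvk FN; exact: filter_ex (filterI FK FN).
Qed.

Lemma compact_opE T : compact_op T <-> rfa T.
Proof.
split=> [/compact_op_lfa/lfa_rfa//|/rfa_lfa]; exact: lfa_compact_op.
Qed.

End CompactOperators.

(** * Operators of partial injections and indicator projections *)

Section PartialInjections.
Context {R : realType} {X Y : choiceType}.
Local Notation C := R[i].
Local Open Scope ring_scope.
Local Open Scope complex_scope.

Definition biuniq (X' Y' : Type) (r : X' -> Y' -> Prop) :=
  (forall x y y', r x y -> r x y' -> y = y') /\ (forall x x' y, r x y -> r x' y -> x = x').

Definition rel_preimage (r : X -> Y -> Prop) (y : Y) : option X :=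
  if pselect (exists x, r x y) is left e then Some (sval (cid e)) else None.

(* The operator delta x |-> w y *: delta y for r x y, and delta x |-> 0 if there is no such y. *)
Definition pio (r : X -> Y -> Prop) (w : Y -> C) : l2 R X -> l2 R Y :=
  wpi (rel_preimage r) w.

Variables (r : X -> Y -> Prop) (w : Y -> C) (M : R).
Hypothesis hr : biuniq r.
Hypothesis wM : forall y, cabs (w y) <= M.
Hypothesis M0 : 0 <= M.

Let preim_inj y y' x : rel_preimage r y = Some x -> rel_preimage r y' = Some x -> y = y'.
Proof.
rewrite /rel_preimage; case: pselect => // e [<-]; case: pselect => // e' [ee].
have [h1 _] := hr; apply: (h1 (sval (cid e))); first exact: (svalP (cid e)).
by rewrite -ee; exact: (svalP (cid e')).
Qed.

Lemma pioE x y f : r x y -> pio r w f y = w y * f x.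
Proof.
move=> rxy; rewrite /pio (wpiE preim_inj wM M0) /rel_preimage.
case: pselect => [e|[]]; last by exists x.
by rewrite (hr.2 _ _ _ ((svalP (cid e))) rxy).
Qed.

Lemma pio0 y f : (forall x, ~ r x y) -> pio r w f y = 0.
Proof.
move=> h; rewrite /pio (wpiE preim_inj wM M0) /rel_preimage.
by case: pselect => // e; have [x /h] := e.
Qed.

Lemma pio_bdd : bdd (pio r w) M. Proof. exact (wpi_bdd preim_inj wM M0). Qed.

Lemma pio_delta x y : r x y -> pio r w (delta x) = w y *: delta y.
Proof.
move=> rxy; apply: l2P => z; have [[x' rz]|nz] := pselect (exists x', r x' z).
  rewrite (pioE _ rz) l2ZE /=; have [xx|xx] := eqVneq x' x.
    by rewrite xx in rz; rewrite (hr.1 _ _ _ rz rxy) eqxx.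
  have [zy|] := eqVneq z y; last by rewrite !mulr0.
  by case/eqP: xx; apply: hr.2 rz _; rewrite zy.
rewrite pio0; last by move=> x' rz; apply: nz; exists x'.
rewrite l2ZE /=; have [zy|] := eqVneq z y; last by rewrite mulr0.
by case: nz; exists x; rewrite zy.
Qed.

Lemma pio_delta0 x : (forall y, ~ r x y) -> pio r w (delta x) = 0.
Proof.
move=> h; apply: l2P => z; have [[x' rz]|nz] := pselect (exists x', r x' z).
  rewrite (pioE _ rz) /=; have [xx|] := eqVneq x' x; last by rewrite mulr0.
  by case: (h z); rewrite -xx.
by rewrite pio0// => x' rz; apply: nz; exists x'.
Qed.

End PartialInjections.

Section UnweightedInjections.
Context {R : realType}.
Local Notation C := R[i].
Local Open Scope ring_scope.
Local Open Scope complex_scope.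

Definition pin (X Y : choiceType) (r : X -> Y -> Prop) : l2 R X -> l2 R Y := pio r (fun=> 1).

Section Basic.
Context {X Y : choiceType}.
Variable r : X -> Y -> Prop.
Hypothesis hr : biuniq r.
Let one_le (y : Y) : cabs (1 : C) <= (1 : R). Proof. by rewrite cabs1. Qed.

Lemma pinE x y f : r x y -> pin r f y = f x.
Proof. by move=> rxy; rewrite /pin (pioE hr one_le ler01 _ rxy) mul1r. Qed.
Lemma pin0 y f : (forall x, ~ r x y) -> pin r f y = 0.
Proof. exact: (pio0 hr one_le ler01). Qed.
Lemma pin_bdd : bdd (pin r) 1.
Proof. exact: (pio_bdd hr one_le ler01). Qed.
Lemma pin_delta x y : r x y -> pin r (delta x) = delta y.
Proof. by move=> rxy; rewrite /pin (pio_delta hr one_le ler01 rxy) scale1r. Qed.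
Lemma pin_delta0 x : (forall y, ~ r x y) -> pin r (delta x) = 0.
Proof. exact: (pio_delta0 hr one_le ler01). Qed.

Lemma biuniqV : biuniq (fun y x => r x y).
Proof. by split=> [y x x' a b|y y' x a b]; [exact: hr.2 a b|exact: hr.1 a b]. Qed.

End Basic.

Lemma pin_ext (X Y : choiceType) (r r' : X -> Y -> Prop) :
  (forall x y, r x y <-> r' x y) -> pin r = pin r'.
Proof.
by move=> e; congr pin; apply/funext => x; apply/funext => y; apply/propext.
Qed.

Lemma biuniq_comp (X Y Z : Type) (r : X -> Y -> Prop) (s : Y -> Z -> Prop) :
  biuniq r -> biuniq s -> biuniq (fun x z => exists2 y, r x y & s y z).
Proof.
move=> [r1 r2] [s1 s2]; split=> [x z z' [y a b] [y' a' b']|x x' z [y a b] [y' a' b']].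
  by rewrite (r1 _ _ _ a a') in b; exact: s1 b b'.
by rewrite (s2 _ _ _ b b') in a; exact: r2 a a'.
Qed.

Lemma pin_comp (X Y Z : choiceType) (r : X -> Y -> Prop) (s : Y -> Z -> Prop) :
  biuniq r -> biuniq s -> pin s \o pin r = pin (fun x z => exists2 y, r x y & s y z).
Proof.
move=> hr hs; have hc := biuniq_comp hr hs; apply/funext => f; apply: l2P => z /=.
have [[y syz]|nz] := pselect (exists y, s y z); last first.
  rewrite !pin0// => [x [y _ syz]|y syz]; apply: nz; by exists y.
rewrite (pinE hs _ syz); have [[x rxy]|nx] := pselect (exists x, r x y).
  by rewrite (pinE hr _ rxy); symmetry; apply: (pinE hc); exists y.
rewrite !pin0// => [x [y' rxy syz']|x rxy]; apply: nx; exists x => //.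
by rewrite (hs.2 _ _ _ syz syz').
Qed.

Lemma pin_isometry (X Y : choiceType) (r : X -> Y -> Prop) f : biuniq r ->
  (forall x, exists y, r x y) -> l2norm (pin r f) = l2norm f.
Proof.
move=> hr tr; have hV := biuniqV hr; apply/eqP; rewrite eq_le.
have -> /= : l2norm (pin r f) <= l2norm f by have := (pin_bdd hr).2 f; rewrite mul1r.
have {1}-> : f = pin (fun y x => r x y) (pin r f).
  apply: l2P => x; have [y rxy] := tr x.
  by rewrite (@pinE _ _ _ hV y x)// (pinE hr _ rxy).
by have := (pin_bdd hV).2 (pin r f); rewrite mul1r.
Qed.

Lemma pin_bounded (X : choiceType) (r : X -> X -> Prop) : biuniq r -> bounded_op (pin r).
Proof. by move=> hr; apply: (bounded_bdd ler01); exact: pin_bdd. Qed.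

Lemma pin_adj (X : choiceType) (r : X -> X -> Prop) : biuniq r ->
  adjoint (pin r) = pin (fun y x => r x y).
Proof.
move=> hr; have hV := biuniqV hr; apply: (adjoint_uniq (pin_bounded hr)) => f g.
apply: (inner_continuous_l (pin_bdd hr)) => x.
rewrite [RHS]innerC inner_delta; have [[y rxy]|nx] := pselect (exists y, r x y).
  by rewrite (pin_delta hr rxy) (@pinE _ _ _ hV y x)// innerC inner_delta.
rewrite (pin_delta0 hr) ?inner0l ?pin0 ?conjc0//; by [move=> y ?; apply: nx; exists y].
Qed.

Definition ind (X : choiceType) (Z : set X) : l2 R X -> l2 R X := pin (fun x y => x = y /\ Z x).

Section Indicator.
Context {X : choiceType}.
Implicit Type Z : set X.

Lemma ind_biuniq Z : biuniq (fun x y => x = y /\ Z x).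
Proof. by split=> [x y y' [<- _] [<- _]|x x' y [-> _] [-> _]]. Qed.

Lemma indE Z f x : Z x -> ind Z f x = f x.
Proof. by move=> Zx; apply: (pinE (@ind_biuniq Z)). Qed.

Lemma indN Z f x : ~ Z x -> ind Z f x = 0.
Proof. by move=> Zx; apply: (pin0 (@ind_biuniq Z)) => y [yx Zy]; apply: Zx; rewrite -yx. Qed.

Lemma ind_bounded Z : bounded_op (ind Z). Proof. exact: pin_bounded (@ind_biuniq Z). Qed.

Lemma ind_adj Z : adjoint (ind Z) = ind Z.
Proof.
rewrite (pin_adj (@ind_biuniq Z)); apply: pin_ext => x y.
by split=> -[<-].
Qed.

Lemma ind_idem Z : ind Z \o ind Z = ind Z.
Proof.
apply/funext => f; apply: l2P => x /=; have [Zx|nZ] := pselect (Z x); first by rewrite !indE.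
by rewrite !indN.
Qed.

Lemma ind_opnorm Z : opnorm (ind Z) <= 1.
Proof. exact: bdd_opnorm ler01 (pin_bdd (@ind_biuniq Z)). Qed.

Lemma rfa_ind_finite Z : rfa (ind Z) -> finite_set Z.
Proof.
move=> [_ /(_ 2^-1)[|s us hs]]; first by rewrite invr_gt0.
apply: (@sub_finite_set _ _ [set` s]) => [x Zx|]; last exact: finite_seq.
apply: contrapT => /= /negP xs.
have : l2norm (opB (ind Z) (ind Z \o pr s) (delta x)) <= 2^-1 * l2norm (delta x : l2 R X).
  apply: (le_trans (opnormP _ _)).
    by apply: bounded_opB; [|apply: bounded_opM; last exact: pr_bounded]; exact: ind_bounded.
  by rewrite ler_wpM2r ?l2norm_ge0.
have e0 : pr s (delta x : l2 R X) = 0.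
  apply: l2P => y; rewrite pr_coord//; case: ifP => // ys; rewrite /=.
  by have [yx|//] := eqVneq y x; rewrite yx (negbTE xs) in ys.
have e1 : ind Z (delta x) = delta x by apply: (pin_delta (@ind_biuniq Z)).
rewrite /opB /= e0 (lin0 (ind_bounded Z).1) subr0 e1 l2norm_delta mulr1.
by move=> h; have : (1 : R) <= 2^-1 := h; lra.
Qed.

End Indicator.
End UnweightedInjections.
Arguments pin {R X Y}.
Arguments ind {R X}.

(** * A criterion for pure infiniteness *)

Section PureInfiniteness.
Context {R : realType} {X : choiceType}.
Local Notation H := (l2 R X).
Local Notation C := R[i].
Local Notation B := (bounded_ops R X).
Local Open Scope ring_scope.
Local Open Scope complex_scope.
Implicit Types (S T U a b w z f : H -> H).
Variable D : set (H -> H).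
Hypothesis hD : @cstar_subalg R B D.
Local Notation AA := (sub_alg B D).

Section Ideals.
Variable J : set (H -> H).
Hypothesis hJ : @ideal R AA J.

Lemma ideal_sub a : J a -> D a. Proof. by case: hJ => -[h _ _ _] _ _ _; exact: h. Qed.
Lemma ideal_0 : J (fun=> 0). Proof. by case: hJ => -[]. Qed.
Lemma ideal_D a b : J a -> J b -> J (opD a b). Proof. by case: hJ => -[_ _ h _] _ _ _; exact: h. Qed.
Lemma ideal_Z c a : J a -> J (opZ c a). Proof. by case: hJ => -[_ _ _ h] _ _ _; exact: h. Qed.
Lemma ideal_B a b : J a -> J b -> J (opB a b).
Proof. by move=> Ja Jb; rewrite opBE; apply: ideal_D => //; exact: ideal_Z. Qed.
Lemma ideal_Ml a b : D a -> J b -> J (a \o b). Proof. by case: hJ => _ h _ _; exact: h. Qed.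
Lemma ideal_Mr a b : D a -> J b -> J (b \o a). Proof. by case: hJ => _ _ h _; exact: h. Qed.
Lemma ideal_closed a : D a -> (forall e : R, 0 < e -> exists2 b, J b & opnorm (opB a b) < e) -> J a.
Proof.
case: hJ => _ _ _ h Da ha; apply: h; split; first exact: Da.
by move=> e /ha[b Jb hb]; exists b; [exact: Jb|rewrite -asubE in hb].
Qed.

End Ideals.

Lemma idealI (J : set (H -> H)) : (forall a, J a -> D a) -> J (fun=> 0) ->
  (forall a b, J a -> J b -> J (opD a b)) -> (forall c a, J a -> J (opZ c a)) ->
  (forall a b, D a -> J b -> J (a \o b)) -> (forall a b, D a -> J b -> J (b \o a)) ->
  (forall a, D a -> (forall e : R, 0 < e -> exists2 b, J b & opnorm (opB a b) < e) -> J a) ->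
  @ideal R AA J.
Proof.
move=> h1 h2 h3 h4 h5 h6 h7; split.
- by split; [exact: h1|exact: h2|exact: h3|exact: h4].
- exact: h5.
- exact: h6.
- move=> a [Da ha]; apply: h7; first exact: Da.
  by move=> e /ha[b Jb hb]; exists b; [exact: Jb|rewrite -asubE].
Qed.

(** * Simplicity modulo J from one projection to which all operators outside J can be cut *)

Section Criterion.
Variables (J : set (H -> H)) (f w : H -> H).
Hypothesis hJ : @ideal R AA J.
Hypothesis Df : D f.
Hypothesis ff : adjoint f = f.
Hypothesis f2 : f \o f = f.
Hypothesis nJf : ~ J f.
Hypothesis cut : forall T, D T -> ~ J T -> exists2 z, D z &
  z \o adjoint T \o T \o adjoint z = f /\ f \o z = z.
Hypothesis Dw : D w.
Hypothesis w1 : adjoint w \o w = f.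
Hypothesis fw : f \o w = w.
Hypothesis wf : w \o f = w.
Hypothesis inf_f : ~ J (opB f (w \o adjoint w)).
Hypothesis full : forall I, @ideal R AA I -> I f -> I = D.

Lemma ideal_full I T : @ideal R AA I -> I T -> ~ J T -> I = D.
Proof.
move=> hI IT nJT; have DT := ideal_sub hI IT; have [z Dz [e _]] := cut DT nJT.
apply: full => //; rewrite -e; apply: (ideal_Mr hI); first exact: (csub_adj hD Dz).
exact: (ideal_Ml hI (csubM hD Dz (csub_adj hD DT)) IT).
Qed.

Lemma only_ideal : (forall I, @ideal R AA I -> I <> [set (fun=> 0)] -> J `<=` I) ->
  J <> [set (fun=> 0)] -> @only_nontrivial_ideal R AA J.
Proof.
move=> hmin J0 I; split=> [[hI I0 ID]|->]; last first.
  by split=> // e; apply: nJf; rewrite e.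
apply/seteqP; split; last exact: hmin.
move=> T IT; apply: contrapT => nJT; apply: ID; exact: ideal_full IT nJT.
Qed.

(** The operator is T (M - z^* z) T^* with M > norm(z)^2. The square root of M - z^* z is sqrt(M) (1
    - d) with d from [half_sqrt]. The inequality places u u^* below a multiple of T T^* for u = T
    z^*, hence in the hereditary subalgebra. *)
Lemma positive_gap T z : D T -> D z -> exists (M : R) y, D y /\
  opB (opZ M%:C (T \o adjoint T)) (T \o adjoint z \o z \o adjoint T) = adjoint y \o y.
Proof.
move=> DT Dz; pose M := opnorm z * opnorm z + 1.
have M0 : 0 < M by rewrite ltr_wpDl// mulr_ge0 ?opnorm_ge0.
have bz := csub_bounded hD Dz; have bT := csub_bounded hD DT.
have Dzz : D (adjoint z \o z) by apply: csubM => //; exact: csub_adj.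
have bzz := csub_bounded hD Dzz.
pose x := opZ (M^-1)%:C (adjoint z \o z).
have [||d Dd [dd _ ed]] := @half_sqrt R X D x hD (csubZ hD _ Dzz).
- by rewrite adjZ// adjM ?adjK//; [rewrite conjc_real|exact: adjoint_bounded].
- apply: (le_lt_trans (opnormZ _ bzz)); rewrite cabs_real ger0_norm ?invr_ge0 ?ltW//.
  rewrite mulrC ltr_pdivrMr// mul1r; apply: (le_lt_trans (opnormM (adjoint_bounded bz) bz)).
  by rewrite opnorm_adjE// ltrDl.
pose s : C := (Num.sqrt M)%:C; pose y := opZ s (opB (adjoint T) (d \o adjoint T)).
have bd := csub_bounded hD Dd; have bTs := adjoint_bounded bT.
exists M, y; split.
  apply: csubZ => //; apply: csubB => //; first exact: csub_adj.
  by apply: csubM => //; exact: csub_adj.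
have bdT := bounded_opM bd bTs.
have -> : adjoint y = opZ s (opB T (T \o d)).
  rewrite /y adjZ; last exact: bounded_opB.
  by rewrite adjB// adjM// adjK// dd /s conjc_real.
apply/funext => h; set g := adjoint T h.
have ss : s * s = M%:C by rewrite /s -rmorphM /= -expr2 sqr_sqrtr ?ltW.
have Mx : M%:C *: x g = adjoint z (z g).
  by rewrite /x /opZ scalerA -rmorphM /= divff ?gt_eqF// scale1r.
rewrite /y /opB /opZ /= -/g (linZ bT.1) (linZ bd.1) (linZ bT.1) -scalerBr scalerA ss.
rewrite -Mx (linZ bT.1) -scalerBr; congr (_ *: _).
rewrite !(linB bT.1) ed (linB bT.1) (linD bT.1) !(linB bd.1) (linB bT.1); l2ring.
Qed.

Section Quotient.
Variables (Q : star_alg R) (k : AA -> Q).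
Hypothesis hk : star_hom k.
Hypothesis sk : forall E, elts Q E -> exists2 a, D a & k a = E.
Hypothesis k0 : forall a, D a -> k a = azero <-> J a.
Hypothesis nk : forall a, D a -> anorm (k a) <= opnorm a.

Let kD a b : D a -> D b -> k (opD a b) = aadd (k a) (k b). Proof. by case: hk => _ h _ _ _; exact: h. Qed.
Let kZ c a : D a -> k (opZ c a) = ascale c (k a). Proof. by case: hk => _ _ h _ _; exact: h. Qed.
Let kM a b : D a -> D b -> k (a \o b) = amul (k a) (k b). Proof. by case: hk => _ _ _ h _; exact: h. Qed.
Let kA a : D a -> k (adjoint a) = astar (k a). Proof. by case: hk => _ _ _ _ h; exact: h. Qed.
Let kE a : D a -> elts Q (k a). Proof. by case: hk => h _ _ _ _; exact: h. Qed.
Let kB a b : D a -> D b -> k (opB a b) = asub (k a) (k b).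
Proof. by move=> Da Db; rewrite opBE kD ?kZ//; exact: csubZ. Qed.
Let k00 : k (fun=> 0) = azero. Proof. by apply/k0; [exact: csub0|exact: ideal_0]. Qed.
Let kJ a b : D a -> D b -> k a = k b -> J (opB a b).
Proof.
move=> Da Db e; apply/k0; first exact: csubB.
rewrite kB// e -kB// -k00; congr k; apply/funext => h; exact: subrr.
Qed.

Let quotient_simple : simple Q.
Proof.
split=> [e|I [hI I0 IQ]].
  by apply: nJf; apply/k0 => //; have : [set azero] (k f) by rewrite -e; exact: kE.
pose I' : set (H -> H) := [set a | D a /\ I (k a)].
case: hI => -[IE I00 ID IZ] IMl IMr Icl.
have hI' : @ideal R AA I'.
  apply: idealI => [a []//||a b [Da Ia] [Db Ib]|c a [Da Ia]|a b Da [Db Ib]|a b Da [Db Ib]|a Da ha].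
  - by split; [exact: csub0|rewrite k00].
  - by split; [exact: csubD|rewrite kD//; exact: ID].
  - by split; [exact: csubZ|rewrite kZ//; exact: IZ].
  - by split; [exact: csubM|rewrite kM//; apply: IMl => //; exact: kE].
  - by split; [exact: csubM|rewrite kM//; apply: IMr => //; exact: kE].
  - split; first exact: Da.
    apply: Icl; split; first exact: kE.
    move=> e /ha[b [Db Ib] hb]; exists (k b); first exact: Ib.
    by rewrite -kB//; apply: le_lt_trans hb; apply: nk; exact: csubB.
have [[T [I'T nJT]]|nT] := pselect (exists T, I' T /\ ~ J T).
  have e := ideal_full hI' I'T nJT; apply: IQ; apply/seteqP; split=> // E /sk[a Da <-].
  have Ia : I' a by rewrite e; exact: Da.
  exact: Ia.2.
apply: I0; apply/seteqP; split=> [E IE'|E ->//].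
have [a Da ea] := sk (IE _ IE'); rewrite -ea; apply/k0 => //.
by apply: contrapT => nJa; apply: nT; exists a; split=> //; split=> //; rewrite ea.
Qed.

(** Let T lift a non-zero element of the hereditary subalgebra and let z cut T to f. Then u = T z^*
    satisfies u^* u = f, the projection q = u u^* lies below a multiple of T T^*, and v = u w u^*
    makes q equivalent to its subprojection q' = u w w^* u^*. The abstract quotient map k covers the
    algebra itself and its quotient by J alike. *)
Theorem quotient_purely_infinite : purely_infinite_simple Q.
Proof.
split; first exact: quotient_simple.
move=> Bh [[[BE B0 BD BZ] BM BA _] hB] Bn0.
have [E BhE E0] : exists2 E, Bh E & E <> azero.
  apply: contrapT => h; apply: Bn0; apply/seteqP; split=> [E BhE|E ->//].
  by apply: contrapT => E0; apply: h; exists E.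
have [T DT eT] := sk (BE _ BhE).
have nJT : ~ J T by move/(k0 DT); rewrite eT.
have [z Dz [zf fz]] := cut DT nJT.
have bT := csub_bounded hD DT; have bz := csub_bounded hD Dz; have bw := csub_bounded hD Dw.
have DTs := csub_adj hD DT; have Dzs := csub_adj hD Dz; have Dws := csub_adj hD Dw.
pose u := T \o adjoint z; have Du : D u by exact: csubM.
have us : adjoint u = z \o adjoint T by rewrite adjM ?adjK//; exact: adjoint_bounded.
have Dus : D (adjoint u) by exact: csub_adj.
have usu : adjoint u \o u = f by rewrite us; exact: zf.
have uf : u \o f = u.
  by rewrite -{2}fz -ff in zf *; rewrite /u -compA -{1}(adjK (csub_bounded hD Df)) -adjM ?ff ?fz//; exact: (csub_bounded hD Df).
have fus : f \o adjoint u = adjoint u by rewrite us compA fz.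
pose q := u \o adjoint u; have Dq : D q by exact: csubM.
pose v := u \o w \o adjoint u; have Dv : D v by apply: csubM => //; exact: csubM.
pose q' := u \o (w \o adjoint w) \o adjoint u.
have Dq' : D q' by apply: csubM => //; apply: csubM => //; exact: csubM.
have vs : adjoint v = u \o adjoint w \o adjoint u.
  have bu := csub_bounded hD Du; have bus := csub_bounded hD Dus.
  by rewrite /v (adjM (bounded_opM bu bw) bus) (adjM bu bw) (adjK bu).
have fE g : f g = adjoint u (u g) by rewrite -[RHS]/((adjoint u \o u) g) usu.
have fwE g : f (w g) = w g by rewrite -[LHS]/((f \o w) g) fw.
have wfE g : w (f g) = w g by rewrite -[LHS]/((w \o f) g) wf.
have w1E g : adjoint w (w g) = f g by rewrite -[LHS]/((adjoint w \o w) g) w1.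
have ufE g : u (f g) = u g by rewrite -[LHS]/((u \o f) g) uf.
have fusE g : f (adjoint u g) = adjoint u g by rewrite -[LHS]/((f \o adjoint u) g) fus.
have fwsE g : f (adjoint w g) = adjoint w g.
  have bf := csub_bounded hD Df.
  have e : f \o adjoint w = adjoint w by rewrite -{1}ff -(adjM bw bf) wf.
  by rewrite -[LHS]/((f \o adjoint w) g) e.
have wsf g : adjoint w (f g) = adjoint w g.
  have bf := csub_bounded hD Df.
  have e : adjoint w \o f = adjoint w by rewrite -{1}ff -(adjM bf bw) fw.
  by rewrite -[LHS]/((adjoint w \o f) g) e.
have qs : adjoint q = q by rewrite /q adjM ?adjK//; exact: (csub_bounded hD).
have qq : q \o q = q by apply/funext => g; rewrite /q /= -fE fusE.
have q's : adjoint q' = q'.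
  have bu := csub_bounded hD Du; have bus := csub_bounded hD Dus.
  have bww := bounded_opM bw (adjoint_bounded bw).
  rewrite /q' (adjM (bounded_opM bu bww) bus) (adjM bu bww) (adjK bu).
  by rewrite (adjM bw (adjoint_bounded bw)) (adjK bw).
have q'q' : q' \o q' = q'.
  by apply/funext => g; rewrite /q' /= -fE fwE w1E fwsE.
have pq : projection (k q) by split; [exact: kE|rewrite -kA// qs|rewrite -kM// qq].
have [M [y [Dy ey]]] := positive_gap DT Dz.
exists (k q).
  have DTT : D (T \o adjoint T) by exact: csubM.
  apply: (hB _ (ascale M%:C (amul E (astar E)))); last by apply/BZ/BM => //; exact: BA.
    exists (k (adjoint u)); first exact: kE.
    have e := adjK (csub_bounded hD Du).
    by rewrite -kA// -kM// e.
  exists (k y); first exact: kE.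
  rewrite -eT -kA// -kM// -kZ// -kB//; last exact: csubZ.
  have -> : amul (astar (k y)) (k y) = k (adjoint y \o y).
    by rewrite (kM (csub_adj hD Dy) Dy) (kA Dy).
  by congr k; rewrite -ey /q us.
split=> //; exists (k v), (k q'); split.
- exact: kE.
- by split; [exact: kE|rewrite -kA// q's|rewrite -kM// q'q'].
- rewrite -kA// -kM//; last exact: csub_adj.
  by congr k; apply/funext => g; rewrite vs /v /q /= -fE fwE w1E -[in RHS]fusE ufE.
- rewrite -kA// -kM//; last exact: csub_adj.
  by congr k; apply/funext => g; rewrite vs /v /q' /= -fE wfE.
- split; first by rewrite -kM//; congr k; apply/funext => g; rewrite /q /q' /= -fE fwE.
  (* Compressing q - q' by u returns f - w w^*, so q and q' cannot agree modulo J. *)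
  move=> e; apply: inf_f; have Jq : J (opB q q') by apply: kJ.
  have -> : opB f (w \o adjoint w) = adjoint u \o opB q q' \o u.
    have bu := csub_bounded hD Du; have bus := csub_bounded hD Dus.
    apply/funext => g; rewrite /opB /q /q' /= (linB bus.1) -!fE fwE wsf.
    by rewrite -[in RHS]ff -[in LHS](congr1 (@^~ g) f2) /= ff.
  by apply: (ideal_Mr hJ) => //; exact: ideal_Ml.
Qed.

End Quotient.

Lemma purely_infinite : J = [set (fun=> 0)] -> purely_infinite_simple AA.
Proof.
move=> J0; apply: (@quotient_purely_infinite AA id); rewrite ?J0//.
by move=> E DE; exists E.
Qed.

Hypothesis Js : forall a, J a -> J (adjoint a).

Lemma cosetP a c : @coset R AA J a c <-> J (opB c a).
Proof.
split=> [[j Jj <-]|Jc].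
  have e : opB (opD a j) a = j by apply/funext => g; rewrite /opB /opD addrAC subrr add0r.
  by rewrite -e in Jj; exact: Jj.
exists (opB c a); first exact: Jc.
by apply/funext => g; rewrite /opB /= addrC subrK.
Qed.

Lemma quotient_alg_purely_infinite : purely_infinite_simple (quotient_alg AA J).
Proof.
have Jsub := ideal_sub hJ; have J0 := ideal_0 hJ.
have opBB a : opB a a = fun=> 0 by apply/funext => g; exact: subrr.
have self a : @coset R AA J a a by apply/cosetP; rewrite opBB.
have Dco a c : D a -> @coset R AA J a c -> D c.
  move=> Da /cosetP/Jsub h; have -> : c = opD a (opB c a) by apply/funext => g; rewrite /opD /opB addrC subrK.
  exact: csubD.
apply: (@quotient_purely_infinite (quotient_alg AA J) (@coset R AA J)).
- split=> [a Da|a b Da Db|c a Da|a b Da Db|a Da].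
  + by exists a.
  + apply/seteqP; split=> [x /cosetP Jx|x [a' [b' [/cosetP Ja /cosetP Jb ->]]]].
      exists a, (opB x a); split=> //.
        by apply/cosetP; move: Jx; congr J; apply/funext => g; rewrite /opB /=; l2ring.
      by apply/funext => g; rewrite /opB /=; l2ring.
    apply/cosetP; have := ideal_D hJ Ja Jb; congr J; apply/funext => g; rewrite /opB /opD /=; l2ring.
  + apply/seteqP; split=> [x /cosetP Jx|x [a' [j [/cosetP Ja Jj ->]]]].
      exists a, (opB x (opZ c a)); split=> //.
      by apply/funext => g; rewrite /opB /opZ /=; l2ring.
    apply/cosetP; have := ideal_D hJ (ideal_Z hJ c Ja) Jj; congr J.
    by apply/funext => g; rewrite /opB /opD /opZ /=; l2ring.
  + apply/seteqP; split=> [x /cosetP Jx|x [a' [b' [j [ca cb Jj ->]]]]].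
      exists a, b, (opB x (a \o b)); split=> //.
      by apply/funext => g; rewrite /opB /=; l2ring.
    have /cosetP Ja := ca; have /cosetP Jb := cb; apply/cosetP.
    have h := ideal_D hJ (ideal_D hJ (ideal_Mr hJ (Dco _ _ Db cb) Ja) (ideal_Ml hJ Da Jb)) Jj.
    move: h; congr J; apply/funext => g; rewrite /opB /opD /= (linB (csub_bounded hD Da).1); l2ring.
  + have ba := csub_bounded hD Da.
    apply/seteqP; split=> [x /cosetP Jx|x [a' ca <-]].
      have Dx : D x by apply: (Dco (adjoint a)); [exact: csub_adj|apply/cosetP].
      have bx := csub_bounded hD Dx.
      exists (adjoint x); last exact: adjK.
      apply/cosetP; have := Js Jx; rewrite adjB ?adjK//; exact: adjoint_bounded.
    have ba' := csub_bounded hD (Dco _ _ Da ca); move/cosetP: ca => Ja.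
    by apply/cosetP; rewrite -[astar a']/(adjoint a') -adjB//; exact: Js.
- by move=> E [a Da <-]; exists a.
- move=> a Da; split=> [e|Ja].
    have : @coset R AA J a a by []. rewrite e => h; exact: h.
  apply/seteqP; split=> [x /cosetP Jx|x Jx].
    have -> : x = opD a (opB x a) by apply/funext => g; rewrite /opD /opB addrC subrK.
    exact: ideal_D.
  by apply/cosetP; exact: ideal_B.
- move=> a Da; apply: ge_inf; last by exists a.
  by exists 0 => _ [b _ <-]; exact: opnorm_ge0.
Qed.

End Criterion.
End PureInfiniteness.

(** * The inverse semigroup and its groupoids *)

Local Notation preim := (@Defs.preim _).

Section PartialBijections.
Variable P : monoidType.
Local Open Scope group_scope.
Implicit Types (p q r x y z : P) (s t : pbij P) (e : set P) (chi : char P).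

Definition mdiv x y := exists z, y = x * z.
Definition pP p : set P := [set x | mdiv p x].
(** The partial bijection q z |-> p z. When lcms exist, these and the empty map are all of I_l. *)
Definition wpq p q : pbij P := [set xy | exists z, xy.1 = q * z /\ xy.2 = p * z].

Lemma left_multE p x y : left_mult p (x, y) = (y = p * x). Proof. by []. Qed.
Lemma rcompE s t x y : (s \; t)%relation (x, y) = exists2 z, t (x, z) & s (z, y). Proof. by []. Qed.
Lemma rinvE s x y : (s^-1)%relation (x, y) = s (y, x). Proof. by []. Qed.
Lemma wpq_E p q x y : wpq p q (x, y) = exists z, x = q * z /\ y = p * z. Proof. by []. Qed.
Definition relE := (left_multE, rcompE, rinvE, wpq_E).

Hypothesis lc : forall x y z, x * y = x * z -> y = z.
Hypothesis rc : forall x y z, x * z = y * z -> x = y.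
Hypothesis lcmP : forall x y, (exists z, mdiv x z /\ mdiv y z) ->
  exists l, forall z, (mdiv x z /\ mdiv y z) <-> mdiv l z.

Lemma mdiv_refl x : mdiv x x. Proof. by exists 1; rewrite mulg1. Qed.
Lemma mdiv_trans x y z : mdiv x y -> mdiv y z -> mdiv x z.
Proof. by move=> [a ->] [b ->]; exists (a * b); rewrite mulgA. Qed.
Lemma mdivMr x y : mdiv x (x * y). Proof. by exists y. Qed.
Lemma mdiv1 x : mdiv 1 x. Proof. by exists x; rewrite mul1g. Qed.

Lemma Il_biuniq s : Il s -> biuniq (fun x y => s (x, y)).
Proof.
elim=> [p|s1 t1 _ h1 _ h2|s1 _ [h1 h2]].
- by split=> [x y y'|x x' y]; rewrite !relE => -> // /lc.
- exact: (biuniq_comp h2 h1).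
- by split=> [x y y'|x x' y]; rewrite !relE; [exact: h2|exact: h1].
Qed.

Lemma Il_mul s x y z : Il s -> s (x, y) -> s (x * z, y * z).
Proof.
move=> hs; elim: hs x y => [p x y|s1 t1 _ h1 _ h2 x y|s1 _ h x y]; rewrite !relE.
- by move=> ->; rewrite mulgA.
- by move=> [u /h2 tu /h1 su]; exists (u * z).
- exact: h.
Qed.

Lemma wpqE p q : wpq p q = (left_mult p \; (left_mult q)^-1)%relation.
Proof.
apply/seteqP; split=> -[x y]; rewrite !relE; first by move=> [z [-> ->]]; exists z.
by move=> [z]; rewrite !relE => -> ->; exists z.
Qed.

Lemma Il_wpq p q : Il (wpq p q).
Proof. by rewrite wpqE; apply: Il_comp; [exact: Il_left|apply: Il_inv; exact: Il_left]. Qed.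

(** After q' z |-> p' z, the map q z |-> p z is defined exactly on the multiples of the lcm l = p' a
    = q b, so the composite is q' a z |-> p b z; it is empty if there is no common multiple. *)
Lemma Il_form s : Il s -> s = set0 \/ exists p q, s = wpq p q.
Proof.
elim=> [p|s1 t1 _ h1 _ h2|s1 _ h].
- right; exists p, 1; apply/seteqP; split=> -[x y]; rewrite !relE.
    by move=> ->; exists x; rewrite mul1g.
  by move=> [z [-> ->]]; rewrite mul1g.
- case: h1 => [->|[p [q ->]]]; first by left; apply/seteqP; split=> // -[x y]; rewrite relE => -[].
  case: h2 => [->|[p' [q' ->]]]; first by left; apply/seteqP; split=> // -[x y]; rewrite relE => -[].
  have [cm|ncm] := pselect (exists z, mdiv p' z /\ mdiv q z); last first.
    left; apply/seteqP; split=> // -[x y]; rewrite relE => -[u]; rewrite !relE => -[z [_ ->]] [z' [e _]]; apply: ncm.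
    by exists (p' * z); split; [exact: mdivMr|exists z'].
  have [l hl] := lcmP cm; have [[a la] [b lb]] := (hl l).2 (mdiv_refl l).
  right; exists (p * b), (q' * a); apply/seteqP; split=> -[x y]; rewrite !relE.
    move=> [u]; rewrite !relE => -[z [-> ->]] [z' [e ->]].
    have [c ec] : mdiv l (p' * z) by apply/hl; split; [exact: mdivMr|exists z'].
    exists c; split.
      by rewrite -mulgA; congr (_ * _); apply: (lc (x := p')); rewrite ec la mulgA.
    by rewrite -mulgA; congr (_ * _); apply: (lc (x := q)); rewrite -e ec lb mulgA.
  move=> [z [-> ->]]; exists (l * z); rewrite relE; [exists (a * z)|exists (b * z)].
    by rewrite {1}la !mulgA.
  by rewrite {1}lb !mulgA.
- case: h => [->|[p [q ->]]]; first by left.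
  by right; exists q, p; apply/seteqP; split=> -[x y]; rewrite !relE => -[z [-> ->]]; exists z.
Qed.

Hypothesis rev : forall x y, exists z, mdiv x z /\ mdiv y z.

Lemma Il_wpq_rev s : Il s -> exists p q, s = wpq p q.
Proof.
elim=> [p|s1 t1 hs1 [p [q e1]] ht1 [p' [q' e2]]|s1 _ [p [q ->]]].
- case: (Il_form (Il_left p)) => // e.
  by have : left_mult p (1, p * 1) by []; rewrite e.
- case: (Il_form (Il_comp hs1 ht1)) => // e.
  have [z [[a ea] [b eb]]] := rev p' q.
  suff : (s1 \; t1)%relation (q' * a, p * b) by rewrite e.
  by exists z; [rewrite e2; exists a|rewrite e1; exists b].
- by exists q, p; apply/seteqP; split=> -[x y]; rewrite !relE => -[z [-> ->]]; exists z.
Qed.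

Lemma dom_wpq p q : dom (wpq p q) = pP q.
Proof.
apply/seteqP; split=> x /=; first by move=> [y [z [/= -> _]]]; exists z.
by move=> [z ->]; exists (p * z); exists z.
Qed.

Lemma constr_idealsE e : constr_ideals e <-> exists q, e = pP q.
Proof.
split=> [[s /Il_wpq_rev[p [q ->]] <-]|[q ->]]; first by exists q; exact: dom_wpq.
by exists (wpq 1 q); [exact: Il_wpq|exact: dom_wpq].
Qed.

Lemma pP_constr q : constr_ideals (pP q). Proof. by apply/constr_idealsE; exists q. Qed.

Lemma pPI p q : exists l, [/\ pP p `&` pP q = pP l, mdiv p l & mdiv q l].
Proof.
have [l hl] := lcmP (rev p q); have [pl ql] := (hl l).2 (mdiv_refl l).
exists l; split=> //; apply/seteqP; split=> x /=; first by move=> h; apply/hl.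
by move/hl.
Qed.

Lemma pP_sub p q : mdiv p q -> pP p `&` pP q = pP q.
Proof. by move=> pq; apply/seteqP; split=> [x []//|x qx]; split=> //; exact: mdiv_trans qx. Qed.

Lemma constr_idealsI e f : constr_ideals e -> constr_ideals f -> constr_ideals (e `&` f).
Proof.
move=> /constr_idealsE[p ->] /constr_idealsE[q ->].
by have [l [-> _ _]] := pPI p q; exact: pP_constr.
Qed.

Lemma constr_ideals_neq0 e : constr_ideals e -> e <> set0.
Proof.
by move=> /constr_idealsE[q ->] e0; have qq : pP q q := mdiv_refl q; rewrite e0 in qq.
Qed.

(** Since all constructible ideals are principal, a character amounts to the set of r with chi(rP) =
    1: closed under left divisors, and directed by lcms. *)
Definition ch chi r : Prop := chi (pP r).

Section Character.
Variable chi : char P.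
Hypothesis hchi : Jhat chi.

Lemma ch_ex : exists r, ch chi r.
Proof.
case: hchi => h1 [e ce] _ _; have /constr_idealsE[q eq] := h1 _ ce.
by exists q; rewrite /ch -eq.
Qed.

Lemma ch_div r r' : ch chi r -> mdiv r' r -> ch chi r'.
Proof.
rewrite /ch => cr /pP_sub e; case: hchi => _ _ _ hm; move: cr; rewrite -e hm; try exact: pP_constr.
by case/andP.
Qed.

Lemma ch_common r r' : ch chi r -> ch chi r' -> exists l, [/\ ch chi l, mdiv r l & mdiv r' l].
Proof.
move=> cr cr'; have [l [e rl r'l]] := pPI r r'; exists l; split=> //.
case: hchi => _ _ _ hm; rewrite /ch -e hm; try exact: pP_constr.
by apply/andP.
Qed.

Lemma ch1 : ch chi 1.
Proof. by have [r cr] := ch_ex; apply: ch_div cr _; exact: mdiv1. Qed.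

Lemma chi_dom s : Il s -> chi (dom s) <-> exists r x, ch chi r /\ s (r, x).
Proof.
move=> hs; have [p [q es]] := Il_wpq_rev hs; rewrite es dom_wpq.
split=> [cq|[r [x [cr [z [/= er _]]]]]].
  by exists q, p; split=> //; exists 1; rewrite !mulg1.
by apply: ch_div cr _; exists z.
Qed.

End Character.

Lemma char_ext (chi psi : char P) : (forall e, chi e -> constr_ideals e) -> (forall e, psi e -> constr_ideals e) ->
  (forall r, ch chi r <-> ch psi r) -> chi = psi.
Proof.
move=> h1 h2 h; apply/funext => e; apply/idP/idP => ce.
  by have /constr_idealsE[q eq] := h1 _ ce; move: ce; rewrite eq => /h.
by have /constr_idealsE[q eq] := h2 _ ce; move: ce; rewrite eq => /h.
Qed.

(** A principal ideal covered by finitely many constructible ideals inside it equals the one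
    containing its generator, so the covering condition on characters is automatic. *)
Lemma Omega_Jhat : @Omega P = @Jhat P.
Proof.
apply/seteqP; split=> [chi []//|chi hchi]; split=> // e fs he hfs eU ce.
have /constr_idealsE[q eq] := he.
have : e q by rewrite eq; exact: mdiv_refl.
rewrite eU => -[f /= ffs fq]; exists f => //.
suff <- : e = f by [].
apply/seteqP; split=> [x|x fx]; last by rewrite eU; exists f.
rewrite eq => -[z ->]; have /constr_idealsE[q' eq'] := hfs _ ffs.
by move: fq; rewrite eq' => -[a ->]; exists (a * z); rewrite mulgA.
Qed.

(* [arrow_at g chi r x]: the arrow g has source chi and maps the point r of the filter chi to x. *)
Definition arrow_at chi r x (g : set (pbij P * char P)) :=
  exists s, [/\ Il s, ch chi r, s (r, x) & g = germ s chi].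

Section Arrows.
Variable chi : char P.
Hypothesis hchi : Jhat chi.

Lemma germ_mem s : Il s -> chi (dom s) -> germ s chi (s, chi).
Proof.
move=> hs cs; split=> //=; exists (dom s); split=> //; by exists s.
Qed.

Lemma germ_sub s t r x : Il s -> Il t -> ch chi r -> s (r, x) -> t (r, x) ->
  germ s chi `<=` germ t chi.
Proof.
move=> hs ht cr sr tr [u psi] [/= hu -> cu [e [he ce hse]]]; split=> //=.
case: hchi => _ _ _ hm; exists (e `&` pP r); split.
- exact: constr_idealsI he (pP_constr r).
- by rewrite hm//; [apply/andP|exact: pP_constr].
- move=> a b [ea [z az]]; rewrite -hse// az.
  have s1 := Il_mul z hs sr; have t1 := Il_mul z ht tr.
  split=> h; first by rewrite ((Il_biuniq ht).1 _ _ _ h t1).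
  by rewrite ((Il_biuniq hs).1 _ _ _ h s1).
Qed.

Lemma germ_eq s t r x : Il s -> Il t -> ch chi r -> s (r, x) -> t (r, x) -> germ s chi = germ t chi.
Proof. by move=> hs ht cr sr tr; apply/seteqP; split; [exact: germ_sub cr sr tr|exact: germ_sub cr tr sr]. Qed.

Lemma germ_char s t psi : Il s -> germ t psi (s, chi) ->
  psi = chi /\ exists r x, [/\ ch chi r, s (r, x) & t (r, x)].
Proof.
move=> hs [/= _ e cs [i [hi ci h]]]; rewrite -e in cs ci *; split=> //.
have [r [x [cr sr]]] := (chi_dom hchi hs).1 cs.
have /constr_idealsE[q iq] := hi; rewrite iq in ci.
have [l [cl [a la] [b lb]]] := ch_common hchi cr ci.
exists l, (x * a); have sl : s (l, x * a) by rewrite la; exact: Il_mul.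
by split=> //; apply/h => //; rewrite iq; exists b.
Qed.

Lemma arrow_at_mul r x z g : arrow_at chi r x g -> ch chi (r * z) -> arrow_at chi (r * z) (x * z) g.
Proof. by move=> [s [hs cr sr ->]] crz; exists s; split=> //; exact: Il_mul. Qed.

Lemma arrow_at_fun r x x' g : arrow_at chi r x g -> arrow_at chi r x' g -> x = x'.
Proof.
move=> [s [hs cr sr ->]] [t [ht _ tr e]].
have cs : chi (dom s) by apply/(chi_dom hchi hs); exists r, x.
have := germ_mem hs cs; rewrite e => /(germ_char hs)[_ [l [y [cl sl tl]]]].
have [k [ck [a ka] [b kb]]] := ch_common hchi cr cl.
have s1 := Il_mul a hs sr; have s2 := Il_mul b hs sl; rewrite -ka in s1; rewrite -kb in s2.
have t1 := Il_mul a ht tr; have t2 := Il_mul b ht tl; rewrite -ka in t1; rewrite -kb in t2.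
apply: (rc (z := a)); rewrite ((Il_biuniq hs).1 _ _ _ s1 s2).
by rewrite ((Il_biuniq ht).1 _ _ _ t1 t2).
Qed.

Lemma arrow_at_inj r x g g' : arrow_at chi r x g -> arrow_at chi r x g' -> g = g'.
Proof. by move=> [s [hs cr sr ->]] [t [ht _ tr ->]]; exact: germ_eq cr sr tr. Qed.

Lemma arrow_at_ex r x : ch chi r -> exists g, arrow_at chi r x g.
Proof.
move=> cr; exists (germ (wpq x r) chi); exists (wpq x r); split=> //; first exact: Il_wpq.
by exists 1; rewrite !mulg1.
Qed.

Lemma arrow_at_source r x g psi r' x' : Jhat psi ->
  arrow_at chi r x g -> arrow_at psi r' x' g -> chi = psi.
Proof.
move=> hpsi [s [hs cr sr e]] [t [ht cr' tr' e']].
have cs : chi (dom s) by apply/(chi_dom hchi hs); exists r, x.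
by have := germ_mem hs cs; rewrite -e e' => -[/= _ -> _ _].
Qed.

Lemma arrow_at_common r x g r' x' g' : arrow_at chi r x g -> arrow_at chi r' x' g' ->
  exists l a b, [/\ l = r * a, l = r' * b, arrow_at chi l (x * a) g & arrow_at chi l (x' * b) g'].
Proof.
move=> h h'; have [s [hs cr sr e]] := h; have [t [ht cr' tr' e']] := h'.
have [l [cl [a la] [b lb]]] := ch_common hchi cr cr'; exists l, a, b; split=> //.
  by rewrite la; apply: arrow_at_mul => //; rewrite -la.
by rewrite lb; apply: arrow_at_mul => //; rewrite -lb.
Qed.

Lemma preim_pP s l : Il s -> preim s (pP l) = dom ((left_mult l)^-1 \; s)%relation.
Proof.
move=> hs; apply/seteqP; split=> x /=.
  by move=> [y sy [z e]]; exists z, y.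
by move=> [z [y sy e]]; exists y => //; exists z.
Qed.

Lemma act_ch s l : Il s -> ch (act s chi) l <-> exists r x, [/\ ch chi r, s (r, x) & mdiv l x].
Proof.
move=> hs; rewrite /ch /act preim_pP//.
have -> : `[< constr_ideals (pP l) >] = true by apply/asboolP; exact: pP_constr.
have hc : Il ((left_mult l)^-1 \; s)%relation by apply: Il_comp => //; apply/Il_inv/Il_left.
split=> [/(chi_dom hchi hc)[r [z [cr [x sr e]]]]|[r [x [cr sr [z e]]]]].
  by exists r, x; split=> //; exists z.
by apply/(chi_dom hchi hc); exists r, z; split=> //; exists x.
Qed.

Lemma act_constr s e : act s chi e -> constr_ideals e.
Proof. by rewrite /act => /andP[/asboolP]. Qed.

Lemma act_germ s t r x : Il s -> Il t -> ch chi r -> s (r, x) -> t (r, x) -> act s chi = act t chi.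
Proof.
move=> hs ht cr sr tr; apply: char_ext => [e /act_constr//|e /act_constr//|l].
have key u v : Il u -> Il v -> u (r, x) -> v (r, x) -> ch (act u chi) l -> ch (act v chi) l.
  move=> hu hv ur vr /(act_ch _ hu)[r' [x' [cr' ur' lx']]]; apply/(act_ch _ hv).
  have [k [ck [a ka] [b kb]]] := ch_common hchi cr cr'; exists k, (x * a); split=> //.
    by rewrite ka; exact: Il_mul.
  have u1 := Il_mul a hu ur; have u2 := Il_mul b hu ur'; rewrite -ka in u1; rewrite -kb in u2.
  by rewrite ((Il_biuniq hu).1 _ _ _ u1 u2); apply: mdiv_trans lx' (mdivMr _ _).
by split; exact: key.
Qed.

Lemma act_Jhat s : Il s -> chi (dom s) -> Jhat (act s chi).
Proof.
move=> hs cs; have [r [x [cr sr]]] := (chi_dom hchi hs).1 cs; split.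
- by move=> e /act_constr.
- by exists (pP x); apply/(act_ch _ hs); exists r, x; split=> //; exact: mdiv_refl.
- by apply/negP => /act_constr/constr_ideals_neq0.
- move=> e f he hf; rewrite /act; have -> : preim s (e `&` f) = preim s e `&` preim s f.
    apply/seteqP; split=> [y [z sz [ez fz]]|y [[z sz ez] [z' sz' fz']]]; first by split; exists z.
    by exists z => //; split=> //; rewrite ((Il_biuniq hs).1 _ _ _ sz sz').
  have pc i : constr_ideals i -> constr_ideals (preim s i).
    move=> /constr_idealsE[q ->]; rewrite preim_pP//.
    by eexists; last by []; apply: Il_comp => //; apply/Il_inv/Il_left.
  case: hchi => _ _ _ hm; rewrite hm; [|exact: pc|exact: pc].
  rewrite !asboolT//; exact: constr_idealsI.
Qed.

End Arrows.
End PartialBijections.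

(** * Operators on l2 of the groupoid attached to elements of I_l *)

Section GroupoidOperators.
Variables (R : realType) (P : monoidType).
Local Notation C := R[i].
Local Open Scope ring_scope.
Local Open Scope complex_scope.
Implicit Types (p q r x y z : P) (s t v : pbij P) (chi : char P).

Hypothesis lc : forall x y z : P, (x * y = x * z)%g -> y = z.
Hypothesis rc : forall x y z : P, (x * z = y * z)%g -> x = y.
Hypothesis lcmP : forall x y : P, (exists z, mdiv x z /\ mdiv y z) ->
  exists l, forall z, (mdiv x z /\ mdiv y z) <-> mdiv l z.

Definition opV v : l2 R P -> l2 R P := pin (fun x y => v (x, y)).

Lemma opV_comp s t : Il s -> Il t -> opV s \o opV t = opV (s \; t)%relation.
Proof. by move=> hs ht; rewrite /opV (pin_comp (Il_biuniq lc ht) (Il_biuniq lc hs)). Qed.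

Lemma opV_adj s : Il s -> adjoint (opV s) = opV (s^-1)%relation.
Proof. by move=> hs; rewrite /opV (pin_adj (Il_biuniq lc hs)). Qed.

Lemma opV_bounded s : Il s -> bounded_op (opV s).
Proof. by move=> hs; apply: pin_bounded; exact: Il_biuniq. Qed.

Inductive spanV : (l2 R P -> l2 R P) -> Prop :=
| spanV0 : spanV (fun=> 0)
| spanVD a b of spanV a & spanV b : spanV (opD a b)
| spanVG c s of Il s : spanV (opZ c (opV s)).

Section OnY.
Hypothesis rev : forall x y : P, exists z, mdiv x z /\ mdiv y z.
Variable Y : set (char P).
Hypothesis YJ : Y `<=` @Jhat P.

(** The arrow g is the product of h with the germ of v at the range of h, expressed in coordinates:
    at a common point r of the source filter, h has the value x and g the value v(x) = y. *)
Definition relU v (h g : groupoid Y) := exists chi r x y,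
  [/\ Y chi, arrow_at chi r x (val h), arrow_at chi r y (val g) & v (x, y)].

Definition opU v : l2 R (groupoid Y) -> l2 R (groupoid Y) := pin (relU v).

Lemma groupoidE g : groupoid Y g <-> exists chi r x, Y chi /\ arrow_at chi r x g.
Proof.
split=> [[s [chi [hs Yc cs ->]]]|[chi [r [x [Yc [s [hs cr sr ->]]]]]]].
  have [r [x [cr sr]]] := (chi_dom lc lcmP rev (YJ Yc) hs).1 cs.
  by exists chi, r, x; split=> //; exists s.
by exists s, chi; split=> //; apply/(chi_dom lc lcmP rev (YJ Yc) hs); exists r, x.
Qed.

Lemma arrowP (g : groupoid Y) : exists chi r x, Y chi /\ arrow_at chi r x (val g).
Proof. by apply/groupoidE; exact: set_mem (valP g). Qed.

Lemma arrow_ex chi r x : Y chi -> ch chi r -> exists g : groupoid Y, arrow_at chi r x (val g).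
Proof.
move=> Yc cr; have [g hg] := arrow_at_ex x cr.
have Yg : groupoid Y g by apply/groupoidE; exists chi, r, x.
by exists (SigSub (mem_set Yg)).
Qed.

Lemma relU_at v (h g : groupoid Y) chi r x : Il v -> Y chi -> relU v h g -> arrow_at chi r x (val h) ->
  exists l a y, [/\ l = (r * a)%g, v ((x * a)%g, y) & arrow_at chi l y (val g)].
Proof.
move=> hv Yc [psi [r' [x' [y' [Yp ah ag vxy]]]]] ah'.
have e := arrow_at_source lc lcmP rev (YJ Yc) (YJ Yp) ah' ah; rewrite -e in ah ag.
have [l [a [b [la lb h1 h2]]]] := arrow_at_common lc lcmP rev (YJ Yc) ah' ah.
exists l, a, (y' * b)%g; split=> //.
  rewrite (arrow_at_fun lc rc lcmP rev (YJ Yc) h1 h2); exact: Il_mul.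
by rewrite lb; apply: arrow_at_mul => //; rewrite -lb; case: h2 => ? [].
Qed.

Lemma relU_biuniq v : Il v -> biuniq (relU v).
Proof.
have half u (h g g' : groupoid Y) : Il u -> relU u h g -> relU u h g' -> g = g'.
  move=> hu [chi [r [x [y [Yc ah ag uxy]]]]] /(relU_at hu Yc)/(_ ah)[l [a [y' [la uy ag']]]].
  apply/val_inj; apply: (arrow_at_inj lc lcmP rev (YJ Yc) _ ag').
  have <- : (y * a)%g = y' by apply: (Il_biuniq lc hu).1 (Il_mul a hu uxy) uy.
  by rewrite la; apply: arrow_at_mul => //; rewrite -la; case: ag' => ? [].
move=> hv; split=> [h g g'|h h' g]; first exact: half.
have flip w (k k' : groupoid Y) : relU w k k' -> relU (w^-1)%relation k' k.
  by move=> [chi [r [x [y [Yc ak ak' wxy]]]]]; exists chi, r, y, x.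
by move=> /flip h1 /flip h2; exact: half (Il_inv hv) h1 h2.
Qed.

Lemma opU_bounded v : Il v -> bounded_op (opU v).
Proof. by move=> hv; apply: pin_bounded; exact: relU_biuniq. Qed.

Lemma opU_comp s t : Il s -> Il t -> opU s \o opU t = opU (s \; t)%relation.
Proof.
move=> hs ht; rewrite /opU (pin_comp (relU_biuniq ht) (relU_biuniq hs)); apply: pin_ext => h g.
split=> [[k [chi [r [x [y [Yc ah ak txy]]]]] sg]|[chi [r [x [z [Yc ah ag [y txy syz]]]]]]].
  have [l [a [z [la syz ag]]]] := relU_at hs Yc sg ak.
  exists chi, l, (x * a)%g, z; split=> //.
    by rewrite la; apply: arrow_at_mul => //; rewrite -la; case: ag => ? [].
  by exists (y * a)%g => //; exact: Il_mul.
have [k ak] := arrow_ex y Yc (let: ex_intro _ (And4 _ c _ _) := ah in c).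
by exists k; exists chi, r; [exists x, y|exists y, z].
Qed.

Lemma opU_adj s : Il s -> adjoint (opU s) = opU (s^-1)%relation.
Proof.
move=> hs; rewrite /opU (pin_adj (relU_biuniq hs)); apply: pin_ext => h g.
by split=> -[chi [r [x [y [Yc a b vxy]]]]]; exists chi, r, y, x.
Qed.

(** The correspondence V_s |-> U_s on linear spans. It is kept as a relation because its being well
    defined is only known through [span2_contractive]. *)
Inductive span2 : (l2 R P -> l2 R P) -> (l2 R (groupoid Y) -> l2 R (groupoid Y)) -> Prop :=
| span20 : span2 (fun=> 0) (fun=> 0)
| span2D a b a' b' of span2 a b & span2 a' b' : span2 (opD a a') (opD b b')
| span2G c s of Il s : span2 (opZ c (opV s)) (opZ c (opU s)).

Lemma span2_spanV a b : span2 a b -> spanV a.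
Proof. by elim=> [|? ? ? ? _ h1 _ h2|c s hs]; [exact: spanV0|exact: spanVD|exact: spanVG]. Qed.

Lemma spanV_span2 a : spanV a -> exists b, span2 a b.
Proof.
elim=> [|a1 a2 _ [b1 h1] _ [b2 h2]|c s hs]; first by eexists; exact: span20.
  by eexists; exact: span2D h1 h2.
by eexists; exact: span2G.
Qed.

Lemma opZ0 (X : choiceType) c : opZ c (fun=> 0 : l2 R X) = fun=> 0.
Proof. by apply/funext => f; exact: scaler0. Qed.
Lemma opZD (X : choiceType) c (a b : l2 R X -> l2 R X) : opZ c (opD a b) = opD (opZ c a) (opZ c b).
Proof. by apply/funext => f; exact: scalerDr. Qed.
Lemma opZA (X : choiceType) c d (a : l2 R X -> l2 R X) : opZ c (opZ d a) = opZ (c * d) a.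
Proof. by apply/funext => f; exact: scalerA. Qed.
Lemma opZM (X : choiceType) c d (a b : l2 R X -> l2 R X) : linear a ->
  opZ c a \o opZ d b = opZ (c * d) (a \o b).
Proof. by move=> la; apply/funext => f; rewrite /opZ /= (linZ la) scalerA. Qed.
Lemma opMD (X : choiceType) (a b b' : l2 R X -> l2 R X) : linear a ->
  a \o opD b b' = opD (a \o b) (a \o b').
Proof. by move=> la; apply/funext => f; rewrite /opD /= (linD la). Qed.
Lemma opM0 (X : choiceType) (a : l2 R X -> l2 R X) : linear a ->
  a \o ((fun=> 0) : l2 R X -> l2 R X) = fun=> 0.
Proof. by move=> la; apply/funext => f; rewrite /= (lin0 la). Qed.
Lemma adj0 (X : choiceType) : adjoint ((fun=> 0) : l2 R X -> l2 R X) = fun=> 0.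
Proof. by apply: (adjoint_uniq (@bounded_op0 R X)) => f g; rewrite inner0l inner0r. Qed.

Lemma span2_bounded a b : span2 a b -> bounded_op a /\ bounded_op b.
Proof.
elim=> [|a1 b1 a2 b2 _ [h1 h1'] _ [h2 h2']|c s hs].
- by split; exact: bounded_op0.
- by split; exact: bounded_opD.
- by split; apply: bounded_opZ; [exact: opV_bounded|exact: opU_bounded].
Qed.

Lemma span2_graph : hom_graph span2.
Proof.
split; [exact: span20|exact: span2_bounded|by move=> s t s' t'; exact: span2D| |split].
- move=> c a b; elim=> [|a1 b1 a2 b2 _ h1 _ h2|d s hs].
  + by rewrite !opZ0; exact: span20.
  + by rewrite !opZD; exact: span2D.
  + by rewrite !opZA; exact: span2G.
- move=> a b a' b' h1 h2; elim: h1 => [|a1 b1 a2 b2 _ i1 _ i2|c s hs]; first exact: span20.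
    exact: span2D i1 i2.
  have lV := bounded_op_linear (bounded_opZ c (opV_bounded hs)).
  have lU := bounded_op_linear (bounded_opZ c (opU_bounded hs)).
  elim: h2 => [|a1 b1 a2 b2 _ i1 _ i2|d t ht].
  + by rewrite (opM0 lV) (opM0 lU); exact: span20.
  + by rewrite (opMD _ _ lV) (opMD _ _ lU); exact: span2D.
  + rewrite (opZM _ _ _ (opV_bounded hs).1) (opZM _ _ _ (opU_bounded hs).1).
    by rewrite opV_comp// opU_comp//; apply/span2G/Il_comp.
- move=> a b; elim=> [|a1 b1 a2 b2 h1 i1 h2 i2|c s hs].
  + by rewrite !adj0; exact: span20.
  + have [ba1 bb1] := span2_bounded h1; have [ba2 bb2] := span2_bounded h2.
    by rewrite !adjD//; exact: span2D.
  + rewrite (adjZ _ (opV_bounded hs)) (adjZ _ (opU_bounded hs)) opV_adj// opU_adj//.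
    by apply/span2G/Il_inv.
Qed.

(* The isometry delta x |-> delta g, where g maps the point r of the filter chi to x. *)
Definition opJ chi r : l2 R P -> l2 R (groupoid Y) := pin (fun x g => arrow_at chi r x (val g)).

Lemma opJ_biuniq chi r : Y chi -> biuniq (fun x (g : groupoid Y) => arrow_at chi r x (val g)).
Proof.
move=> Yc; split=> [x g g' h h'|x x' g h h'].
  by apply/val_inj; exact: (arrow_at_inj lc lcmP rev (YJ Yc) h h').
exact: (arrow_at_fun lc rc lcmP rev (YJ Yc) h h').
Qed.

Lemma opJ_isometry chi r f : Y chi -> ch chi r -> l2norm (opJ chi r f) = l2norm f.
Proof.
by move=> Yc cr; apply: pin_isometry; [exact: opJ_biuniq|move=> x; exact: arrow_ex].
Qed.

Lemma opJ_linear chi r : Y chi -> linear (opJ chi r).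
Proof. move=> Yc; exact (pin_bdd (opJ_biuniq r Yc)).1. Qed.

Lemma opJ_delta chi r x (g : groupoid Y) : Y chi -> arrow_at chi r x (val g) ->
  opJ chi r (delta x) = delta g.
Proof. move=> Yc h; exact (pin_delta (opJ_biuniq r Yc) h). Qed.

(* On finitely many basis vectors of one fibre, an element of the span acts as on l2 P, read at a
   sufficiently deep point r of the filter. *)
Lemma span2_deep a b : span2 a b -> forall chi (L : seq (groupoid Y)), Y chi ->
  (forall h, h \in L -> exists r x, arrow_at chi r x (val h)) ->
  exists2 r, ch chi r & forall r', ch chi r' -> mdiv r r' -> forall h, h \in L ->
    exists2 x, arrow_at chi r' x (val h) & b (delta h) = opJ chi r' (a (delta x)).
Proof.
move=> hab chi L Yc; have hc := YJ Yc.
have base : (forall h, h \in L -> exists r x, arrow_at chi r x (val h)) ->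
    exists2 r, ch chi r & forall r', ch chi r' -> mdiv r r' -> forall h, h \in L ->
    exists x, arrow_at chi r' x (val h).
  elim: (L) => [_|h L' ih hL]; first by exists 1%g => //; exact: ch1.
  have [h'|r cr hr] := ih; first by move=> h'L; apply: hL; rewrite inE h'L orbT.
  have [r1 [x1 a1]] := hL h (mem_head _ _).
  have cr1 : ch chi r1 by case: a1 => ? [].
  have [l [cl rl r1l]] := ch_common lc lcmP rev hc cr cr1.
  exists l => // r' cr' lr' g; rewrite inE => /orP[/eqP ->|].
    have [z ez] := mdiv_trans r1l lr'; exists (x1 * z)%g; rewrite ez.
    by apply: arrow_at_mul => //; rewrite -ez.
  by move=> gL; apply: hr gL => //; exact: mdiv_trans lr'.
elim: hab => [|a1 b1 a2 b2 h1 i1 h2 i2|c s hs] hL.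
- have [r cr hr] := base hL; exists r => // r' cr' rr' h hL'.
  by have [x ax] := hr r' cr' rr' h hL'; exists x => //; rewrite (lin0 (opJ_linear _ Yc)).
- have [r1 cr1 hr1] := i1 hL; have [r2 cr2 hr2] := i2 hL.
  have [l [cl r1l r2l]] := ch_common lc lcmP rev hc cr1 cr2.
  exists l => // r' cr' lr' h hL'.
  have [x ax e] := hr1 r' cr' (mdiv_trans r1l lr') h hL'.
  have [x' ax' e'] := hr2 r' cr' (mdiv_trans r2l lr') h hL'.
  rewrite (arrow_at_fun lc rc lcmP rev hc ax' ax) in e'.
  by exists x => //; rewrite /opD e e' (linD (opJ_linear _ Yc)).
- have [r0 cr0 hr0] := base hL.
  (* The point r is taken deep enough for s to be defined at the coordinate of every h in L on which
     U_s does not vanish. *)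
  have [r cr hr] : exists2 r, ch chi r & forall r', ch chi r' -> mdiv r r' -> forall h, h \in L ->
      (exists g, relU s h g) -> exists x y, arrow_at chi r' x (val h) /\ s (x, y).
    elim: (L) hL {hr0} => [_|h L' ih hL]; first by exists 1%g => //; exact: ch1.
    have [h'|r cr hr] := ih; first by move=> h'L; apply: hL; rewrite inE h'L orbT.
    have [[g sg]|ng] := pselect (exists g, relU s h g); last first.
      exists r => // r' cr' rr' h'; rewrite inE => /orP[/eqP -> /ng//|]; exact: hr.
    have [r1 [x1 a1]] := hL h (mem_head _ _).
    have [l1 [z1 [y1 [el sy ag]]]] := relU_at hs Yc sg a1.
    have cl1 : ch chi l1 by case: ag => ? [].
    have [l [cl rl l1l]] := ch_common lc lcmP rev hc cr cl1.
    exists l => // r' cr' lr' h'; rewrite inE => /orP[/eqP -> _|h'L]; last first.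
      by apply: hr => //; exact: mdiv_trans lr'.
    have [z ez] := mdiv_trans l1l lr'; exists (x1 * z1 * z)%g, (y1 * z)%g; split.
      rewrite ez el; apply: arrow_at_mul; last by rewrite -el -ez.
      by apply: arrow_at_mul => //; rewrite -el.
    exact: Il_mul.
  have [l [cl r0l rl]] := ch_common lc lcmP rev hc cr0 cr.
  exists l => // r' cr' lr' h hL'.
  have [x ax] := hr0 r' cr' (mdiv_trans r0l lr') h hL'; exists x => //.
  have bs := Il_biuniq lc hs; have bU := relU_biuniq hs.
  rewrite /opZ (linZ (opJ_linear _ Yc)); congr (_ *: _).
  have [hg|ng] := pselect (exists g, relU s h g).
    have [x' [y [ax' sxy]]] := hr r' cr' (mdiv_trans rl lr') h hL' hg.
    rewrite (arrow_at_fun lc rc lcmP rev hc ax' ax) in sxy.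
    have [g ag] := arrow_ex y Yc cr'.
    rewrite /opU (@pin_delta _ _ _ _ bU h g); last by exists chi, r', x, y.
    by rewrite /opV (pin_delta bs sxy) (opJ_delta Yc ag).
  rewrite /opU (pin_delta0 bU); last by move=> g sg; apply: ng; exists g.
  rewrite /opV (pin_delta0 bs) ?(lin0 (opJ_linear _ Yc))// => y sxy.
  by have [g ag] := arrow_ex y Yc cr'; apply: ng; exists g, chi, r', x, y.
Qed.

Definition src (g : groupoid Y) : char P := sval (cid (arrowP g)).

Lemma srcP g : Y (src g) /\ exists r x, arrow_at (src g) r x (val g).
Proof. by rewrite /src; case: (cid _) => /= chi [r [x [Yc ax]]]; split=> //; exists r, x. Qed.

Lemma src_at g chi r x : Y chi -> arrow_at chi r x (val g) -> src g = chi.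
Proof.
move=> Yc ax; have [Ys [r' [x' ax']]] := srcP g.
exact: (arrow_at_source lc lcmP rev (YJ Ys) (YJ Yc) ax' ax).
Qed.

Lemma span2_fibre a b : span2 a b -> forall h g, src h <> src g -> b (delta h) g = 0.
Proof.
elim=> [//|a1 b1 a2 b2 _ i1 _ i2|c s hs] h g hg.
  by rewrite /opD l2DE i1// i2// addr0.
rewrite /opZ l2ZE; have bU := relU_biuniq hs.
rewrite /opU; have [[k sk]|nk] := pselect (exists k, relU s k g); last first.
  by rewrite (pin0 bU) ?mulr0// => k sk; apply: nk; exists k.
rewrite (pinE bU _ sk) /=; have [kh|_] := eqVneq k h; last by rewrite mulr0.
rewrite kh in sk; case: sk => chi [r [x [y [Yc ah ag _]]]].
by case: hg; rewrite (src_at Yc ah) (src_at Yc ag).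
Qed.

(** The operator b is block diagonal for the source fibres. On finitely many basis vectors of one
    fibre, [span2_deep] identifies it with a through the isometry [opJ]. *)
Lemma span2_contractive a b : span2 a b -> opnorm b <= opnorm a.
Proof.
move=> hab; have [ba bb] := span2_bounded hab.
apply: (bdd_opnorm (opnorm_ge0 _)).
apply: (fibre_bound (c := src) (opnorm_ge0 _) (opnorm_bdd bb)).
  by move=> h g; exact: span2_fibre hab h g.
move=> L chi uL hL w; have [->|[h0 L0]] : L = [::] \/ exists h, h \in L.
  - by case: (L) => [|h L']; [left|right; exists h; rewrite mem_head].
  - by rewrite /fin big_nil (lin0 bb.1) l2norm0 mulr0.
have Yc : Y chi by rewrite -(hL _ L0); exact: (srcP h0).1.
have hL' h : h \in L -> exists r x, arrow_at chi r x (val h).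
  by move=> hhL; rewrite -(hL _ hhL); exact: (srcP h).2.
have [r cr hr] := span2_deep hab Yc hL'.
have /choice[x hx] : forall h, exists x, h \in L ->
    arrow_at chi r x (val h) /\ b (delta h) = opJ chi r (a (delta x)).
  move=> h; have [hhL|nL] := boolP (h \in L); last by exists 1%g.
  by have [x ax e] := hr r cr (mdiv_refl r) h hhL; exists x.
have lJ := opJ_linear r Yc.
pose u := \sum_(h <- L) w h *: (delta (x h) : l2 R P).
have e1 : fin L w = opJ chi r u.
  rewrite (lin_sum _ _ lJ) /fin big_seq [RHS]big_seq; apply: eq_bigr => h hhL.
  by rewrite (linZ lJ) (opJ_delta Yc (hx h hhL).1).
have -> : b (fin L w) = opJ chi r (a u).
  rewrite (lin_fin _ _ bb.1) (lin_sum _ _ ba.1) (lin_sum _ _ lJ) big_seq [RHS]big_seq.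
  by apply: eq_bigr => h hhL; rewrite (linZ ba.1) (linZ lJ) (hx h hhL).2.
by rewrite e1 !opJ_isometry//; exact: opnormP.
Qed.

End OnY.
End GroupoidOperators.

(** * The space of characters and continuous functions on it *)

Section CharacterTopology.
Variable P : monoidType.
Implicit Types (chi psi : char P) (F : seq (set P)) (e : set P).

Definition agree F chi psi := forall e, e \in F -> psi e = chi e.

Lemma agree_nbhs F chi : nbhs chi [set psi | agree F chi psi].
Proof.
elim: F => [|e F ih]; first by apply: filterS (@filterT _ (nbhs chi) _) => psi _.
have h : nbhs chi [set psi : char P | psi e = chi e].
  apply: (@proj_continuous (set P) (fun=> bool) e chi [set chi e]).
  exact: discrete_set1.
apply: filterS (filterI h ih) => psi [/= h1 h2] e'; rewrite inE => /orP[/eqP ->//|].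
exact: h2.
Qed.

Lemma nbhs_agree chi (N : set (char P)) : nbhs chi N -> exists F, [set psi | agree F chi psi] `<=` N.
Proof.
pose G : set_system (char P) := [set M | exists F, [set psi | agree F chi psi] `<=` M].
have GF : Filter G.
  split=> [|A B [F1 h1] [F2 h2]|A B AB [F1 h1]].
  - by exists [::].
  - exists (F1 ++ F2) => psi h; split; [apply: h1|apply: h2] => e eF; apply: h;
      by rewrite mem_cat eF ?orbT.
  - by exists F1; exact: subset_trans AB.
have : {ptws, G --> chi}.
  apply/cvg_sup => e A [B [[D _ <-] Dc] BA]; exists [:: e] => psi h.
  by apply: BA; rewrite /= (h e) ?mem_head.
by move=> h /h.
Qed.

Lemma char_compact : compact [set: char P].
Proof.
have := @tychonoff (set P) (fun=> bool) (fun=> [set: bool]) (fun=> bool_compact).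
by congr compact; apply/seteqP; split.
Qed.

Lemma agree_closed (K : set (char P)) :
  (forall chi, (forall F, exists2 psi, K psi & agree F chi psi) -> K chi) -> compact K.
Proof.
move=> h; apply: (subclosed_compact _ char_compact) => // chi hchi; apply: h => F.
by have [psi [Kpsi ag]] := hchi _ (agree_nbhs F chi); exists psi.
Qed.

End CharacterTopology.

Section CharacterFunctions.
Variables (R : realType) (P : monoidType).
Local Notation C := R[i].
Local Open Scope ring_scope.
Local Open Scope complex_scope.
Implicit Types (chi psi : char P) (F : seq (set P)) (k : char P -> C).
Hypothesis lc : forall x y z : P, (x * y = x * z)%g -> y = z.
Hypothesis lcmP : forall x y : P, (exists z, mdiv x z /\ mdiv y z) ->
  exists l, forall z, (mdiv x z /\ mdiv y z) <-> mdiv l z.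
Hypothesis rev : forall x y : P, exists z, mdiv x z /\ mdiv y z.

(** Each defining condition concerns finitely many values, hence is closed; being non-zero is one of
    them because it amounts to chi(P) = 1. *)
Lemma Jhat_compact (e : set P) : compact (@Jhat P `&` [set chi : char P | chi e]).
Proof.
apply: agree_closed => chi h; split; last first.
  by have [psi [_ /= pe] ag] := h [:: e]; rewrite -(ag e) ?mem_head.
split.
- move=> f cf; have [psi [[h1 _ _ _] _] ag] := h [:: f].
  by apply: h1; rewrite (ag f) ?mem_head.
- exists (pP 1%g); have [psi [hpsi _] ag] := h [:: pP 1%g].
  by rewrite -(ag (pP 1%g)) ?mem_head//; exact: ch1.
- by have [psi [[_ _ h3 _] _] ag] := h [:: set0]; rewrite -(ag set0) ?mem_head.
- move=> f g hf hg; have [psi [[_ _ _ h4] _] ag] := h [:: f `&` g; f; g].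
  by rewrite -(ag (f `&` g)) -?(ag f) -?(ag g) ?h4// !inE eqxx ?orbT.
Qed.

Inductive spanC : (char P -> C) -> Prop :=
| spanC0 : spanC (fun=> 0)
| spanCD k k' of spanC k & spanC k' : spanC (fun chi => k chi + k' chi)
| spanCG c r : spanC (fun chi => c * (chi (pP r))%:R).

Lemma spanC_ext k k' : (forall chi, k chi = k' chi) -> spanC k -> spanC k'.
Proof. by move=> e; have -> : k = k' by apply/funext. Qed.

Lemma spanCZ c k : spanC k -> spanC (fun chi => c * k chi).
Proof.
elim=> [|k1 k2 _ h1 _ h2|d r].
- by apply: spanC_ext spanC0 => chi; rewrite mulr0.
- by apply: spanC_ext (spanCD h1 h2) => chi; rewrite mulrDr.
- by apply: spanC_ext (spanCG (c * d) r) => chi; rewrite mulrA.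
Qed.

Lemma spanC_mulch q k : spanC k ->
  exists2 k', spanC k' & forall chi, Jhat chi -> k' chi = (chi (pP q))%:R * k chi.
Proof.
elim=> [|k1 k2 _ [k1' s1 h1] _ [k2' s2 h2]|c r].
- by exists (fun=> 0) => [|chi _]; [exact: spanC0|rewrite mulr0].
- by eexists; [exact: spanCD s1 s2|move=> chi hchi /=; rewrite h1// h2// mulrDr].
- have [l [e _ _]] := pPI lcmP rev q r; eexists; first exact: (spanCG c l).
  move=> chi [_ _ _ hm]; rewrite -e hm; [|exact: (pP_constr lc lcmP rev)..].
  by case: (chi (pP q)); case: (chi (pP r)); rewrite ?mul1r ?mul0r ?mulr0.
Qed.

Lemma spanC_bounded k : spanC k -> exists2 M : R, 0 <= M & forall chi, cabs (k chi) <= M.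
Proof.
elim=> [|k1 k2 _ [M1 m1 h1] _ [M2 m2 h2]|c r].
- by exists 0 => // chi; rewrite cabs0.
- exists (M1 + M2) => [|chi]; first exact: addr_ge0.
  by apply: (le_trans (cabsD _ _)); exact: lerD.
- exists (cabs c) => [|chi]; first exact: cabs_ge0.
  by case: (chi (pP r)); rewrite ?mulr1// mulr0 cabs0 cabs_ge0.
Qed.

(** Induction on F by cases on the value at its first member qP: the function is k0 + chi(qP) (k1 -
    k0). A member that is not constructible always has the value 0. *)
Lemma spanC_pattern F (phi : seq bool -> C) :
  exists2 k, spanC k & forall chi, Jhat chi -> k chi = phi [seq chi e | e <- F].
Proof.
elim: F phi => [|e F ih] phi.
  eexists; first exact: (spanCG (phi [::]) 1%g).
  by move=> chi hchi /=; rewrite (ch1 lc lcmP rev hchi) mulr1.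
have [k0 s0 h0] := ih (fun b => phi (false :: b)).
have [he|he] := pselect (constr_ideals e); last first.
  exists k0 => // chi hchi; rewrite h0//=; case: hchi => h1 _ _ _.
  by case ce : (chi e) => //; case: he; exact: h1.
have [q eq] := (constr_idealsE lc lcmP rev e).1 he.
have [k1 s1 h1] := ih (fun b => phi (true :: b)).
have [k2 s2 h2] := spanC_mulch q (spanCD s1 (spanCZ (-1) s0)).
eexists; first exact: (spanCD s0 s2).
move=> chi hchi /=; rewrite h2// h0// h1//= -eq mulN1r; case: (chi e).
  by rewrite mul1r addrC subrK.
by rewrite mul0r addr0.
Qed.

(** By compactness h is, up to e, a function of the values of the character on finitely many ideals,
    and [spanC_pattern] handles such functions exactly. *)
Lemma spanC_approx (d : set P) (h : char P -> C^o) (e : R) : 0 < e ->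
  {within @Jhat P `&` [set chi : char P | chi d], continuous h} ->
  exists2 k, spanC k & forall chi, Jhat chi -> chi d -> cabs (h chi - k chi) <= e.
Proof.
set K := _ `&` _ => e0 hc.
have lf chi0 : K chi0 -> exists F, forall chi, K chi -> agree F chi0 chi -> cabs (h chi0 - h chi) < e / 2.
  move=> K0; have /subspace_continuousP/(_ _ K0)/cvgrPdist_lt := hc.
  have e2 : 0 < (e / 2)%:C by rewrite ltcR divr_gt0.
  move=> /(_ _ e2); rewrite near_withinE => /nbhs_agree[F hF].
  exists F => chi Kc ag; have := hF chi ag Kc.
  by rewrite cabsE ltcR.
pose G : set_system (seq (set P)) := [set M | exists F0, forall F, {subset F0 <= F} -> M F].
have GF : Filter G.
  split=> [|A B [F1 h1] [F2 h2]|A B AB [F1 h1]].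
  - by exists [::].
  - by exists (F1 ++ F2) => F sF; split; [apply: h1|apply: h2] => x xF; apply: sF; rewrite mem_cat xF ?orbT.
  - by exists F1 => F sF; apply/AB/h1.
have /compact_near_coveringP := @Jhat_compact d; rewrite -/K.
move=> /(_ _ G (fun F chi => K chi -> forall psi, K psi -> agree F chi psi -> cabs (h chi - h psi) < e) GF).
case=> [chi0 K0|F hF].
  have [F0 hF0] := lf _ K0.
  exists ([set psi | agree F0 chi0 psi], [set F : seq (set P) | {subset F0 <= F}]).
    by split=> /=; [exact: agree_nbhs|exists F0].
  move=> [chi F] /= [ag sF] Kc psi Kp ag'.
  have -> : h chi - h psi = (h chi0 - h psi) - (h chi0 - h chi) by ring.
  apply: (le_lt_trans (cabsB _ _)); rewrite [e]splitr; apply: ltrD.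
    by apply: hF0 => // x xF; rewrite ag' ?sF// ag.
  exact: hF0.
have {}hF := hF F (fun _ => id).
pose phi (b : seq bool) : C := if pselect (exists2 chi, K chi & [seq chi x | x <- F] = b) is left ex
  then h (s2val (cid2 ex)) else 0.
have [k sk hk] := spanC_pattern F phi; exists k => // chi hchi cd.
rewrite hk// /phi; case: pselect => [ex|[]]; last by exists chi.
apply/ltW/hF => //; first exact: s2valP (cid2 ex).
move=> x xF; have /eq_in_map/(_ x xF) := s2valP' (cid2 ex); by [].
Qed.

End CharacterFunctions.

Lemma bdd_comp (R : realType) (X Y Z : choiceType) (S : l2 R Y -> l2 R Z) (T : l2 R X -> l2 R Y) (M N : R) :
  (0 <= M)%R -> bdd S M -> bdd T N -> bdd (S \o T) (M * N)%R.
Proof.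
move=> M0 [lS bS] [lT bT]; split=> [c f g|f] /=; first by rewrite lT lS.
by apply: (le_trans (bS _)); rewrite -mulrA ler_wpM2l.
Qed.

(** * Convolution operators and restriction to an invariant subspace *)

Section RegularRepresentation.
Variables (R : realType) (P : monoidType).
Local Notation C := R[i].
Local Open Scope ring_scope.
Local Open Scope complex_scope.
Implicit Types (p q r x y z : P) (s t v : pbij P) (chi : char P).

Hypothesis lc : forall x y z : P, (x * y = x * z)%g -> y = z.
Hypothesis rc : forall x y z : P, (x * z = y * z)%g -> x = y.
Hypothesis lcmP : forall x y : P, (exists z, mdiv x z /\ mdiv y z) ->
  exists l, forall z, (mdiv x z /\ mdiv y z) <-> mdiv l z.
Hypothesis rev : forall x y : P, exists z, mdiv x z /\ mdiv y z.

Section OnY.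
Variable Y : set (char P).
Hypothesis YJ : Y `<=` @Jhat P.
Hypothesis Yact : forall s chi, Il s -> Y chi -> chi (dom s) -> Y (act s chi).
Local Notation opU := (opU (R := R) (Y := Y)).
Local Notation relU := (relU (Y := Y)).

Let relU_bi v (hv : Il v) := relU_biuniq lc rc lcmP rev YJ hv.

Lemma rep_arrow (k : groupoid Y) b chi : val k (b, chi) ->
  [/\ Y chi, Il b & exists r x, [/\ ch chi r, b (r, x) & arrow_at chi r x (val k)]].
Proof.
move=> kb; have [psi [r [x [Yp [t [ht cr tr e]]]]]] := arrowP lc lcmP rev YJ k.
have hb : Il b by move: kb; rewrite e => -[].
have [ep [r' [x' [cr' br' tr']]]] : psi = chi /\ exists r x, [/\ ch psi r, b (r, x) & t (r, x)].
  have e1 : chi = psi by move: kb; rewrite e => -[/= _ ->].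
  move: kb; rewrite e e1 => kb; split=> //; exact: (germ_char lc lcmP rev (YJ Yp) hb kb).2.
rewrite -ep; split=> //; exists r', x'; split=> //.
by exists t.
Qed.

Lemma rep_ex (k : groupoid Y) : exists bc : pbij P * char P, val k bc.
Proof.
have [psi [r [x [Yp [t [ht cr tr e]]]]]] := arrowP lc lcmP rev YJ k.
exists (t, psi); rewrite e; apply: germ_mem => //.
by apply/(chi_dom lc lcmP rev (YJ Yp) ht); exists r, x.
Qed.

Definition rng (k : groupoid Y) : char P :=
  act (sval (cid (rep_ex k))).1 (sval (cid (rep_ex k))).2.

Lemma rep_source (k : groupoid Y) b b' chi chi' : val k (b, chi) -> val k (b', chi') -> chi = chi'.
Proof.
move=> /rep_arrow[Yc _ [r [x [_ _ a]]]] /rep_arrow[Yc' _ [r' [x' [_ _ a']]]].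
exact: (arrow_at_source lc lcmP rev (YJ Yc) (YJ Yc') a a').
Qed.

Lemma rngP (k : groupoid Y) b chi : val k (b, chi) -> rng k = act b chi.
Proof.
move=> kb; rewrite /rng; case: (cid _) => -[b' chi'] /= kb'.
have e := rep_source kb' kb; rewrite e in kb' *.
have [Yc hb [r [x [cr br ax]]]] := rep_arrow kb; have [_ hb' [r' [x' [cr' br' ax']]]] := rep_arrow kb'.
have [l [a [c [la lc' h1 h2]]]] := arrow_at_common lc lcmP rev (YJ Yc) ax ax'.
have e2 := arrow_at_fun lc rc lcmP rev (YJ Yc) h1 h2.
apply: (act_germ lc lcmP rev (YJ Yc) hb' hb (r := l) (x := (x * a)%g)).
- by case: h1 => ? [].
- by rewrite e2 lc'; exact: Il_mul.
- by rewrite la; exact: Il_mul.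
Qed.

Lemma rng_ch (k : groupoid Y) chi r x : Y chi -> arrow_at chi r x (val k) -> ch (rng k) x.
Proof.
move=> Yc [s [hs cr sr e]]; have cs : chi (dom s) by apply/(chi_dom lc lcmP rev (YJ Yc) hs); exists r, x.
have ks : val k (s, chi) by rewrite e; exact: germ_mem.
rewrite (rngP ks); apply/(act_ch lc lcmP rev (YJ Yc) _ hs); exists r, x; split=> //; exact: mdiv_refl.
Qed.

Lemma ch_rng (k : groupoid Y) l : ch (rng k) l ->
  exists chi r x, [/\ Y chi, arrow_at chi r x (val k) & mdiv l x].
Proof.
have [[b chi] kb] := rep_ex k; rewrite (rngP kb).
have [Yc hb [r0 [x0 [cr0 br0 ax0]]]] := rep_arrow kb.
move=> /(act_ch lc lcmP rev (YJ Yc) _ hb)[r [x [cr br lx]]].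
exists chi, r, x; split=> //; have [c [cl [a la] [d ld]]] := ch_common lc lcmP rev (YJ Yc) cr cr0.
have [s [hs _ sr0 e]] := ax0; exists b; split=> //; rewrite e; exact: (germ_eq lc lcmP rev (YJ Yc) hs hb cr0 sr0 br0).
Qed.

Lemma rng_Y (k : groupoid Y) : Y (rng k).
Proof.
have [[b chi] kb] := rep_ex k; rewrite (rngP kb); have [Yc hb [r [x [cr br _]]]] := rep_arrow kb.
by apply: Yact => //; apply/(chi_dom lc lcmP rev (YJ Yc) hb); exists r, x.
Qed.

Lemma rng_dom s (k g : groupoid Y) : Il s -> relU s k g -> (rng k) (dom s).
Proof.
move=> hs [chi [r [x [y [Yc ak ag sxy]]]]].
apply/(chi_dom lc lcmP rev (YJ (rng_Y k)) hs); exists x, y; split=> //; exact: rng_ch ak.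
Qed.

Definition wt s (theta : char P -> C) (g : groupoid Y) : C :=
  if pselect (exists k, relU s k g) is left e then theta (rng (sval (cid e))) else 0.

Lemma wt_at s theta (k g : groupoid Y) : Il s -> relU s k g -> wt s theta g = theta (rng k).
Proof.
move=> hs skg; rewrite /wt; case: pselect => [e|[]]; last by exists k.
by rewrite ((relU_bi hs).2 _ _ _ (svalP (cid e)) skg).
Qed.

Lemma wt_bound s theta (M : R) : Il s -> 0 <= M ->
  (forall chi, Y chi -> chi (dom s) -> cabs (theta chi) <= M) -> forall g, cabs (wt s theta g) <= M.
Proof.
move=> hs M0 h g; rewrite /wt; case: pselect => [e|_]; last by rewrite cabs0.
by apply: h; [exact: rng_Y|exact: rng_dom (svalP (cid e))].
Qed.

(** Convolution by the function [s, chi] |-> theta(chi) on the bisection of s: an arrow k goes to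
    the product of s and k, weighted by theta at the range of k. *)
Definition opT s theta := pio (relU s) (wt s theta).

Lemma opT_bdd s theta (M : R) : Il s -> 0 <= M ->
  (forall chi, Y chi -> chi (dom s) -> cabs (theta chi) <= M) -> bdd (opT s theta) M.
Proof. by move=> hs M0 h; apply: (pio_bdd (relU_bi hs) (wt_bound hs M0 h) M0). Qed.

(** The germ on the left is g h^-1, the argument of f in the definition of [regular_rep]; the
    equivalence turns convolution into the combinatorial relation [relU]. *)
Lemma germ_relU s (g h : groupoid Y) a b chi : Il s -> val g (a, chi) -> val h (b, chi) ->
  bisection Y s (germ (a \; b^-1)%relation (act b chi)) <-> relU s h g.
Proof.
move=> hs ga hb; have [Yc Ia [r [y [cr ar ag]]]] := rep_arrow ga.
have [_ Ib [r' [x [cr' br' ah]]]] := rep_arrow hb.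
have hc := YJ Yc; have Iab : Il (a \; b^-1)%relation by apply: Il_comp => //; exact: Il_inv.
have [l [c [d [lc1 ld h1 h2]]]] := arrow_at_common lc lcmP rev hc ag ah.
have cl : ch chi l by case: h1 => ? [].
have al : a (l, y * c)%g by rewrite lc1; exact: Il_mul.
have bl : b (l, x * d)%g by rewrite ld; exact: Il_mul.
have cb : chi (dom b) by apply/(chi_dom lc lcmP rev hc Ib); exists r', x.
have hac := act_Jhat lc lcmP rev hc Ib cb; have Yac := Yact Ib Yc cb.
have abl : (a \; b^-1)%relation ((x * d)%g, (y * c)%g) by exists l.
have cxd : ch (act b chi) (x * d)%g.
  by apply/(act_ch lc lcmP rev hc _ Ib); exists l, (x * d)%g; split=> //; exact: mdiv_refl.
split=> [[psi [Ypsi /= psis e]]|].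
  have abc : act b chi (dom (a \; b^-1)%relation).
    by apply/(chi_dom lc lcmP rev hac Iab); exists (x * d)%g, (y * c)%g.
  have := germ_mem Iab abc; rewrite -e => hg.
  have [ep [x0 [y0 [cx0 [r0 /= b0 a0] s0]]]] := germ_char lc lcmP rev hac Iab hg.
  have /(act_ch lc lcmP rev hc _ Ib)[r1 [x1 [cr1 br1 [e1 x1e]]]] := cx0.
  have er : r1 = (r0 * e1)%g by apply: (Il_biuniq lc Ib).2 br1 _; rewrite x1e; exact: Il_mul.
  have s1 := Il_mul e1 hs s0; have a1 := Il_mul e1 Ia a0; rewrite -er in a1; rewrite -x1e in s1.
  exists chi, r1, x1, (y0 * e1)%g; split=> //.
    have [t [It _ tr' et]] := ah; exists b; split=> //; rewrite et.
    exact: (germ_eq lc lcmP rev hc It Ib cr' tr' br').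
  have [t [It _ tr et]] := ag; exists a; split=> //; rewrite et.
  exact: (germ_eq lc lcmP rev hc It Ia cr tr ar).
move=> shg; have [l' [a' [y' [el sy ag']]]] := relU_at lc rc lcmP rev YJ hs Yc shg h2.
have cl' : ch chi l' by case: ag' => ? [].
have yy : y' = (y * c * a')%g.
  apply: (arrow_at_fun lc rc lcmP rev hc ag'); rewrite el; apply: arrow_at_mul => //.
  by rewrite -el.
rewrite yy in sy; have cx' : ch (act b chi) (x * d * a')%g.
  apply/(act_ch lc lcmP rev hc _ Ib); exists l', (x * d * a')%g; split=> //; last exact: mdiv_refl.
  by rewrite el; exact: Il_mul.
exists (act b chi).
  split=> //=; apply/(chi_dom lc lcmP rev hac hs); by exists (x * d * a')%g, (y * c * a')%g.
apply: (germ_eq lc lcmP rev hac hs Iab cx' sy).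
exact: Il_mul.
Qed.

Lemma regular_rep_opT s theta (M : R) f : Il s -> 0 <= M ->
  (forall chi, Y chi -> chi (dom s) -> cabs (theta chi) <= M) ->
  (forall chi, Y chi -> chi (dom s) -> f (germ s chi) = theta chi) ->
  (forall g, ~ bisection Y s g -> f g = 0) -> regular_rep f (opT s theta).
Proof.
move=> hs M0 hM f1 f0; have hT := opT_bdd hs M0 hM; split; first exact: bounded_bdd M0 hT.
have wM := wt_bound hs M0 hM.
move=> g h a b chi psi ga hb; split=> [e|ne].
  rewrite -{psi}e in hb; have iff := germ_relU hs ga hb.
  have [shg|ns] := pselect (relU s h g).
    rewrite /opT (pioE (relU_bi hs) wM M0 _ shg) /= eqxx mulr1 (wt_at theta hs shg) (rngP hb).
    have [chi' [Yc' cs' e]] := iff.2 shg.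
    have Iab : Il (a \; b^-1)%relation.
      by have [_ Ia _] := rep_arrow ga; have [_ Ib _] := rep_arrow hb; apply: Il_comp => //; exact: Il_inv.
    have e' : chi' = act b chi.
      have := germ_mem hs cs'; rewrite e => -[] //.
    by rewrite -e f1//; rewrite e'.
  rewrite f0; last by move/iff.
  have [[k skg]|nk] := pselect (exists k, relU s k g); last first.
    by rewrite /opT (pio0 (relU_bi hs) wM M0)// => k skg; apply: nk; exists k.
  rewrite /opT (pioE (relU_bi hs) wM M0 _ skg) /=; have [kh|_] := eqVneq k h; last by rewrite mulr0.
  by case: ns; rewrite -kh.
have [[k skg]|nk] := pselect (exists k, relU s k g); last first.
  by rewrite /opT (pio0 (relU_bi hs) wM M0)// => k skg; apply: nk; exists k.
rewrite /opT (pioE (relU_bi hs) wM M0 _ skg) /=; have [kh|_] := eqVneq k h; last by rewrite mulr0.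
rewrite kh in skg; case: ne.
have [Yc _ [r [x [_ _ ag]]]] := rep_arrow ga; have [Yp _ [r' [x' [_ _ ah]]]] := rep_arrow hb.
case: skg => om [r0 [x0 [y0 [Yo a1 a2 _]]]].
rewrite (arrow_at_source lc lcmP rev (YJ Yc) (YJ Yo) ag a2).
by rewrite (arrow_at_source lc lcmP rev (YJ Yp) (YJ Yo) ah a1).
Qed.

Lemma opT_const s c : Il s -> opT s (fun=> c) = opZ c (opU s).
Proof.
move=> hs; have M : forall chi, Y chi -> chi (dom s) -> cabs c <= cabs c by [].
have hT := opT_bdd hs (cabs_ge0 c) M; have wM := wt_bound hs (cabs_ge0 c) M.
apply: (bdd_ext hT (bddZ c (pin_bdd (relU_bi hs)))) => k.
have [[g sg]|ng] := pselect (exists g, relU s k g).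
  rewrite /opT (pio_delta (relU_bi hs) wM (cabs_ge0 c) sg) (wt_at (fun=> c) hs sg).
  by rewrite /opZ (pin_delta (relU_bi hs) sg).
rewrite /opT (pio_delta0 (relU_bi hs) wM (cabs_ge0 c)); last by move=> g sg; apply: ng; exists g.
by rewrite /opZ (pin_delta0 (relU_bi hs)) ?scaler0// => g sg; apply: ng; exists g.
Qed.

Lemma regular_rep_opZU s c f : Il s ->
  (forall chi, Y chi -> chi (dom s) -> f (germ s chi) = c) ->
  (forall g, ~ bisection Y s g -> f g = 0) -> regular_rep f (opZ c (opU s)).
Proof.
move=> hs f1 f0; rewrite -opT_const//.
exact: (@regular_rep_opT s (fun=> c) (cabs c) f hs (cabs_ge0 c)).
Qed.

Lemma regular_rep_uniq f (T T' : l2 R (groupoid Y) -> l2 R (groupoid Y)) :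
  regular_rep f T -> regular_rep f T' -> T = T'.
Proof.
move=> [bT h] [bT' h']; apply: bounded_ext => // k; apply: l2P => g.
have [[a chi] ga] := rep_ex g; have [[b psi] kb] := rep_ex k.
have [h1 h2] := h g k a b chi psi ga kb; have [h1' h2'] := h' g k a b chi psi ga kb.
have [e|ne] := pselect (chi = psi); first by rewrite h1// h1'.
by rewrite h2// h2'.
Qed.

Lemma regular_repD f f' (T T' : l2 R (groupoid Y) -> l2 R (groupoid Y)) :
  regular_rep f T -> regular_rep f' T' -> regular_rep (fun g => f g + f' g) (opD T T').
Proof.
move=> [bT h] [bT' h']; split; first exact: bounded_opD.
move=> g k a b chi psi ga kb.
have [h1 h2] := h g k a b chi psi ga kb; have [h1' h2'] := h' g k a b chi psi ga kb.
by rewrite /opD l2DE; split=> e; [rewrite h1// h1'|rewrite h2// h2'// addr0].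
Qed.

Lemma regular_rep0 : regular_rep (fun=> 0) ((fun=> 0) : l2 R (groupoid Y) -> l2 R (groupoid Y)).
Proof. by split; [exact: bounded_op0|move=> g k a b chi psi _ _; split]. Qed.

Lemma opU_restrict s r h : Il s ->
  opU (s \; wpq r r)%relation (delta h) = ((rng h) (pP r))%:R *: opU s (delta h).
Proof.
move=> hs; have hr := Il_wpq r r; rewrite -(opU_comp R lc rc lcmP rev YJ hs hr) /=.
have bU := relU_bi hr; have e1 g : relU (wpq r r) h g -> g = h /\ ch (rng h) r.
  move=> [chi [r0 [x [y [Yc ah ag [z [/= ex ey]]]]]]].
  have xy : x = y by rewrite ex ey.
  rewrite -xy in ag; split; first by apply/val_inj; exact: (arrow_at_inj lc lcmP rev (YJ Yc) ag ah).
  apply: (ch_div lc lcmP rev (YJ (rng_Y h)) (rng_ch Yc ah)); by exists z.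
have [cr|ncr] := boolP ((rng h) (pP r)); rewrite ?scale1r ?scale0r.
  have [chi [r0 [x [Yc ah [z ex]]]]] := ch_rng cr.
  have -> // : opU (wpq r r) (delta h) = delta h.
  by apply: (pin_delta bU); exists chi, r0, x, x; split=> //; exists z.
have -> : opU (wpq r r) (delta h) = 0.
  by apply: (pin_delta0 bU) => g /e1[_ cr]; case/negP: ncr.
exact (lin0 (pin_bdd (relU_bi hs)).1).
Qed.

Lemma weight_close s (theta k : char P -> C) (M e : R) b : Il s -> 0 <= M -> 0 <= e ->
  (forall chi, Y chi -> chi (dom s) -> cabs (theta chi) <= M) ->
  bounded_op b -> (forall h, b (delta h) = k (rng h) *: opU s (delta h)) ->
  (forall chi, Y chi -> chi (dom s) -> cabs (theta chi - k chi) <= e) ->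
  opnorm (opB (opT s theta) b) <= e.
Proof.
move=> hs M0 e0 hM bb hb he; have hT := opT_bdd hs M0 hM; have wM := wt_bound hs M0 hM.
pose d chi := theta chi - k chi; have hd := opT_bdd hs e0 he; have wd := wt_bound hs e0 he.
apply: (bdd_opnorm e0); have -> : opB (opT s theta) b = opT s d; last exact: hd.
apply: (bdd_ext (bddB hT (opnorm_bdd bb)) hd) => h; rewrite /opB hb.
have [[g sg]|ng] := pselect (exists g, relU s h g).
  rewrite /opT (pio_delta (relU_bi hs) wM M0 sg) (pio_delta (relU_bi hs) wd e0 sg).
  by rewrite (wt_at theta hs sg) (wt_at d hs sg) /opU (pin_delta (relU_bi hs) sg) -scalerBl.
rewrite /opT (pio_delta0 (relU_bi hs) wM M0); last by move=> g sg; apply: ng; exists g.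
rewrite (pio_delta0 (relU_bi hs) wd e0); last by move=> g sg; apply: ng; exists g.
by rewrite /opU (pin_delta0 (relU_bi hs)) ?scaler0 ?subr0// => g sg; apply: ng; exists g.
Qed.

Lemma elementary_const s c : Il s ->
  elementary_fun Y (fun g => if `[< bisection Y s g >] then c else 0 : C).
Proof.
move=> hs; exists s, (fun=> c); split=> //.
- by apply: continuous_subspaceT => x; exact: cvg_cst.
- by move=> chi Yc cs; rewrite asboolT//; exists chi.
- by move=> g ng; rewrite asboolF.
Qed.

Lemma Cc0 : Cc Y (fun=> 0 : C).
Proof. by exists 0%N, (fun _ _ => 0); split=> [[]//|g]; rewrite big_ord0. Qed.

Lemma CcD f f' : Cc Y f -> Cc Y f' -> Cc Y (fun g => f g + f' g : C).
Proof.
move=> [n [F [eF hF]]] [n' [F' [eF' hF']]].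
exists (n + n')%N, (fun i => match fintype.split i with inl j => F j | inr j => F' j end).
split=> [i|g]; first by case: (fintype.split i).
rewrite hF hF' big_split_ord /=; congr (_ + _); apply: eq_bigr => i _.
  by case: splitP => j /= e; [congr F; exact/val_inj|have := ltn_ord i; rewrite e ltnNge leq_addr].
case: splitP => j /= e; first by have := ltn_ord j; rewrite -e ltnNge leq_addr.
by congr F'; apply/val_inj/eqP; rewrite -(eqn_add2l n); apply/eqP.
Qed.

Lemma span2_Cc a b : span2 (Y := Y) a b -> exists2 f : set (pbij P * char P) -> C, Cc Y f & regular_rep f b.
Proof.
elim=> [|a1 b1 a2 b2 _ [f1 c1 r1] _ [f2 c2 r2]|c s hs].
- by exists (fun=> 0); [exact: Cc0|exact: regular_rep0].
- by exists (fun g => f1 g + f2 g); [exact: CcD|exact: regular_repD].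
- have h := elementary_const c hs; eexists; last first.
    apply: (regular_rep_opZU (f := fun g => if `[< bisection Y s g >] then c else 0)) => //.
      by move=> chi Yc cs; rewrite asboolT//; exists chi.
    by move=> g ng; rewrite asboolF.
  by exists 1%N, (fun=> fun g => if `[< bisection Y s g >] then c else 0); split=> // g; rewrite big_ord1.
Qed.

End OnY.

(* The same [a] serves every Y, in particular Omega and its boundary. *)
Lemma spanC_span2 s k : Il s -> spanC (R := R) k -> exists a, forall (Y : set (char P)) (YJ : Y `<=` @Jhat P)
  (Yact : forall s chi, Il s -> Y chi -> chi (dom s) -> Y (act s chi)),
  exists2 b, span2 (Y := Y) a b & forall h, b (delta h) = k (rng YJ h) *: opU (R := R) s (delta h).
Proof.
move=> hs; elim=> [|k1 k2 _ [a1 h1] _ [a2 h2]|c r].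
- exists (fun=> 0) => Y YJ Yact; exists (fun=> 0); first exact: span20.
  by move=> h; rewrite scale0r.
- exists (opD a1 a2) => Y YJ Yact; have [b1 s1 e1] := h1 Y YJ Yact; have [b2 s2 e2] := h2 Y YJ Yact.
  exists (opD b1 b2); first exact: span2D.
  by move=> h; rewrite /opD e1 e2 scalerDl.
- exists (opZ c (opV (R := R) (s \; wpq r r)%relation)) => Y YJ Yact.
  exists (opZ c (opU (s \; wpq r r)%relation)).
    by apply: span2G; apply: Il_comp => //; exact: Il_wpq.
  by move=> h; rewrite /opZ opU_restrict// scalerA.
Qed.

Section TwoSpaces.
Variables Y1 Y2 : set (char P).
Hypothesis Y1J : Y1 `<=` @Jhat P.
Hypothesis Y1act : forall s chi, Il s -> Y1 chi -> chi (dom s) -> Y1 (act s chi).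
Hypothesis JY1 : @Jhat P `<=` Y1.
Hypothesis Y2J : Y2 `<=` @Jhat P.
Hypothesis Y2act : forall s chi, Il s -> Y2 chi -> chi (dom s) -> Y2 (act s chi).

(** The smallest character, given by evaluation at the point 1. Its source fibre carries a copy of
    the left regular representation, so passing from V_s to U_s loses no norm on a space containing
    it. *)
Definition chi1 : char P := fun e => `[< constr_ideals e /\ e 1%g >].

Lemma chi1_Jhat : Jhat chi1.
Proof.
split=> [e /asboolP[]//|||e f he hf].
- by exists (pP 1%g); apply/asboolP; split; [exact: (pP_constr lc lcmP rev)|exact: mdiv_refl].
- by apply/negP => /asboolP[].
- apply/asboolP/andP => [[_ [e1 f1]]|[/asboolP[_ e1] /asboolP[_ f1]]].
    by split; apply/asboolP.
  by split=> //; exact: (constr_idealsI lc lcmP rev).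
Qed.

Lemma ch_chi1 r : ch chi1 r -> mdiv r 1%g. Proof. by move=> /asboolP[]. Qed.

Lemma span2_chi1 a b : span2 (Y := Y1) a b ->
  forall f, b (opJ (R := R) Y1 chi1 1%g f) = opJ Y1 chi1 1%g (a f).
Proof.
have Yc := JY1 chi1_Jhat; have c1 := ch1 lc lcmP rev chi1_Jhat.
have lJ := opJ_linear (R := R) lc rc lcmP rev Y1J 1%g Yc.
elim=> [|a1 b1 a2 b2 _ h1 _ h2|c s hs] f; first by rewrite (lin0 lJ).
  by rewrite /opD h1 h2 (linD lJ).
rewrite /opZ (linZ lJ); congr (_ *: _).
have bJ := opJ_biuniq lc rc lcmP rev Y1J 1%g Yc; have bU := relU_biuniq lc rc lcmP rev Y1J hs.
have bs := Il_biuniq lc hs.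
have h1 := bdd_comp ler01 (pin_bdd (R := R) bU) (pin_bdd bJ).
have h2 := bdd_comp ler01 (pin_bdd (R := R) bJ) (pin_bdd bs).
suff e : pin (relU (Y := Y1) s) \o opJ Y1 chi1 1%g = opJ Y1 chi1 1%g \o opV (R := R) s.
  exact: (congr1 (@^~ f) e).
apply: (bdd_ext h1 h2) => x; have [g ax] := arrow_ex lc lcmP rev Y1J x Yc c1.
change (opU (Y := Y1) s (opJ Y1 chi1 1%g (delta x)) = opJ Y1 chi1 1%g (opV (R := R) s (delta x))).
rewrite (opJ_delta R lc rc lcmP rev Y1J Yc ax).
have [[y sxy]|ns] := pselect (exists y, s (x, y)).
  have [k ay] := arrow_ex lc lcmP rev Y1J y Yc c1.
  rewrite /opU /opV (pin_delta bs sxy) (opJ_delta R lc rc lcmP rev Y1J Yc ay).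
  apply: (pin_delta bU); by exists chi1, 1%g, x, y.
rewrite /opV (pin_delta0 bs) ?(lin0 lJ); last by move=> y sxy; apply: ns; exists y.
rewrite /opU (pin_delta0 bU)// => k sgk; apply: ns.
have [l [z [y [el sy ay]]]] := relU_at lc rc lcmP rev Y1J hs Yc sgk ax.
have cl : ch chi1 l by case: ay => ? [].
have [w ew] := ch_chi1 cl; exists (y * w)%g.
have := Il_mul w hs sy; rewrite -mulgA.
by rewrite (_ : z * w = 1)%g ?mulg1// ew el mul1g.
Qed.

Lemma span2_isometric a b : span2 (R := R) (Y := Y1) a b -> opnorm b = opnorm a.
Proof.
move=> h; have [ba bb] := span2_bounded lc rc lcmP rev Y1J h.
apply/eqP; rewrite eq_le (span2_contractive lc rc lcmP rev Y1J h) /=.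
apply: opnorm_le; first exact: opnorm_ge0.
move=> f; have Yc := JY1 chi1_Jhat; have c1 := ch1 lc lcmP rev chi1_Jhat.
rewrite -(opJ_isometry lc rc lcmP rev Y1J (a f) Yc c1) -(span2_chi1 h).
by apply: (le_trans (opnormP bb _)); rewrite (opJ_isometry lc rc lcmP rev Y1J _ Yc c1).
Qed.

Definition span12 (b : l2 R (groupoid Y1) -> l2 R (groupoid Y1))
  (b' : l2 R (groupoid Y2) -> l2 R (groupoid Y2)) := exists a, span2 a b /\ span2 a b'.

Lemma span12_graph : hom_graph span12.
Proof.
have [g0 gb gD gZ [gM gA]] := span2_graph R lc rc lcmP rev Y1J.
have [g0' gb' gD' gZ' [gM' gA']] := span2_graph R lc rc lcmP rev Y2J.
split.
- by exists (fun=> 0).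
- by move=> b b' [a [/gb[_ ?] /gb'[_ ?]]].
- by move=> b b' c c' [a [h1 h2]] [a' [h3 h4]]; exists (opD a a'); split; [exact: gD|exact: gD'].
- by move=> c b b' [a [h1 h2]]; exists (opZ c a); split; [exact: gZ|exact: gZ'].
split=> [b b' c c' [a [h1 h2]] [a' [h3 h4]]|b b' [a [h1 h2]]].
  by exists (a \o a'); split; [exact: gM|exact: gM'].
by exists (adjoint a); split; [exact: gA|exact: gA'].
Qed.

Lemma span12_contractive b b' : span12 b b' -> opnorm b' <= opnorm b.
Proof.
move=> [a [h1 h2]]; rewrite (span2_isometric h1).
exact: (span2_contractive lc rc lcmP rev Y2J h2).
Qed.

Local Notation restr f := (patch (fun=> 0) (groupoid Y2) f).

(** The coefficient function h is approximated uniformly by elements of [spanC]. The same element of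
    the span of the V_s represents the approximation on both spaces, so the two convolution
    operators lie in the closed graph of the restriction map. *)
Lemma elementary_pair f : elementary_fun Y1 f -> exists T T',
  [/\ regular_rep f T, regular_rep (restr f) T' & gbar span12 T T'].
Proof.
move=> [s [h [hs hc f1 f0]]].
have eK : Y1 = @Jhat P by apply/seteqP; split.
have approx (e : R) : 0 < e -> exists2 k, spanC (R := R) k & forall chi, Jhat chi -> chi (dom s) -> cabs (h chi - k chi) <= e.
  by move=> e0; apply: (spanC_approx lc lcmP rev e0); rewrite -eK.
have [k1 sk1 hk1] := approx 1 ltr01; have [M1 M10 hM1] := spanC_bounded sk1.
have hM chi : Jhat chi -> chi (dom s) -> cabs (h chi) <= 1 + M1.
  move=> Jc cs; have -> : h chi = (h chi - k1 chi) + k1 chi by rewrite subrK.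
  by apply: (le_trans (cabsD _ _)); apply: lerD => //; exact: hk1.
have M0 : 0 <= 1 + M1 by rewrite addr_ge0.
have hMY1 chi : Y1 chi -> chi (dom s) -> cabs (h chi) <= 1 + M1 by move=> /Y1J; exact: hM.
have hMY2 chi : Y2 chi -> chi (dom s) -> cabs (h chi) <= 1 + M1 by move=> /Y2J; exact: hM.
have bT := bounded_bdd M0 (opT_bdd Y1J Y1act hs M0 hMY1).
have bT' := bounded_bdd M0 (opT_bdd Y2J Y2act hs M0 hMY2).
exists (opT Y1J s h), (opT Y2J s h); split.
- exact: (regular_rep_opT Y1J Y1act hs M0 hMY1).
- apply: (regular_rep_opT Y2J Y2act hs M0 hMY2) => [chi Y2c cs|g ng].
    rewrite patchT ?f1//; first by apply: JY1; exact: Y2J.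
    by rewrite inE; exists s, chi.
  have [gY|gY] := pselect (groupoid Y2 g); last by rewrite patchN// notin_setE.
  rewrite patchT ?inE// f0// => -[chi [Yc /= cs] eg]; apply: ng.
  move: gY => [t [psi [ht Ypsi ct e]]]; exists psi; last first.
    have := germ_mem hs cs; rewrite eg e => -[/= _ ec _ _].
    by rewrite -e -eg ec.
  split=> //=; have := germ_mem hs cs; rewrite eg e => -[/= _ <- _ _]; exact: cs.
- split=> // e e0; have e2 : 0 < e / 2 by rewrite divr_gt0.
  have e2e : e / 2 < e by rewrite ltr_pdivrMr// ltr_pMr// ltr1n.
  have [k sk hk] := approx _ e2; have [a ha] := spanC_span2 hs sk.
  have [b sb eb] := ha Y1 Y1J Y1act; have [b' sb' eb'] := ha Y2 Y2J Y2act.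
  have [_ bb] := span2_bounded lc rc lcmP rev Y1J sb; have [_ bb'] := span2_bounded lc rc lcmP rev Y2J sb'.
  exists b, b'; split; first by exists a.
    apply: le_lt_trans e2e; apply: (weight_close Y1act hs M0 (ltW e2) hMY1 bb eb).
    by move=> chi /Y1J; exact: hk.
  apply: le_lt_trans e2e; apply: (weight_close Y2act hs M0 (ltW e2) hMY2 bb' eb').
  by move=> chi /Y2J; exact: hk.
Qed.

Lemma Cc_pair f : Cc Y1 f -> exists T T',
  [/\ regular_rep f T, regular_rep (restr f) T' & gbar span12 T T'].
Proof.
move=> [n [F [eF hF]]]; have -> : f = fun g => \sum_(i < n) F i g by apply/funext.
elim: n F eF {f hF} => [|n ih] F eF.
  have e : (fun g => \sum_(i < 0) F i g) = fun=> 0 by apply/funext => g; rewrite big_ord0.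
  exists (fun=> 0), (fun=> 0); rewrite e; split; [exact: regular_rep0| |exact: gbar0 span12_graph].
  have -> : restr (fun=> 0 : C) = fun=> 0 by apply/funext => g; rewrite /patch; case: ifP.
  exact: regular_rep0.
have [T1 [T1' [r1 r1' g1]]] := ih (fun i => F (widen_ord (leqnSn n) i)) (fun i => eF _).
have [T2 [T2' [r2 r2' g2]]] := elementary_pair (eF ord_max).
exists (opD T1 T2), (opD T1' T2'); split.
- have -> : (fun g => \sum_(i < n.+1) F i g) =
      fun g => \sum_(i < n) F (widen_ord (leqnSn n) i) g + F ord_max g.
    by apply/funext => g; rewrite big_ord_recr.
  exact: regular_repD.
- have -> : restr (fun g => \sum_(i < n.+1) F i g) =
      fun g => restr (fun g => \sum_(i < n) F (widen_ord (leqnSn n) i) g) g + restr (F ord_max) g.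
    by apply/funext => g; rewrite /patch; case: ifP => _; rewrite ?addr0// big_ord_recr.
  exact: regular_repD.
- exact: (gbarD span12_graph g1 g2).
Qed.

End TwoSpaces.
End RegularRepresentation.

(** * The reduced algebra as the closed span of partial isometries *)

Section ToeplitzAlgebra.
Variables (R : realType) (P : monoidType).
Local Notation C := R[i].
Local Notation VP := (@opV R P).
Local Open Scope ring_scope.
Local Open Scope complex_scope.
Implicit Types (p q r x y z : P) (s t v : pbij P) (chi : char P).

Hypothesis lc : forall x y z : P, (x * y = x * z)%g -> y = z.

Lemma spanV_bounded a : spanV a -> @bounded_op R P a.
Proof.
elim=> [|a1 a2 _ h1 _ h2|c s hs]; first exact: bounded_op0.
  exact: bounded_opD.
by apply: bounded_opZ; exact: opV_bounded.
Qed.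

Lemma spanVZ c a : spanV a -> @spanV R P (opZ c a).
Proof.
elim=> [|a1 a2 _ h1 _ h2|d s hs]; first by rewrite opZ0; exact: spanV0.
  by rewrite opZD; exact: spanVD.
by rewrite opZA; exact: spanVG.
Qed.

Lemma spanVM a b : spanV a -> spanV b -> @spanV R P (a \o b).
Proof.
move=> h1 h2; elim: h1 => [|a1 a2 _ i1 _ i2|c s hs]; first exact: spanV0.
  exact: spanVD i1 i2.
have lV := bounded_op_linear (bounded_opZ c (opV_bounded R lc hs)).
elim: h2 => [|a1 a2 _ i1 _ i2|d t ht].
- by rewrite (opM0 lV); exact: spanV0.
- by rewrite (opMD _ _ lV); exact: spanVD.
- by rewrite (opZM _ _ _ (opV_bounded R lc hs).1) opV_comp//; apply/spanVG/Il_comp.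
Qed.

Lemma spanV_adj a : spanV a -> @spanV R P (adjoint a).
Proof.
elim=> [|a1 a2 h1 i1 h2 i2|c s hs]; first by rewrite adj0; exact: spanV0.
  by rewrite adjD; [exact: spanVD|exact: spanV_bounded..].
by rewrite (adjZ _ (opV_bounded R lc hs)) opV_adj//; apply/spanVG/Il_inv.
Qed.

Definition CL := @aclosure R (bounded_ops R P) (@spanV R P).

Lemma CL_csub : @cstar_subalg R (bounded_ops R P) CL.
Proof.
apply: closure_csub; [exact: spanV_bounded|exact: spanV0|exact: spanVD|exact: spanVZ|exact: spanVM|exact: spanV_adj].
Qed.

Lemma spanV_CL a : spanV a -> CL a.
Proof.
move=> ha; apply/aclosureE; split; first exact: spanV_bounded.
move=> e e0; exists a => //; apply: le_lt_trans e0; apply: opnorm_le => // f.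
by rewrite /opB subrr l2norm0 mul0r.
Qed.

Lemma opZ1 (X : choiceType) (a : l2 R X -> l2 R X) : opZ 1 a = a.
Proof. by apply/funext => f; exact: scale1r. Qed.

Lemma opV_span s : Il s -> spanV (VP s).
Proof. by move=> hs; rewrite -[VP s]opZ1; exact: spanVG. Qed.

Lemma opV_CL s : Il s -> CL (VP s). Proof. by move=> hs; apply/spanV_CL/opV_span. Qed.

Lemma left_regularE p T : left_regular p T <-> T = VP (left_mult p).
Proof.
have hp := Il_left p; have bp := Il_biuniq lc hp.
have d x : VP (left_mult p) (delta x) = delta (p * x)%g by apply: (pin_delta bp).
split=> [[bT hT]|->]; last by split; [exact: opV_bounded|].
by apply: bounded_ext => //; [exact: opV_bounded|move=> x; rewrite hT d].
Qed.

Lemma Cstar_lambda_elts : cstar_generated (bounded_ops R P) [set T | exists p, left_regular p T] = CL.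
Proof.
apply/seteqP; split=> [T|T hT B hB sB].
  apply; first exact: CL_csub.
  by move=> S [p /left_regularE ->]; apply: opV_CL; exact: Il_left.
have hV s : Il s -> B (VP s).
  elim=> [p|s1 t1 h1 B1 h2 B2|s1 h1 B1].
  - by apply: sB; exists p; apply/left_regularE.
  - by rewrite -opV_comp//; exact: (csubM hB B1 B2).
  - by rewrite -opV_adj//; exact: (csub_adj hB B1).
have hS a : spanV a -> B a.
  elim=> [|a1 a2 _ B1 _ B2|c s hs]; first exact: (csub0 hB).
    exact: (csubD hB B1 B2).
  by apply: (csubZ hB); exact: hV.
have [bT h] := (aclosureE _ _).1 hT; apply: (csub_closed hB) => // e /h[b sb hb].
by exists b => //; exact: hS.
Qed.

Lemma CL_approx T (e : R) : CL T -> 0 < e -> exists2 S, spanV S & opnorm (opB T S) < e.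
Proof. by move=> /aclosureE[_ h] /h. Qed.

End ToeplitzAlgebra.

(** * The canonical projection and its kernel for left reversible monoids *)

Section BoundaryKernel.
Variables (R : realType) (P : monoidType).
Local Notation C := R[i].
Local Notation VP := (@opV R P).
Local Open Scope ring_scope.
Local Open Scope complex_scope.
Implicit Types (p q r x y z : P) (s t v : pbij P) (chi : char P).

Hypothesis lc : forall x y z : P, (x * y = x * z)%g -> y = z.
Hypothesis rc : forall x y z : P, (x * z = y * z)%g -> x = y.
Hypothesis lcmP : forall x y : P, (exists z, mdiv x z /\ mdiv y z) ->
  exists l, forall z, (mdiv x z /\ mdiv y z) <-> mdiv l z.
Hypothesis rev : forall x y : P, exists z, mdiv x z /\ mdiv y z.

(** The largest character. It exists because, with common multiples available, constructible ideals
    are non-empty and closed under intersection. *)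
Definition chi_oo : char P := fun e => `[< constr_ideals e >].

Lemma chi_oo_Jhat : Jhat chi_oo.
Proof.
split=> [e /asboolP//|||e f he hf].
- by exists (pP 1%g); apply/asboolP; exact: (pP_constr lc lcmP rev).
- by apply/negP => /asboolP/(constr_ideals_neq0 lc lcmP rev).
- by rewrite /chi_oo !asboolT//; exact: (constr_idealsI lc lcmP rev).
Qed.

Lemma ch_oo r : ch chi_oo r. Proof. by apply/asboolP; exact: (pP_constr lc lcmP rev). Qed.

Lemma chi_oo_max chi : Jhat chi -> (forall e, chi e -> chi_oo e).
Proof. by move=> [h _ _ _] e /h ce; apply/asboolP. Qed.

Lemma boundaryE : @boundary P = [set chi_oo].
Proof.
have m : maximal_chars chi_oo.
  split=> [|psi hpsi le]; first exact: chi_oo_Jhat.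
  apply/funext => e; apply/idP/idP; [exact: chi_oo_max|exact: le].
have u chi : maximal_chars chi -> chi = chi_oo.
  by move=> [hc /(_ _ chi_oo_Jhat) h]; rewrite h//; exact: chi_oo_max.
apply/seteqP; split=> [chi [hc cl]|_ ->]; last first.
  by split; [exact: chi_oo_Jhat|exact: subset_closure].
apply/funext => e; have [psi [/u -> /= ag]] := cl _ (agree_nbhs [:: e] chi).
by rewrite (ag e) ?mem_head.
Qed.

Local Notation O := (@Omega P).
Local Notation bd := (@boundary P).

Lemma OJ : O `<=` @Jhat P. Proof. by rewrite (Omega_Jhat lc lcmP rev). Qed.
Lemma JO : @Jhat P `<=` O. Proof. by rewrite (Omega_Jhat lc lcmP rev). Qed.
Lemma bJ : bd `<=` @Jhat P. Proof. by move=> chi []. Qed.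
Lemma Oact s chi : Il s -> O chi -> chi (dom s) -> O (act s chi).
Proof. by move=> hs /OJ hc cs; apply: JO; exact: (act_Jhat lc lcmP rev). Qed.
Lemma bact s chi : Il s -> bd chi -> chi (dom s) -> bd (act s chi).
Proof.
move=> hs; rewrite boundaryE => -> cs /=; apply: (char_ext lc lcmP rev).
- by move=> e /act_constr.
- by move=> e /asboolP.
move=> r; split=> _; first exact: ch_oo.
apply/(act_ch lc lcmP rev chi_oo_Jhat _ hs); have [p [q e]] := Il_wpq_rev lc lcmP rev hs.
have [z [[a ea] rz]] := rev p r; exists (q * a)%g, z; split=> //; first exact: ch_oo.
by rewrite e; exists a.
Qed.

Local Notation SO := (@span2 R P O).
Local Notation Sb := (@span2 R P bd).
Local Notation S12 := (@span12 R P O bd).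

Let gO := span2_graph R lc rc lcmP rev OJ.
Let cO := span2_contractive (R := R) lc rc lcmP rev OJ.
Let iO := span2_isometric (R := R) lc rc lcmP rev OJ JO.
Let g12 := span12_graph R lc rc lcmP rev OJ bJ.
Let c12 := span12_contractive (R := R) lc rc lcmP rev OJ JO bJ.

Lemma aclosure_eq (X : choiceType) (S1 S2 : set (l2 R X -> l2 R X)) :
  S1 `<=` @aclosure R (bounded_ops R X) S2 -> S2 `<=` S1 ->
  @aclosure R (bounded_ops R X) S1 = @aclosure R (bounded_ops R X) S2.
Proof.
move=> h12 h21; apply/seteqP; split=> a /aclosureE[ba h]; apply/aclosureE; split=> // e e0.
  have [b S1b hb] := h _ (divr_gt0 e0 (ltr0Sn _ 1)).
  have [bb hb'] := (aclosureE _ _).1 (h12 _ S1b); have [c S2c hc] := hb' _ (divr_gt0 e0 (ltr0Sn _ 1)).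
  have [] := (aclosureE _ c).1 (h12 _ (h21 _ S2c)) => bc _.
  exists c => //; apply: (le_lt_trans (opnorm_triangle ba bb bc)).
  by rewrite [e]splitr; exact: ltrD.
by have [b S2b hb] := h _ e0; exists b => //; exact: h21.
Qed.

Let gdomO : gdom SO = @CL R P.
Proof.
rewrite /gdom /CL; congr (@aclosure _ (bounded_ops R P) _); apply/seteqP; split=> a.
  by move=> [b /span2_spanV].
exact: spanV_span2.
Qed.

Let elts_O : @aclosure R (bounded_ops R (groupoid O)) [set T | exists2 f, Cc O f & regular_rep f T] = gdom S12.
Proof.
apply: aclosure_eq => [T [f cf rT]|b [b' [a [h _]]]].
  have [T1 [T1' [r1 _ h1]]] := Cc_pair lc rc lcmP rev OJ Oact JO bJ bact cf.
  rewrite (regular_rep_uniq lc lcmP rev OJ rT r1).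
  exact: gbar_dom h1.
exact: (span2_Cc lc rc lcmP rev OJ Oact h).
Qed.

Let gdom12 : gdom S12 = gran SO.
Proof.
rewrite /gdom /gran; congr (@aclosure _ (bounded_ops R (groupoid O)) _); apply/seteqP; split=> b.
  by move=> [b' [a [h _]]]; exists a.
by move=> [a h]; have [b' h'] := spanV_span2 bd (span2_spanV h); exists b', a.
Qed.

Let gran12 : gran S12 `<=` @aclosure R (bounded_ops R (groupoid bd)) [set T | exists2 f, Cc bd f & regular_rep f T].
Proof.
move=> T /aclosureE[bT h]; apply/aclosureE; split=> // e /h[b [b0 [a [_ hb]]] lb].
by exists b => //; exact: (span2_Cc lc rc lcmP rev bJ bact hb).
Qed.

Lemma canonical_iso_ex : @canonical_iso R P (gext SO).
Proof.
split.
  rewrite /Cstar_lambda /Cstar_groupoid (Cstar_lambda_elts R lc) elts_O gdom12 -gdomO.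
  exact: gext_iso gO iO.
move=> p T /(left_regularE lc) ->; have hp := Il_left p.
have h : SO (VP (left_mult p)) (opU (left_mult p)).
  by rewrite -[VP _]opZ1 -[opU _]opZ1; exact: span2G.
rewrite (gextE gO cO (gbar_sub gO h)) -[opU _]opZ1.
apply: (regular_rep_opZU lc rc lcmP rev OJ Oact) => //.
  by move=> chi Oc cs; rewrite indicE mem_set//; exists chi.
by move=> g ng; rewrite indicE memNset.
Qed.

Lemma restriction_map_ex : @restriction_map R P (gext S12).
Proof.
split; last first.
  move=> f T cf rT; have [T1 [T1' [r1 r1' h1]]] := Cc_pair lc rc lcmP rev OJ Oact JO bJ bact cf.
  by rewrite (regular_rep_uniq lc lcmP rev OJ rT r1) (gextE g12 c12 h1).
have [h1 h2 h3 h4 h5] := gext_hom g12 c12.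
rewrite /Cstar_groupoid elts_O; split=> [a Da|a b Da Db|c a Da|a b Da Db|a Da].
- exact: gran12 (h1 _ Da).
- exact: h2.
- exact: h3.
- exact: h4.
- exact: h5.
Qed.

(** [Ker_boundary] asks for a canonical projection that kills T, so no operator can be put into the
    kernel before one is constructed. *)
Lemma canonical_projection_ex : exists pi, @canonical_projection R P pi.
Proof.
exists (gext S12 \o gext SO), (gext SO), (gext S12).
by split; [exact: canonical_iso_ex|exact: restriction_map_ex|].
Qed.

Section Projection.
Variable pi : @Cstar_lambda R P -> Cstar_groupoid R bd.
Hypothesis hpi : canonical_projection pi.

Lemma projection_hom : @star_hom R (sub_alg (bounded_ops R P) (@CL R P)) (Cstar_groupoid R bd) pi.
Proof.
have [Phi [rho [[[[a1 a2 a3 a4 a5] _] _] [[b1 b2 b3 b4 b5] _] ->]]] := hpi.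
rewrite /Cstar_lambda (Cstar_lambda_elts R lc) in a1 a2 a3 a4 a5.
split=> [a Da|a b Da Db|c a Da|a b Da Db|a Da] /=.
- exact/b1/a1.
- by rewrite a2// b2//; exact: a1.
- by rewrite a3// b3//; exact: a1.
- by rewrite a4// b4//; exact: a1.
- by rewrite a5// b5//; exact: a1.
Qed.

Lemma projection_opV s : Il s -> pi (VP s) = opU (R := R) (Y := bd) s.
Proof.
have [p1 p2 p3 p4 p5] := projection_hom.
elim=> [p|s1 t1 h1 e1 h2 e2|s1 h1 e1].
- have [Phi [rho [[_ hPhi] [_ hrho] ->]]] := hpi.
  have hp := Il_left p; have lr := (left_regularE lc p (VP (left_mult p))).2 erefl.
  have r1 := hPhi p _ lr.
  have cf : Cc O (\1_(bisection O (left_mult p)) : _ -> C).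
    have h := elementary_const (R := R) O 1 hp.
    exists 1%N, (fun=> fun g => if `[< bisection O (left_mult p) g >] then 1 else 0).
    split=> // g; rewrite big_ord1 indicE; case: asboolP => h0; first by rewrite mem_set.
    by rewrite memNset.
  have r2 := hrho _ _ cf r1.
  apply: (regular_rep_uniq lc lcmP rev bJ r2); rewrite -[opU _]opZ1.
  apply: (regular_rep_opZU lc rc lcmP rev bJ bact) => //.
    move=> chi bc cs; rewrite patchT; last by rewrite inE; exists (left_mult p), chi.
    rewrite indicE mem_set//; exists chi => //; split=> //; exact/JO/bJ.
  move=> g ng; rewrite /patch; case: ifP => // /set_mem gb; rewrite indicE memNset// => -[chi [Oc /= cs] eg].
  apply: ng; move: gb => [t [psi [ht bpsi ct e]]].
  have := germ_mem hp cs; rewrite eg e => -[/= _ ec _ _].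
  by exists chi; [split; [rewrite ec|]|rewrite eg].
- by rewrite -(opV_comp R lc h1 h2) p4 ?e1 ?e2; [exact: (opU_comp R lc rc lcmP rev bJ h1 h2)|exact: opV_CL..].
- by rewrite -(opV_adj R lc h1) p5 ?e1; [exact: (opU_adj R lc rc lcmP rev bJ h1)|exact: opV_CL].
Qed.

Lemma projection_span a b : Sb a b -> pi a = b.
Proof.
have [p1 p2 p3 p4 p5] := projection_hom.
have p0 : pi (fun=> 0) = fun=> 0.
  have CL0 := csub0 (CL_csub R lc); have e : opZ 0 (fun=> 0 : l2 R P) = (fun=> 0) by exact: opZ0.
  have h := p3 0 _ CL0; rewrite -[ascale 0 _ in X in pi X]/(opZ 0 (fun=> 0 : l2 R P)) e in h.
  by rewrite h; apply/funext => f; exact: scale0r.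
elim=> [|a1 b1 a2 b2 h1 e1 h2 e2|c s hs]; first exact: p0.
  by rewrite (p2 a1 a2) ?e1 ?e2//; apply: spanV_CL => //; [exact: (span2_spanV h1)|exact: (span2_spanV h2)].
by rewrite (p3 c (VP s)) ?projection_opV//; exact: opV_CL.
Qed.

Lemma projection_contractive a : CL a -> opnorm (pi a) <= opnorm a.
Proof.
move=> Ca; have := @star_hom_contractive R _ _ _ _ (CL_csub R lc) _ pi projection_hom a Ca.
by apply=> t /aclosureE[].
Qed.

End Projection.

Lemma relU_left_onto p (g : groupoid bd) : exists k, relU (left_mult p) k g.
Proof.
have [chi [r [x [bc ax]]]] := arrowP lc lcmP rev bJ g.
have e : chi = chi_oo by move: bc; rewrite boundaryE.
have [z [[a ea] [b eb]]] := rev x p.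
have cra : ch chi (r * a)%g by rewrite e; exact: ch_oo.
have [k ak] := arrow_ex lc lcmP rev bJ b bc cra.
exists k, chi, (r * a)%g, b, z; split=> //.
by rewrite ea; apply: arrow_at_mul.
Qed.

(** Every x has a common multiple with p, and at the boundary point all r belong to the filter; so
    the isometry U_p is onto. *)
Lemma opU_left_adj p : opU (R := R) (Y := bd) (left_mult p) \o adjoint (opU (R := R) (Y := bd) (left_mult p)) = id.
Proof.
have hp := Il_left p; have bU := relU_biuniq lc rc lcmP rev bJ hp.
rewrite (pin_adj bU); apply/funext => f; apply: l2P => g /=.
have [k kg] := relU_left_onto p g; rewrite (pinE bU _ kg).
exact: (pinE (biuniqV bU)).
Qed.

(** For s = [wpq p q] the map is defined on all of p'P as soon as q divides p'. On such vectors V_s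
    and U_s agree through the copy of l2(P) in the fibre of [chi_oo]. *)
Lemma span2_boundary_deep a b : Sb a b -> exists p, forall p', mdiv p p' ->
  forall f, opJ bd chi_oo 1%g (a (VP (left_mult p') f)) = b (opJ bd chi_oo 1%g (VP (left_mult p') f)).
Proof.
have bc : bd chi_oo by rewrite boundaryE.
have lJ := opJ_linear (R := R) lc rc lcmP rev bJ 1%g bc.
elim=> [|a1 b1 a2 b2 _ [p1 h1] _ [p2 h2]|c s hs].
- by exists 1%g => p' _ f; rewrite (lin0 lJ).
- have [z [m1 m2]] := rev p1 p2; exists z => p' zp f.
  by rewrite /opD (linD lJ) h1 ?h2//; [exact: mdiv_trans zp|exact: mdiv_trans zp].
have [p [q es]] := Il_wpq_rev lc lcmP rev hs; exists q => p' [w ew] f.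
rewrite /opZ (linZ lJ); congr (_ *: _).
have bJ' := opJ_biuniq lc rc lcmP rev bJ 1%g bc; have bU := relU_biuniq lc rc lcmP rev bJ hs.
have bs := Il_biuniq lc hs; have bl := Il_biuniq lc (Il_left p').
have b1 := bdd_comp ler01 (pin_bdd (R := R) bJ') (bdd_comp ler01 (pin_bdd (R := R) bs) (pin_bdd bl)).
have b2 := bdd_comp ler01 (pin_bdd (R := R) bU) (bdd_comp ler01 (pin_bdd (R := R) bJ') (pin_bdd bl)).
suff e : opJ bd chi_oo 1%g \o (VP s \o VP (left_mult p')) =
    opU s \o (opJ bd chi_oo 1%g \o VP (left_mult p')) by exact: (congr1 (@^~ f) e).
apply: (bdd_ext b1 b2) => x.
change (opJ bd chi_oo 1%g (VP s (VP (left_mult p') (delta x))) =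
  opU s (opJ bd chi_oo 1%g (VP (left_mult p') (delta x)))).
have -> : VP (left_mult p') (delta x) = delta (p' * x)%g by apply: (pin_delta bl).
have sxy : s ((p' * x)%g, (p * (w * x))%g).
  by rewrite es; exists (w * x)%g; split=> //=; rewrite ew mulgA.
rewrite {1}/opV (pin_delta bs sxy).
have [g ag] := arrow_ex lc lcmP rev bJ (p' * x)%g bc (ch_oo 1%g).
have [k ak] := arrow_ex lc lcmP rev bJ (p * (w * x))%g bc (ch_oo 1%g).
rewrite (opJ_delta R lc rc lcmP rev bJ bc ag) (opJ_delta R lc rc lcmP rev bJ bc ak).
by symmetry; apply: (pin_delta bU); exists chi_oo, 1%g, (p' * x)%g, (p * (w * x))%g.
Qed.

(** If the projection kills T, the image b of an approximant S of T is small, and S V_p acts like b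
    on deep vectors, so T V_p is small. Conversely pi(T) = pi(T V_p) U_p^* for every p, since U_p
    U_p^* = 1, and pi is contractive. *)
Lemma Ker_boundaryP T : Ker_boundary R P T <-> CL T /\
  forall e : R, 0 < e -> exists p, opnorm (T \o VP (left_mult p)) < e.
Proof.
have bc : bd chi_oo by rewrite boundaryE.
have hD := CL_csub R lc; have bV p := opV_bounded R lc (Il_left p).
have nV p : opnorm (VP (left_mult p)) <= 1 by apply: (bdd_opnorm ler01); apply: pin_bdd; exact: (Il_biuniq lc (Il_left p)).
have cB (pi : @Cstar_lambda R P -> Cstar_groupoid R bd) (hpi : canonical_projection pi) a b : CL a -> CL b -> pi (opB a b) = opB (pi a) (pi b).
  move=> Ca Cb; have [p1 p2 p3 p4 p5] := projection_hom hpi.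
  have Cz := csubZ hD (-1) Cb; rewrite opBE (p2 _ _ Ca Cz) (p3 _ _ Cb).
  by apply/funext => f; rewrite /opB /= scaleN1r.
rewrite /Ker_boundary /mkset /Cstar_lambda (Cstar_lambda_elts R lc).
split=> [[CT [pi hpi piT]]|[CT hT]].
  split; first exact: CT.
  move=> e e0; have [S sS hS] := CL_approx CT (divr_gt0 e0 (ltr0Sn _ 1)).
  have [b hb] := spanV_span2 bd sS; have [p hp] := span2_boundary_deep hb.
  have CS := spanV_CL lc sS; have bT := csub_bounded hD CT; have bS := csub_bounded hD CS.
  have [_ bb] := span2_bounded lc rc lcmP rev bJ hb.
  have nb : opnorm b < e / 2.
    apply: le_lt_trans hS; have := projection_contractive hpi (csubB hD CT CS).
    rewrite (cB _ hpi _ _ CT CS) piT (projection_span hpi hb).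
    rewrite (_ : opB _ _ = opZ (-1) b); last by apply/funext => f; rewrite /opB /opZ scaleN1r sub0r.
    apply: le_trans; rewrite -{1}[b](_ : opZ (-1) (opZ (-1) b) = b).
      apply: (le_trans (opnormZ _ (bounded_opZ _ bb))); by rewrite cabsN cabs1 mul1r.
    by rewrite opZA mulrNN mulr1 opZ1.
  exists p; have -> : T \o VP (left_mult p) = opD (opB T S \o VP (left_mult p)) (S \o VP (left_mult p)).
    by apply/funext => f; rewrite /opD /opB /= subrK.
  have bTS := bounded_opB bT bS.
  apply: (le_lt_trans (opnormD (bounded_opM bTS (bV p)) (bounded_opM bS (bV p)))).
  rewrite [e]splitr; apply: ltr_leD.
    apply: (le_lt_trans (opnormM bTS (bV p))); apply: le_lt_trans hS.
    by rewrite -[leRHS]mulr1; apply: ler_pM; rewrite ?opnorm_ge0.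
  apply: (@le_trans _ _ (opnorm b)); last exact: ltW.
  apply: opnorm_le => [|f]; first exact: opnorm_ge0.
  rewrite -[S \o _]/(fun f => S (VP (left_mult p) f)).
  rewrite -(opJ_isometry lc rc lcmP rev bJ _ bc (ch_oo 1%g)) (hp _ (mdiv_refl p)).
  apply: (le_trans (opnormP bb _)); rewrite ler_wpM2l ?opnorm_ge0//.
  rewrite (opJ_isometry lc rc lcmP rev bJ _ bc (ch_oo 1%g)).
  by apply: (le_trans (opnormP (bV p) f)); rewrite ler_piMl ?l2norm_ge0.
split; first exact: CT.
have [pi hpi] := canonical_projection_ex; exists pi; first exact: hpi.
have [p1 p2 p3 p4 p5] := projection_hom hpi.
have bpi a : CL a -> bounded_op (pi a) by move=> /p1/aclosureE[].
apply: opnorm_eq0; first exact: bpi.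
apply/eqP; rewrite eq_le opnorm_ge0 andbT; apply/ler_addgt0Pr => e e0; rewrite add0r.
have [p hp] := hT e e0; have hl := Il_left p; have CV := opV_CL R lc hl.
have bU := opU_bounded R lc rc lcmP rev bJ hl.
have e1 : pi T = pi (T \o VP (left_mult p)) \o adjoint (opU (left_mult p)).
  by rewrite (p4 _ _ CT CV) (projection_opV hpi hl) /= -[RHS]/(pi T \o (opU _ \o adjoint (opU _))) opU_left_adj.
have CTV := csubM hD CT CV.
rewrite e1; apply: (le_trans (opnormM (bpi _ CTV) (adjoint_bounded bU))).
apply: (@le_trans _ _ (opnorm (pi (T \o VP (left_mult p))) * 1)).
  rewrite ler_wpM2l ?opnorm_ge0// opnorm_adjE//; apply: (bdd_opnorm ler01); apply: pin_bdd.
  exact: (relU_biuniq lc rc lcmP rev bJ hl).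
rewrite mulr1; apply: (le_trans (projection_contractive hpi CTV)); exact: ltW.
Qed.

End BoundaryKernel.

(** * Ideals of the reduced algebra *)

Section ArtinOperators.
Variables (R : realType) (A : choiceType) (m : A -> A -> option nat).
Hypothesis hm : coxeter_matrix m.
Local Notation P := (artin_tits m).
Local Notation C := R[i].
Local Notation VP := (@opV R P).
Local Notation CLP := (@CL R P).
Local Open Scope ring_scope.
Local Open Scope complex_scope.
Implicit Types (p q r x y z : P) (Y Z : set P) (S T U : l2 R P -> l2 R P) (a b c d : A).

Lemma artin_lc : forall x y z : P, (x * y = x * z)%g -> y = z. Proof. exact: artin_lcancel. Qed.
Lemma artin_rc : forall x y z : P, (x * z = y * z)%g -> x = y. Proof. exact: artin_rcancel. Qed.
Lemma artin_lcmP : forall x y : P, (exists z, mdiv x z /\ mdiv y z) ->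
  exists l, forall z, (mdiv x z /\ mdiv y z) <-> mdiv l z.
Proof.
move=> x y [z [xz yz]]; have [l [xl yl h _]] := artin_lcm hm xz yz; exists l => w.
split=> [[xw yw]|lw]; first exact: h.
by split; [exact: mdiv_trans lw|exact: mdiv_trans lw].
Qed.

Let lc := artin_lc.
Let hD := CL_csub R lc.

Definition Vl p : l2 R P -> l2 R P := VP (left_mult p).

Lemma Vl_CL p : CLP (Vl p). Proof. exact (opV_CL R lc (Il_left p)). Qed.
Lemma Vl_bounded p : bounded_op (Vl p). Proof. exact (opV_bounded R lc (Il_left p)). Qed.
Lemma Vls_CL p : CLP (adjoint (Vl p)). Proof. exact (csub_adj hD (Vl_CL p)). Qed.

Let bl p := Il_biuniq lc (Il_left p).

Lemma Vl_delta p x : Vl p (delta x) = delta (p * x)%g. Proof. exact (pin_delta (bl p) (erefl _)). Qed.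
Lemma VlE p f x : Vl p f (p * x)%g = f x. Proof. exact (pinE (bl p) f (erefl _)). Qed.
Lemma VlN p f y : ~ mdiv p y -> Vl p f y = 0.
Proof. by move=> h; apply: (pin0 (bl p)) => x e; apply: h; exists x. Qed.
Lemma VlsE p f x : adjoint (Vl p) f x = f (p * x)%g.
Proof.
rewrite /Vl /opV (pin_adj (bl p)); exact: (pinE (biuniqV (bl p))).
Qed.

Lemma VlsVl p : adjoint (Vl p) \o Vl p = id.
Proof. by apply/funext => f; apply: l2P => x; rewrite /= VlsE VlE. Qed.

Lemma ind_ext Y Z : (forall x, Y x <-> Z x) -> ind Y = ind Z :> (l2 R P -> l2 R P).
Proof. by move=> e; congr ind; apply/seteqP; split=> x /e. Qed.

Lemma ind_pP p : ind (pP p) = Vl p \o adjoint (Vl p).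
Proof.
apply/funext => f; apply: l2P => y /=; have [[x ->]|h] := pselect (mdiv p y).
  by rewrite VlE VlsE indE//; exists x.
by rewrite VlN// indN.
Qed.

Lemma ind_setT : ind setT = id :> (l2 R P -> l2 R P).
Proof. by apply/funext => f; apply: l2P => y; rewrite indE. Qed.

Lemma indI Y Z : ind (Y `&` Z) = ind Y \o ind Z :> (l2 R P -> l2 R P).
Proof.
apply/funext => f; apply: l2P => y /=; have [Yy|nY] := pselect (Y y); last first.
  by rewrite indN ?indN// => -[].
rewrite [RHS]indE//; have [Zy|nZ] := pselect (Z y); first by rewrite !indE.
by rewrite !indN// => -[].
Qed.

Lemma indC Y : ind (~` Y) = opB id (ind Y) :> (l2 R P -> l2 R P).
Proof.
apply/funext => f; apply: l2P => y; rewrite /opB l2BE; have [Yy|nY] := pselect (Y y).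
  by rewrite indN ?indE ?subrr// => /(_ Yy).
by rewrite [LHS]indE// indN// subr0.
Qed.

Lemma id_CL : CLP id.
Proof. by have := csubM hD (Vls_CL 1%g) (Vl_CL 1%g); rewrite VlsVl. Qed.
Lemma indP_CL p : CLP (ind (pP p)).
Proof. rewrite ind_pP; exact (csubM hD (Vl_CL p) (Vls_CL p)). Qed.
Lemma indI_CL Y Z : CLP (ind Y) -> CLP (ind Z) -> CLP (ind (Y `&` Z)).
Proof. move=> h1 h2; rewrite indI; exact (csubM hD h1 h2). Qed.
Lemma indC_CL Y : CLP (ind Y) -> CLP (ind (~` Y)).
Proof. by move=> h; rewrite indC; exact (csubB hD id_CL h). Qed.

Definition avoid (F : seq P) : set P := [set y | forall x, x \in F -> ~ mdiv x y].

Lemma avoid_CL F : CLP (ind (avoid F)).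
Proof.
elim: F => [|x F ih].
  have -> : avoid [::] = setT by apply/seteqP; split.
  by rewrite ind_setT; exact: id_CL.
have -> : avoid (x :: F) = ~` pP x `&` avoid F.
  apply/seteqP; split=> [y h|y [h1 h2] z]; last first.
    by rewrite inE => /orP[/eqP -> //|]; exact: h2.
  split; first by apply: h; rewrite mem_head.
  by move=> z zF; apply: h; rewrite inE zF orbT.
exact: (indI_CL (indC_CL (indP_CL x)) ih).
Qed.

Lemma Vl_conj p Y : adjoint (Vl p) \o ind Y \o Vl p = ind [set y | Y (p * y)%g].
Proof.
apply/funext => f; apply: l2P => y; rewrite /= VlsE; have [Yy|nY] := pselect (Y (p * y)%g).
  transitivity (Vl p f (p * y)%g); first exact: indE.
  by rewrite VlE; symmetry; exact: indE.
by transitivity (0 : C); [exact: indN|symmetry; exact: indN].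
Qed.

Lemma Vl_conjV p Y : Vl p \o ind Y \o adjoint (Vl p) = ind [set x | exists2 y, Y y & x = (p * y)%g].
Proof.
apply/funext => f; apply: l2P => x /=; have [[y ->]|h] := pselect (mdiv p x); last first.
  by rewrite VlN// indN// => -[y _ e]; apply: h; exists y.
rewrite VlE; have [Yy|nY] := pselect (Y y); first by rewrite !indE ?VlsE//; exists y.
by rewrite !indN// => -[y' Yy' /lc e]; apply: nY; rewrite e.
Qed.

Definition scalar_on Y S := exists s : C, forall f, ind Y (S (ind Y f)) = s *: ind Y f.

Lemma scalar_on0 Y : scalar_on Y (fun=> 0).
Proof.
by exists 0 => f; rewrite scale0r (lin0 (ind_bounded (R := R) Y).1).
Qed.

Lemma scalar_onD Y S T : scalar_on Y S -> scalar_on Y T -> scalar_on Y (opD S T).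
Proof.
move=> [s hs] [t ht]; exists (s + t) => f.
by rewrite /opD (linD (ind_bounded (R := R) Y).1) hs ht scalerDl.
Qed.

Lemma scalar_onZ Y (k : C) S : scalar_on Y S -> scalar_on Y (opZ k S).
Proof.
by move=> [s hs]; exists (k * s) => f; rewrite /opZ (linZ (ind_bounded (R := R) Y).1) hs scalerA.
Qed.

(** Either no q x and p x lie in Y together and the compression vanishes, or p = q and Y is
    contained in pP, where V_p V_p^* is the identity. *)
Lemma scalar_on_wpq Y p q : (forall x, Y (q * x)%g -> Y (p * x)%g -> p = q) ->
  (forall x, Y (q * x)%g -> Y (p * x)%g -> Y `<=` pP p) -> scalar_on Y (VP (wpq p q)).
Proof.
move=> h1 h2; have bw := Il_biuniq lc (Il_wpq p q).
have [[x [Yq Yp]]|nx] := pselect (exists x, Y (q * x)%g /\ Y (p * x)%g).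
  have e := h1 x Yq Yp; have sY := h2 x Yq Yp; exists 1 => f; rewrite scale1r; apply: l2P => y.
  have [Yy|nY] := pselect (Y y); last by rewrite !indN.
  rewrite [LHS]indE//; have [w ew] := sY _ Yy; rewrite /opV (pinE bw (x := (q * w)%g)); last first.
    by exists w.
  by rewrite -e -ew.
exists 0 => f; rewrite scale0r; apply: l2P => y; have [Yy|nY] := pselect (Y y); last by rewrite indN.
rewrite indE//; have [[w ew]|h] := pselect (mdiv p y); last first.
  by rewrite /opV (pin0 bw)// => x [w [_ e]]; apply: h; exists w.
rewrite /opV (pinE bw (x := (q * w)%g)); last by exists w.
by rewrite indN// => Yq; apply: nx; exists w; rewrite -ew.
Qed.

Lemma opV_set0 : VP set0 = fun=> 0.
Proof.
have b0 : biuniq (fun x y : P => (set0 : pbij P) (x, y)) by split.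
by apply/funext => f; apply: l2P => y; apply: (pin0 b0) => x [].
Qed.

(* For y in [exact_power c k], c^k is the exact power of c dividing y and no other atom divides y. *)
Definition exact_power c k : set P := [set y | exists y', [/\ y = (atom m c ^+ k * y')%g,
  ~ mdiv (atom m c) y' & forall d, d <> c -> ~ mdiv (atom m d) y]].

Lemma exact_power_sub c k y : (0 < k)%N -> exact_power c k.+1 (atom m c * y)%g -> exact_power c k y.
Proof.
move=> k0 [y' [e ny' hd]]; rewrite expgS -mulgA in e; have ey := lc e.
exists y'; split=> // d dc; rewrite ey => h; apply: (hd d dc); rewrite e mulgA -expgS.
have k1 : (0 < k.+1)%N by [].
apply/(ldiv_atom_pow hm y' dc k1); exact/(ldiv_atom_pow hm y' dc k0).
Qed.

(** An element of [exact_power c k] with k > 0 has c as its only atomic divisor, and dividing by c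
    lowers k by one; so the letters of q are all c while k lasts. *)
Lemma exact_power_div c k q x : (len q < k)%N -> exact_power c k (q * x)%g -> q = (atom m c ^+ len q)%g.
Proof.
elim/(@atom_ind A m): q k x => [|d q ih] k x; first by rewrite (len1 hm).
rewrite (lenM hm (atom m d)) (len_atom hm) add1n; case: k => // k; rewrite ltnS => qk Y.
have dc : d = c.
  apply: contrapT => dc; case: Y => y' [_ _ /(_ d dc)]; apply.
  by rewrite -mulgA; exact: mdivMr.
rewrite dc -mulgA in Y *; have k0 : (0 < k)%N by exact: leq_ltn_trans qk.
by rewrite expgS -(ih k x qk (exact_power_sub k0 Y)).
Qed.

Lemma exact_power_uniq c i j x y : ~ mdiv (atom m c) x -> ~ mdiv (atom m c) y ->
  (atom m c ^+ i * x = atom m c ^+ j * y)%g -> i = j.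
Proof.
elim: i j => [|i ih] [|j] nx ny //.
- by rewrite expg0 mul1g expgS -mulgA => e; case: nx; rewrite e; exact: mdivMr.
- by rewrite expg0 mul1g expgS -mulgA => e; case: ny; rewrite -e; exact: mdivMr.
- by rewrite !expgS -!mulgA => /lc/ih ->.
Qed.

(** If k exceeds the lengths of p and q, both are powers of c. If q x and p x carry the same exact
    power of c, these powers agree, so every term contributes a scalar. *)
Lemma scalar_on_exact S : spanV S -> exists N : nat, forall c k, (N < k)%N -> scalar_on (exact_power c k) S.
Proof.
elim=> [|S1 S2 _ [N1 h1] _ [N2 h2]|s v hv].
- by exists 0%N => c k _; exact: scalar_on0.
- exists (maxn N1 N2) => c k; rewrite gtn_max => /andP[k1 k2].
  by apply: scalar_onD; [exact: h1|exact: h2].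
case: (Il_form lc artin_lcmP hv) => [->|[p [q ->]]].
  exists 0%N => c k _; apply: scalar_onZ; rewrite opV_set0; exact: scalar_on0.
exists (len p + len q)%N => c k pqk; apply: scalar_onZ.
have pk : (len p < k)%N by apply: leq_ltn_trans pqk; exact: leq_addr.
have qk : (len q < k)%N by apply: leq_ltn_trans pqk; exact: leq_addl.
apply: scalar_on_wpq => x Yq Yp.
  have eq := exact_power_div qk Yq; have ep := exact_power_div pk Yp.
  move: Yq Yp => [y [e1 ny _]] [y' [e2 ny' _]].
  rewrite eq in e1; rewrite ep in e2.
  have x1 : x = (atom m c ^+ (k - len q) * y)%g.
    by apply: (lc (x := (atom m c ^+ len q)%g)); rewrite e1 mulgA -expgnDr subnKC// ltnW.
  have x2 : x = (atom m c ^+ (k - len p) * y')%g.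
    by apply: (lc (x := (atom m c ^+ len p)%g)); rewrite e2 mulgA -expgnDr subnKC// ltnW.
  rewrite x1 in x2; have := exact_power_uniq ny ny' x2 => h.
  by rewrite ep eq; congr (_ ^+ _)%g; lia.
rewrite (exact_power_div pk Yp) => _ [y [-> _ _]].
by rewrite -(subnKC (ltnW pk)) expgnDr -mulgA; exact: mdivMr.
Qed.

(** F collects the first letters of all p and q in S. On elements avoiding them only the terms with
    p = q = 1 survive. *)
Lemma scalar_on_avoid S : spanV S -> exists F : seq A, forall Y,
  (forall y a, Y y -> a \in F -> ~ mdiv (atom m a) y) -> scalar_on Y S.
Proof.
elim=> [|S1 S2 _ [F1 h1] _ [F2 h2]|s v hv].
- by exists [::] => Y _; exact: scalar_on0.
- exists (F1 ++ F2) => Y hY.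
  by apply: scalar_onD; [apply: h1|apply: h2] => y a Yy aF; apply: hY; rewrite // mem_cat aF ?orbT.
case: (Il_form lc artin_lcmP hv) => [->|[p [q ->]]].
  exists [::] => Y _; apply: scalar_onZ; rewrite opV_set0; exact: scalar_on0.
have first u : exists F : seq A, forall Y x,
    (forall y a, Y y -> a \in F -> ~ mdiv (atom m a) y) -> Y (u * x)%g -> u = 1%g.
  case: (atom_case u) => [->|[a [w ->]]]; first by exists [::].
  exists [:: a] => Y x h Yx; case: (h _ a Yx); rewrite ?mem_head// -mulgA; exact: mdivMr.
have [Fp hp] := first p; have [Fq hq] := first q; exists (Fp ++ Fq) => Y hY.
have ep x : Y (p * x)%g -> p = 1%g.
  by apply: hp => y a Yy aF; apply: hY; rewrite // mem_cat aF.
have eq x : Y (q * x)%g -> q = 1%g.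
  by apply: hq => y a Yy aF; apply: hY; rewrite // mem_cat aF orbT.
apply: scalar_onZ; apply: scalar_on_wpq => x Yq Yp; first by rewrite (ep x Yp) (eq x Yq).
by rewrite (ep x Yp) => y _; exact: mdiv1.
Qed.

(** In the corner of f = 1_Y, the operator a' = V_x0^* T^* T V_x0 is within t/4 of a scalar s, and s
    is within t/4 of t = <a' delta_y0, delta_y0>. So x = f - t^-1 f a' f has norm at most 1/2, and
    [corner_inverse] normalises f a' f to f. *)
Lemma compress T x0 Y y0 S : CLP T -> CLP (ind Y) -> Y y0 -> CLP S -> scalar_on Y S ->
  let t := l2norm (T (delta (x0 * y0)%g)) ^+ 2 in 0 < t ->
  opnorm (opB (adjoint (Vl x0) \o adjoint T \o T \o Vl x0) S) < t / 4 ->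
  exists2 z, CLP z & z \o adjoint T \o T \o adjoint z = ind Y /\ ind Y \o z = z.
Proof.
move=> CT CY Yy0 CS [s hs] t t0; set a' := _ \o Vl x0 => haS.
have bT := csub_bounded hD CT; have bS := csub_bounded hD CS; have bV := Vl_bounded x0.
have bTs := adjoint_bounded bT; have bVs := adjoint_bounded bV.
have Ca' : CLP a'.
  exact: (csubM hD (csubM hD (csubM hD (Vls_CL x0) (csub_adj hD CT)) CT) (Vl_CL x0)).
have ba' := csub_bounded hD Ca'; pose f := ind Y : l2 R P -> l2 R P.
have bf : bounded_op f by exact: ind_bounded.
have a's : adjoint a' = a'.
  rewrite /a' (adjM (bounded_opM (bounded_opM bVs bTs) bT) bV) (adjM (bounded_opM bVs bTs) bT).
  by rewrite (adjM bVs bTs) !adjK.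
have fs : adjoint f = f by exact: ind_adj.
have f2 : f \o f = f by exact: ind_idem.
have fE h : f (f h) = f h by rewrite -[LHS]/((f \o f) h) f2.
have fd : f (delta y0) = delta y0 by apply: (pin_delta (@ind_biuniq P Y)).
have nf : opnorm f <= 1 by exact: ind_opnorm.
have hsf h : f (S (f h)) = s *: f h := hs h.
have ta : t%:C = inner (a' (delta y0)) (delta y0).
  rewrite /t -Vl_delta -inner_norm (inner_adjr _ _ bT) (inner_adjr _ _ bV).
  by [].
have sS : s = inner (S (delta y0)) (delta y0).
  have := congr1 (fun h => inner h (delta y0)) (hs (delta y0)).
  rewrite /= -/f fd innerZl (inner_norm (delta y0)) l2norm_delta expr1n mulr1 => <-.
  by rewrite (inner_adj _ _ bf) fs fd.
have haS' : opnorm (opB a' S) <= t / 4 by exact: ltW.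
have st : cabs (s - t%:C) <= t / 4.
  rewrite sS ta -innerBl -cabsN -innerNl opprB; apply: (le_trans (inner_le _ _)).
  by rewrite l2norm_delta mulr1; have := opnormP (bounded_opB ba' bS) (delta y0);
     rewrite l2norm_delta mulr1 => /le_trans; apply.
pose x := opB f (opZ (t^-1)%:C (f \o a' \o f)).
have bfaf := bounded_opM (bounded_opM bf ba') bf.
have Cfaf : CLP (f \o a' \o f) by exact: (csubM hD (csubM hD CY Ca') CY).
have Cx : CLP x by exact: (csubB hD CY (csubZ hD _ Cfaf)).
have xs : adjoint x = x.
  rewrite /x (adjB bf (bounded_opZ _ bfaf)) (adjZ _ bfaf) fs conjc_real.
  by rewrite (adjM (bounded_opM bf ba') bf) (adjM bf ba') fs a's.
have cx : corner CLP f x.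
  split; first exact: Cx.
    by apply/funext => h; rewrite /x /opB /opZ /= (linB bf.1) (linZ bf.1) !fE.
  by apply/funext => h; rewrite /x /opB /opZ /= !fE.
have nx : opnorm x < 1.
  have xE : x = opZ (t^-1)%:C (opB (opZ (t%:C - s) f) (f \o opB a' S \o f)).
    apply/funext => h; rewrite /x /opZ /opB /= scalerBr scalerA.
    have tt : (t^-1)%:C * (t%:C - s) = 1 - (t^-1)%:C * s.
      by rewrite mulrBr -rmorphM mulVf ?gt_eqF.
    rewrite tt scalerBl scale1r (linB bf.1) scalerBr hsf scalerA.
    by l2ring.
  have b1 := bounded_opZ (t%:C - s) bf.
  have b2 := bounded_opM (bounded_opM bf (bounded_opB ba' bS)) bf.
  rewrite xE; apply: (le_lt_trans (opnormZ _ (bounded_opB b1 b2))).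
  rewrite cabs_real ger0_norm ?invr_ge0 ?ltW// mulrC ltr_pdivrMr// mul1r.
  have n1 : opnorm (opZ (t%:C - s) f) <= t / 4.
    apply: (le_trans (opnormZ _ bf)); rewrite -[leRHS]mulr1.
    by apply: ler_pM; rewrite ?cabs_ge0 ?opnorm_ge0// -cabsN opprB.
  have n2 : opnorm (f \o opB a' S \o f) <= t / 4.
    have bb := bounded_opB ba' bS.
    apply: (le_trans (opnormM (bounded_opM bf bb) bf)); rewrite -[leRHS]mulr1.
    apply: ler_pM; rewrite ?opnorm_ge0//; apply: (le_trans (opnormM bf bb)).
    by rewrite -[leRHS]mul1r; apply: ler_pM; rewrite ?opnorm_ge0.
  apply: (le_lt_trans (opnormB b1 b2)); apply: (le_lt_trans (lerD n1 n2)).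
  by clear -t0; lra.
have [y [Cy fy yf] ey] := corner_inverse hD CY fs f2 cx xs nx.
have by_ := csub_bounded hD Cy.
pose r : C := (Num.sqrt t^-1)%:C; have rr : r * r = (t^-1)%:C.
  by rewrite /r -rmorphM -expr2 sqr_sqrtr ?invr_ge0 ?ltW.
have rc_ : conjc r = r by exact: conjc_real.
have bys := adjoint_bounded by_; have b3 := bounded_opM bys bVs.
exists (opZ r (adjoint y \o adjoint (Vl x0))).
  exact: (csubZ hD _ (csubM hD (csub_adj hD Cy) (Vls_CL x0))).
have fyE h : f (y h) = y h by rewrite -[LHS]/((f \o y) h) fy.
have fys h : adjoint y (f h) = adjoint y h.
  by have := adjM bf by_; rewrite fy fs => e; rewrite [in RHS]e.
split; last first.
  apply/funext => h; rewrite /opZ /= -/f (linZ bf.1); congr (_ *: _).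
  have := adjM by_ bf; rewrite yf fs => e.
  by rewrite [in RHS]e.
rewrite adjZ// adjM// !adjK// rc_ -ey.
apply/funext => h; rewrite /opZ /opB /x /= (linZ bT.1) (linZ bTs.1) (linZ bVs.1) (linZ bys.1).
rewrite scalerA rr opprB addrC subrK (linZ bys.1); congr (_ *: _).
by rewrite /opB /= fys fyE.
Qed.

End ArtinOperators.

(** * Operators vanishing along powers of atoms are compact *)

Section Exactness.
Variables (R : realType) (A : choiceType) (m : A -> A -> option nat).
Hypothesis hm : coxeter_matrix m.
Hypothesis fA : finite_set [set: A].
Local Notation P := (artin_tits m).
Local Notation C := R[i].
Local Notation VP := (@opV R P).
Local Notation CLP := (@CL R P).
Local Open Scope ring_scope.
Local Open Scope complex_scope.
Implicit Types (p q r x y z : P) (S T U : l2 R P -> l2 R P) (a b c d : A).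

Let lc := artin_lc hm.
Let hD := CL_csub R lc.

Definition lincomb (l : seq (C * (P * P))) : l2 R P -> l2 R P :=
  fun f => \sum_(t <- l) t.1 *: VP (wpq t.2.1 t.2.2) f.

Lemma spanV_lincomb S : spanV S -> exists l, S = lincomb l.
Proof.
elim=> [|S1 S2 _ [l1 ->] _ [l2 ->]|s v hv].
- by exists [::]; apply/funext => f; rewrite /lincomb big_nil.
- by exists (l1 ++ l2); apply/funext => f; rewrite /lincomb big_cat.
case: (Il_form lc (artin_lcmP hm) hv) => [->|[p [q ->]]].
  by exists [::]; apply/funext => f; rewrite /lincomb big_nil opV_set0 /opZ scaler0.
by exists [:: (s, (p, q))]; apply/funext => f; rewrite /lincomb big_seq1.
Qed.

Lemma fsq_fin (L : seq P) (h : P -> C^o) : uniq L -> l2norm (fin L h : l2 R P) ^+ 2 = \sum_(x <- L) cabs (h x) ^+ 2.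
Proof. by move=> uL; rewrite norm_fin//; apply: eq_bigr => x _; rewrite sqr_cabs. Qed.

(* The quadratic form of the partial isometry delta (q z) |-> delta (p z), with entries weighted by
   n, is that of a weighted partial injection. *)
Lemma weighted_form (L : seq P) (h : P -> C^o) p q (n : P -> P -> nat) (K : nat) : uniq L ->
  (forall x y, x \in L -> y \in L -> wpq p q (x, y) -> (n x y <= K)%N) ->
  cabs (\sum_(x <- L) \sum_(y <- L) (h x * conjc (h y)) *
     (inner (VP (wpq p q) (delta x)) (delta y) * (n x y)%:R)) <= K%:R * l2norm (fin L h : l2 R P) ^+ 2.
Proof.
move=> uL hn; have bw := Il_biuniq lc (Il_wpq p q).
pose r (x y : P) := [/\ wpq p q (x, y), x \in L & y \in L].
have br : biuniq r.
  by split=> [x y y' [h1 _ _] [h2 _ _]|x x' y [h1 _ _] [h2 _ _]]; [exact: bw.1 h1 h2|exact: bw.2 h1 h2].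
pose w (y : P) : C := if pselect (exists x, r x y) is left e then (n (sval (cid e)) y)%:R else 0.
have wE x y : r x y -> w y = (n x y)%:R.
  by move=> rxy; rewrite /w; case: pselect => [e|[]]; [rewrite (br.2 _ _ _ (svalP (cid e)) rxy)|exists x].
have cn (k : nat) : cabs (k%:R : C) = k%:R.
  by rewrite -(rmorph_nat (real_complex R)) cabs_real ger0_norm ?ler0n.
have K0 : 0 <= K%:R :> R by rewrite ler0n.
have wK y : cabs (w y) <= K%:R.
  rewrite /w; case: pselect => [e|_]; last by rewrite cabs0.
  by rewrite cn ler_nat; have [h1 h2 h3] := svalP (cid e); exact: hn.
pose W := pio r w; have hW : bdd W K%:R := pio_bdd br wK K0.
have -> : \sum_(x <- L) \sum_(y <- L) (h x * conjc (h y)) *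
     (inner (VP (wpq p q) (delta x)) (delta y) * (n x y)%:R) = inner (W (fin L h)) (fin L h).
  rewrite (lin_fin _ _ hW.1) inner_suml big_seq [RHS]big_seq; apply: eq_bigr => x xL.
  rewrite /fin inner_sumr big_seq [RHS]big_seq; apply: eq_bigr => y yL.
  rewrite innerZl innerZr mulrA; congr (_ * _).
  have [rxy|nr] := pselect (wpq p q (x, y)).
    have rr : r x y by [].
    rewrite /W (pio_delta br wK K0 rr) innerZl (wE _ _ rr) /opV (pin_delta bw rxy).
    by rewrite mulrC.
  have z1 : inner (VP (wpq p q) (delta x)) (delta y) = 0.
    rewrite inner_delta; have [[x' rx]|nx] := pselect (exists x', wpq p q (x', y)); last first.
      by apply: (pin0 bw) => x' rx; apply: nx; exists x'.
    rewrite /opV (pinE bw _ rx) /=; have [e|//] := eqVneq x' x.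
    by case: nr; rewrite -e.
  rewrite z1 mul0r inner_delta; symmetry.
  have [[x' rx]|nx] := pselect (exists x', r x' y); last first.
    by apply: (pio0 br wK K0) => x' rx; apply: nx; exists x'.
  rewrite /W (pioE br wK K0 _ rx) /=; have [e|_] := eqVneq x' x; last by rewrite mulr0.
  by case: nr; rewrite -e; case: rx.
apply: (le_trans (inner_le _ _)); rewrite expr2 mulrA.
by rewrite ler_wpM2r ?l2norm_ge0//; exact: hW.2.
Qed.

Lemma filter_sandwich (T : eqType) (s : seq T) (a b c : pred T) :
  (forall x : T, x \in s -> a x -> b x) -> (forall x : T, x \in s -> b x -> c x) ->
  size (seq.filter a s) = size (seq.filter c s) -> seq.filter b s = seq.filter a s.
Proof.
move=> ab bc; rewrite !size_filter => e.
have ac (x : T) : x \in s -> a x -> c x by move=> xs /(ab _ xs); exact: bc.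
have key (s' : seq T) : {subset s' <= s} -> (count a s' <= count c s')%N.
  elim: s' => //= x s' ih h; apply: leq_add; last by apply: ih => y ys; apply: h; rewrite inE ys orbT.
  by case ax : (a x) => //; rewrite ac// h// mem_head.
apply: eq_in_filter => x xs; apply/idP/idP => [bx|]; last exact: ab.
apply: contraT => nax; have cx := bc _ xs bx.
have : (count a (rem x s) <= count c (rem x s))%N by apply: key => y; exact: mem_rem.
have pe := perm_to_rem xs; move: e; rewrite (permP pe a) (permP pe c) /= (negbTE nax) cx.
lia.
Qed.

(** The sum g(i) + g(i + 1) drops by g(i) - g(i + 2) at each step, hence by at least one at each
    index counted. *)
Lemma telescope_count (g : nat -> nat) (M : nat) : (forall i, g i.+1 <= g i)%N ->
  (\sum_(i < M) (g i.+2 != g i) + (g M + g M.+1) <= g 0 + g 1)%N.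
Proof.
move=> hg; elim: M => [|M ih]; first by rewrite big_ord0.
rewrite big_ord_recr /=; apply: leq_trans ih.
have h1 := hg M; have h2 := hg M.+1.
case: eqP => [|/eqP] h; rewrite /=; lia.
Qed.

Lemma right_translation_bound T L (h : P -> C^o) : bounded_op T ->
  (forall p c (d : R), 0 < d -> exists N : nat, forall j, (N <= j)%N ->
     l2norm (T (delta (p * atom m c ^+ j)%g)) < d) ->
  forall c (d : R), 0 < d -> exists N : nat,
    \sum_(x <- L) cabs (h x) * l2norm (T (delta (x * atom m c ^+ N)%g)) <= d.
Proof.
move=> bT hT c d d0; pose K := \sum_(x <- L) cabs (h x) + 1.
have K0 : 0 < K by rewrite ltr_wpDl// sumr_ge0// => x _; exact: cabs_ge0.
have [N hN] : exists N : nat, forall x, x \in L -> l2norm (T (delta (x * atom m c ^+ N)%g)) <= d / K.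
  have dK : 0 < d / K by rewrite divr_gt0.
  have [N hN] : exists N : nat, forall j, (N <= j)%N -> forall x, x \in L ->
      l2norm (T (delta (x * atom m c ^+ j)%g)) <= d / K.
    elim: (L) => [|x L' [N hN]]; first by exists 0%N.
    have [N' hN'] := hT x c _ dK; exists (maxn N N') => j; rewrite geq_max => /andP[j1 j2] y.
    by rewrite inE => /orP[/eqP ->|yL]; [exact/ltW/hN'|exact: hN].
  by exists N; exact: hN.
exists N; apply: (@le_trans _ _ (\sum_(x <- L) cabs (h x) * (d / K))).
  rewrite big_seq [leRHS]big_seq; apply: ler_sum => x xL.
  by rewrite ler_wpM2l ?cabs_ge0// hN.
rewrite -mulr_suml mulrCA; apply: ler_piMr; [exact: ltW|rewrite ler_pdivrMr// mul1r].
by rewrite /K lerDl.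
Qed.

(** At points good for c, right translation by c^N commutes with S, because a short q divides x c^N
    only if it divides x. After translation T is negligible by hypothesis, and only the difference T
    - S is left. *)
Lemma good_bound T S (l : seq (C * (P * P))) (e : R) (L0 : nat) : bounded_op T -> S = lincomb l ->
  bounded_op S -> (forall t, t \in l -> (len t.2.2 <= L0)%N) -> opnorm (opB T S) <= e ->
  (forall p c (d : R), 0 < d -> exists N : nat, forall j, (N <= j)%N ->
     l2norm (T (delta (p * atom m c ^+ j)%g)) < d) ->
  forall L (h : P -> C^o) c, uniq L -> (forall x, x \in L -> h x != 0 -> good L0 x c) ->
  l2norm (S (fin L h)) <= e * l2norm (fin L h).
Proof.
move=> bT Sl bS hl TS hT L h c uL hgood; apply/ler_addgt0Pr => d d0.
have [N hN] := right_translation_bound L h bT hT c d0.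
pose rel (x y : P) := y = (x * atom m c ^+ N)%g.
have br : biuniq rel.
  by split=> [x y y' -> ->|x x' y -> /(artin_rc hm)].
pose Rt : l2 R P -> l2 R P := pin rel; have bR : bounded_op Rt := pin_bounded br.
have Rd x : Rt (delta x) = delta (x * atom m c ^+ N)%g by apply: (pin_delta br).
have iso f : l2norm (Rt f) = l2norm f.
  by apply: (pin_isometry f br) => x; exists (x * atom m c ^+ N)%g.
have comm : Rt (S (fin L h)) = S (Rt (fin L h)).
  rewrite (lin_fin _ _ bS.1) (lin_sum _ _ bR.1) (lin_fin _ _ bR.1) (lin_sum _ _ bS.1).
  rewrite big_seq [RHS]big_seq; apply: eq_bigr => x xL; rewrite (linZ bR.1) (linZ bS.1).
  have [->|hx] := eqVneq (h x) 0; first by rewrite !scale0r.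
  congr (_ *: _); rewrite Rd Sl /lincomb (lin_sum _ _ bR.1) big_seq [RHS]big_seq.
  apply: eq_bigr => -[k [p q]] tl /=; rewrite (linZ bR.1); congr (_ *: _).
  have bw := Il_biuniq lc (Il_wpq p q); have g := hgood x xL hx.
  have [[z ez]|nq] := pselect (mdiv q x).
    rewrite /opV (@pin_delta _ _ _ _ bw x (p * z)%g); last by exists z.
    rewrite Rd (@pin_delta _ _ _ _ bw _ (p * z * atom m c ^+ N)%g)//.
    by exists (z * atom m c ^+ N)%g; rewrite /= ez !mulgA.
  have nq' : ~ mdiv q (x * atom m c ^+ N)%g by move=> /(g q N (hl _ tl)).
  rewrite /opV !(pin_delta0 bw) ?(lin0 bR.1)// => y [z [e1 _]]; [apply: nq'|apply: nq]; by exists z.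
rewrite -iso comm; have -> : S (Rt (fin L h)) = T (Rt (fin L h)) - opB T S (Rt (fin L h)).
  by rewrite /opB opprB addrC subrK.
apply: (le_trans (ler_l2normB _ _)); rewrite addrC; apply: lerD.
  apply: (le_trans (opnormP (bounded_opB bT bS) _)); rewrite iso.
  by rewrite ler_wpM2r ?l2norm_ge0.
rewrite (lin_fin _ _ bR.1) (lin_sum _ _ bT.1); apply: le_trans hN.
apply: (le_trans (ler_l2norm_sum _ _)); apply: ler_sum => x _.
by rewrite (linZ bT.1) l2normZ Rd.
Qed.

Lemma scale_exists (Q : seq P) (L0 : nat) : exists scale : nat -> nat, scale 0%N = L0 /\
  forall i, (scale i <= scale i.+1)%N /\ forall x y z c, x \in Q -> y \in Q ->
    good (m := m) (scale i.+1) (y * z)%g c -> good (scale i) (x * z)%g c.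
Proof.
have /choice[f hf] : forall L, exists L', (L <= L')%N /\ forall x y z c, x \in Q -> y \in Q ->
    good (m := m) L' (y * z)%g c -> good L (x * z)%g c.
  by move=> L; have [L' h1 h2] := good_shift hm fA Q Q L; exists L'.
by exists (fun n => iter n f L0); split=> // i; exact: hf.
Qed.

Lemma lincomb_form l L (u v : P -> C^o) :
  inner (lincomb l (fin L u)) (fin L v) = \sum_(x <- L) \sum_(y <- L) (u x * conjc (v y)) *
    inner (lincomb l (delta x)) (delta y).
Proof.
have ll : linear (lincomb l).
  move=> k f g; rewrite /lincomb scaler_sumr -big_split /=; apply: eq_bigr => t _.
  by rewrite (opV_bounded R lc (Il_wpq _ _)).1 scalerDr !scalerA mulrC.
rewrite (lin_fin _ _ ll) inner_suml; apply: eq_bigr => x _.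
rewrite {1}/fin inner_sumr; apply: eq_bigr => y _.
by rewrite innerZl innerZr mulrA.
Qed.

(** For each scale i, h is cut into the pieces h_{i,c} supported where the chosen atom is c, and
    [good_bound] estimates S on each piece. Summing over the scales, M norm(S h)^2 equals the sum of
    the squares for the pieces plus the entries of S^* S weighted by the number of scales at which
    the choices at x and y differ. That number is at most K, so large M makes the second part
    small. *)
Lemma long_estimate T (e : R) : CLP T -> 0 < e ->
  (forall p c (d : R), 0 < d -> exists N : nat, forall j, (N <= j)%N ->
     l2norm (T (delta (p * atom m c ^+ j)%g)) < d) ->
  exists n : nat, forall L (h : P -> C^o), uniq L -> (forall x, x \in L -> (n <= len x)%N) ->
    l2norm (T (fin L h)) <= 3 * e * l2norm (fin L h).
Proof.
move=> CT e0 hT; have [S sS hS] := CL_approx CT e0; have bT := csub_bounded hD CT.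
have CS := spanV_CL lc sS; have bS := csub_bounded hD CS.
have [l el] := spanV_lincomb sS.
have [lB eB] := spanV_lincomb (spanVM lc (spanV_adj lc sS) sS).

have [eA heA] : exists eA : seq A, forall c, c \in eA.
  have /finite_seqP[s es] := fA; exists s => c.
  by have : [set` s] c by rewrite -es.
pose L0 := (\sum_(t <- l) len t.2.2)%N.
have hL0 t : t \in l -> (len t.2.2 <= L0)%N.
  by move=> tl; rewrite /L0 (big_rem t)//= leq_addr.
pose Q := [seq t.2.1 | t <- lB] ++ [seq t.2.2 | t <- lB].
have [scale [s0 hs]] := scale_exists Q L0.
have smono i : (L0 <= scale i)%N.
  by elim: i => [|i ih]; [rewrite s0|exact: leq_trans ih (hs i).1].
pose D := \sum_(t <- lB) cabs t.1; have D0 : 0 <= D by apply: sumr_ge0 => t _; exact: cabs_ge0.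
pose K := (2 * size eA)%N.
(* With this M the weighted part, at most D K norm(h)^2, does not exceed e^2 M norm(h)^2. *)
have [M [M0 hM]] : exists M : nat, (0 < M)%N /\ K%:R * D / e ^+ 2 <= M%:R.
  exists (Num.truncn (K%:R * D / e ^+ 2)).+1; split=> //.
  by apply/ltW; rewrite truncnS_gt// divr_ge0 ?mulr_ge0 ?sqr_ge0 ?ler0n.
(* An atom that is good at the top scale is good at all lower scales, so the lists G i.+1 x are
   non-empty for i < M and the default [c0] below is never chosen on L. *)
have [n hn] := good_exists hm fA (scale M.+1).
exists n => L h uL hL.
have [|x0L] := boolP (L == [::]).
  by move=> /eqP ->; rewrite /fin big_nil (lin0 bT.1) l2norm0 mulr0.
have [c0 _] : exists c0 : A, True.
  case: (L) x0L hL => // x L' _ hL; have [c _] := hn x (hL x (mem_head _ _)); by exists c.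
pose G i x := [seq c <- eA | `[< good (scale i) x c >]].
pose a i x := head c0 (G i.+1 x).
have Gle i x c : good (scale i.+1) x c -> good (scale i) x c by apply: good_le; exact: (hs i).1.
have agood i x : (i < M)%N -> x \in L -> good L0 x (a i x).
  move=> iM xL; have [c gc] := hn x (hL x xL).
  have : c \in G i.+1 x.
    rewrite mem_filter heA andbT; apply/asboolP.
    have : (i.+1 <= M.+1)%N by rewrite ltnS ltnW.
    move: gc; elim: M.+1 => [|k ih] gc; first by rewrite ltn0.
    rewrite leq_eqVlt => /orP[/eqP ->//|]; rewrite ltnS; apply: ih; exact: Gle.
  have : a i x \in G i.+1 x \/ G i.+1 x = [::] by rewrite /a; case: (G i.+1 x) => [|c' s]; [right|left; exact: mem_head].
  case=> [|-> //]; rewrite mem_filter => /andP[/asboolP g _] _.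
  exact: good_le (smono _) g.
pose nn x y := (\sum_(i < M) (a i x != a i y))%N.
have hnn t x y : t \in lB -> wpq t.2.1 t.2.2 (x, y) -> (nn x y <= K)%N.
  move=> tl [z [/= ex ey]].
  have pQ : t.2.1 \in Q by rewrite mem_cat (map_f (fun t : C * (P * P) => t.2.1)).
  have qQ : t.2.2 \in Q by rewrite mem_cat (map_f (fun t : C * (P * P) => t.2.2)) ?orbT.
  pose g i := size (G i x).
  have gmono i : (g i.+1 <= g i)%N.
    rewrite /g !size_filter; apply: sub_count => c /asboolP gc; apply/asboolP; exact: Gle.
  (* Changing x into y costs one scale in each direction, so G i.+1 y lies between G i.+2 x and G i
     x. If these two have the same size, all lists coincide, and so do the choices at scale i. *)
  have sub i : ((a i x != a i y : nat) <= (g i.+2 != g i))%N.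
    case ge : (g i.+2 == g i); last by case: (_ != _).
    suff -> : a i x = a i y by rewrite eqxx.
    have e1 : G i.+1 y = G i.+2 x.
      apply: filter_sandwich (eqP ge) => c _ /asboolP gc; apply/asboolP.
        by rewrite ey; apply: ((hs i.+1).2 _ _ _ _ pQ qQ); rewrite -ex.
      by rewrite ex; apply: ((hs i).2 _ _ _ _ qQ pQ); rewrite -ey.
    have e2 : G i.+1 x = G i.+2 x.
      by apply: filter_sandwich (eqP ge) => c _ /asboolP gc; apply/asboolP; exact: Gle.
    by rewrite /a e1 e2.
  apply: (@leq_trans (\sum_(i < M) (g i.+2 != g i))%N); first by apply: leq_sum => i _; exact: sub.
  have := telescope_count M gmono; have : (g 0%N <= size eA)%N by rewrite /g size_filter count_size.
  have : (g 1%N <= size eA)%N by rewrite /g size_filter count_size.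
  rewrite /K; clear; lia.
pose hic i c : P -> C^o := fun x => (a i x == c)%:R * h x.
have Sic i c : (i < M)%N -> l2norm (S (fin L (hic i c))) <= e * l2norm (fin L (hic i c)).
  move=> iM; apply: (good_bound bT el bS hL0 (ltW hS) hT (c := c)) => // x xL.
  rewrite /hic; have [<- _|_] := eqVneq (a i x) c; first exact: agood.
  by rewrite mul0r eqxx.
have SB (u : P -> C^o) : (l2norm (S (fin L u)) ^+ 2)%:C = inner (lincomb lB (fin L u)) (fin L u).
  by rewrite -eB /= -inner_norm (inner_adjr _ _ bS).
pose uA := undup eA; have uuA : uniq uA by exact: undup_uniq.
have huA c : c \in uA by rewrite mem_undup.
have pick (x : P) i (F : A -> C) : \sum_(c <- uA) (a i x == c)%:R * F c = F (a i x).
  rewrite (bigD1_seq (a i x))//= eqxx mul1r big1 ?addr0// => c.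
  by rewrite eq_sym => /negbTE ->; rewrite mul0r.
(* For fixed x and y, the scales with equal choices and those with different choices add up to M;
   the former give the squares of the pieces, the latter the weight nn. *)
have main : (M%:R * l2norm (S (fin L h)) ^+ 2)%:C =
    \sum_(i < M) \sum_(c <- uA) (l2norm (S (fin L (hic i c))) ^+ 2)%:C +
    \sum_(t <- lB) t.1 * \sum_(x <- L) \sum_(y <- L) (h x * conjc (h y)) *
     (inner (VP (wpq t.2.1 t.2.2) (delta x)) (delta y) * (nn x y)%:R).
  have -> : \sum_(i < M) \sum_(c <- uA) (l2norm (S (fin L (hic i c))) ^+ 2)%:C =
      \sum_(x <- L) \sum_(y <- L) (h x * conjc (h y)) * inner (lincomb lB (delta x)) (delta y) *
        (\sum_(i < M) (a i x == a i y)%:R).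
    under eq_bigr => i _ do under eq_bigr => c _ do rewrite SB lincomb_form.
    under eq_bigr => i _ do rewrite exchange_big /=.
    rewrite exchange_big /=; apply: eq_bigr => x _.
    under eq_bigr => i _ do rewrite exchange_big /=.
    rewrite exchange_big /=; apply: eq_bigr => y _.
    rewrite mulr_sumr; apply: eq_bigr => i _.
    rewrite -(pick x i (fun c => (h x * conjc (h y)) * inner (lincomb lB (delta x)) (delta y) * (c == a i y)%:R)).
    apply: eq_bigr => c _; rewrite /hic [c == _]eq_sym.
    by case: (a i x == c); case: (a i y == c); rewrite ?mul1r ?mul0r ?mulr1 ?mulr0 ?conjc0 ?mul0r ?mulr0 ?mul0r.
  have -> : \sum_(t <- lB) t.1 * \sum_(x <- L) \sum_(y <- L) (h x * conjc (h y)) *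
     (inner (VP (wpq t.2.1 t.2.2) (delta x)) (delta y) * (nn x y)%:R) =
     \sum_(x <- L) \sum_(y <- L) (h x * conjc (h y)) * inner (lincomb lB (delta x)) (delta y) * (nn x y)%:R.
    under eq_bigr => t _ do rewrite mulr_sumr.
    rewrite exchange_big /=; apply: eq_bigr => x _.
    under eq_bigr => t _ do rewrite mulr_sumr.
    rewrite exchange_big /=; apply: eq_bigr => y _.
    rewrite /lincomb inner_suml mulr_sumr mulr_suml; apply: eq_bigr => t _.
    rewrite innerZl; ring.
  rewrite rmorphM /= SB lincomb_form -big_split /= mulr_sumr; apply: eq_bigr => x _.
  rewrite -big_split /= mulr_sumr; apply: eq_bigr => y _.
  rewrite -mulrDr /nn natr_sum -big_split /=.
  have -> : \sum_(i < M) ((a i x == a i y)%:R + ((a i x != a i y) : nat)%:R) = (M%:R : C).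
    rewrite (eq_bigr (fun=> 1)); first by rewrite sumr_const card_ord.
    by move=> i _; case: (_ == _); rewrite /= ?addr0 ?add0r.
  by rewrite rmorph_nat mulrC.
have nh : \sum_(i < M) \sum_(c <- uA) l2norm (fin L (hic i c)) ^+ 2 = M%:R * l2norm (fin L h) ^+ 2.
  rewrite (eq_bigr (fun=> l2norm (fin L h : l2 R P) ^+ 2)).
    by rewrite sumr_const card_ord mulr_natl.
  move=> i _; under eq_bigr => c _ do rewrite fsq_fin//.
  rewrite exchange_big /= fsq_fin//; apply: eq_bigr => x _.
  rewrite (bigD1_seq (a i x))//= /hic eqxx mul1r big1 ?addr0// => c.
  by rewrite eq_sym => /negbTE ->; rewrite mul0r cabs0 expr0n.
pose N2 := l2norm (fin L h : l2 R P) ^+ 2; have N20 : 0 <= N2 by exact: sqr_ge0.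
have S2 : M%:R * l2norm (S (fin L h)) ^+ 2 <= e ^+ 2 * (M%:R * N2) + D * (K%:R * N2).
  apply: (@le_trans _ _ (cabs (M%:R * l2norm (S (fin L h)) ^+ 2)%:C)).
    by rewrite cabs_real ler_norm.
  rewrite main; apply: (le_trans (cabsD _ _)); apply: lerD.
    have -> : \sum_(i < M) \sum_(c <- uA) (l2norm (S (fin L (hic i c))) ^+ 2)%:C =
      (\sum_(i < M) \sum_(c <- uA) l2norm (S (fin L (hic i c))) ^+ 2)%:C.
      by rewrite rmorph_sum; apply: eq_bigr => i _; rewrite rmorph_sum.
    rewrite cabs_real ger0_norm; last by apply: sumr_ge0 => i _; apply: sumr_ge0 => c _; exact: sqr_ge0.
    rewrite -nh mulr_sumr; apply: ler_sum => i _; rewrite mulr_sumr; apply: ler_sum => c _.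
    by rewrite -exprMn ler_sqr ?nnegrE ?mulr_ge0 ?l2norm_ge0 ?Sic// ltW.
  apply: (le_trans (cabs_sum _ _)); rewrite /D mulr_suml big_seq [leRHS]big_seq; apply: ler_sum => t tl.
  rewrite cabsM ler_wpM2l ?cabs_ge0//; apply: weighted_form => // x y _ _; exact: hnn.
have S3 : l2norm (S (fin L h)) <= 2 * e * l2norm (fin L h).
  have r0 : 0 <= 2 * e * l2norm (fin L h) by rewrite mulr_ge0 ?l2norm_ge0// mulr_ge0// ltW.
  rewrite -ler_sqr ?nnegrE ?l2norm_ge0//.
  have M0' : 0 < M%:R :> R by rewrite ltr0n.
  rewrite -(ler_pM2l M0'); apply: (le_trans S2).
  have h1 : D * (K%:R * N2) <= e ^+ 2 * (M%:R * N2).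
    have hM' : D * K%:R <= e ^+ 2 * M%:R by rewrite mulrC [leRHS]mulrC -ler_pdivrMr ?exprn_gt0.
    have -> : D * (K%:R * N2) = D * K%:R * N2 by rewrite mulrA.
    have -> : e ^+ 2 * (M%:R * N2) = e ^+ 2 * M%:R * N2 by rewrite mulrA.
    exact (ler_wpM2r N20 hM').
  have -> : M%:R * (2 * e * l2norm (fin L h)) ^+ 2 = 4 * (e ^+ 2 * (M%:R * N2)) by rewrite /N2; ring.
  have h2 : 0 <= e ^+ 2 * (M%:R * N2) := mulr_ge0 (sqr_ge0 _) (mulr_ge0 (ler0n _ _) N20).
  move: h1 h2; move: (D * _) (e ^+ 2 * _) => u v h1 h2; lra.
have -> : T (fin L h) = opB T S (fin L h) + S (fin L h) by rewrite /opB subrK.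
apply: (le_trans (ler_l2normD _ _)).
have -> : 3 * e * l2norm (fin L h) = e * l2norm (fin L h) + 2 * e * l2norm (fin L h) by ring.
apply: lerD => //; apply: (le_trans (opnormP (bounded_opB bT bS) _)).
by rewrite ler_wpM2r ?l2norm_ge0// ltW.
Qed.

Theorem vanishing_compact T : CLP T ->
  (forall p c (d : R), 0 < d -> exists N : nat, forall j, (N <= j)%N ->
     l2norm (T (delta (p * atom m c ^+ j)%g)) < d) -> rfa T.
Proof.
move=> CT hT; have bT := csub_bounded hD CT; split; first exact: bT.
move=> e e0; have e3 : 0 < e / 3 by rewrite divr_gt0.
have [n hn] := long_estimate CT e3 hT; have [s hs] := finite_ball hm fA n.
have us := undup_uniq s; exists (undup s) => //; have bp := pr_bounded (R := R) us.
apply: (bdd_opnorm (ltW e0)).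
apply: (bdd_dense (ltW e0) (opnorm_bdd (bounded_opB bT (bounded_opM bT bp)))) => L uL h.
rewrite /opB /= -(linB bT.1); pose L' := [seq x <- L | x \notin undup s].
have uL' : uniq L' by rewrite filter_uniq.
have -> : fin L h - pr (undup s) (fin L h) = fin L' h.
  apply: l2P => x; rewrite l2BE pr_coord// !finE// mem_filter.
  by case: (x \in undup s); case: (x \in L); rewrite ?subrr ?subr0.
apply: (@le_trans _ _ (e * l2norm (fin L' h))).
  have -> : e = 3 * (e / 3) by rewrite mulrCA mulfV ?mulr1// pnatr_eq0.
  apply: hn => // x; rewrite mem_filter mem_undup => /andP[xs _].
  by apply: contraR xs; rewrite -ltnNge => /ltnW/hs.
apply: ler_wpM2l; [exact: ltW|].
have -> : fin L' h = fin L h - pr (undup s) (fin L h).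
  apply: l2P => x; rewrite l2BE pr_coord// !finE// mem_filter.
  by case: (x \in undup s); case: (x \in L); rewrite ?subrr ?subr0.
exact (pr_compl_norm (fin L h) us).
Qed.

End Exactness.

(** * Matrix units and minimality of the compact operators *)

Section MatrixUnits.
Variables (R : realType) (A : choiceType) (m : A -> A -> option nat).
Hypothesis hm : coxeter_matrix m.
Local Notation P := (artin_tits m).
Local Notation C := R[i].
Local Notation CLP := (@CL R P).
Local Open Scope ring_scope.
Local Open Scope complex_scope.
Implicit Types (p q r x y z : P) (Y Z : set P) (S T U : l2 R P -> l2 R P) (a b c d : A).

Let lc := artin_lc hm.
Let hD := CL_csub R lc.

Definition munit x y : l2 R P -> l2 R P := Vl x \o ind [set 1%g] \o adjoint (Vl y).

Lemma deltaE x y : delta x y = (y == x)%:R :> C. Proof. by []. Qed.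

Lemma op0_delta T : bounded_op T -> (forall x, T (delta x) = 0) -> T = (fun=> 0).
Proof.
move=> bT h; have e x : adjoint T (delta x) = 0.
  apply: l2P => y; rewrite -inner_delta -(inner_adjr _ _ bT) h.
  by rewrite inner0r.
apply/funext => f; apply: l2P => x; rewrite -inner_delta (inner_adj _ _ bT) e.
by rewrite inner0r.
Qed.

Lemma munitE x y f : munit x y f = f y *: delta x.
Proof.
apply: l2P => z; rewrite l2ZE deltaE.
change (munit x y f z) with (Vl x (ind [set 1%g] (adjoint (Vl y) f)) z).
have [[w ->]|h] := pselect (mdiv x z); last first.
  rewrite VlN//; case: eqP => [e|_]; last by rewrite mulr0.
  by case: h; exists 1%g; rewrite mulg1 e.
rewrite VlE//; have [->|w1] := pselect (w = 1%g).
  by rewrite indE// VlsE// !mulg1 eqxx mulr1.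
rewrite indN//; case: eqP => [e|_]; last by rewrite mulr0.
by case: w1; apply: (lc (x := x)); rewrite e mulg1.
Qed.

Lemma munit_bounded x y : bounded_op (munit x y).
Proof.
have b1 := Vl_bounded R hm x; have b2 := ind_bounded (R := R) [set 1%g : P].
exact (bounded_opM (bounded_opM b1 b2) (adjoint_bounded (Vl_bounded R hm y))).
Qed.

Lemma munit_comp T x y z w : bounded_op T ->
  munit x y \o T \o munit z w = opZ (T (delta z) y) (munit x w).
Proof.
move=> bT; apply/funext => f; rewrite /opZ /= !munitE (linZ bT.1) l2ZE scalerA.
by rewrite [in RHS]mulrC.
Qed.

Lemma pr_cons x s : pr (x :: s) = opD (munit x x) (pr s) :> (l2 R P -> l2 R P).
Proof. by apply/funext => f; rewrite /opD munitE /pr /fin big_cons. Qed.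

Lemma pr_nil : pr [::] = (fun=> 0) :> (l2 R P -> l2 R P).
Proof. by apply/funext => f; rewrite /pr /fin big_nil. Qed.

Lemma rfa_csub D T : @cstar_subalg R (bounded_ops R P) D -> (forall x y, D (munit x y)) -> rfa T -> D T.
Proof.
move=> hD' Dm rT; have bT : bounded_op T := rT.1.
apply: (csub_closed hD' bT) => e e0; have e2 : 0 < e / 2 by rewrite divr_gt0.
have [s us hs] := rfa_pr_approx rT e2.
have lt : opnorm (opB T (pr s \o T \o pr s)) < e.
  by apply: (le_lt_trans hs); rewrite ltr_pdivrMr// ltr_pMr// ltr1n.
exists (pr s \o T \o pr s) => //; clear -lc bT hD' Dm.
have h1 x t : D (munit x x \o T \o pr t).
  elim: t => [|y t ih].
    have -> : munit x x \o T \o pr [::] = (fun=> 0).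
      apply/funext => f; rewrite pr_nil /=; have b := bounded_opM (munit_bounded x x) bT.
      exact: (lin0 b.1).
    exact: (csub0 hD').
  have -> : munit x x \o T \o pr (y :: t) = opD (opZ (T (delta y) x) (munit x y)) (munit x x \o T \o pr t).
    rewrite -(munit_comp _ _ _ _ bT) pr_cons; apply/funext => f.
    rewrite /opD /=; have b := bounded_opM (munit_bounded x x) bT.
    exact (linD b.1 _ _).
  exact: (csubD hD' (csubZ hD' _ (Dm _ _)) ih).
have h2 (r t : seq P) : D (pr r \o T \o pr t).
  elim: r => [|x r ih]; first by rewrite pr_nil; exact: (csub0 hD').
  rewrite pr_cons; exact (csubD hD' (h1 x t) ih).
exact: h2.
Qed.

(** A non-zero S in I has a non-zero matrix coefficient; multiplying S by matrix units on both sides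
    isolates it, so I contains all matrix units and with them the truncations [pr]. *)
Lemma rfa_minimal (D I : set (l2 R P -> l2 R P)) : @cstar_subalg R (bounded_ops R P) D ->
  (forall x y, D (munit x y)) -> ideal (sub_alg (bounded_ops R P) D) I ->
  I <> [set (fun=> 0)] -> @rfa R P `<=` I.
Proof.
move=> hD' Dm hI nI T rT; have bT : bounded_op T := rT.1.
have [S IS [y [x xy0]]] : exists2 S, I S & exists y x, S (delta y) x <> 0.
  apply: contrapT => h; apply: nI; apply/seteqP; split=> [S IS|S ->]; last exact: (ideal_0 hI).
  have bS := csub_bounded hD' (ideal_sub hI IS).
  apply/funext => f; apply: contrapT => Sf; apply: h; exists S => //.
  apply: contrapT => h; apply: Sf.
  have z1 : S = (fun=> 0).
    apply: (op0_delta bS) => y; apply: l2P => x; rewrite l20E.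
    by apply: contrapT => h'; apply: h; exists y, x.
  by rewrite z1.
have Iu u v : I (munit u v).
  have -> : munit u v = opZ (S (delta y) x)^-1 (munit u x \o S \o munit y v).
    have bS := csub_bounded hD' (ideal_sub hI IS).
    rewrite (munit_comp _ _ _ _ bS); apply/funext => f; rewrite /opZ scalerA mulVf ?scale1r//.
    exact/eqP.
  exact: (ideal_Z hI _ (ideal_Mr hI (Dm y v) (ideal_Ml hI (Dm u x) IS))).
have DT : D T by exact: (rfa_csub hD' Dm rT).
apply: (ideal_closed hI DT) => e e0; have e2 : 0 < e / 2 by rewrite divr_gt0.
have [s us hs] := rfa_pr_approx rT e2.
have lt : opnorm (opB T (pr s \o T \o pr s)) < e.
  by apply: (le_lt_trans hs); rewrite ltr_pdivrMr// ltr_pMr// ltr1n.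
exists (pr s \o T \o pr s) => //; have Ip t : I (pr t).
  elim: t => [|z t ih]; first by rewrite pr_nil; exact: (ideal_0 hI).
  rewrite pr_cons; exact: (ideal_D hI (Iu z z) ih).
exact: (ideal_Ml hI (csubM hD' (ideal_sub hI (Ip s)) DT) (Ip s)).
Qed.

Lemma rfa_ideal (D : set (l2 R P -> l2 R P)) : @cstar_subalg R (bounded_ops R P) D ->
  (forall x y, D (munit x y)) -> ideal (sub_alg (bounded_ops R P) D) (@rfa R P).
Proof.
move=> hD' Dm; apply: idealI.
- move=> T; exact: rfa_csub.
- by have := rfaZ 0 (rfa_pr (R := R) (s := [:: 1%g : P]) isT); congr rfa; apply/funext => f; rewrite /opZ scale0r.
- by move=> S T hS hT; exact: rfaD.
- by move=> k T hT; exact: rfaZ.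
- by move=> S T /(csub_bounded hD') bS hT; exact: rfaM.
- by move=> S T /(csub_bounded hD') bS hT; exact: rfaMr.
by move=> T /(csub_bounded hD') bT h; exact: rfa_closed.
Qed.

End MatrixUnits.

(** * Cutting operators to a fixed projection *)

Section Cutting.
Variables (R : realType) (A : choiceType) (m : A -> A -> option nat).
Hypothesis hm : coxeter_matrix m.
Hypothesis irr : irreducible m.
Local Notation P := (artin_tits m).
Local Notation C := R[i].
Local Notation CLP := (@CL R P).
Local Open Scope ring_scope.
Local Open Scope complex_scope.
Implicit Types (p q r x y z : P) (Y Z Q : set P) (S T U : l2 R P -> l2 R P) (a b c d : A).

Let lc := artin_lc hm.
Let hD := CL_csub R lc.

Definition cuts T Y := exists2 z, CLP z &
  z \o adjoint T \o T \o adjoint z = ind Y /\ ind Y \o z = z.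

(** Replacing z by 1_Q V_u^* z replaces 1_Y by 1_Q V_u^* 1_Y V_u 1_Q. The middle factor is the
    indicator of all y with u y in Y, which contains Q. *)
Lemma cuts_transport T Y Q u : CLP T -> CLP (ind Q) -> (forall q, Q q -> Y (u * q)%g) ->
  cuts T Y -> cuts T Q.
Proof.
move=> CT CQ uQ [z Cz [e1 _]].
have bz := csub_bounded hD Cz; have bV := Vl_bounded R hm u; have bQ := csub_bounded hD CQ.
have bVs := adjoint_bounded bV.
exists (ind Q \o adjoint (Vl u) \o z).
  exact (csubM hD (csubM hD CQ (Vls_CL R hm u)) Cz).
split; last first.
  apply/funext => f; rewrite -[LHS]/((ind Q \o ind Q) (adjoint (Vl u) (z f))).
  by rewrite ind_idem.
have -> : adjoint (ind Q \o adjoint (Vl u) \o z) = adjoint z \o Vl u \o ind Q.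
  rewrite (adjM (bounded_opM bQ bVs) bz) (adjM bQ bVs) adjK// ind_adj.
  by [].
transitivity (ind Q \o (adjoint (Vl u) \o (z \o adjoint T \o T \o adjoint z) \o Vl u) \o ind Q).
  by [].
rewrite e1 (Vl_conj R hm) -!indI; apply: ind_ext => y; split=> [[[]]//|Qy].
by split; [split; [|exact: uQ]|].
Qed.

Lemma neighbour a : (exists a1, a1 <> a) -> exists2 b, b <> a & forall n, m a b = Some n -> (2 < n)%N.
Proof.
move=> [a1 ne]; have [[|b p] /= hp lp] := irr.2 a a1; first by case: ne.
move: hp => /andP[/andP[/eqP nab hn] _]; exists b; first by move=> e; apply: nab.
by move=> n e; move: hn; rewrite e.
Qed.

Lemma not_mdiv_pow a b n : a <> b -> ~ mdiv (atom m a) (atom m b ^+ n)%g.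
Proof.
move=> ab; rewrite -[X in mdiv _ X]mul1g => /(ldiv_atom_expn hm); rewrite mul1g => -[z e].
have l := congr1 (@len A m) e; rewrite (lenM hm (atom m a)) !(len_atom hm) in l.
have z1 : z = 1%g by apply: len_eq0; lia.
by apply: ab; move: e; rewrite z1 mulg1 => /(atom_inj hm).
Qed.

Lemma exact_power_pow c k : exact_power c k (atom m c ^+ k)%g.
Proof.
exists 1%g; split; first by rewrite mulg1.
  by rewrite -(expg0 (atom m c)) => -[z /(congr1 (@len A m))]; rewrite (lenM hm (atom m c)) (len_atom hm) expg0 (len1 hm).
by move=> d dc; exact: not_mdiv_pow.
Qed.

Lemma one_CL : finite_set [set: A] -> CLP (ind [set 1%g]).
Proof.
move=> /finite_seqP[s es]; have sE d : d \in s by have : [set` s] d by rewrite -es.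
have -> : [set 1%g : P] = avoid [seq atom m d | d <- s]; last exact: avoid_CL.
apply/seteqP; split=> [_ -> x /mapP[a _ ->] [z e]|y h].
  by have := congr1 (@len A m) e; rewrite (lenM hm (atom m a)) (len_atom hm) (len1 hm).
have [//|[a [z e]]] := atom_case y; case: (h (atom m a)); last by exists z.
exact: map_f.
Qed.

Lemma munit_CL x y : finite_set [set: A] -> CLP (munit (m := m) x y).
Proof. move=> fA; exact (csubM hD (csubM hD (Vl_CL R hm x) (one_CL fA)) (Vls_CL R hm y)). Qed.

Lemma exact_power_CL c k : finite_set [set: A] -> CLP (ind (exact_power c k : set P)).
Proof.
move=> /finite_seqP[s es].
have sE d : d \in s by have : [set` s] d by rewrite -es.
have -> : exact_power c k = pP (atom m c ^+ k)%g `&` (~` pP (atom m c ^+ k.+1)%g) `&`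
    avoid [seq atom m d | d <- s & d != c].
  apply/seteqP; split=> [y [y' [e h1 h2]]|y [[[y' e] h1] h2]].
    split; last by move=> x /mapP[d]; rewrite mem_filter => /andP[/eqP dc _] ->; exact: h2.
    split; first by exists y'.
    move=> [w]; rewrite e expgSr -mulgA => /lc ew; apply: h1; by exists w.
  exists y'; split=> //.
    by move=> [w ew]; apply: h1; exists w; rewrite e ew expgSr mulgA.
  by move=> d dc; apply: h2; apply: map_f; rewrite mem_filter sE andbT; apply/eqP.
exact (indI_CL hm (indI_CL hm (indP_CL R hm _) (indC_CL hm (indP_CL R hm _))) (avoid_CL R hm _)).
Qed.

Lemma approx_compressed T p (d : R) : CLP T -> 0 < d -> exists2 S, spanV S &
  opnorm (opB (adjoint (Vl p) \o adjoint T \o T \o Vl p) S) < d.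
Proof.
move=> CT d0; apply: CL_approx d0.
exact (csubM hD (csubM hD (csubM hD (Vls_CL R hm p) (csub_adj hD CT)) CT) (Vl_CL R hm p)).
Qed.

(** By [vanishing_compact] some T delta_(p c^j) stay at norm at least d for arbitrarily large j. As
    d is fixed before the approximant S, j can be taken beyond the bound from which S is a scalar on
    [exact_power c j]. *)
Lemma finite_cut T : finite_set [set: A] -> CLP T -> ~ rfa T ->
  exists c k, (0 < k)%N /\ cuts T (exact_power c k).
Proof.
move=> fA CT nT.
have [p [c [d [d0 hd]]]] : exists p c (d : R), 0 < d /\ forall N : nat, exists2 j, (N <= j)%N &
    d <= l2norm (T (delta (p * atom m c ^+ j)%g)).
  apply: contrapT => h; apply: nT; apply: (vanishing_compact hm fA CT) => p c d d0.
  apply: contrapT => h'; apply: h; exists p, c, d; split=> // N.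
  apply: contrapT => h2; apply: h'; exists N => j Nj; rewrite ltNge; apply/negP => h3.
  by apply: h2; exists j.
have d4 : 0 < d ^+ 2 / 4 by rewrite divr_gt0 ?exprn_gt0.
have [S sS hS] := approx_compressed p CT d4; have [N hN] := scalar_on_exact hm sS.
have [j Nj dj] := hd N.+1; exists c, j; split; first exact: leq_ltn_trans Nj.
have t2 : d ^+ 2 <= l2norm (T (delta (p * atom m c ^+ j)%g)) ^+ 2.
  by rewrite ler_sqr ?nnegrE ?l2norm_ge0//; exact: ltW.
apply: (compress hm CT (exact_power_CL c j fA) (exact_power_pow c j) (spanV_CL lc sS) (hN c j Nj)).
  by apply: lt_le_trans t2; rewrite exprn_gt0.
apply: (lt_le_trans hS); by apply: ler_wpM2r t2; rewrite invr_ge0.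
Qed.

Lemma infinite_cut T : CLP T -> T <> (fun=> 0) -> exists F, cuts T (avoid [seq atom m a | a <- F]).
Proof.
move=> CT nT; have bT := csub_bounded hD CT.
have [x hx] : exists x, T (delta x) <> 0.
  apply: contrapT => h; apply: nT; apply: (op0_delta bT) => x; apply: contrapT => h'; apply: h; by exists x.
have t0 : 0 < l2norm (T (delta (x * 1)%g)) ^+ 2.
  rewrite mulg1 exprn_gt0// lt_neqAle l2norm_ge0 andbT eq_sym; apply/eqP => e; apply: hx.
  apply: l2P => y; apply: cabs_eq0; apply/le_anti; rewrite cabs_ge0 andbT -e; exact: l2_coord_le.
have t4 : 0 < l2norm (T (delta (x * 1)%g)) ^+ 2 / 4 by rewrite divr_gt0.
have [S sS hS] := approx_compressed x CT t4; have [F hF] := scalar_on_avoid hm sS; exists F.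
apply: (compress hm CT (avoid_CL R hm _) _ (spanV_CL lc sS) (hF _ _) t0 hS).
  move=> y /mapP[a _ ->] [z /(congr1 (@len A m))]; rewrite (lenM hm (atom m a)) (len_atom hm) (len1 hm).
  by [].
by move=> y a h aF; apply: h; exact: map_f.
Qed.

(** An atom other than c dividing c^k b x already divides c b x, and it must be b. As b and c do not
    commute, b x then begins with b c, so c divides x, contrary to the hypothesis on x. *)
Lemma exact_power_game b c k x : (0 < k)%N -> b <> c -> (forall n, m c b = Some n -> (2 < n)%N) ->
  (forall d, mdiv (atom m d) x -> d = b) -> exact_power c k (atom m c ^+ k * (atom m b * x))%g.
Proof.
move=> k0 bc hn hx; exists (atom m b * x)%g; split=> //.
  by move=> h; have [n [z [_ _ /hx e]]] := ldiv_atomM_neq hm (nesym bc) h; apply: bc.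
move=> d dc /(ldiv_atom_pow hm _ dc k0) /(ldiv_atomM_neq hm dc)[n [z [mn e dx]]].
have db : d = b.
  apply: contrapT => db; have [n' [z' [_ _ /hx]]] := ldiv_atomM_neq hm db dx; exact: db.
have n2 : (2 < n)%N by apply: hn; rewrite -db.
apply: bc; symmetry; apply: hx; case: n n2 e {mn} => [|[|[|n]]]// _.
rewrite db /res /= !wp_cons -!mulgA => /lc ->; by eexists.
Qed.

Lemma enum_atoms : finite_set [set: A] -> exists F : seq A, forall a, a \in F.
Proof. by move=> /finite_seqP[s es]; exists s => d; have : [set` s] d by rewrite -es. Qed.

Definition away a : set P := ~` pP (atom m a).

Lemma away_CL a : CLP (ind (away a)). Proof. exact (indC_CL hm (indP_CL R hm _)). Qed.

Lemma neq_atom a : (exists a0 a1 : A, a0 <> a1) -> exists a1, a1 <> a.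
Proof.
move=> [a0 [a1 ne]]; have [e|h] := pselect (a0 = a); last by exists a0.
by exists a1 => e'; apply: ne; rewrite e e'.
Qed.

(** For q not divisible by a, the game provides u such that only b can divide u q, where b is a
    neighbour of c; the prefix c^k b then leads into [exact_power c k]. *)
Lemma finite_cut_away T a : finite_set [set: A] -> left_reversible P -> (exists a0 a1 : A, a0 <> a1) ->
  CLP T -> ~ rfa T -> cuts T (away a).
Proof.
move=> fA rev two CT nT; have [c [k [k0 ck]]] := finite_cut fA CT nT.
have [b bc hn] := neighbour (neq_atom c two); have [F hF] := enum_atoms fA.
have [u hu] := game_reversible hm irr rev (hF a) (hF b) (neq_atom a two).
apply: (cuts_transport (u := (atom m c ^+ k * (atom m b * u))%g) CT (away_CL a) _ ck) => q nq.
rewrite -!mulgA; apply: exact_power_game => // d; exact: hu.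
Qed.

Lemma finite_cut_id T : finite_set [set: A] -> ~ left_reversible P -> (exists a0 a1 : A, a0 <> a1) ->
  CLP T -> ~ rfa T -> cuts T setT.
Proof.
move=> fA nrev two CT nT; have [c [k [k0 ck]]] := finite_cut fA CT nT.
have [b bc hn] := neighbour (neq_atom c two); have [F hF] := enum_atoms fA.
have [u hu] := game_nonreversible hm irr nrev (hF b) two.
have CI : CLP (ind setT) by rewrite ind_setT; exact: id_CL.
apply: (cuts_transport (u := (atom m c ^+ k * (atom m b * u))%g) CT CI _ ck) => q _.
rewrite -!mulgA; apply: exact_power_game => // d; exact: hu.
Qed.

Lemma fresh_atom (F : seq A) : ~ finite_set [set: A] -> exists b, b \notin F.
Proof.
move=> nfA; apply: contrapT => h; apply: nfA; apply/finite_seqP; exists F.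
apply/seteqP; split=> // a _; apply: contrapT => h'; apply: h; exists a; exact/negP.
Qed.

Lemma infinite_two : ~ finite_set [set: A] -> exists a0 a1 : A, a0 <> a1.
Proof.
move=> nfA; have [a _] := fresh_atom [::] nfA; have [b hb] := fresh_atom [:: a] nfA.
by exists a, b => e; move: hb; rewrite e mem_head.
Qed.

(** As A is infinite there is an atom b outside F; a game ending at b carries every q not divisible
    by a to an element avoiding F. *)
Lemma infinite_cut_away T a : ~ finite_set [set: A] -> left_reversible P ->
  CLP T -> T <> (fun=> 0) -> cuts T (away a).
Proof.
move=> nfA rev CT nT; have [F ck] := infinite_cut CT nT.
have [b bF] := fresh_atom F nfA; pose G := [:: a, b & F].
have aG : a \in G by rewrite mem_head.
have bG : b \in G by rewrite !inE eqxx orbT.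
have [u hu] := game_reversible hm irr rev aG bG (neq_atom a (infinite_two nfA)).
apply: (cuts_transport (u := u) CT (away_CL a) _ ck) => q nq.
move=> y /mapP[d dF ->] du; have dG : d \in G by rewrite !inE dF !orbT.
by move/negP: bF; apply; rewrite -(hu q nq d dG du).
Qed.

Lemma infinite_cut_id T : ~ finite_set [set: A] -> ~ left_reversible P ->
  CLP T -> T <> (fun=> 0) -> cuts T setT.
Proof.
move=> nfA nrev CT nT; have [F ck] := infinite_cut CT nT.
have [b bF] := fresh_atom F nfA; pose G := b :: F.
have bG : b \in G by rewrite mem_head.
have [u hu] := game_nonreversible hm irr nrev bG (infinite_two nfA).
have CI : CLP (ind setT) by rewrite ind_setT; exact: id_CL.
apply: (cuts_transport (u := u) CT CI _ ck) => q _.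
move=> y /mapP[d dF ->] du; have dG : d \in G by rewrite !inE dF !orbT.
by move/negP: bF; apply; rewrite -(hu q d dG du).
Qed.

Lemma infinite_powers b Y : (forall n, Y (atom m b ^+ n.+1)%g) -> ~ rfa (ind Y : l2 R P -> l2 R P).
Proof.
move=> hY /rfa_ind_finite fY; apply: infinite_nat.
have -> : [set: nat] = (fun n => atom m b ^+ n.+1)%g @^-1` Y by apply/seteqP; split=> // n _; exact: hY.
by apply: finite_preimage fY => i j _ _ /(expg_atom_inj hm) [].
Qed.

(** Let b be a neighbour of a, and let v come from a game after which, of a and b, only a can divide
    v q. Then u = b a v works: if a divided b a v q, the braid of length at least 3 would force b to
    divide v q. The powers of b, which u never divides, show that V_u is far from onto on the
    complement of aP. *)
Lemma away_shift a : left_reversible P -> (exists a0 a1 : A, a0 <> a1) -> exists u,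
  (forall q, away a q -> away a (u * q)%g) /\
  exists b, b <> a /\ forall n, ~ mdiv u (atom m b ^+ n.+1)%g.
Proof.
move=> rev two; have [b ba hn] := neighbour (neq_atom a two).
have aG : a \in [:: a; b] by rewrite mem_head.
have bG : b \in [:: a; b] by rewrite !inE eqxx orbT.
have [u hu] := game_reversible hm irr rev aG aG (neq_atom a two).
exists (atom m b * (atom m a * u))%g; split=> [q nq|].
  rewrite -!mulgA => h; have [n [z [mn e _]]] := ldiv_atomM_neq hm (nesym ba) h.
  have n2 : (2 < n)%N by apply: hn; rewrite -mn; have [-> _] := hm (nesym ba).
  apply: ba; apply: (hu q nq b bG); case: n n2 e {mn} => [|[|[|n]]]// _.
  rewrite /res /= !wp_cons -!mulgA => /lc ->; by eexists.
exists b; split=> // n [z]; rewrite expgS -!mulgA => /lc e.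
by apply: (not_mdiv_pow (n := n) (nesym ba)); exists (u * z)%g.
Qed.

End Cutting.

(** * The kernel as an ideal generated by complements of principal ideals *)

Section Kernel.
Variables (R : realType) (A : choiceType) (m : A -> A -> option nat).
Hypothesis hm : coxeter_matrix m.
Hypothesis rev : left_reversible (artin_tits m).
Local Notation P := (artin_tits m).
Local Notation C := R[i].
Local Notation CLP := (@CL R P).
Local Open Scope ring_scope.
Local Open Scope complex_scope.
Implicit Types (p q r x y z : P) (Y Z Q : set P) (S T U : l2 R P -> l2 R P) (a b c d : A).

Let lc := artin_lc hm.
Let hD := CL_csub R lc.
Local Notation Kr := (Ker_boundary R P : set (l2 R P -> l2 R P)).

Lemma common_mdiv p q : exists z, mdiv p z /\ mdiv q z.
Proof. exact: ((left_reversibleP m).1 rev p q). Qed.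

Lemma KerP T : Kr T <-> CLP T /\ forall e : R, 0 < e -> exists p, opnorm (T \o Vl p) < e.
Proof. exact (Ker_boundaryP lc (artin_rc hm) (artin_lcmP hm) common_mdiv T). Qed.

Lemma Vl_opnorm p : opnorm (Vl p : l2 R P -> l2 R P) <= 1.
Proof. apply: bdd_opnorm; [exact: ler01|exact (pin_bdd (Il_biuniq lc (Il_left p)))]. Qed.

Lemma VlM p q : Vl (p * q)%g = Vl p \o Vl q :> (l2 R P -> l2 R P).
Proof.
apply/funext => f; apply: l2P => x.
change (Vl (p * q)%g f x = Vl p (Vl q f) x).
have [[w ->]|h] := pselect (mdiv p x); last first.
  by rewrite !VlN// => -[w e]; apply: h; exists (q * w)%g; rewrite mulgA.
rewrite VlE//; have [[v ->]|h] := pselect (mdiv q w); first by rewrite mulgA !VlE.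
by rewrite !VlN// => -[v e]; apply: h; exists v; apply: (lc (x := p)); rewrite mulgA.
Qed.

Lemma opnorm_Vl_mul T p q : bounded_op T -> opnorm (T \o Vl (p * q)%g) <= opnorm (T \o Vl p).
Proof.
move=> bT; have bp := bounded_opM bT (Vl_bounded R hm p); have bq := Vl_bounded R hm q.
have -> : T \o Vl (p * q)%g = (T \o Vl p) \o Vl q by rewrite VlM.
apply: (le_trans (opnormM bp bq)); rewrite -[leRHS]mulr1.
by apply: ler_wpM2l; [exact: opnorm_ge0|exact: Vl_opnorm].
Qed.

Lemma Ker_CL T : Kr T -> CLP T. Proof. by move=> /KerP[]. Qed.

Lemma KerD S T : Kr S -> Kr T -> Kr (opD S T).
Proof.
move=> /KerP[CS hS] /KerP[CT hT]; apply/KerP; split; first exact: (csubD hD CS CT).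
have bS := csub_bounded hD CS; have bT := csub_bounded hD CT.
move=> e e0; have e2 : 0 < e / 2 by rewrite divr_gt0.
have [p hp] := hS _ e2; have [q hq] := hT _ e2.
have [_ [[p' ->] [q' eq]]] := common_mdiv p q; exists (p * p')%g.
have bV := Vl_bounded R hm (p * p')%g.
have -> : opD S T \o Vl (p * p')%g = opD (S \o Vl (p * p')%g) (T \o Vl (p * p')%g) by [].
apply: (le_lt_trans (opnormD (bounded_opM bS bV) (bounded_opM bT bV))).
rewrite [e]splitr; apply: ltrD; first exact: le_lt_trans (opnorm_Vl_mul _ _ bS) hp.
by rewrite eq; exact: le_lt_trans (opnorm_Vl_mul _ _ bT) hq.
Qed.

Lemma Ker_Ml S T : CLP S -> Kr T -> Kr (S \o T).
Proof.
move=> CS /KerP[CT hT]; apply/KerP; split; first exact: (csubM hD CS CT).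
have bS := csub_bounded hD CS; have bT := csub_bounded hD CT.
move=> e e0; pose K := opnorm S + 1; have K0 : 0 < K by rewrite ltr_wpDl// opnorm_ge0.
have [p hp] := hT _ (divr_gt0 e0 K0); exists p; have bV := bounded_opM bT (Vl_bounded R hm p).
have -> : (S \o T) \o Vl p = S \o (T \o Vl p) by [].
apply: (le_lt_trans (opnormM bS bV)); apply: (@le_lt_trans _ _ (K * opnorm (T \o Vl p))).
  by apply: ler_wpM2r; [exact: opnorm_ge0|rewrite /K lerDl].
by rewrite mulrC -ltr_pdivlMr.
Qed.

Lemma Ker0 : Kr (fun=> 0).
Proof.
apply/KerP; split; first exact: (csub0 hD).
move=> e e0; exists 1%g; apply: le_lt_trans e0; apply: bdd_opnorm => //.
have [lV _] := Vl_bounded R hm 1%g.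
split=> [k f g|f]; first by rewrite /= scaler0 addr0.
by rewrite /= l2norm0 mul0r.
Qed.

Lemma KerZ (k : C) T : Kr T -> Kr (opZ k T).
Proof.
move=> hT; have -> : opZ k T = opZ k id \o T by [].
exact (Ker_Ml (csubZ hD k (id_CL R hm)) hT).
Qed.

Lemma Ker_closed T : CLP T -> (forall e : R, 0 < e -> exists2 S, Kr S & opnorm (opB T S) < e) -> Kr T.
Proof.
move=> CT h; apply/KerP; split; first exact: CT.
have bT := csub_bounded hD CT; move=> e e0; have e2 : 0 < e / 2 by rewrite divr_gt0.
have [S /KerP[CS hS] TS] := h _ e2; have bS := csub_bounded hD CS; have [p hp] := hS _ e2.
have bV := Vl_bounded R hm p; have bB := bounded_opB bT bS; exists p.
have -> : T \o Vl p = opD (opB T S \o Vl p) (S \o Vl p).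
  by apply/funext => f; rewrite /opD /opB /= subrK.
apply: (le_lt_trans (opnormD (bounded_opM bB bV) (bounded_opM bS bV))).
rewrite [e]splitr; apply: ltrD; last exact: hp.
apply: le_lt_trans TS; apply: (le_trans (opnormM bB bV)); rewrite -[leRHS]mulr1.
by apply: ler_wpM2l; [exact: opnorm_ge0|exact: Vl_opnorm].
Qed.

Lemma Ker_Vl T q : Kr T -> Kr (T \o Vl q).
Proof.
move=> /KerP[CT hT]; apply/KerP; split; first exact: (csubM hD CT (Vl_CL R hm q)).
have bT := csub_bounded hD CT.
move=> e e0; have [p hp] := hT _ e0; have [_ [[q' ->] [p' ep]]] := common_mdiv q p.
exists q'; have -> : (T \o Vl q) \o Vl q' = T \o Vl (p * p')%g by rewrite -ep VlM.
exact: le_lt_trans (opnorm_Vl_mul _ _ bT) hp.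
Qed.

Lemma Ker_Vls T q : Kr T -> Kr (T \o adjoint (Vl q)).
Proof.
move=> /KerP[CT hT]; apply/KerP; split; first exact: (csubM hD CT (Vls_CL R hm q)).
move=> e e0; have [p hp] := hT _ e0; exists (q * p)%g.
have -> : (T \o adjoint (Vl q)) \o Vl (q * p)%g = T \o (adjoint (Vl q) \o Vl q) \o Vl p by rewrite VlM.
by rewrite (VlsVl R hm).
Qed.

Lemma wpq_Vl p q : opV (wpq p q) = Vl p \o adjoint (Vl q) :> (l2 R P -> l2 R P).
Proof.
have bw := Il_biuniq lc (Il_wpq p q).
apply/funext => f; apply: l2P => y.
change (opV (wpq p q) f y = Vl p (adjoint (Vl q) f) y).
have [[w ->]|h] := pselect (mdiv p y).
  rewrite VlE// VlsE//; apply: (pinE bw); by exists w.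
rewrite VlN//; apply: (pin0 bw) => x [w [_ e]]; apply: h; by exists w.
Qed.

(** Smallness of T V_p is a one-sided condition. Common multiples absorb a factor V_q, the identity
    V_q^* V_q = 1 absorbs V_q^*, and approximation of S by combinations of V_p V_q^* does the
    rest. *)
Lemma Ker_Mr S T : CLP S -> Kr T -> Kr (T \o S).
Proof.
move=> CS hT; have CT := Ker_CL hT; have bT := csub_bounded hD CT.
have span S' : spanV S' -> Kr (T \o S').
  elim=> [|S1 S2 _ h1 _ h2|s v hv].
  - have -> : T \o (fun=> 0) = (fun=> 0) :> (l2 R P -> l2 R P) by apply/funext => f; exact (lin0 bT.1).
    exact: Ker0.
  - have -> : T \o opD S1 S2 = opD (T \o S1) (T \o S2) by apply/funext => f; exact (linD bT.1 _ _).
    exact: KerD.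
  have -> : T \o opZ s (opV v) = opZ s (T \o opV v) by apply/funext => f; exact (linZ bT.1 _ _).
  apply: KerZ; case: (Il_form lc (artin_lcmP hm) hv) => [->|[p [q ->]]].
    rewrite opV_set0; have -> : T \o (fun=> 0) = (fun=> 0) :> (l2 R P -> l2 R P) by apply/funext => f; exact (lin0 bT.1).
    exact: Ker0.
  by rewrite wpq_Vl; exact (Ker_Vls q (Ker_Vl p hT)).
apply: (Ker_closed (csubM hD CT CS)) => e e0.
pose K := opnorm T + 1; have K0 : 0 < K by rewrite ltr_wpDl// opnorm_ge0.
have [S' sS' hS'] := CL_approx CS (divr_gt0 e0 K0); exists (T \o S'); first exact: span.
have bS := csub_bounded hD CS; have bS' := csub_bounded hD (spanV_CL lc sS').
have bB := bounded_opB bS bS'.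
have -> : opB (T \o S) (T \o S') = T \o opB S S' by apply/funext => f; rewrite /opB /= (linB bT.1).
apply: (le_lt_trans (opnormM bT bB)); apply: (@le_lt_trans _ _ (K * opnorm (opB S S'))).
  by apply: ler_wpM2r; [exact: opnorm_ge0|rewrite /K lerDl].
by rewrite mulrC -ltr_pdivlMr.
Qed.

Lemma Ker_indC p : Kr (ind (~` pP p)).
Proof.
apply/KerP; split; first exact (indC_CL hm (indP_CL R hm p)).
move=> e e0; exists p; have -> : ind (~` pP p) \o Vl p = (fun=> 0) :> (l2 R P -> l2 R P).
  apply/funext => f; apply: l2P => y; change (ind (~` pP p) (Vl p f) y = 0).
  have [h|h] := pselect (pP p y); last by rewrite indE// VlN.
  by rewrite indN// => /(_ h).
apply: le_lt_trans e0; apply: bdd_opnorm => //; split=> [k f g|f]; first by rewrite scaler0 addr0.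
by rewrite l2norm0 mul0r.
Qed.

(** The projections 1 - V_p V_p^* act as an approximate unit: the difference is T V_p V_p^*. Closure
    of the kernel under adjoints follows from this. *)
Lemma Ker_cut T (e : R) : Kr T -> 0 < e -> exists p, opnorm (opB T (T \o ind (~` pP p))) < e.
Proof.
move=> /KerP[CT hT] /hT[p hp]; exists p; have bT := csub_bounded hD CT.
have bV := Vl_bounded R hm p.
have -> : opB T (T \o ind (~` pP p)) = (T \o Vl p) \o adjoint (Vl p).
  apply/funext => f; rewrite indC /opB /= (linB bT.1) opprB addrC subrK ind_pP//.
apply: (le_lt_trans _ hp); have b := bounded_opM bT bV.
apply: (le_trans (opnormM b (adjoint_bounded bV))); rewrite -[leRHS]mulr1.
apply: ler_wpM2l; first exact: opnorm_ge0.
by rewrite opnorm_adjE//; exact: Vl_opnorm.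
Qed.

Lemma Ker_adj T : Kr T -> Kr (adjoint T).
Proof.
move=> hT; have CT := Ker_CL hT; have bT := csub_bounded hD CT; have CTs := csub_adj hD CT.
apply: (Ker_closed CTs) => e e0; have [p hp] := Ker_cut hT e0.
have bi := ind_bounded (R := R) (~` pP p).
exists (ind (~` pP p) \o adjoint T); first exact (Ker_Mr CTs (Ker_indC p)).
have -> : opB (adjoint T) (ind (~` pP p) \o adjoint T) = adjoint (opB T (T \o ind (~` pP p))).
  by rewrite (adjB bT (bounded_opM bT bi)) (adjM bT bi) ind_adj.
by rewrite opnorm_adjE//; exact (bounded_opB bT (bounded_opM bT bi)).
Qed.

Lemma Ker_csub : @cstar_subalg R (bounded_ops R P) Kr.
Proof.
split.
- split=> [T /Ker_CL CT||S T|k T]; [exact: (csub_bounded hD CT)|exact: Ker0|exact: KerD|exact: KerZ].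
- move=> S T hS hT; exact (Ker_Ml (Ker_CL hS) hT).
- exact: Ker_adj.
move=> T /aclosureE[bT h]; apply: Ker_closed => //.
apply: (csub_closed hD bT) => e e0; have [S kS hS] := h e e0; exists S => //; exact: Ker_CL.
Qed.

Lemma indU Y Z : (forall x, Y x -> ~ Z x) -> ind (Y `|` Z) = opD (ind Y) (ind Z) :> (l2 R P -> l2 R P).
Proof.
move=> YZ; apply/funext => f; apply: l2P => x; rewrite l2DE.
have [Yx|nY] := pselect (Y x).
  have -> : ind (Y `|` Z) f x = f x by apply: indE; left.
  have -> : ind Y f x = f x by exact: indE.
  by have -> : ind Z f x = 0; [apply: indN; exact: YZ|rewrite addr0].
have -> : ind Y f x = 0 by exact: indN.
rewrite add0r; have [Zx|nZ] := pselect (Z x).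
  have -> : ind (Y `|` Z) f x = f x by apply: indE; right.
  by symmetry; exact: indE.
have -> : ind Z f x = 0 by exact: indN.
by apply: indN => -[].
Qed.

(** The complement of a p P is the disjoint union of the complement of aP and of a times the
    complement of pP. *)
Lemma conj_indC_mul y a p : Vl y \o ind (~` pP (atom m a * p)%g) \o adjoint (Vl y) =
  opD (Vl y \o ind (~` pP (atom m a)) \o adjoint (Vl y))
    (Vl (y * atom m a)%g \o ind (~` pP p) \o adjoint (Vl (y * atom m a)%g)) :> (l2 R P -> l2 R P).
Proof.
apply: (etrans (Vl_conjV R hm y _)); symmetry.
apply: (etrans (f_equal2 opD (Vl_conjV R hm y _) (Vl_conjV R hm (y * atom m a)%g _))).
rewrite -indU => [|x [w nw ->] [v _]]; last by rewrite -mulgA => /lc e; apply: nw; exists v.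
apply: ind_ext => x; split=> [[[w nw ->]|[w nw ->]]|[w nw ->]].
- exists w => // -[v e]; apply: nw; exists (p * v)%g; by rewrite mulgA.
- exists (atom m a * w)%g; last by rewrite mulgA.
  by move=> [v]; rewrite -mulgA => /lc e; apply: nw; exists v.
have [[v ev]|h2] := pselect (pP (atom m a) w); [right|left]; last by exists w.
exists v; last by rewrite ev mulgA.
by move=> [v' e]; apply: nw; exists v'; rewrite ev e mulgA.
Qed.

(* 1 - V_p V_p^* is a sum of conjugates V_x (1 - V_a V_a^* ) V_x^* with a an atom. *)
Lemma Ker_full (I : set (l2 R P -> l2 R P)) : ideal (sub_alg (bounded_ops R P) Kr) I ->
  (forall a, I (ind (~` pP (atom m a)))) -> I = Kr.
Proof.
move=> hI Ia; have Icut y p : I (Vl y \o ind (~` pP p) \o adjoint (Vl y)).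
  elim/(@atom_ind A m): p y => [|a p ih] y.
    have -> : ind (~` pP 1%g) = (fun=> 0) :> (l2 R P -> l2 R P).
      apply/funext => f; apply: l2P => x; rewrite indN// => h; apply: h; exists x; by rewrite mul1g.
    have -> : Vl y \o (fun=> 0) \o adjoint (Vl y) = (fun=> 0) :> (l2 R P -> l2 R P).
      by apply/funext => f; exact (lin0 (Vl_bounded R hm y).1).
    exact: (ideal_0 hI).
  rewrite conj_indC_mul.
  apply: (ideal_D hI) (ih _); have Ka := Ker_indC (atom m a).
  have e : (Vl y \o ind (~` pP (atom m a))) \o ind (~` pP (atom m a)) \o
      (ind (~` pP (atom m a)) \o adjoint (Vl y)) =
      Vl y \o ind (~` pP (atom m a)) \o adjoint (Vl y) :> (l2 R P -> l2 R P).
    by apply/funext => f; have i2 := congr1 (fun g => g _) (ind_idem (R := R) (~` pP (atom m a)));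
       rewrite /= in i2; rewrite /= !i2.
  rewrite -e; have K1 := Ker_Mr (Vls_CL R hm y) Ka; have K2 := Ker_Ml (Vl_CL R hm y) Ka.
  exact (ideal_Mr hI K1 (ideal_Ml hI K2 (Ia a))).
have I1 p : I (ind (~` pP p)).
  have := Icut 1%g p; congr I; apply/funext => f; apply: l2P => x.
  have V1 g : Vl 1%g g = g :> l2 R P by apply: l2P => z; rewrite -{1}[z]mul1g VlE.
  have V1s g : adjoint (Vl 1%g) g = g :> l2 R P by apply: l2P => z; rewrite VlsE// mul1g.
  by rewrite -[LHS]/(Vl 1%g (ind (~` pP p) (adjoint (Vl 1%g) f)) x) V1 V1s.
apply/seteqP; split=> [T|T KT]; first exact: (ideal_sub hI).
apply: (ideal_closed hI KT) => e e0; have [p hp] := Ker_cut KT e0.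
exists (T \o ind (~` pP p)) => //; exact: (ideal_Ml hI KT (I1 p)).
Qed.

Lemma Ker_munit (a : A) x y : finite_set [set: A] -> Kr (munit (m := m) x y).
Proof.
move=> fA; have K1 : Kr (ind [set 1%g]).
  have -> : ind [set 1%g] = ind [set 1%g] \o ind (~` pP (atom m a)) :> (l2 R P -> l2 R P).
    rewrite -indI; apply: ind_ext => z; split=> [->|[]//]; split=> // -[w e].
    have := congr1 (@len A m) e; rewrite (lenM hm (atom m a)) (len_atom hm) (len1 hm).
    by [].
  exact (Ker_Ml (one_CL R hm fA) (Ker_indC (atom m a))).
exact (Ker_Mr (Vls_CL R hm y) (Ker_Ml (Vl_CL R hm x) K1)).
Qed.

End Kernel.

(** * Applying the criterion to the kernel and to the whole algebra *)

Section Structure.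
Variables (R : realType) (A : choiceType) (m : A -> A -> option nat).
Hypothesis hm : coxeter_matrix m.
Hypothesis irr : irreducible m.
Local Notation P := (artin_tits m).
Local Notation H := (l2 R P).
Local Notation CLP := (@CL R P).
Local Notation Kr := (Ker_boundary R P : set (H -> H)).
Local Notation alg D := (sub_alg (bounded_ops R P) D).
Local Open Scope ring_scope.
Implicit Types (T : H -> H) (J I : set (H -> H)) (a b c : A).

Let lc := artin_lc hm.
Let hD := CL_csub R lc.

(** The conclusions of the criterion for a pair of algebra and ideal. J is either zero, for infinite
    A, or the ideal of compact operators, for finite A. *)
Definition dichotomy (D J : set (H -> H)) :=
  [/\ J = [set (fun=> 0)] -> purely_infinite_simple (alg D),
      (forall T, J T -> J (adjoint T)) -> purely_infinite_simple (quotient_alg (alg D) J) &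
      (forall I, ideal (alg D) I -> I <> [set (fun=> 0)] -> J `<=` I) -> J <> [set (fun=> 0)] ->
        only_nontrivial_ideal (alg D) J].

(** Here f is the indicator of the complement of aP and w = V_u f with u from [away_shift];
    infinitely many powers of b lie under f - w w^*, which is therefore not compact. Fullness of f
    holds because cutting f itself produces the complements of all cP, and these generate the
    kernel. *)
Lemma Ker_dichotomy J : left_reversible P -> (exists a0 a1 : A, a0 <> a1) ->
  ideal (alg Kr) J -> J `<=` @rfa R P ->
  (forall a T, CLP T -> ~ J T -> cuts T (@away A m a)) -> dichotomy Kr J.
Proof.
move=> rev two hJ Jrfa cutJ; have hK := Ker_csub R hm rev.
have [a _] := two; pose Q := @away A m a; pose f : H -> H := ind Q.
have [u [uQ [b [ba hb]]]] := away_shift hm irr a rev two.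
pose w : H -> H := Vl u \o f.
have Ka c : Kr (ind (@away A m c)) by exact (Ker_indC R hm rev (atom m c)).
have Qb n : Q (atom m b ^+ n.+1)%g by exact (not_mdiv_pow hm (nesym ba)).
have ff : adjoint f = f by exact: ind_adj.
have f2 : f \o f = f by exact: ind_idem.
have nJf : ~ J f by move=> /Jrfa; exact: (infinite_powers hm Qb).
have cut c T : Kr T -> ~ J T -> exists2 z, Kr z &
    z \o adjoint T \o T \o adjoint z = ind (@away A m c) /\ ind (@away A m c) \o z = z.
  move=> KT nJT; have [z Cz [e1 e2]] := cutJ c T (Ker_CL hm rev KT) nJT; exists z => //.
  rewrite -e2; exact (Ker_Mr hm rev Cz (Ka c)).
have Dw : Kr w by exact (Ker_Ml hm rev (Vl_CL R hm u) (Ka a)).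
have bV := Vl_bounded R hm u; have bf : bounded_op f by exact: ind_bounded.
have ws : adjoint w = f \o adjoint (Vl u) by rewrite /w (adjM bV bf) ff.
have w1 : adjoint w \o w = f.
  rewrite ws; transitivity (f \o (adjoint (Vl u) \o Vl u) \o f); first by [].
  by rewrite (VlsVl R hm); exact: f2.
have fw : f \o w = w.
  apply/funext => g; apply: l2P => y; change (f (Vl u (f g)) y = Vl u (f g) y).
  have [Qy|nQy] := pselect (Q y); first exact: indE.
  transitivity (0 : R[i]); first exact: indN.
  have [[v ev]|nuy] := pselect (mdiv u y); last by rewrite VlN.
  rewrite ev VlE//; symmetry; apply: indN => Qv; apply: nQy; rewrite ev; exact: uQ.
have wf : w \o f = w by exact (congr1 (fun g => Vl u \o g) f2).
have inf_f : ~ J (opB f (w \o adjoint w)).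
  pose Y1 : set P := [set x | exists2 y, Q y & x = (u * y)%g].
  have e1 : w \o adjoint w = ind Y1.
    rewrite ws; have e0 := congr1 (fun g => Vl u \o g \o adjoint (Vl u)) f2.
    exact (etrans e0 (Vl_conjV R hm u Q)).
  have e2 : f = opD (ind Y1) (ind (Q `&` ~` Y1)).
    have d x : Y1 x -> ~ (Q `&` ~` Y1) x := fun Yx h => h.2 Yx.
    apply: (etrans _ (indU R d)); apply: ind_ext => x; split=> [Qx|[[y Qy ->]|[]//]]; last exact: uQ.
    have [Yx|nY] := pselect (Y1 x); [left; exact Yx|right; split; [exact Qx|exact nY]].
  have -> : opB f (w \o adjoint w) = ind (Q `&` ~` Y1).
    by rewrite e1 e2; apply/funext => g; rewrite /opB /opD addrC addKr.
  move=> /Jrfa; apply: (infinite_powers hm (b := b)) => n; split; first exact: Qb.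
  by move=> [y _ ey]; apply: (hb n); exists y.
have full I : ideal (alg Kr) I -> I f -> I = Kr.
  move=> hI If; apply: (Ker_full hm rev hI) => c.
  have [z Kz [<- _]] := cut c f (Ka a) nJf.
  have Kzs : Kr (adjoint z) by exact (Ker_adj hm rev Kz).
  have Kfs : Kr (adjoint f) by rewrite ff; exact (Ka a).
  exact (ideal_Mr hI Kzs (ideal_Ml hI (csubM hK Kz Kfs) If)).
split.
- exact (purely_infinite hK hJ (Ka a) ff f2 nJf (cut a) Dw w1 fw wf inf_f full).
- exact (quotient_alg_purely_infinite hK hJ (Ka a) ff f2 nJf (cut a) Dw w1 fw wf inf_f full).
exact (only_ideal hK hJ (Ka a) nJf (cut a) full).
Qed.

(** Here f = 1 and w = V_a. The defect 1 - V_a V_a^* is not compact, since no power of another atom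
    b is divisible by a. *)
Lemma CL_dichotomy J : (exists a0 a1 : A, a0 <> a1) ->
  ideal (alg CLP) J -> J `<=` @rfa R P ->
  (forall T, CLP T -> ~ J T -> cuts T [set: P]) -> dichotomy CLP J.
Proof.
move=> two hJ Jrfa cutJ; have [a _] := two; have [b ba] := neq_atom a two.
pose f : H -> H := ind setT; have fE : f = id by exact: ind_setT.
have Df : CLP f by rewrite fE; exact: id_CL.
have ff : adjoint f = f by exact: ind_adj.
have f2 : f \o f = f by exact: ind_idem.
have nJf : ~ J f by move=> /Jrfa; apply: (infinite_powers hm (b := b)).
have Dw : CLP (Vl (atom m a)) by exact: Vl_CL.
have w1 : adjoint (Vl (atom m a)) \o Vl (atom m a) = f by rewrite fE; exact: VlsVl.
have fw : f \o Vl (atom m a) = Vl (atom m a) by rewrite fE.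
have wf : Vl (atom m a) \o f = Vl (atom m a) by rewrite fE.
have inf_f : ~ J (opB f (Vl (atom m a) \o adjoint (Vl (atom m a)))).
  rewrite fE -(ind_pP R hm) -indC => /Jrfa; apply: (infinite_powers hm (b := b)) => n.
  exact (not_mdiv_pow hm (nesym ba)).
have full I : ideal (alg CLP) I -> I f -> I = CLP.
  rewrite fE => hI I1; apply/seteqP; split=> [T|T CT]; first exact: (ideal_sub hI).
  exact (ideal_Ml hI CT I1).
split.
- exact (purely_infinite hD hJ Df ff f2 nJf cutJ Dw w1 fw wf inf_f full).
- exact (quotient_alg_purely_infinite hD hJ Df ff f2 nJf cutJ Dw w1 fw wf inf_f full).
exact (only_ideal hD hJ Df nJf cutJ full).
Qed.

Lemma zero_ideal D : @cstar_subalg R (bounded_ops R P) D -> ideal (alg D) [set (fun=> 0)].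
Proof.
move=> hD'; apply: idealI.
- by move=> T ->; exact: (csub0 hD').
- by [].
- by move=> S T -> ->; apply/funext => g; rewrite /opD addr0.
- by move=> k T ->; apply/funext => g; rewrite /opZ scaler0.
- by move=> S T DS ->; have bS := csub_bounded hD' DS; apply/funext => g; exact (lin0 bS.1).
- by move=> S T DS ->.
move=> T DT h; have bT := csub_bounded hD' DT; apply/funext => g; apply: l2P => x.
apply: cabs_eq0; apply/le_anti; rewrite cabs_ge0 andbT; apply: (le_trans (l2_coord_le _ _)).
apply/ler_addgt0Pr => e e0; rewrite add0r; pose K := l2norm g + 1.
have K0 : 0 < K by rewrite ltr_wpDl// l2norm_ge0.
have [S -> hS] := h _ (divr_gt0 e0 K0).
have TE : opB T (fun=> 0) = T by apply/funext => g'; rewrite /opB subr0.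
rewrite TE in hS; apply: (le_trans (opnormP bT g)); apply: (@le_trans _ _ (opnorm T * K)).
  by apply: ler_wpM2l; [exact: opnorm_ge0|rewrite /K lerDl].
by rewrite -ler_pdivlMr//; exact: ltW.
Qed.

Lemma zero_rfa : [set (fun=> 0)] `<=` @rfa R P.
Proof.
move=> _ ->; have := rfaZ 0 (rfa_pr (R := R) (s := [:: 1%g : P]) isT).
by congr rfa; apply/funext => f; rewrite /opZ scale0r.
Qed.

Lemma compact_opsE : compact_ops R P = @rfa R P :> set (H -> H).
Proof. by apply/seteqP; split=> T /compact_opE. Qed.

Lemma rfa_neq0 : @rfa R P <> [set (fun=> 0)].
Proof.
move=> e; have := rfa_pr (R := R) (s := [:: 1%g : P]) isT; rewrite e /= => e'.
have := congr1 (fun T : H -> H => T (delta 1%g) 1%g) e'; rewrite pr_coord//.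
by rewrite mem_head !deltaE eqxx => /eqP; rewrite oner_eq0.
Qed.

Lemma compact_dichotomy D : @cstar_subalg R (bounded_ops R P) D ->
  (forall x y, D (munit (m := m) x y)) -> dichotomy D (@rfa R P) ->
  only_nontrivial_ideal (alg D) (compact_ops R P) /\
  purely_infinite_simple (quotient_alg (alg D) (compact_ops R P)).
Proof.
move=> hD' Dm [_ h1 h2]; rewrite compact_opsE; split; last by apply: h1; exact: rfa_adj.
apply: h2 rfa_neq0 => I hI nI; exact (rfa_minimal hm hD' Dm hI nI).
Qed.

Lemma atom_powers c (y : P) : (forall a, a = c) -> exists k, y = (atom m c ^+ k)%g.
Proof.
move=> hc; elim/(@atom_ind A m): y => [|a y [k ->]]; first by exists 0%N.
by exists k.+1; rewrite expgS (hc a).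
Qed.

Lemma rfa_ind (Y : set P) : finite_set Y -> rfa (ind Y : H -> H).
Proof.
move=> /finite_seqP[s es]; have us := undup_uniq s; have := rfa_pr (R := R) us.
congr rfa; apply/funext => f; apply: l2P => x; rewrite pr_coord// mem_undup es.
by case: ifP => xs; symmetry; [exact: indE|apply: indN; apply/negP; rewrite xs].
Qed.

(** All elements are powers of c, so complements of principal ideals are finite and the approximate
    unit of [Ker_cut] consists of finite rank projections. *)
Lemma Ker_single c : left_reversible P -> (forall a, a = c) -> Kr = compact_ops R P.
Proof.
move=> rev hc; rewrite compact_opsE; have hK := Ker_csub R hm rev.
have fA : finite_set [set: A].
  by apply: (sub_finite_set _ (finite_set1 c)) => a _; exact: hc.
apply/seteqP; split=> T; last first.
  apply: (rfa_csub hm hK) => x y; exact (Ker_munit R hm rev c x y fA).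
move=> KT; have bT := csub_bounded hK KT; apply: (rfa_closed bT) => e e0.
have [p hp] := Ker_cut hm rev KT e0; exists (T \o ind (~` pP p)) => //.
apply: (rfaM bT); apply: rfa_ind; have [n ->] := atom_powers p hc.
apply: (sub_finite_set (B := (fun k => atom m c ^+ k)%g @` `I_n)).
  move=> y ny; have [k ek] := atom_powers y hc; exists k => //=; rewrite ltnNge; apply/negP => nk.
  by apply: ny; exists (atom m c ^+ (k - n))%g; rewrite -expgnDr subnKC.
exact: finite_image (finite_II n).
Qed.

End Structure.

Local Open Scope card_scope.

Theorem theorem3 (R : realType) (A : choiceType) (m : A -> A -> option nat)
    (hm : coxeter_matrix m) (hirr : irreducible m) :
  [/\ spherical m ->
        ([set: A] #= [set: 'I_1] ->
           Ker_boundary R (artin_tits m) = compact_ops R (artin_tits m)) /\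
        ([set: 'I_2] #<= [set: A] -> finite_set [set: A] ->
           only_nontrivial_ideal (Ker_alg R (artin_tits m))
             (compact_ops R (artin_tits m)) /\
           purely_infinite_simple
             (quotient_alg (Ker_alg R (artin_tits m))
                (compact_ops R (artin_tits m)))),
      ~ finitely_generated (artin_tits m) ->
        left_reversible (artin_tits m) ->
        purely_infinite_simple (Ker_alg R (artin_tits m)),
      finitely_generated (artin_tits m) -> ~ spherical m ->
        only_nontrivial_ideal (Cstar_lambda R (artin_tits m))
          (compact_ops R (artin_tits m)) /\
        purely_infinite_simple
          (quotient_alg (Cstar_lambda R (artin_tits m))
             (compact_ops R (artin_tits m))) &
      ~ finitely_generated (artin_tits m) ->
        ~ left_reversible (artin_tits m) ->
        purely_infinite_simple (Cstar_lambda R (artin_tits m))].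
Proof.
have hC := CL_csub R (artin_lc hm).
have CE := Cstar_lambda_elts R (artin_lc hm).
split=> [sph|nfg rev|fg nsph|nfg nrev].
- have rev := spherical_reversible hm sph; split=> [/card_eqP[g]|/card_leP[g] fA].
    have [c _] := hirr.1; apply: (Ker_single R hm rev (c := c)) => a.
    have e : g (to_setT a) = g (to_setT c) by apply: val_inj; rewrite [LHS]ord1 [RHS]ord1.
    exact (congr1 val (injT e)).
  have two : exists a0 a1 : A, a0 <> a1.
    exists (val (g (to_setT ord0))), (val (g (to_setT ord_max))) => /val_inj e.
    by have := congr1 (fun i => val (val i)) (injT e).
  have hK := Ker_csub R hm rev; have [c _] := two.
  have Dm x y := Ker_munit R hm rev c x y fA.
  apply: (compact_dichotomy hm hK Dm).
  apply: (Ker_dichotomy hm hirr rev two (rfa_ideal hm hK Dm)) => // a T; exact: finite_cut_away.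
- have nfA : ~ finite_set [set: A] by move=> /(finitely_generatedP hm).
  have hK := Ker_csub R hm rev.
  have [h _ _] := Ker_dichotomy hm hirr rev (infinite_two nfA) (zero_ideal hK) (@zero_rfa R A m)
    (fun a T => infinite_cut_away hm hirr a nfA rev).
  exact: h.
- have fA := (finitely_generatedP hm).1 fg.
  (* With finitely many atoms, left reversibility would make the Coxeter group finite, hence P
     spherical. *)
  have nrev : ~ left_reversible (artin_tits m).
    by move=> rev; apply: nsph; split=> //; exact: reversible_spherical.
  have Dm x y := munit_CL R hm x y fA; rewrite /Cstar_lambda CE.
  (* With a single atom, P would consist of its powers and be left reversible. *)
  have two : exists a0 a1 : A, a0 <> a1.
    apply: contrapT => h; apply: nrev => p q; have [c _] := hirr.1.
    have hc a : a = c by apply: contrapT => ac; apply: h; exists a, c.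
    have [i ->] := atom_powers p hc; have [j ->] := atom_powers q hc.
    exists (atom m c ^+ (i + j))%g; split; [exists (atom m c ^+ j)%g|exists (atom m c ^+ i)%g] => //.
      by rewrite expgnDr.
    by rewrite addnC expgnDr.
  apply: (compact_dichotomy hm hC Dm).
  apply: (CL_dichotomy hm two (rfa_ideal hm hC Dm)) => // T; exact: finite_cut_id.
have nfA : ~ finite_set [set: A] by move=> /(finitely_generatedP hm).
rewrite /Cstar_lambda CE; have [h _ _] := CL_dichotomy hm (infinite_two nfA) (zero_ideal hC) (@zero_rfa R A m)
  (fun T => infinite_cut_id hm hirr nfA nrev).
exact: h.
Qed.
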